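(* The alignable V-nets of the second kind, up to a box reparametrization (and a constant scaling), are two $1$-parameter families of V-nets $\{\eta_k^+\}$ and $\{\eta_k^-\}$ on $\Omega^k$, where $k\in(0,\pi)$ is the alignability parameter. The members of these families are classified through the following first and second fundamental forms: $$I_{\eta^+}=\csc^4\!\left(\tfrac\omega2\right)\left(\tfrac1{u^2}\mathrm{d}u^2+2\tfrac{\cos\omega}{uv}\,\mathrm{d}u\,\mathrm{d}v+\tfrac1{v^2}\mathrm{d}v^2\right),\qquad II_{\eta^+}=2\cot\!\left(\tfrac\omega2\right)\left(\tfrac{\lambda}{u}\mathrm{d}u^2+\tfrac{1}{v\lambda}\mathrm{d}v^2\right)$$ for the positive-alignable ones and $$I_{\eta^-}=\sec^4\!\left(\tfrac\omega2\right)\left(\tfrac1{u^2}\mathrm{d}u^2-2\tfrac{\cos\omega}{uv}\,\mathrm{d}u\,\mathrm{d}v+\tfrac1{v^2}\mathrm{d}v^2\right),\qquad II_{\eta^-}=2\tan\!\left(\tfrac\omega2\right)\left(\tfrac{\lambda}{u}\mathrm{d}u^2-\tfrac{1}{v\lambda}\mathrm{d}v^2\right)$$ for the negative-alignable ones, where $\lambda=e^t$, $t\in\mathbb{R}$ (the isometric deformation parameter), and $\omega(u,v)=W_k(\sqrt{4uv})$ with $W_k$ the solution of $$W_{rr}+r^{-1}W_r-\sin W=0,\qquad W(0)=k,\quad W_r(0)=0.$$ The Gaussian and mean curvatures of $\eta^\pm$ are $$\mathrm{K}^+=uv\,\sin^4\!\left(\tfrac\omega2\right),\quad \mathrm{K}^-=-uv\,\cos^4\!\left(\tfrac\omega2\right),\quad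 \mathrm{H}^+=\tfrac14\left(\lambda u+\tfrac v\lambda\right)\tan\!\left(\tfrac\omega2\right),\quad \mathrm{H}^-=\tfrac14\left(\lambda u-\tfrac v\lambda\right)\cot\!\left(\tfrac\omega2\right).$$
   Context: Everything is smooth and local; nets are considered up to isometries of $\mathbb{R}^3$ (hence $II$ up to an overall sign). A net is an immersion $\eta:\Omega\to\mathbb{R}^3$, $\Omega\subset\mathbb{R}^2$. A V-net is a non-developable net that is conjugate ($\eta_{uv}\in\mathrm{span}\{\eta_u,\eta_v\}$) and whose coordinate lines are geodesics. A box reparametrization is $(u,v)\mapsto(f(u),g(v))$. A K-surface is a surface of constant Gaussian curvature $-1$. Its K-frame $(E_1,E_3)$ consists of unit vector fields along the asymptotic directions (they commute), with dual coframe $(\theta^1,\theta^3)$. $\eta$ is a rotation field of $\psi$ if $\mathrm{d}\xi=\eta\times\mathrm{d}\psi$ for some $\xi$. Each V-net $\eta$ is a rotation field of a unique K-surface $\psi$ whose asymptotic lines correspond to the V-net lines, and $\mathrm{d}\psi^{-1}\circ\mathrm{d}\eta=b\,E_1\otimes\theta^3+c\,E_3\otimes\theta^1$ with nowhere vanishing $b,c$. With $\bar\theta^1=c\theta^1$, $\bar\theta^3=b\theta^3$, the V-net is positive-alignable if $\mathrm{d}\bar\theta^1+\mathrm{d}\bar\theta^3=0$ and negative-alignable if $\mathrm{d}\bar\theta^1-\mathrm{d}\bar\theta^3=0$ (the former condition with $E_1$ replaced by $-E_1$). It is of the second kind if its K-surface is an Amsler K-surface, i.e. a piece, within a sector between the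 lines, of a pseudospherical surface containing two non-parallel straight asymptotic lines; here $k\in(0,\pi)$ is the angle between the two rays bounding the sector, which correspond to the boundary rays $\{v=0,u>0\}$ and $\{u=0,v>0\}$ of the first quadrant in canonical asymptotic coordinates. $\Omega^k\subset\{u>0,v>0\}$ is the region adjacent to the axes and bounded by the first cusp curve, that is $\Omega^k=\{u,v>0,\ 4uv<r_1^2\}$ where $r_1>0$ is the first value with $W_k(r_1)=\pi$. *)

(* Defs.v *)
From Stdlib Require Import Reals.
From Coquelicot Require Import Coquelicot.
Open Scope R_scope.

Definition vec : Type := (R * R * R)%type.
Definition cx (p : vec) : R := fst (fst p).
Definition cy (p : vec) : R := snd (fst p).
Definition cz (p : vec) : R := snd p.
Definition vzero : vec := (0, 0, 0).
Definition vadd (p q : vec) : vec := (cx p + cx q, cy p + cy q, cz p + cz q).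
Definition vscal (a : R) (p : vec) : vec := (a * cx p, a * cy p, a * cz p).
Definition vsub (p q : vec) : vec := vadd p (vscal (-1) q).
Definition dot (p q : vec) : R := cx p * cx q + cy p * cy q + cz p * cz q.
Definition vnorm (p : vec) : R := sqrt (dot p p).
Definition cross (p q : vec) : vec :=
  (cy p * cz q - cz p * cy q, cz p * cx q - cx p * cz q, cx p * cy q - cy p * cx q).

(* Orientation-reversing isometries are included. *)
Definition isometry (T : vec -> vec) : Prop :=
  forall p q : vec, vnorm (vsub (T p) (T q)) = vnorm (vsub p q).

Definition dom : Type := R -> R -> Prop.
Definition map3 : Type := R -> R -> vec.

Definition open_dom (Om : dom) : Prop :=
  forall u v : R, Om u v -> locally_2d Om u v.

Definition connected_dom (Om : dom) : Prop :=
  forall A : dom,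
    (forall u v, Om u v -> A u v -> locally_2d (fun x y => Om x y -> A x y) u v) ->
    (forall u v, Om u v -> ~ A u v -> locally_2d (fun x y => Om x y -> ~ A x y) u v) ->
    (forall u v, Om u v -> A u v) \/ (forall u v, Om u v -> ~ A u v).

Definition du (f : R -> R -> R) : R -> R -> R := fun u v => Derive (fun x => f x v) u.
Definition dv (f : R -> R -> R) : R -> R -> R := fun u v => Derive (fun y => f u y) v.

(* [ex_diff_n f n u v]: the iterated partial derivatives of [f] up to order [n]
   exist and are continuous at [(u, v)]. *)
Definition smooth (Om : dom) (f : R -> R -> R) : Prop :=
  forall (n : nat) (u v : R), Om u v -> ex_diff_n f n u v.

Definition smooth_map (Om : dom) (F : map3) : Prop :=
  smooth Om (fun u v => cx (F u v)) /\
  smooth Om (fun u v => cy (F u v)) /\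
  smooth Om (fun u v => cz (F u v)).

Definition pu (F : map3) : map3 := fun u v =>
  (du (fun x y => cx (F x y)) u v, du (fun x y => cy (F x y)) u v,
   du (fun x y => cz (F x y)) u v).
Definition pv (F : map3) : map3 := fun u v =>
  (dv (fun x y => cx (F x y)) u v, dv (fun x y => cy (F x y)) u v,
   dv (fun x y => cz (F x y)) u v).

Definition field : Type := R -> R -> R * R.

Definition smooth_field (Om : dom) (X : field) : Prop :=
  smooth Om (fun u v => fst (X u v)) /\ smooth Om (fun u v => snd (X u v)).

Definition pairing (a X : R * R) : R := fst a * fst X + snd a * snd X.

Definition fscal (f : R -> R -> R) (a : field) : field :=
  fun u v => (f u v * fst (a u v), f u v * snd (a u v)).

(* The coefficient of [du /\ dv] in the exterior derivative of [p du + q dv]. *)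
Definition dform (a : field) : R -> R -> R := fun u v =>
  du (fun x y => snd (a x y)) u v - dv (fun x y => fst (a x y)) u v.

Definition diff (F : map3) (u v : R) (X : R * R) : vec :=
  vadd (vscal (fst X) (pu F u v)) (vscal (snd X) (pv F u v)).

Definition immersed_net (Om : dom) (eta : map3) : Prop :=
  open_dom Om /\ smooth_map Om eta /\
  forall u v, Om u v -> cross (pu eta u v) (pv eta u v) <> vzero.

Definition unit_normal (eta : map3) (u v : R) : vec :=
  vscal (/ vnorm (cross (pu eta u v) (pv eta u v))) (cross (pu eta u v) (pv eta u v)).

Definition fE (eta : map3) (u v : R) : R := dot (pu eta u v) (pu eta u v).
Definition fF (eta : map3) (u v : R) : R := dot (pu eta u v) (pv eta u v).
Definition fG (eta : map3) (u v : R) : R := dot (pv eta u v) (pv eta u v).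
Definition fL (eta : map3) (u v : R) : R := dot (pu (pu eta) u v) (unit_normal eta u v).
Definition fM (eta : map3) (u v : R) : R := dot (pv (pu eta) u v) (unit_normal eta u v).
Definition fN (eta : map3) (u v : R) : R := dot (pv (pv eta) u v) (unit_normal eta u v).

Definition second_form (eta : map3) (u v : R) (X : R * R) : R :=
  fL eta u v * fst X ^ 2 + 2 * fM eta u v * fst X * snd X + fN eta u v * snd X ^ 2.

Definition gauss_curvature (eta : map3) (u v : R) : R :=
  (fL eta u v * fN eta u v - fM eta u v ^ 2) /
  (fE eta u v * fG eta u v - fF eta u v ^ 2).
Definition mean_curvature (eta : map3) (u v : R) : R :=
  (fE eta u v * fN eta u v + fG eta u v * fL eta u v - 2 * fF eta u v * fM eta u v) /
  (2 * (fE eta u v * fG eta u v - fF eta u v ^ 2)).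

Definition geodesic_curvature_u (eta : map3) (u v : R) : R :=
  dot (unit_normal eta u v) (cross (pu eta u v) (pu (pu eta) u v)) / vnorm (pu eta u v) ^ 3.
Definition geodesic_curvature_v (eta : map3) (u v : R) : R :=
  dot (unit_normal eta u v) (cross (pv eta u v) (pv (pv eta) u v)) / vnorm (pv eta u v) ^ 3.

Definition V_net (Om : dom) (eta : map3) : Prop :=
  immersed_net Om eta /\
  forall u v, Om u v ->
    gauss_curvature eta u v <> 0 /\
    (exists a b : R,
       pv (pu eta) u v = vadd (vscal a (pu eta u v)) (vscal b (pv eta u v))) /\
    geodesic_curvature_u eta u v = 0 /\
    geodesic_curvature_v eta u v = 0.

Definition K_surface (Om : dom) (psi : map3) : Prop :=
  immersed_net Om psi /\ forall u v, Om u v -> gauss_curvature psi u v = -1.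

Definition K_frame (Om : dom) (psi : map3) (E1 E3 : field) : Prop :=
  smooth_field Om E1 /\ smooth_field Om E3 /\
  forall u v, Om u v ->
    vnorm (diff psi u v (E1 u v)) = 1 /\
    vnorm (diff psi u v (E3 u v)) = 1 /\
    second_form psi u v (E1 u v) = 0 /\
    second_form psi u v (E3 u v) = 0 /\
    fst (E1 u v) * snd (E3 u v) - snd (E1 u v) * fst (E3 u v) <> 0.

Definition dual_coframe (Om : dom) (E1 E3 th1 th3 : field) : Prop :=
  smooth_field Om th1 /\ smooth_field Om th3 /\
  forall u v, Om u v ->
    pairing (th1 u v) (E1 u v) = 1 /\ pairing (th1 u v) (E3 u v) = 0 /\
    pairing (th3 u v) (E1 u v) = 0 /\ pairing (th3 u v) (E3 u v) = 1.

Definition rotation_field (Om : dom) (eta psi : map3) : Prop :=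
  exists xi : map3, smooth_map Om xi /\
    forall u v, Om u v -> forall X : R * R,
      diff xi u v X = cross (eta u v) (diff psi u v X).

(* The last clause says that the asymptotic lines of [psi] correspond to the
   coordinate lines of [eta], with [E1] along the u-lines and [E3] along the v-lines. *)
Definition K_surface_of (Om : dom) (eta psi : map3) (E1 E3 : field) : Prop :=
  K_surface Om psi /\ K_frame Om psi E1 E3 /\ rotation_field Om eta psi /\
  forall u v, Om u v -> snd (E1 u v) = 0 /\ fst (E3 u v) = 0.

(* [d psi^-1 o d eta = b E1 (x) th3 + c E3 (x) th1]; the condition is
   [d (c th1) + s d (b th3) = 0].  Reversing one of [E1], [E3] exchanges the cases
   [s = 1] and [s = -1]; reversing both, or replacing [psi] by [- psi], changes nothing. *)
Definition alignment (s : R) (Om : dom) (eta psi : map3) (E1 E3 : field) : Prop :=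
  exists (th1 th3 : field) (b c : R -> R -> R),
    dual_coframe Om E1 E3 th1 th3 /\ smooth Om b /\ smooth Om c /\
    forall u v, Om u v ->
      b u v <> 0 /\ c u v <> 0 /\
      (forall X : R * R,
         diff eta u v X =
         vadd (vscal (b u v * pairing (th3 u v) X) (diff psi u v (E1 u v)))
              (vscal (c u v * pairing (th1 u v) X) (diff psi u v (E3 u v)))) /\
      dform (fscal c th1) u v + s * dform (fscal b th3) u v = 0.

Definition positive_alignment := alignment 1.
Definition negative_alignment := alignment (-1).

(* A pseudospherical surface in canonical asymptotic coordinates [(x, y)] in which both
   coordinate axes are straight lines; [k] is the angle of the sector that corresponds
   to the first quadrant.  The second clause keeps the domain between the axes: since the
   sine-Gordon equation is hyperbolic, the values at [(x, y)] are determined by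
   the two lines only when the whole rectangle spanned by the origin and [(x, y)]
   belongs to the surface. *)
Definition Amsler_surface (k : R) (U : dom) (Psi : map3) : Prop :=
  (forall t : R, U t 0 /\ U 0 t) /\
  (forall x y a b : R, U x y -> 0 <= a <= 1 -> 0 <= b <= 1 -> U (a * x) (b * y)) /\
  K_surface U Psi /\
  (forall x y, U x y ->
     fE Psi x y = 1 /\ fG Psi x y = 1 /\ fL Psi x y = 0 /\ fN Psi x y = 0) /\
  exists a b : vec,
    (forall t : R, Psi t 0 = vadd (Psi 0 0) (vscal t a)) /\
    (forall t : R, Psi 0 t = vadd (Psi 0 0) (vscal t b)) /\
    dot a b = cos k.

(* [psi] is a piece of an Amsler surface of angle [k], inside the open sector that
   corresponds to the first quadrant; [(phi1, phi2)] are the canonical asymptotic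
   coordinates on the piece. *)
Definition Amsler_piece (k : R) (Om : dom) (psi : map3) (phi1 phi2 : R -> R -> R) : Prop :=
  exists (U : dom) (Psi : map3),
    Amsler_surface k U Psi /\ smooth Om phi1 /\ smooth Om phi2 /\
    forall u v, Om u v ->
      0 < phi1 u v /\ 0 < phi2 u v /\ U (phi1 u v) (phi2 u v) /\
      psi u v = Psi (phi1 u v) (phi2 u v).

(* [E1 = d/d phi1] and [E3 = d/d phi2]. *)
Definition canonical_frame (Om : dom) (phi1 phi2 : R -> R -> R) (E1 E3 : field) : Prop :=
  forall u v, Om u v ->
    pairing (du phi1 u v, dv phi1 u v) (E1 u v) = 1 /\
    pairing (du phi2 u v, dv phi2 u v) (E1 u v) = 0 /\
    pairing (du phi1 u v, dv phi1 u v) (E3 u v) = 0 /\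
    pairing (du phi2 u v, dv phi2 u v) (E3 u v) = 1.

Definition alignable_second_kind (k : R) (Om : dom) (eta : map3) : Prop :=
  V_net Om eta /\
  exists (psi : map3) (E1 E3 : field) (phi1 phi2 : R -> R -> R),
    K_surface_of Om eta psi E1 E3 /\ Amsler_piece k Om psi phi1 phi2 /\
    (positive_alignment Om eta psi E1 E3 \/ negative_alignment Om eta psi E1 E3).

(* The sign of the alignment refers to the K-frame of the canonical asymptotic
   coordinates in which the sector is the first quadrant. *)
Definition positive_alignable_second_kind (k : R) (Om : dom) (eta : map3) : Prop :=
  V_net Om eta /\
  exists (psi : map3) (E1 E3 : field) (phi1 phi2 : R -> R -> R),
    K_surface_of Om eta psi E1 E3 /\ Amsler_piece k Om psi phi1 phi2 /\
    canonical_frame Om phi1 phi2 E1 E3 /\ positive_alignment Om eta psi E1 E3.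

Definition negative_alignable_second_kind (k : R) (Om : dom) (eta : map3) : Prop :=
  V_net Om eta /\
  exists (psi : map3) (E1 E3 : field) (phi1 phi2 : R -> R -> R),
    K_surface_of Om eta psi E1 E3 /\ Amsler_piece k Om psi phi1 phi2 /\
    canonical_frame Om phi1 phi2 E1 E3 /\ negative_alignment Om eta psi E1 E3.

(* [W] is only meaningful on [r >= 0]; hence the one-sided derivative at 0. *)
Definition W_solution (k : R) (W : R -> R) : Prop :=
  W 0 = k /\
  filterlim (fun r => (W r - W 0) / r) (at_right 0) (locally 0) /\
  forall r, 0 < r ->
    ex_derive W r /\ ex_derive (Derive W) r /\
    Derive (Derive W) r + / r * Derive W r - sin (W r) = 0.

Definition first_cusp (W : R -> R) (r1 : R) : Prop :=
  0 < r1 /\ W r1 = PI /\ forall r, 0 <= r < r1 -> W r <> PI.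

Definition Omega_k (r1 : R) : dom := fun u v => 0 < u /\ 0 < v /\ 4 * u * v < r1 ^ 2.

Definition omega (W : R -> R) (u v : R) : R := W (sqrt (4 * u * v)).

Definition csc (x : R) : R := / sin x.
Definition sec (x : R) : R := / cos x.
Definition cot (x : R) : R := cos x / sin x.

(* Here [I = E du^2 + 2 F du dv + G dv^2] and [II = L du^2 + 2 M du dv + N dv^2];
   [eps] is [1] or [-1], the sign of the second form being that of the unit normal. *)
Definition eta_plus (W : R -> R) (r1 lam eps : R) (eta : map3) : Prop :=
  immersed_net (Omega_k r1) eta /\
  forall u v, Omega_k r1 u v ->
    let w := omega W u v in
    fE eta u v = csc (w / 2) ^ 4 * (1 / u ^ 2) /\
    fF eta u v = csc (w / 2) ^ 4 * (cos w / (u * v)) /\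
    fG eta u v = csc (w / 2) ^ 4 * (1 / v ^ 2) /\
    fL eta u v = eps * (2 * cot (w / 2) * (lam / u)) /\
    fM eta u v = 0 /\
    fN eta u v = eps * (2 * cot (w / 2) * (1 / (v * lam))).

Definition eta_minus (W : R -> R) (r1 lam eps : R) (eta : map3) : Prop :=
  immersed_net (Omega_k r1) eta /\
  forall u v, Omega_k r1 u v ->
    let w := omega W u v in
    fE eta u v = sec (w / 2) ^ 4 * (1 / u ^ 2) /\
    fF eta u v = - (sec (w / 2) ^ 4 * (cos w / (u * v))) /\
    fG eta u v = sec (w / 2) ^ 4 * (1 / v ^ 2) /\
    fL eta u v = eps * (2 * tan (w / 2) * (lam / u)) /\
    fM eta u v = 0 /\
    fN eta u v = - (eps * (2 * tan (w / 2) * (1 / (v * lam)))).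

(* Open connected domains with connected coordinate lines; every point of an open set
   has a neighbourhood of this kind (an open box), and [Omega_k r1] is one.  On such
   domains a coordinate change that is locally of the form [(f u, g v)] is globally so. *)
Definition net_domain (D : dom) : Prop :=
  open_dom D /\ connected_dom D /\
  (forall u v1 v2 v, D u v1 -> D u v2 -> v1 <= v <= v2 -> D u v) /\
  (forall u1 u2 u v, D u1 v -> D u2 v -> u1 <= u <= u2 -> D u v).

(* On [D], [eta] is [eta0] up to a box reparametrization [(f u, g v)], a scaling by
   a constant [s] and an isometry. *)
Definition equivalent_to_piece_of (D : dom) (eta : map3) (D0 : dom) (eta0 : map3) : Prop :=
  exists (f g : R -> R) (s : R) (T : vec -> vec),
    0 < s /\ isometry T /\
    forall u v, D u v ->
      (forall n : nat, ex_derive_n f n u /\ ex_derive_n g n v) /\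
      Derive f u <> 0 /\ Derive g v <> 0 /\
      D0 (f u) (g v) /\
      eta u v = T (vscal s (eta0 (f u) (g v))).

(* Main.v *)
(* In z = u v = r^2/4 the Painleve equation becomes z w'' + w' = sin w, an analytic equation
   without singular initial condition; om = w (x y) solves the sine-Gordon equation
   om_xy = sin om with om = k on both axes.  Integrating the Gauss-Weingarten equations for the
   frame (e1, e2, n) that bisects the asymptotic directions P = psi_x, Q = psi_y gives the
   Amsler surface, and uniqueness of the Goursat problem shows that it is the only one.

   A net with K-surface psi and diagonal coordinate change satisfies
   eta_x = C Q and eta_y = B P.  The compatibility eta_xy = eta_yx together with the alignment
   condition C_y = sg B_x forces C = q beta / x and B = sg q beta / y with
   beta = 2 / (1 - sg cos om), up to a constant q.  Hence an aligned net is, up to similarity,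
   the model net in the coordinates (x, y), and the family in lambda is obtained from it by
   (u, v) |-> (lambda u, v / lambda).  Conversely, the forms of eta^+ and eta^- give the pair
   of unit vectors (Q, P) along the coordinate lines, whose frame satisfies the same linear
   system as the Amsler frame and therefore differs from it by a rotation. *)
Require Import Defs.
From Stdlib Require Import Reals Lra Lia Psatz Factorial IndefiniteDescription Classical.
From Coquelicot Require Import Coquelicot.
Open Scope R_scope.

(** * Smooth functions of one and two variables *)

(** Degeneracy is the obstacle that shapes the proof: [psi_x] and [psi_y] become parallel where
    [sin om = 0], while the bisecting frame extends to the whole plane. One global frame then serves
    the model nets on [Omega_k] as well as Amsler surfaces on any admissible domain, and every
    uniqueness claim turns into the statement that a function with vanishing gradient is constant.

    The constant [q] appears for the following reason. Compatibility and alignment control only the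
    derivatives [C_y] and [B_x], but comparing the turning terms also forces [x C = sg y B]; hence
    [x C / beta] can be differentiated in either direction, and both partials vanish.

    The two families are treated at once through the sign [sg], and the sign [eps] of the second
    form is absorbed into the choice of the normal field. An alignable net comes with arbitrary
    signs of [E1] and [E3] and an arbitrary order of the two asymptotic families; on a connected
    domain these discrete data are constant, and they are normalised before the classification is
    applied. *)

Definition has_du (f : R -> R -> R) (u v l : R) : Prop := is_derive (fun x => f x v) u l.
Definition has_dv (f : R -> R -> R) (u v l : R) : Prop := is_derive (fun y => f u y) v l.

Lemma du_eq f u v l : has_du f u v l -> du f u v = l.
Proof. intros H; exact (is_derive_unique _ _ _ H). Qed.

Lemma dv_eq f u v l : has_dv f u v l -> dv f u v = l.
Proof. intros H; exact (is_derive_unique _ _ _ H). Qed.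

Lemma has_du_ext_loc (f g : R -> R -> R) u v l :
  locally_2d (fun x y => f x y = g x y) u v -> has_du f u v l -> has_du g u v l.
Proof.
  intros [d Hd] H. unfold has_du. eapply is_derive_ext_loc; [|exact H].
  exists d. intros x Hx. apply Hd; [exact Hx|].
  replace (v - v) with 0 by ring. rewrite Rabs_R0. apply cond_pos.
Qed.

Lemma has_dv_ext_loc (f g : R -> R -> R) u v l :
  locally_2d (fun x y => f x y = g x y) u v -> has_dv f u v l -> has_dv g u v l.
Proof.
  intros [d Hd] H. unfold has_dv. eapply is_derive_ext_loc; [|exact H].
  exists d. intros y Hy. apply Hd; [|exact Hy].
  replace (u - u) with 0 by ring. rewrite Rabs_R0. apply cond_pos.
Qed.

Lemma locally_2d_of_dom (Om : dom) (P : R -> R -> Prop) u v :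
  open_dom Om -> (forall x y, Om x y -> P x y) -> Om u v -> locally_2d P u v.
Proof.
  intros HO HP Huv. destruct (HO u v Huv) as [d Hd].
  exists d. intros x y Hx Hy. apply HP, Hd; assumption.
Qed.

Lemma smooth_sub (Om D : dom) f :
  (forall u v, D u v -> Om u v) -> smooth Om f -> smooth D f.
Proof. intros H S n u v Huv. apply S, H, Huv. Qed.

Lemma smooth_continuity Om f u v : smooth Om f -> Om u v -> continuity_2d_pt f u v.
Proof. intros S H. exact (proj1 (S 0%nat u v H)). Qed.

Lemma smooth_has_du Om f u v : smooth Om f -> Om u v -> has_du f u v (du f u v).
Proof. intros S H. apply Derive_correct. exact (proj1 (proj2 (S 1%nat u v H))). Qed.

Lemma smooth_has_dv Om f u v : smooth Om f -> Om u v -> has_dv f u v (dv f u v).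
Proof. intros S H. apply Derive_correct. exact (proj1 (proj2 (proj2 (S 1%nat u v H)))). Qed.

Lemma smooth_du Om f : smooth Om f -> smooth Om (du f).
Proof. intros S n u v H. exact (ex_diff_n_deriv_aux1 f n u v (S _ u v H)). Qed.

Lemma smooth_dv Om f : smooth Om f -> smooth Om (dv f).
Proof. intros S n u v H. exact (ex_diff_n_deriv_aux2 f n u v (S _ u v H)). Qed.

(** Smoothness by an invariant: a class of continuous functions closed under both partial
    derivatives consists of smooth functions. The induction on the order runs over the whole class
    at once, so no derivative is ever computed beyond the first. *)
Lemma smooth_coind (Om : dom) (C : (R -> R -> R) -> Prop) :
  open_dom Om ->
  (forall f, C f ->
     (forall u v, Om u v -> continuity_2d_pt f u v) /\
     exists fu fv, C fu /\ C fv /\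
       forall u v, Om u v -> has_du f u v (fu u v) /\ has_dv f u v (fv u v)) ->
  forall f, C f -> smooth Om f.
Proof.
  intros HO HC f Hf n. revert f Hf.
  induction n as [|n IH]; intros f Hf u v Huv;
    destruct (HC f Hf) as [Hc (fu & fv & Hfu & Hfv & Hd)].
  - split; [apply Hc, Huv | exact I].
  - destruct (Hd u v Huv) as [D1 D2].
    split; [apply Hc, Huv|].
    split; [exists (fu u v); exact D1|].
    split; [exists (fv u v); exact D2|].
    split.
    + apply (ex_diff_n_ext_loc fu); [|apply IH; assumption].
      apply (locally_2d_of_dom Om); [exact HO| |exact Huv].
      intros x y Hxy. symmetry. exact (du_eq _ _ _ _ (proj1 (Hd x y Hxy))).
    + apply (ex_diff_n_ext_loc fv); [|apply IH; assumption].
      apply (locally_2d_of_dom Om); [exact HO| |exact Huv].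
      intros x y Hxy. symmetry. exact (dv_eq _ _ _ _ (proj2 (Hd x y Hxy))).
Qed.

Lemma smooth_ext (Om : dom) f g :
  open_dom Om -> (forall u v, Om u v -> f u v = g u v) -> smooth Om f -> smooth Om g.
Proof.
  intros HO E S n u v Huv. apply (ex_diff_n_ext_loc f); [|apply S, Huv].
  apply (locally_2d_of_dom Om); assumption.
Qed.

(** Total differentiability from one partial that exists nearby and is continuous at the point,
    together with the other partial at the point alone. This is the source of the two-variable chain
    rule and of the continuity of primitives. *)
Lemma differentiable_of_partials (f fu fv : R -> R -> R) u v :
  locally_2d (fun x y => has_du f x y (fu x y)) u v ->
  has_dv f u v (fv u v) -> continuity_2d_pt fu u v ->
  differentiable_pt_lim f u v (fu u v) (fv u v).
Proof.
  intros [d H1] H2 H3.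
  apply filterdiff_differentiable_pt_lim.
  apply (is_derive_filterdiff f u v fu (fv u v)).
  - exists d. intros [x y] [Hx Hy]. apply H1; assumption.
  - exact H2.
  - apply continuity_2d_pt_filterlim in H3. exact H3.
Qed.

Lemma differentiable_continuous (f : R -> R -> R) u v a b :
  differentiable_pt_lim f u v a b -> continuity_2d_pt f u v.
Proof. intros H. apply differentiable_continuity_pt. exists a, b. exact H. Qed.

Lemma smooth_differentiable Om f u v :
  open_dom Om -> smooth Om f -> Om u v ->
  differentiable_pt_lim f u v (du f u v) (dv f u v).
Proof.
  intros HO S H. apply differentiable_of_partials.
  - apply (locally_2d_of_dom Om); [exact HO| |exact H].
    intros x y. apply smooth_has_du, S.
  - apply (smooth_has_dv Om); assumption.
  - apply (smooth_continuity Om); [apply smooth_du, S|exact H].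
Qed.

(** * Smooth functions of one variable and closure properties *)

Definition smooth1 (J : R -> Prop) (f : R -> R) : Prop :=
  forall (n : nat) (t : R), J t -> ex_derive_n f n t.

Lemma ex_derive_n_Derive f n t : ex_derive_n (Derive f) n t <->
  match n with O => True | _ => ex_derive_n f (S n) t end.
Proof.
  destruct n as [|n]; [split; auto; intros; exact I|].
  assert (E : forall x, Derive_n (Derive f) n x = Derive_n f (S n) x).
  { intros x. change (Derive f) with (Derive_n f 1). rewrite Derive_n_comp.
    rewrite PeanoNat.Nat.add_comm. reflexivity. }
  split; intros H; simpl in *.
  - eapply ex_derive_ext; [|exact H]. intros x. apply E.
  - eapply ex_derive_ext; [|exact H]. intros x. symmetry. apply E.
Qed.

Lemma smooth1_Derive J f : smooth1 J f -> smooth1 J (Derive f).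
Proof. intros S n t Ht. apply ex_derive_n_Derive. destruct n; [exact I|apply S, Ht]. Qed.

Lemma smooth1_is_derive J f t : smooth1 J f -> J t -> is_derive f t (Derive f t).
Proof. intros S Ht. apply Derive_correct. exact (S 1%nat t Ht). Qed.

Lemma smooth1_coind (J : R -> Prop) (C : (R -> R) -> Prop) :
  (forall t, J t -> locally t J) ->
  (forall f, C f -> exists f', C f' /\ forall t, J t -> is_derive f t (f' t)) ->
  forall f, C f -> smooth1 J f.
Proof.
  intros HJ HC f Hf n.
  (* Nothing is known about [Derive_n] outside [J], so it is identified with a member of the class
     on [J] only; openness of [J] carries differentiability over. *)
  assert (A : forall n f, C f -> exists g, C g /\ forall t, J t -> Derive_n f n t = g t).
  { clear f Hf n. induction n as [|n IH]; intros f Hf.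
    - exists f. split; [exact Hf|reflexivity].
    - destruct (IH f Hf) as (g & Hg & E). destruct (HC g Hg) as (g' & Hg' & D).
      exists g'. split; [exact Hg'|]. intros t Ht. simpl.
      rewrite (Derive_ext_loc _ g).
      + apply is_derive_unique, D, Ht.
      + destruct (HJ t Ht) as [d Hd]. exists d. intros y Hy. apply E, Hd, Hy. }
  intros t Ht. destruct n as [|n]; [exact I|].
  destruct (A n f Hf) as (g & Hg & E). destruct (HC g Hg) as (g' & Hg' & D).
  simpl. apply (ex_derive_ext_loc g).
  - destruct (HJ t Ht) as [d Hd]. exists d. intros y Hy. symmetry. apply E, Hd, Hy.
  - exists (g' t). apply D, Ht.
Qed.

(** The derivative of a product or of a composite is a sum of products and composites, so closure
    rules cannot be proved one operation at a time by coinduction. The invariant class has to be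
    closed under all operations simultaneously. [G] holds generators that are not yet known to be
    smooth. *)
Inductive hull (Om : dom) (G : (R -> R -> R) -> Prop) : (R -> R -> R) -> Prop :=
| hull_gen f : G f -> hull Om G f
| hull_smooth f : smooth Om f -> hull Om G f
| hull_plus f g : hull Om G f -> hull Om G g -> hull Om G (fun u v => f u v + g u v)
| hull_mult f g : hull Om G f -> hull Om G g -> hull Om G (fun u v => f u v * g u v)
| hull_comp1 J h f : smooth1 J h -> hull Om G f -> (forall u v, Om u v -> J (f u v)) ->
    hull Om G (fun u v => h (f u v))
| hull_comp2 U h f g : open_dom U -> smooth U h -> hull Om G f -> hull Om G g ->
    (forall u v, Om u v -> U (f u v) (g u v)) -> hull Om G (fun u v => h (f u v) (g u v)).

(** Regularity bootstrap: a generator only has to be continuous with partials in the hull, where it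
    may occur itself. Primitives of smooth forms and solutions of the frame system are smooth for
    this reason. *)
Lemma hull_is_smooth (Om : dom) (G : (R -> R -> R) -> Prop) :
  open_dom Om ->
  (forall f, G f ->
     (forall u v, Om u v -> continuity_2d_pt f u v) /\
     exists fu fv, hull Om G fu /\ hull Om G fv /\
       forall u v, Om u v -> has_du f u v (fu u v) /\ has_dv f u v (fv u v)) ->
  forall f, hull Om G f -> smooth Om f.
Proof.
  intros HO HG. apply smooth_coind; [exact HO|].
  intros f Hf. induction Hf as [f Hf|f Hf|f g Hf [cf (fu & fv & Hfu & Hfv & Df)] Hg [cg (gu & gv & Hgu & Hgv & Dg)]
    |f g Hf [cf (fu & fv & Hfu & Hfv & Df)] Hg [cg (gu & gv & Hgu & Hgv & Dg)]
    |J h f Hh Hf [cf (fu & fv & Hfu & Hfv & Df)] HJ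
    |U h f g HU Hh Hf [cf (fu & fv & Hfu & Hfv & Df)] Hg [cg (gu & gv & Hgu & Hgv & Dg)] HUfg].
  - apply HG, Hf.
  - split; [intros u v; apply smooth_continuity, Hf|].
    exists (du f), (dv f).
    split; [apply hull_smooth, smooth_du, Hf|].
    split; [apply hull_smooth, smooth_dv, Hf|].
    intros u v H; split; [apply (smooth_has_du Om)|apply (smooth_has_dv Om)]; assumption.
  - split; [intros u v H; apply continuity_2d_pt_plus; auto|].
    exists (fun u v => fu u v + gu u v), (fun u v => fv u v + gv u v).
    split; [apply hull_plus; assumption|]. split; [apply hull_plus; assumption|].
    intros u v H; split.
    + apply (is_derive_plus (fun x => f x v) (fun x => g x v)); [apply Df|apply Dg]; assumption.
    + apply (is_derive_plus (fun x => f u x) (fun x => g u x)); [apply Df|apply Dg]; assumption.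
  - split; [intros u v H; apply continuity_2d_pt_mult; auto|].
    exists (fun u v => fu u v * g u v + f u v * gu u v), (fun u v => fv u v * g u v + f u v * gv u v).
    split; [apply hull_plus; apply hull_mult; assumption|].
    split; [apply hull_plus; apply hull_mult; assumption|].
    intros u v H; split.
    + apply (is_derive_mult (fun x => f x v) (fun x => g x v));
        [apply Df|apply Dg|intros; apply Rmult_comm]; assumption.
    + apply (is_derive_mult (fun x => f u x) (fun x => g u x));
        [apply Df|apply Dg|intros; apply Rmult_comm]; assumption.
  - split.
    + intros u v H. apply (continuity_1d_2d_pt_comp h f); [|apply cf, H].
      apply continuity_pt_filterlim. apply (ex_derive_continuous h).
      exact (Hh 1%nat _ (HJ u v H)).
    + exists (fun u v => fu u v * Derive h (f u v)), (fun u v => fv u v * Derive h (f u v)).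
      assert (hull Om G (fun u v => Derive h (f u v))).
      { apply (hull_comp1 Om G J); [apply smooth1_Derive, Hh|assumption..]. }
      split; [apply hull_mult; assumption|]. split; [apply hull_mult; assumption|].
      intros u v H1; split.
      * apply (is_derive_comp h (fun x => f x v)); [|apply Df, H1].
        apply (smooth1_is_derive J); [exact Hh|apply HJ, H1].
      * apply (is_derive_comp h (fun x => f u x)); [|apply Df, H1].
        apply (smooth1_is_derive J); [exact Hh|apply HJ, H1].
  - assert (A : forall u v, Om u v -> differentiable_pt_lim h (f u v) (g u v)
        (du h (f u v) (g u v)) (dv h (f u v) (g u v))).
    { intros u v H. apply (smooth_differentiable U); auto. }
    split.
    + intros u v H. apply continuity_2d_pt_filterlim.
      specialize (smooth_continuity U h _ _ Hh (HUfg u v H)) as c.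
      apply continuity_2d_pt_filterlim in c.
      specialize (cf u v H). specialize (cg u v H).
      apply continuity_2d_pt_filterlim in cf. apply continuity_2d_pt_filterlim in cg.
      apply (filterlim_comp_2 (G := locally (f u v)) (H := locally (g u v)) _ _ (fun x y => h x y) cf cg).
      intros P HP. specialize (c P HP). destruct c as [d Hd].
      apply (Filter_prod _ _ _ (fun x => ball (f u v) d x) (fun y => ball (g u v) d y)).
      * exists d. auto.
      * exists d. auto.
      * intros x y Hx Hy. apply (Hd (x, y)). split; assumption.
    + exists (fun u v => du h (f u v) (g u v) * fu u v + dv h (f u v) (g u v) * gu u v),
             (fun u v => du h (f u v) (g u v) * fv u v + dv h (f u v) (g u v) * gv u v).
      assert (hull Om G (fun u v => du h (f u v) (g u v))).
      { apply (hull_comp2 Om G U); try assumption. apply smooth_du, Hh. }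
      assert (hull Om G (fun u v => dv h (f u v) (g u v))).
      { apply (hull_comp2 Om G U); try assumption. apply smooth_dv, Hh. }
      split; [apply hull_plus; apply hull_mult; assumption|].
      split; [apply hull_plus; apply hull_mult; assumption|].
      intros u v H1; split; apply is_derive_Reals.
      * apply (derivable_pt_lim_comp_2d h (fun x => f x v) (fun x => g x v)); [apply A, H1|..];
          apply is_derive_Reals; [apply Df|apply Dg]; exact H1.
      * apply (derivable_pt_lim_comp_2d h (fun x => f u x) (fun x => g u x)); [apply A, H1|..];
          apply is_derive_Reals; [apply Df|apply Dg]; exact H1.
Qed.

Definition no_gen : (R -> R -> R) -> Prop := fun _ => False.

Lemma smooth_hull (Om : dom) f : open_dom Om -> hull Om no_gen f -> smooth Om f.
Proof. intros HO. apply hull_is_smooth; [exact HO|]. intros g []. Qed.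

Lemma smooth_const (Om : dom) (c : R) : open_dom Om -> smooth Om (fun _ _ => c).
Proof.
  intros HO. apply (smooth_coind Om (fun f => exists c, f = fun _ _ => c)); [exact HO| |exists c; reflexivity].
  intros f (a & ->). split; [intros; apply continuity_2d_pt_const|].
  exists (fun _ _ => 0), (fun _ _ => 0).
  split; [exists 0; reflexivity|]. split; [exists 0; reflexivity|].
  intros u v _. split; apply (is_derive_const a).
Qed.

Lemma smooth_fst (Om : dom) : open_dom Om -> smooth Om (fun u _ => u).
Proof.
  intros HO. apply (smooth_coind Om (fun f => f = (fun u _ => u) \/ exists c, f = fun _ _ => c)); [exact HO| |left; reflexivity].
  intros f [->|(a & ->)].
  - split; [intros; apply continuity_2d_pt_id1|].
    exists (fun _ _ => 1), (fun _ _ => 0).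
    split; [right; exists 1; reflexivity|]. split; [right; exists 0; reflexivity|].
    intros u v _. split; [apply (is_derive_id u)|apply (is_derive_const u)].
  - split; [intros; apply continuity_2d_pt_const|].
    exists (fun _ _ => 0), (fun _ _ => 0).
    split; [right; exists 0; reflexivity|]. split; [right; exists 0; reflexivity|].
    intros u v _. split; apply (is_derive_const a).
Qed.

Lemma smooth_snd (Om : dom) : open_dom Om -> smooth Om (fun _ v => v).
Proof.
  intros HO. apply (smooth_coind Om (fun f => f = (fun _ v => v) \/ exists c, f = fun _ _ => c)); [exact HO| |left; reflexivity].
  intros f [->|(a & ->)].
  - split; [intros; apply continuity_2d_pt_id2|].
    exists (fun _ _ => 0), (fun _ _ => 1).
    split; [right; exists 0; reflexivity|]. split; [right; exists 1; reflexivity|].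
    intros u v _. split; [apply (is_derive_const v)|apply (is_derive_id v)].
  - split; [intros; apply continuity_2d_pt_const|].
    exists (fun _ _ => 0), (fun _ _ => 0).
    split; [right; exists 0; reflexivity|]. split; [right; exists 0; reflexivity|].
    intros u v _. split; apply (is_derive_const a).
Qed.

Lemma smooth_plus (Om : dom) f g : open_dom Om -> smooth Om f -> smooth Om g ->
  smooth Om (fun u v => f u v + g u v).
Proof. intros. apply smooth_hull; [assumption|]. apply hull_plus; apply hull_smooth; assumption. Qed.

Lemma smooth_mult (Om : dom) f g : open_dom Om -> smooth Om f -> smooth Om g ->
  smooth Om (fun u v => f u v * g u v).
Proof. intros. apply smooth_hull; [assumption|]. apply hull_mult; apply hull_smooth; assumption. Qed.

Lemma smooth_comp1 (Om : dom) J h f : open_dom Om -> smooth1 J h -> smooth Om f ->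
  (forall u v, Om u v -> J (f u v)) -> smooth Om (fun u v => h (f u v)).
Proof. intros. apply smooth_hull; [assumption|]. apply (hull_comp1 _ _ J); try apply hull_smooth; assumption. Qed.

Lemma smooth_comp2 (Om U : dom) h f g : open_dom Om -> open_dom U -> smooth U h ->
  smooth Om f -> smooth Om g -> (forall u v, Om u v -> U (f u v) (g u v)) ->
  smooth Om (fun u v => h (f u v) (g u v)).
Proof. intros. apply smooth_hull; [assumption|]. apply (hull_comp2 _ _ U); try apply hull_smooth; assumption. Qed.

Lemma smooth_opp (Om : dom) f : open_dom Om -> smooth Om f -> smooth Om (fun u v => - f u v).
Proof.
  intros. apply (smooth_ext Om (fun u v => (-1) * f u v)); [assumption|intros; ring|].
  apply smooth_mult; [assumption|apply smooth_const; assumption|assumption].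
Qed.

Lemma smooth_minus (Om : dom) f g : open_dom Om -> smooth Om f -> smooth Om g ->
  smooth Om (fun u v => f u v - g u v).
Proof. intros. apply smooth_plus; [assumption..|]. apply smooth_opp; assumption. Qed.

Lemma smooth_pow (Om : dom) f n : open_dom Om -> smooth Om f -> smooth Om (fun u v => f u v ^ n).
Proof.
  intros HO S. induction n as [|n IH]; simpl; [apply smooth_const, HO|].
  apply smooth_mult; assumption.
Qed.

Lemma smooth1_sin J : (forall t, J t -> locally t J) -> smooth1 J sin.
Proof.
  intros HJ. apply (smooth1_coind J (fun f => exists a b, f = fun t => a * sin t + b * cos t)); [exact HJ| |].
  - intros f (a & b & ->). exists (fun t => (- b) * sin t + a * cos t).
    split; [exists (-b), a; reflexivity|]. intros t _. auto_derive; [exact I|ring].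
  - exists 1, 0. apply FunctionalExtensionality.functional_extensionality. intros; ring.
Qed.

Lemma smooth1_cos J : (forall t, J t -> locally t J) -> smooth1 J cos.
Proof.
  intros HJ. apply (smooth1_coind J (fun f => exists a b, f = fun t => a * sin t + b * cos t)); [exact HJ| |].
  - intros f (a & b & ->). exists (fun t => (- b) * sin t + a * cos t).
    split; [exists (-b), a; reflexivity|]. intros t _. auto_derive; [exact I|ring].
  - exists 0, 1. apply FunctionalExtensionality.functional_extensionality. intros; ring.
Qed.

Lemma smooth1_exp J : (forall t, J t -> locally t J) -> smooth1 J exp.
Proof.
  intros HJ. apply (smooth1_coind J (fun f => f = exp)); [exact HJ| |reflexivity].
  intros f ->. exists exp. split; [reflexivity|]. intros t _. apply is_derive_exp.
Qed.

Lemma locally_neq0 t : t <> 0 -> locally t (fun x => x <> 0).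
Proof.
  intros H. exists (mkposreal _ (Rabs_pos_lt t H)). intros y Hy ->.
  unfold ball in Hy; simpl in Hy; unfold AbsRing_ball, abs, minus, plus, opp in Hy; simpl in Hy.
  rewrite Rplus_0_l, Rabs_Ropp in Hy. lra.
Qed.

Lemma locally_pos t : 0 < t -> locally t (fun x => 0 < x).
Proof. intros H. apply (open_gt 0 t H). Qed.

Lemma smooth1_inv : smooth1 (fun t => t <> 0) Rinv.
Proof.
  apply (smooth1_coind _ (fun f => exists c n, f = fun t => c * (/ t) ^ n)).
  - apply locally_neq0.
  - intros f (c & n & ->). exists (fun t => (- c * INR n) * (/ t) ^ S n).
    split; [exists (- c * INR n), (S n); reflexivity|].
    intros t Ht. auto_derive; [exact Ht|]. destruct n; simpl pred; [simpl; ring|].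
    simpl pow. field. exact Ht.
  - exists 1, 1%nat. apply FunctionalExtensionality.functional_extensionality. intros; simpl; ring.
Qed.

(** The invariant class is [c sqrt t / t^n]: the factor [1 / sqrt t] produced by differentiation is
    rewritten as [sqrt t / t]. *)
Lemma smooth1_sqrt : smooth1 (fun t => 0 < t) sqrt.
Proof.
  apply (smooth1_coind _ (fun f => exists c n, f = fun t => c * sqrt t * (/ t) ^ n)).
  - apply locally_pos.
  - intros f (c & n & ->). exists (fun t => (c * (/ 2 - INR n)) * sqrt t * (/ t) ^ S n).
    split; [exists (c * (/ 2 - INR n)), (S n); reflexivity|].
    intros t Ht. assert (0 < sqrt t) by (apply sqrt_lt_R0, Ht).
    assert (E : / sqrt t = sqrt t * / t).
    { apply (Rmult_eq_reg_l (sqrt t)); [|lra]. rewrite Rinv_r by lra.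
      rewrite <- Rmult_assoc, sqrt_sqrt by lra. field. lra. }
    auto_derive; [split; [lra|split; [lra|exact I]]|].
    rewrite ?Rinv_mult, E. destruct n; simpl pred; simpl pow; [simpl INR; field|].
    lra. field. lra.
  - exists 1, 0%nat. apply FunctionalExtensionality.functional_extensionality. intros; simpl; ring.
Qed.

Lemma smooth_sin (Om : dom) f : open_dom Om -> smooth Om f -> smooth Om (fun u v => sin (f u v)).
Proof.
  intros. apply (smooth_comp1 Om (fun _ => True)); auto. apply smooth1_sin.
  intros t _. apply filter_true.
Qed.

Lemma smooth_cos (Om : dom) f : open_dom Om -> smooth Om f -> smooth Om (fun u v => cos (f u v)).
Proof.
  intros. apply (smooth_comp1 Om (fun _ => True)); auto. apply smooth1_cos.
  intros t _. apply filter_true.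
Qed.

Lemma smooth_exp (Om : dom) f : open_dom Om -> smooth Om f -> smooth Om (fun u v => exp (f u v)).
Proof.
  intros. apply (smooth_comp1 Om (fun _ => True)); auto. apply smooth1_exp.
  intros t _. apply filter_true.
Qed.

Lemma smooth_inv (Om : dom) f : open_dom Om -> smooth Om f ->
  (forall u v, Om u v -> f u v <> 0) -> smooth Om (fun u v => / f u v).
Proof. intros. apply (smooth_comp1 Om (fun t => t <> 0)); auto. apply smooth1_inv. Qed.

Lemma smooth_div (Om : dom) f g : open_dom Om -> smooth Om f -> smooth Om g ->
  (forall u v, Om u v -> g u v <> 0) -> smooth Om (fun u v => f u v / g u v).
Proof. intros. apply smooth_mult; auto. apply smooth_inv; auto. Qed.

Lemma smooth_sqrt (Om : dom) f : open_dom Om -> smooth Om f ->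
  (forall u v, Om u v -> 0 < f u v) -> smooth Om (fun u v => sqrt (f u v)).
Proof. intros. apply (smooth_comp1 Om (fun t => 0 < t)); auto. apply smooth1_sqrt. Qed.

Ltac smooth_tac :=
  repeat first
    [ assumption
    | apply smooth_const | apply smooth_fst | apply smooth_snd
    | apply smooth_plus | apply smooth_minus | apply smooth_opp | apply smooth_mult
    | apply smooth_div | apply smooth_inv | apply smooth_pow
    | apply smooth_sin | apply smooth_cos | apply smooth_exp ].

(** Makes the composition rules for two variables available in one variable, by regarding a function
    as constant in the second argument. *)
Lemma smooth1_of_smooth (J : R -> Prop) g :
  (forall t, J t -> locally t J) -> smooth (fun u _ => J u) (fun u _ => g u) -> smooth1 J g.
Proof.
  intros HJ. apply (smooth1_coind J (fun g => smooth (fun u _ => J u) (fun u _ => g u))); [exact HJ|].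
  intros f Hf. exists (Derive f). split; [apply (smooth_du _ _ Hf)|].
  intros t Ht. apply (smooth_has_du _ _ t 0 Hf Ht).
Qed.

Lemma smooth1_primitive (J : R -> Prop) f g :
  (forall t, J t -> locally t J) -> (forall t, J t -> is_derive f t (g t)) -> smooth1 J g -> smooth1 J f.
Proof.
  intros HJ D Sg.
  apply (smooth1_coind J (fun h => smooth1 J h \/ h = f)); [exact HJ| |right; reflexivity].
  intros h [Hh| ->].
  - exists (Derive h). split; [left; apply smooth1_Derive, Hh|].
    intros t Ht. apply (smooth1_is_derive J); assumption.
  - exists g. split; [left; exact Sg|exact D].
Qed.

Lemma smooth_primitive (Om : dom) f p q :
  open_dom Om -> smooth Om p -> smooth Om q ->
  (forall u v, Om u v -> has_du f u v (p u v) /\ has_dv f u v (q u v)) -> smooth Om f.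
Proof.
  intros HO Sp Sq D. apply (hull_is_smooth Om (fun g => g = f)); [exact HO| |apply hull_gen; reflexivity].
  intros g ->. split.
  - intros u v H. apply (differentiable_continuous _ _ _ (p u v) (q u v)).
    apply differentiable_of_partials; [|apply D, H|apply (smooth_continuity Om); assumption].
    apply (locally_2d_of_dom Om); [exact HO| |exact H]. intros x y Hxy. apply D, Hxy.
  - exists p, q. split; [apply hull_smooth, Sp|]. split; [apply hull_smooth, Sq|exact D].
Qed.

Lemma smooth_schwarz (Om : dom) f u v :
  open_dom Om -> smooth Om f -> Om u v -> dv (du f) u v = du (dv f) u v.
Proof.
  intros HO S H. symmetry. apply (Schwarz f u v).
  - apply (locally_2d_of_dom Om); [exact HO| |exact H]. intros x y Hxy.
    split; [eexists; apply (smooth_has_du Om); assumption|].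
    split; [eexists; apply (smooth_has_dv Om); assumption|].
    split; [eexists; apply (smooth_has_du Om (dv f)); [apply smooth_dv, S|exact Hxy]|].
    eexists; apply (smooth_has_dv Om (du f)); [apply smooth_du, S|exact Hxy].
  - apply (smooth_continuity Om (du (dv f))); [apply smooth_du, smooth_dv, S|exact H].
  - apply (smooth_continuity Om (dv (du f))); [apply smooth_dv, smooth_du, S|exact H].
Qed.

(** * Functions with vanishing gradient *)

Lemma const_on_segment f a b :
  (forall t, Rmin a b <= t <= Rmax a b -> is_derive f t 0) -> f a = f b.
Proof.
  intros H. destruct (Rtotal_order a b) as [L|[->|L]]; [|reflexivity|].
  - apply eq_is_derive; [|exact L]. intros t Ht. apply H.
    rewrite Rmin_left, Rmax_right; lra.
  - symmetry. apply eq_is_derive; [|exact L]. intros t Ht. apply H.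
    rewrite Rmin_right, Rmax_left; lra.
Qed.

Lemma const_on_box f u v (d : R) x y :
  (forall a b, Rabs (a - u) < d -> Rabs (b - v) < d -> has_du f a b 0 /\ has_dv f a b 0) ->
  Rabs (x - u) < d -> Rabs (y - v) < d -> f x y = f u v.
Proof.
  intros H Hx Hy.
  assert (d0 : 0 < d) by (pose proof (Rabs_pos (x - u)); lra).
  transitivity (f x v).
  - symmetry. apply (const_on_segment (fun t => f x t)). intros t Ht. apply H; [exact Hx|].
    revert Hy Ht. unfold Rmin, Rmax, Rabs. repeat destruct Rle_dec; repeat destruct Rcase_abs; lra.
  - symmetry. apply (const_on_segment (fun t => f t v)). intros t Ht. apply H.
    + revert Hx Ht. unfold Rmin, Rmax, Rabs. repeat destruct Rle_dec; repeat destruct Rcase_abs; lra.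
    + replace (v - v) with 0 by ring. rewrite Rabs_R0. exact d0.
Qed.

(** Vanishing partials make the function locally constant, so its level set through the base point
    and the complement are both relatively open. *)
Lemma connected_const (D : dom) f u0 v0 u v :
  open_dom D -> connected_dom D ->
  (forall u v, D u v -> has_du f u v 0 /\ has_dv f u v 0) ->
  D u0 v0 -> D u v -> f u v = f u0 v0.
Proof.
  intros HO HC H H0 Huv.
  assert (A : forall a b, D a b -> locally_2d (fun x y => f x y = f a b) a b).
  { intros a b Hab. destruct (HO a b Hab) as [d Hd]. exists d. intros x y Hx Hy.
    apply (const_on_box f a b d); [|assumption..]. intros; apply H, Hd; assumption. }
  destruct (HC (fun x y => f x y = f u0 v0)) as [B|B].
  - intros a b Hab E. destruct (A a b Hab) as [d Hd]. exists d. intros x y Hx Hy _.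
    rewrite (Hd x y Hx Hy). exact E.
  - intros a b Hab E. destruct (A a b Hab) as [d Hd]. exists d. intros x y Hx Hy _.
    rewrite (Hd x y Hx Hy). exact E.
  - apply B, Huv.
  - exfalso. apply (B u0 v0 H0). reflexivity.
Qed.

(** * Exact forms and Volterra equations *)

Definition swap_dom (D : dom) : dom := fun u v => D v u.

Lemma open_swap D : open_dom D -> open_dom (swap_dom D).
Proof.
  intros H u v Huv. destruct (H v u Huv) as [d Hd]. exists d. intros x y Hx Hy.
  apply Hd; assumption.
Qed.

Lemma smooth_swap D f : open_dom D -> smooth D f -> smooth (swap_dom D) (fun u v => f v u).
Proof.
  intros HO S. pose proof (open_swap D HO) as HO'.
  apply (smooth_comp2 _ D f (fun _ v => v) (fun u _ => u)); smooth_tac.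
  intros u v H; exact H.
Qed.

Lemma open_preimage (U : dom) (f g : R -> R -> R) :
  open_dom U ->
  (forall u v, continuity_2d_pt f u v) -> (forall u v, continuity_2d_pt g u v) ->
  open_dom (fun u v => U (f u v) (g u v)).
Proof.
  intros HU Hf Hg u v H. destruct (HU _ _ H) as [d Hd].
  destruct (Hf u v d) as [d1 H1]. destruct (Hg u v d) as [d2 H2].
  exists (mkposreal (Rmin d1 d2) (Rmin_stable_in_posreal d1 d2)). simpl. intros x y Hx Hy.
  apply Hd; [apply H1|apply H2]; eapply Rlt_le_trans; try eassumption; [apply Rmin_l|apply Rmin_l|apply Rmin_r|apply Rmin_r].
Qed.

Definition star_shaped (D : dom) : Prop :=
  forall u v s, D u v -> 0 <= s <= 1 -> D (s * u) (s * v).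

(** The homotopy operator of the Poincare lemma: the integral of the form along the ray from the
    origin. *)
Definition radial_primitive (p q : R -> R -> R) (u v : R) : R :=
  RInt (fun s => u * p (s * u) (s * v) + v * q (s * u) (s * v)) 0 1.

(** Differentiation under the integral sign and closedness turn the integrand into
    [d/ds (s p (s u, s v))], whose integral over [[0, 1]] is [p (u, v)]. *)
Lemma radial_primitive_du (D : dom) p q :
  open_dom D -> star_shaped D -> smooth D p -> smooth D q ->
  (forall u v, D u v -> dv p u v = du q u v) ->
  forall u v, D u v -> has_du (radial_primitive p q) u v (p u v).
Proof.
  intros HO HS Sp Sq E u v Huv.
  set (Dh := fun x s : R => D (s * x) (s * v)).
  assert (HDh : open_dom Dh).
  { apply (open_preimage D (fun x s => s * x) (fun x s => s * v) HO); intros;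
    apply continuity_2d_pt_mult; try apply continuity_2d_pt_id1; try apply continuity_2d_pt_id2; apply continuity_2d_pt_const. }
  set (f := fun x s => x * p (s * x) (s * v) + v * q (s * x) (s * v)).
  assert (Sf : smooth Dh f).
  { unfold f. smooth_tac.
    - apply (smooth_comp2 Dh D p (fun x s => s * x) (fun x s => s * v)); smooth_tac. auto.
    - apply (smooth_comp2 Dh D q (fun x s => s * x) (fun x s => s * v)); smooth_tac. auto. }
  assert (R01 : forall t, Rmin 0 1 <= t <= Rmax 0 1 -> 0 <= t <= 1)
    by (intros t; rewrite Rmin_left, Rmax_right by lra; auto).
  assert (HL : locally u (fun x => D x v)).
  { destruct (HO u v Huv) as [d Hd]. exists d. intros x Hx. apply Hd; [exact Hx|].
    replace (v - v) with 0 by ring. rewrite Rabs_R0. apply cond_pos. }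
  unfold has_du.
  assert (V : RInt (fun s => Derive (fun x => f x s) u) 0 1 = p u v).
  { rewrite (RInt_ext _ (fun s => p (s * u) (s * v) + s * (u * du p (s * u) (s * v) + v * dv p (s * u) (s * v)))).
    - apply is_RInt_unique.
      replace (p u v) with (minus (1 * p (1 * u) (1 * v)) (0 * p (0 * u) (0 * v)))
        by (unfold minus, plus, opp; simpl; rewrite !Rmult_1_l; ring).
      apply (is_RInt_derive (fun s => s * p (s * u) (s * v))).
      + intros s Hs. assert (Hd : D (s * u) (s * v)) by (apply HS; [exact Huv|apply R01, Hs]).
        apply is_derive_Reals.
        replace (p (s * u) (s * v) + s * (u * du p (s * u) (s * v) + v * dv p (s * u) (s * v)))
          with (1 * p (s * u) (s * v) + s * (du p (s * u) (s * v) * u + dv p (s * u) (s * v) * v)) by ring.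
        apply (derivable_pt_lim_mult (fun s => s) (fun s => p (s * u) (s * v))); [apply derivable_pt_lim_id|].
        apply (derivable_pt_lim_comp_2d p (fun s => s * u) (fun s => s * v)).
        * apply (smooth_differentiable D); assumption.
        * apply is_derive_Reals. auto_derive; [exact I|ring].
        * apply is_derive_Reals. auto_derive; [exact I|ring].
      + intros s Hs. assert (Hd : D (s * u) (s * v)) by (apply HS; [exact Huv|apply R01, Hs]).
        set (g := fun (_ s : R) => p (s * u) (s * v) + s * (u * du p (s * u) (s * v) + v * dv p (s * u) (s * v))).
        assert (Og : open_dom (fun _ s : R => D (s * u) (s * v))).
        { apply (open_preimage D (fun x s => s * u) (fun x s => s * v) HO); intros;
          apply continuity_2d_pt_mult; try apply continuity_2d_pt_id2; apply continuity_2d_pt_const. }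
        assert (Sg : smooth (fun _ s => D (s * u) (s * v)) g).
        { unfold g. smooth_tac.
          - apply (smooth_comp2 _ D p (fun x s => s * u) (fun x s => s * v)); smooth_tac. auto.
          - apply (smooth_comp2 _ D (du p) (fun x s => s * u) (fun x s => s * v)); smooth_tac; [apply smooth_du, Sp|auto].
          - apply (smooth_comp2 _ D (dv p) (fun x s => s * u) (fun x s => s * v)); smooth_tac; [apply smooth_dv, Sp|auto]. }
        apply (ex_derive_continuous (fun s => g 0 s)).
        exists (dv g 0 s). apply (smooth_has_dv _ g 0 s Sg). exact Hd.
    - rewrite Rmin_left, Rmax_right by lra. intros s Hs.
      assert (Hd : D (s * u) (s * v)) by (apply HS; [exact Huv|lra]).
      apply is_derive_unique. unfold f. rewrite (E _ _ Hd). apply is_derive_Reals.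
      replace (p (s * u) (s * v) + s * (u * du p (s * u) (s * v) + v * du q (s * u) (s * v)))
        with ((1 * p (s * u) (s * v) + u * (du p (s * u) (s * v) * s + dv p (s * u) (s * v) * 0)) +
               v * (du q (s * u) (s * v) * s + dv q (s * u) (s * v) * 0)) by ring.
      apply (derivable_pt_lim_plus (fun x => x * p (s * x) (s * v)) (fun x => v * q (s * x) (s * v))).
      + apply (derivable_pt_lim_mult (fun x => x) (fun x => p (s * x) (s * v))); [apply derivable_pt_lim_id|].
        apply (derivable_pt_lim_comp_2d p (fun x => s * x) (fun x => s * v)).
        * apply (smooth_differentiable D); assumption.
        * apply is_derive_Reals. auto_derive; [exact I|ring].
        * apply derivable_pt_lim_const.
      + apply (derivable_pt_lim_scal (fun x => q (s * x) (s * v))).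
        apply (derivable_pt_lim_comp_2d q (fun x => s * x) (fun x => s * v)).
        * apply (smooth_differentiable D); assumption.
        * apply is_derive_Reals. auto_derive; [exact I|ring].
        * apply derivable_pt_lim_const. }
  rewrite <- V.
  apply (is_derive_RInt_param f 0 1 u).
  - revert HL. apply filter_imp. intros x Hx t Ht. eexists. apply (smooth_has_du Dh f x t Sf).
    apply HS; auto.
  - intros t Ht. apply (smooth_continuity Dh (du f)); [apply smooth_du, Sf|]. apply HS; auto.
  - revert HL. apply filter_imp. intros x Hx. apply (ex_RInt_continuous (fun s => f x s)).
    intros t Ht. apply (ex_derive_continuous (fun s => f x s)).
    exists (dv f x t). apply (smooth_has_dv Dh f x t Sf). apply HS; auto.
Qed.

Lemma closed_form_exact (D : dom) p q :
  open_dom D -> star_shaped D -> smooth D p -> smooth D q ->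
  (forall u v, D u v -> dv p u v = du q u v) ->
  exists f, smooth D f /\
    forall u v, D u v -> has_du f u v (p u v) /\ has_dv f u v (q u v).
Proof.
  intros HO HS Sp Sq E. exists (radial_primitive p q).
  assert (A : forall u v, D u v -> has_du (radial_primitive p q) u v (p u v) /\
     has_dv (radial_primitive p q) u v (q u v)).
  { intros u v Huv. split; [apply (radial_primitive_du D); assumption|].
    (* The other partial is the first one for the problem with both variables exchanged. *)
    pose proof (radial_primitive_du (swap_dom D) (fun u v => q v u) (fun u v => p v u)
      (open_swap D HO) (fun a b s H Hs => HS b a s H Hs) (smooth_swap D q HO Sq) (smooth_swap D p HO Sp)
      (fun a b H => eq_sym (E b a H)) v u Huv) as B.
    unfold has_du in B. unfold has_dv. eapply is_derive_ext; [|exact B].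
    intros t. apply RInt_ext. intros s _. simpl. ring. }
  split; [|exact A]. apply (smooth_primitive D _ p q); assumption.
Qed.

(** Picard iteration for a system with components indexed by [I]. A Volterra operator gains a factor
    [|t| / (n + 1)] at the step [n], so the differences of the iterates are dominated by an
    exponential series whatever the size of [L]; the solution exists on the whole line although [L]
    depends on [T]. *)
Lemma volterra_fixed_point (I : Type) (F : (I -> R -> R) -> I -> R -> R) :
  (forall f, (forall i t, continuous (f i) t) -> forall i t, continuous (F f i) t) ->
  (forall T, 0 < T -> exists M, forall i t, Rabs t <= T -> Rabs (F (fun _ _ => 0) i t) <= M) ->
  (forall T, 0 < T -> exists L, 0 <= L /\ forall f g n M,
     (forall i t, continuous (f i) t) -> (forall i t, continuous (g i) t) -> 0 <= M ->
     (forall i t, Rabs t <= T -> Rabs (f i t - g i t) <= M * (Rabs t ^ n / INR (fact n))) ->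
     forall i t, Rabs t <= T ->
       Rabs (F f i t - F g i t) <= L * M * (Rabs t ^ S n / INR (fact (S n)))) ->
  exists f, (forall i t, continuous (f i) t) /\ forall i t, f i t = F f i t.
Proof.
  intros HC H0 HL.
  set (it := fun n => Nat.iter n F (fun _ _ => 0)).
  assert (Cit : forall n i t, continuous (it n i) t).
  { induction n; intros i t; [apply continuous_const|apply HC; assumption]. }
  set (d := fun i t n => it (S n) i t - it n i t).
  assert (B : forall T, 0 < T -> exists L M, 0 <= L /\ 0 <= M /\ forall n i t, Rabs t <= T ->
     Rabs (d i t n) <= M * ((L * T) ^ n / INR (fact n))).
  { intros T HT. destruct (H0 T HT) as [M HM]. destruct (HL T HT) as (L & L0 & H).
    assert (M0 : 0 <= Rmax M 0) by apply Rmax_r.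
    exists L, (Rmax M 0). split; [exact L0|]. split; [exact M0|].
    assert (K : forall n i t, Rabs t <= T -> Rabs (d i t n) <= Rmax M 0 * L ^ n * (Rabs t ^ n / INR (fact n))).
    { induction n; intros i t Ht.
      - unfold d, it; simpl. rewrite Rminus_0_r, Rdiv_1_r, !Rmult_1_r.
        eapply Rle_trans; [apply HM, Ht|apply Rmax_l].
      - replace (Rmax M 0 * L ^ S n) with (L * (Rmax M 0 * L ^ n)) by (simpl; ring).
        apply (H (it (S n)) (it n) n); auto.
        apply Rmult_le_pos; [exact M0|apply pow_le, L0]. }
    intros n i t Ht. eapply Rle_trans; [apply K, Ht|].
    rewrite Rmult_assoc. apply Rmult_le_compat_l; [exact M0|].
    rewrite Rpow_mult_distr. unfold Rdiv. rewrite Rmult_assoc.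
    apply Rmult_le_compat_l; [apply pow_le, L0|].
    apply Rmult_le_compat_r; [left; apply Rinv_0_lt_compat, INR_fact_lt_0|].
    apply pow_incr. split; [apply Rabs_pos|exact Ht]. }
  assert (Sum : forall i t n, sum_n (d i t) n = it (S n) i t).
  { intros i t n. induction n.
    - rewrite sum_O. unfold d, it; simpl. ring.
    - rewrite sum_Sn, IHn. change (it (S n) i t + (it (S (S n)) i t - it (S n) i t) = it (S (S n)) i t). ring. }
  assert (Ser : forall M x, ex_series (fun n => M * (x ^ n / INR (fact n)))).
  { intros M x. apply (ex_series_scal_l M (fun n => x ^ n / INR (fact n))). exists (exp x).
    apply (is_series_ext (fun k => scal (pow_n x k) (/ INR (fact k)))); [|apply (is_exp_Reals x)].
    intros k. rewrite pow_n_pow. reflexivity. }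
  assert (ExS : forall i t, ex_series (d i t)).
  { intros i t. destruct (B (Rabs t + 1)) as (L & M & L0 & M0 & H); [pose proof (Rabs_pos t); lra|].
    apply (ex_series_le (d i t) (fun n => M * ((L * (Rabs t + 1)) ^ n / INR (fact n)))); [|apply Ser].
    intros n. apply H. lra. }
  set (f := fun i t => Series (d i t)).
  (* The tail of the majorising exponential series does not depend on [i] and [t], so the
     convergence is uniform for [|t| <= T]; this gives continuity of the limit. *)
  assert (Tail : forall T, 0 < T -> forall eps, 0 < eps -> exists N, forall n i t, (N <= n)%nat -> Rabs t <= T ->
      Rabs (f i t - it (S n) i t) <= eps).
  { intros T HT eps He. destruct (B T HT) as (L & M & L0 & M0 & H).
    set (a := fun n => M * ((L * T) ^ n / INR (fact n))).
    assert (Ea : ex_series a) by apply Ser.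
    assert (a0 : forall n, 0 <= a n).
    { intros n. apply Rmult_le_pos; [exact M0|]. apply Rmult_le_pos; [apply pow_le; nra|].
      left; apply Rinv_0_lt_compat, INR_fact_lt_0. }
    pose proof (Series_correct a Ea) as Sa.
    apply is_lim_seq_Reals in Sa. destruct (Sa eps He) as [N HN].
    exists N. intros n i t Hn Ht.
    assert (E1 : f i t - it (S n) i t = Series (fun k => d i t (S n + k)%nat)).
    { unfold f. rewrite (Series_incr_n (d i t) (S n)); [|lia|apply ExS].
      rewrite <- (Sum i t n). simpl pred. rewrite sum_n_Reals. ring. }
    assert (E2 : Series a - sum_n a n = Series (fun k => a (S n + k)%nat)).
    { rewrite (Series_incr_n a (S n)); [|lia|apply Ea]. simpl pred. rewrite sum_n_Reals. ring. }
    rewrite E1.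
    assert (exA : ex_series (fun k => a (S n + k)%nat)) by (apply ex_series_incr_n, Ea).
    assert (exD : ex_series (fun k => Rabs (d i t (S n + k)%nat))).
    { apply (ex_series_le (fun k => Rabs (d i t (S n + k)%nat)) (fun k => a (S n + k)%nat)); [|exact exA].
      intros k. unfold norm; simpl. unfold abs; simpl. rewrite Rabs_Rabsolu. apply H, Ht. }
    eapply Rle_trans; [apply Series_Rabs, exD|].
    eapply Rle_trans.
    - apply Series_le; [|exact exA]. intros k. split; [apply Rabs_pos|apply H, Ht].
    - fold (a (S n)). change (Series (fun k => a (S n + k)%nat) <= eps). rewrite <- E2.
      specialize (HN n Hn). unfold R_dist in HN. rewrite Rabs_minus_sym in HN.
      eapply Rle_trans; [apply Rle_abs|left; exact HN]. }
  assert (Cf : forall i t, continuous (f i) t).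
  { intros i t. apply continuity_pt_filterlim. intros eps He.
    destruct (Tail (Rabs t + 1)) with (eps := eps / 4) as [N HN]; [pose proof (Rabs_pos t); lra|lra|].
    pose proof (Cit (S N) i t) as c. apply continuity_pt_filterlim in c.
    destruct (c (eps / 4)) as (al & al0 & Hal); [lra|].
    exists (Rmin al 1). split; [apply Rmin_pos; lra|].
    intros x [Hx1 Hx2].
    assert (T1 : Rabs (f i x - it (S N) i x) <= eps / 4).
    { apply HN; [lia|]. simpl in Hx2. unfold R_dist in Hx2.
      pose proof (Rmin_r al 1). pose proof (Rabs_triang_inv x t). lra. }
    assert (T2 : Rabs (f i t - it (S N) i t) <= eps / 4) by (apply HN; [lia|lra]).
    assert (T3 : Rabs (it (S N) i x - it (S N) i t) < eps / 4).
    { apply (Hal x). split; [exact Hx1|]. eapply Rlt_le_trans; [exact Hx2|apply Rmin_l]. }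
    simpl. unfold R_dist.
    replace (f i x - f i t) with ((f i x - it (S N) i x) + (it (S N) i x - it (S N) i t) - (f i t - it (S N) i t)) by ring.
    revert T1 T2 T3. unfold Rabs. repeat destruct Rcase_abs; lra. }
  exists f. split; [exact Cf|]. intros i t.
  assert (Ht : 0 < Rabs t + 1) by (pose proof (Rabs_pos t); lra).
  destruct (HL _ Ht) as (L & L0 & H).
  (* [f] and [F f] are both compared with one late iterate and its image; the second comparison is
     the Volterra estimate for [n = 0], with the tail bound as [M]. *)
  assert (K : forall eps, 0 < eps -> Rabs (f i t - F f i t) <= eps).
  { intros eps He. set (e1 := eps / (1 + L * (Rabs t + 1))).
    assert (D0 : 0 < 1 + L * (Rabs t + 1)) by (assert (0 <= L * (Rabs t + 1)) by (apply Rmult_le_pos; lra); lra).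
    assert (e0 : 0 < e1) by (apply Rdiv_lt_0_compat; lra).
    destruct (Tail (Rabs t + 1) Ht e1 e0) as [N HN].
    assert (A1 : Rabs (F f i t - F (it (S N)) i t) <= L * e1 * (Rabs t ^ 1 / INR (fact 1))).
    { apply (H f (it (S N)) 0%nat); auto; [lra| |lra].
      intros j s Hs. simpl. rewrite Rdiv_1_r, Rmult_1_r. apply HN; auto. }
    assert (A2 : Rabs (f i t - it (S (S N)) i t) <= e1) by (apply HN; [lia|lra]).
    replace (Rabs t ^ 1 / INR (fact 1)) with (Rabs t) in A1 by (simpl; field). change (it (S (S N)) i t) with (F (it (S N)) i t) in A2.
    assert (A3 : e1 * (1 + L * (Rabs t + 1)) = eps) by (unfold e1; field; lra).
    assert (0 <= L * e1) by (apply Rmult_le_pos; lra).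
    replace (f i t - F f i t) with ((f i t - F (it (S N)) i t) - (F f i t - F (it (S N)) i t)) by ring.
    assert (Rabs ((f i t - F (it (S N)) i t) - (F f i t - F (it (S N)) i t)) <= e1 + L * e1 * Rabs t).
    { revert A1 A2. generalize (L * e1 * Rabs t). intros z. unfold Rabs. repeat destruct Rcase_abs; lra. }
    nra. }
  destruct (Req_dec (f i t) (F f i t)) as [E|NE]; [exact E|exfalso].
  assert (0 < Rabs (f i t - F f i t)) by (apply Rabs_pos_lt; lra).
  specialize (K (Rabs (f i t - F f i t) / 2)). lra.
Qed.

(** * The Amsler profile *)

Lemma ex_RInt_cont (h : R -> R) a b : (forall t, continuous h t) -> ex_RInt h a b.
Proof. intros H. apply (ex_RInt_continuous h). intros t _. apply H. Qed.

Lemma RInt_volterra_bound_pos (h : R -> R) z n M :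
  (forall t, continuous h t) -> 0 <= z ->
  (forall s, 0 <= s <= z -> Rabs (h s) <= M * (s ^ n / INR (fact n))) ->
  Rabs (RInt h 0 z) <= M * (z ^ S n / INR (fact (S n))).
Proof.
  intros Ch z0 H.
  assert (I : is_RInt (fun s => M * (s ^ n / INR (fact n))) 0 z (M * (z ^ S n / INR (fact (S n))))).
  { replace (M * (z ^ S n / INR (fact (S n)))) with
      (minus (M * (z ^ S n / INR (fact (S n)))) (M * (0 ^ S n / INR (fact (S n)))))
      by (unfold minus, plus, opp; simpl; unfold Rdiv; ring).
    apply (is_RInt_derive (fun z => M * (z ^ S n / INR (fact (S n))))).
    - intros s _.
      assert (E : INR (fact (S n)) = INR (S n) * INR (fact n)) by (rewrite fact_simpl; apply mult_INR).
      pose proof (INR_fact_neq_0 n). assert (INR (S n) <> 0) by (apply not_0_INR; lia).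
      revert E. generalize (INR (fact (S n))). intros q E. auto_derive; [exact I|].
      change (pred (S n)) with n. rewrite E. change (match n with O => 1 | S _ => INR n + 1 end) with (INR (S n)).
      field. split; assumption.
    - intros s _. apply (ex_derive_continuous (fun s => M * (s ^ n / INR (fact n)))). auto_derive. exact I. }
  assert (Ex : ex_RInt h 0 z) by (apply ex_RInt_cont; auto).
  rewrite <- (is_RInt_unique _ _ _ _ I).
  eapply Rle_trans; [apply abs_RInt_le; [exact z0|exact Ex]|].
  apply RInt_le; [exact z0| |eexists; exact I|intros s Hs; apply H; lra].
  apply (ex_RInt_continuous (fun t => Rabs (h t))). intros s _.
  apply (continuous_comp h Rabs); [apply Ch|apply continuous_Rabs].
Qed.

Lemma RInt_volterra_bound (h : R -> R) z n M :
  (forall t, continuous h t) ->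
  (forall s, Rabs s <= Rabs z -> Rabs (h s) <= M * (Rabs s ^ n / INR (fact n))) ->
  Rabs (RInt h 0 z) <= M * (Rabs z ^ S n / INR (fact (S n))).
Proof.
  intros Ch H. destruct (Rle_dec 0 z) as [z0|z0].
  - rewrite (Rabs_right z) by lra. apply RInt_volterra_bound_pos; [exact Ch|exact z0|].
    intros s Hs. rewrite <- (Rabs_right s) at 2 by lra. apply H. rewrite !Rabs_right; lra.
  - assert (E : RInt h 0 z = - RInt (fun s => h (- s)) 0 (- z)).
    { pose proof (is_RInt_comp_opp h 0 (- z) (RInt h 0 z)) as K.
      rewrite Ropp_0, Ropp_involutive in K.
      specialize (K (RInt_correct h 0 z (ex_RInt_cont h 0 z Ch))).
      assert (Ex : ex_RInt (fun s => h (- s)) 0 (- z)).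
      { apply ex_RInt_cont. intros t. apply (continuous_comp Ropp h); [|apply Ch].
        apply (continuous_opp (fun t : R => t)). apply continuous_id. }
      rewrite <- (is_RInt_unique _ _ _ _ K). exact (RInt_opp (fun s => h (- s)) 0 (- z) Ex). }
    rewrite E, Rabs_Ropp, (Rabs_left z) by lra.
    apply RInt_volterra_bound_pos; [|lra|].
    + intros t. apply (continuous_comp Ropp h); [|apply Ch].
      apply (continuous_opp (fun t : R => t)). apply continuous_id.
    + intros s Hs. replace (s ^ n) with (Rabs (- s) ^ n) by (rewrite Rabs_Ropp, Rabs_right by lra; reflexivity).
      apply H. rewrite Rabs_Ropp, Rabs_right, Rabs_left; lra.
Qed.

Lemma RInt_primitive (h : R -> R) a : (forall t, continuous h t) -> forall z, is_derive (fun z => a + RInt h 0 z) z (h z).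
Proof.
  intros Ch z. replace (h z) with (0 + h z) by ring.
  apply (is_derive_plus (fun _ => a) (fun z => RInt h 0 z)); [apply (is_derive_const a)|].
  apply (is_derive_RInt h _ 0); [|apply Ch].
  apply filter_forall. intros x. apply (RInt_correct h), ex_RInt_cont; auto.
Qed.

Lemma continuous_of_derive (f : R -> R) t l : is_derive f t l -> continuous f t.
Proof. intros H. apply (ex_derive_continuous f). exists l. exact H. Qed.

(** [moment 0 f s] is the mean of [f] over [[0, s]]. The profile equation reads [(z w')' = sin w],
    so [w'] is the mean of [sin w] over [[0, z]]: in this form the division by [z] has disappeared.
    Differentiating [moment j f] produces [moment (j + 1) f'], which is why all powers are
    needed. *)
Definition moment (j : nat) (f : R -> R) (s : R) : R := RInt (fun t => t ^ j * f (s * t)) 0 1.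

Lemma continuity_2d_moment j (f : R -> R) s t :
  (forall t, continuous f t) -> continuity_2d_pt (fun s t => t ^ j * f (s * t)) s t.
Proof.
  intros Cf. apply continuity_2d_pt_mult.
  - apply (continuity_1d_2d_pt_comp (fun t => t ^ j) (fun _ t => t)); [|apply continuity_2d_pt_id2].
    apply derivable_continuous_pt, derivable_pt_pow.
  - apply (continuity_1d_2d_pt_comp f (fun s t => s * t)).
    + apply continuity_pt_filterlim, Cf.
    + apply continuity_2d_pt_mult; [apply continuity_2d_pt_id1|apply continuity_2d_pt_id2].
Qed.

Lemma moment_integrand_continuous j (f : R -> R) s t :
  (forall t, continuous f t) -> continuous (fun t => t ^ j * f (s * t)) t.
Proof.
  intros Cf. apply (continuous_mult (fun t => t ^ j) (fun t => f (s * t))).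
  - apply (ex_derive_continuous (fun t => t ^ j)). auto_derive. exact I.
  - apply (continuous_comp (fun t => s * t) f); [|apply Cf].
    apply (ex_derive_continuous (fun t => s * t)). auto_derive. exact I.
Qed.

Lemma ex_RInt_moment j (f : R -> R) s :
  (forall t, continuous f t) -> ex_RInt (fun t => t ^ j * f (s * t)) 0 1.
Proof.
  intros Cf. apply (ex_RInt_continuous (fun t => t ^ j * f (s * t))). intros t _.
  apply moment_integrand_continuous, Cf.
Qed.

Lemma moment_continuous j (f : R -> R) : (forall t, continuous f t) -> forall s, continuous (moment j f) s.
Proof.
  intros Cf s. apply continuity_pt_filterlim. intros eps He.
  destruct (uniform_continuity_2d_1d' (fun s t => t ^ j * f (s * t)) 0 1 s
     (fun x _ => continuity_2d_moment j f s x Cf) (mkposreal (eps / 2) ltac:(lra))) as [d Hd].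
  exists d. split; [apply cond_pos|]. intros x [_ Hx]. simpl in *. unfold R_dist in *.
  unfold moment.
  assert (E : RInt (fun t => t ^ j * f (x * t)) 0 1 - RInt (fun t => t ^ j * f (s * t)) 0 1 =
     RInt (fun t => minus (t ^ j * f (x * t)) (t ^ j * f (s * t))) 0 1).
  { symmetry. apply (RInt_minus (fun t => t ^ j * f (x * t)) (fun t => t ^ j * f (s * t))); apply ex_RInt_moment, Cf. }
  rewrite E. apply Rle_lt_trans with ((1 - 0) * (eps / 2)); [|lra].
  apply (abs_RInt_le_const _ 0 1); [lra| |].
  - apply (ex_RInt_minus (fun t => t ^ j * f (x * t)) (fun t => t ^ j * f (s * t))); apply ex_RInt_moment, Cf.
  - intros t Ht. left. apply Hd; try lra.
    + pose proof (cond_pos d). lra.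
    + revert Hx. unfold Rabs. destruct Rcase_abs; lra.
    + replace (t - t) with 0 by ring. rewrite Rabs_R0. apply cond_pos.
Qed.

Lemma moment_is_derive j (f f' : R -> R) :
  (forall t, is_derive f t (f' t)) -> (forall t, continuous f' t) ->
  forall s, is_derive (moment j f) s (moment (S j) f' s).
Proof.
  intros D Cf' s.
  assert (Cf : forall t, continuous f t) by (intros t; apply (continuous_of_derive f t (f' t)), D).
  assert (Dx : forall x t, is_derive (fun x => t ^ j * f (x * t)) x (t ^ S j * f' (x * t))).
  { intros x t. replace (t ^ S j * f' (x * t)) with (t ^ j * (t * f' (x * t))) by (simpl; ring).
    apply (is_derive_scal (fun x => f (x * t))).
    apply (is_derive_comp f (fun x => x * t)); [apply D|]. auto_derive; [exact I|ring]. }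
  unfold moment.
  rewrite <- (RInt_ext (fun t => Derive (fun u => t ^ j * f (u * t)) s)).
  - apply (is_derive_RInt_param (fun x t => t ^ j * f (x * t)) 0 1 s).
    + apply filter_forall. intros x t _. eexists. apply Dx.
    + intros t _. eapply continuity_2d_pt_ext; [|apply (continuity_2d_moment (S j) f' s t Cf')].
      intros x y. symmetry. apply is_derive_unique, Dx.
    + apply filter_forall. intros x. apply (ex_RInt_moment j f x Cf).
  - intros t _. apply is_derive_unique, Dx.
Qed.

(** The class that makes the profile smooth: it contains [w' = moment 0 (sin w)], and the derivative
    of each of its members stays inside it. *)
Inductive amsler_class (w : R -> R) : (R -> R) -> Prop :=
| ac_w : amsler_class w w
| ac_sin f : amsler_class w f -> amsler_class w (fun t => sin (f t))
| ac_cos f : amsler_class w f -> amsler_class w (fun t => cos (f t))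
| ac_opp f : amsler_class w f -> amsler_class w (fun t => - f t)
| ac_plus f g : amsler_class w f -> amsler_class w g -> amsler_class w (fun t => f t + g t)
| ac_mult f g : amsler_class w f -> amsler_class w g -> amsler_class w (fun t => f t * g t)
| ac_moment j f : amsler_class w f -> amsler_class w (moment j f).

Lemma amsler_class_derive (w : R -> R) :
  (forall t, continuous w t) -> (forall z, is_derive w z (moment 0 (fun t => sin (w t)) z)) ->
  forall f, amsler_class w f -> exists f', amsler_class w f' /\ forall t, is_derive f t (f' t).
Proof.
  intros Cw Dw.
  assert (C : forall f, amsler_class w f -> forall t, continuous f t).
  { intros f Hf. induction Hf; intros t.
    - apply Cw.
    - apply (continuous_comp f sin); [apply IHHf|apply continuous_sin].
    - apply (continuous_comp f cos); [apply IHHf|apply continuous_cos].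
    - apply (continuous_opp f), IHHf.
    - apply (continuous_plus f g); auto.
    - apply (continuous_mult f g); auto.
    - apply moment_continuous, IHHf. }
  intros f Hf. induction Hf as [|f Hf [f' [Hf' D]]|f Hf [f' [Hf' D]]|f Hf [f' [Hf' D]]
    |f g Hf [f' [Hf' Df]] Hg [g' [Hg' Dg]]|f g Hf [f' [Hf' Df]] Hg [g' [Hg' Dg]]|j f Hf [f' [Hf' D]]].
  - exists (moment 0 (fun t => sin (w t))). split; [apply ac_moment, ac_sin, ac_w|exact Dw].
  - exists (fun t => f' t * cos (f t)). split; [apply ac_mult; [exact Hf'|apply ac_cos, Hf]|].
    intros t. apply (is_derive_comp sin f); [apply is_derive_sin|apply D].
  - exists (fun t => f' t * - sin (f t)). split; [apply ac_mult; [exact Hf'|apply ac_opp, ac_sin, Hf]|].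
    intros t. apply (is_derive_comp cos f); [apply is_derive_cos|apply D].
  - exists (fun t => - f' t). split; [apply ac_opp, Hf'|]. intros t. apply (is_derive_opp f), D.
  - exists (fun t => f' t + g' t). split; [apply ac_plus; assumption|].
    intros t. apply (is_derive_plus f g); auto.
  - exists (fun t => f' t * g t + f t * g' t).
    split; [apply ac_plus; apply ac_mult; assumption|].
    intros t. apply (is_derive_mult f g); [apply Df|apply Dg|intros; apply Rmult_comm].
  - exists (moment (S j) f'). split; [apply ac_moment, Hf'|].
    intros t. apply moment_is_derive; auto.
Qed.

(* [w (r^2 / 4) = W r]. *)
Definition amsler_profile (k : R) (w : R -> R) : Prop :=
  smooth1 (fun _ => True) w /\ w 0 = k /\
  forall z, z * Derive (Derive w) z + Derive w z = sin (w z).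

Lemma sin_lipschitz a b : Rabs (sin a - sin b) <= Rabs (a - b).
Proof.
  destruct (MVT_gen sin b a cos) as (c & _ & E).
  - intros x _. apply is_derive_sin.
  - intros x _. apply continuity_sin.
  - rewrite E, Rabs_mult. pose proof (Rabs_pos (a - b)). pose proof (COS_bound c).
    assert (Rabs (cos c) <= 1) by (apply Rabs_le; lra). nra.
Qed.

(** [w] is a fixed point of [f |-> k + int_0^z moment 0 (sin f)]. The Volterra estimate holds with
    [L = 1], because the sine is 1-Lipschitz and averaging over [[0, s]] does not increase a bound
    that is monotone in [|s|]. Negative arguments are included, so that [w (x y)] is defined on the
    whole plane. *)
Lemma amsler_profile_exists k : exists w, amsler_profile k w.
Proof.
  set (F := fun (f : unit -> R -> R) (i : unit) z =>
     k + RInt (moment 0 (fun t => sin (f i t))) 0 z).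
  assert (Csin : forall f : R -> R, (forall t, continuous f t) -> forall t, continuous (fun t => sin (f t)) t).
  { intros f Cf t. apply (continuous_comp f sin); [apply Cf|apply continuous_sin]. }
  destruct (volterra_fixed_point unit F) as (f & Cf & Ef).
  - intros f Cf i t. apply (continuous_of_derive _ t (moment 0 (fun t => sin (f i t)) t)).
    apply RInt_primitive. apply moment_continuous, Csin, Cf.
  - intros T _. exists (Rabs k). intros i t _. unfold F.
    rewrite (RInt_ext _ (fun _ => 0)).
    + rewrite RInt_const. unfold scal; simpl; unfold mult; simpl. rewrite Rmult_0_r, Rplus_0_r. lra.
    + intros x _. unfold moment. rewrite (RInt_ext _ (fun _ => 0)).
      * rewrite RInt_const. unfold scal; simpl; unfold mult; simpl. ring.
      * intros y _. rewrite sin_0. apply Rmult_0_r.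
  - intros T HT. exists 1. split; [lra|]. intros f g n M Cf Cg M0 H i t Ht.
    assert (C1 : forall t, continuous (fun t => sin (f i t)) t) by (apply Csin, Cf).
    assert (C2 : forall t, continuous (fun t => sin (g i t)) t) by (apply Csin, Cg).
    assert (Cm1 := moment_continuous 0 _ C1). assert (Cm2 := moment_continuous 0 _ C2).
    unfold F. rewrite Rmult_1_l.
    match goal with |- Rabs (k + ?a - (k + ?b)) <= _ => replace (k + a - (k + b)) with (a - b) by ring; change (a - b) with (minus a b) end.
    rewrite <- (RInt_minus (moment 0 (fun t => sin (f i t))) (moment 0 (fun t => sin (g i t))));
      [|apply ex_RInt_cont; auto..].
    apply RInt_volterra_bound.
    + intros s. apply (continuous_minus (moment 0 (fun t => sin (f i t))) (moment 0 (fun t => sin (g i t)))); auto.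
    + intros s Hs. unfold moment.
      rewrite <- (RInt_minus (fun u => u ^ 0 * sin (f i (s * u))) (fun u => u ^ 0 * sin (g i (s * u))));
        [|apply (ex_RInt_moment 0 _ _ C1)|apply (ex_RInt_moment 0 _ _ C2)].
      eapply Rle_trans; [apply (abs_RInt_le_const _ 0 1 (M * (Rabs s ^ n / INR (fact n)))); [lra| |]|lra].
      * apply (ex_RInt_minus (fun u => u ^ 0 * sin (f i (s * u))) (fun u => u ^ 0 * sin (g i (s * u))));
         [apply (ex_RInt_moment 0 _ _ C1)|apply (ex_RInt_moment 0 _ _ C2)].
      * intros u Hu. unfold minus, plus, opp; simpl.
        replace (1 * sin (f i (s * u)) + - (1 * sin (g i (s * u)))) with (sin (f i (s * u)) - sin (g i (s * u))) by ring.
        eapply Rle_trans; [apply sin_lipschitz|].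
        assert (Rabs (s * u) <= Rabs s).
        { rewrite Rabs_mult, (Rabs_right u) by lra. pose proof (Rabs_pos s). nra. }
        eapply Rle_trans; [apply H; lra|]. apply Rmult_le_compat_l; [exact M0|].
        apply Rmult_le_compat_r; [left; apply Rinv_0_lt_compat, INR_fact_lt_0|].
        apply pow_incr. split; [apply Rabs_pos|assumption].
  - set (w := f tt).
    assert (Cw : forall t, continuous w t) by (intros; apply Cf).
    assert (Csw := Csin w Cw).
    assert (Dw : forall z, is_derive w z (moment 0 (fun t => sin (w t)) z)).
    { intros z. apply (is_derive_ext (F f tt)); [intros; symmetry; apply Ef|].
      apply RInt_primitive, moment_continuous, Csw. }
    exists w. split; [|split].
    + apply (smooth1_coind _ (amsler_class w)); [intros; apply filter_true| |apply ac_w].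
      intros g Hg. destruct (amsler_class_derive w Cw Dw g Hg) as (g' & Hg' & D). exists g'. auto.
    + unfold w. rewrite Ef. unfold F. rewrite RInt_point. apply Rplus_0_r.
    + intros z.
      assert (E : forall z, Derive w z = moment 0 (fun t => sin (w t)) z) by (intros; apply is_derive_unique, Dw).
      assert (D2 : forall t, is_derive (fun t => sin (w t)) t (moment 0 (fun t => sin (w t)) t * cos (w t))).
      { intros t. apply (is_derive_comp sin w); [apply is_derive_sin|apply Dw]. }
      assert (C2 : forall t, continuous (fun t => moment 0 (fun t => sin (w t)) t * cos (w t)) t).
      { intros t. apply (continuous_mult (moment 0 (fun t => sin (w t))) (fun t => cos (w t))).
        - apply moment_continuous, Csw.
        - apply (continuous_comp w cos); [apply Cw|apply continuous_cos]. }
      set (h := fun t => moment 0 (fun t => sin (w t)) t * cos (w t)) in *.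
      assert (E2 : Derive (Derive w) z = moment 1 h z).
      { apply is_derive_unique. eapply is_derive_ext; [|apply (moment_is_derive 0 _ h D2 C2 z)].
        intros t. symmetry. apply E. }
      rewrite E2, E.
      (* [g] is the derivative of [t sin (w (z t))]; integrating it over [[0, 1]] in two ways is the
         profile equation. *)
      set (g := fun t => plus (scal z (t ^ 1 * h (z * t))) (t ^ 0 * sin (w (z * t)))).
      assert (I1 : is_RInt g 0 1 (z * moment 1 h z + moment 0 (fun t => sin (w t)) z)).
      { apply (is_RInt_plus (fun t => scal z (t ^ 1 * h (z * t))) (fun t => t ^ 0 * sin (w (z * t)))).
        - apply (is_RInt_scal (fun t => t ^ 1 * h (z * t))).
          apply (RInt_correct (fun t => t ^ 1 * h (z * t))), (ex_RInt_moment 1 h z C2).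
        - apply (RInt_correct (fun t => t ^ 0 * sin (w (z * t)))), (ex_RInt_moment 0 _ z Csw). }
      assert (I2 : is_RInt g 0 1 (minus (1 * sin (w (z * 1))) (0 * sin (w (z * 0))))).
      { apply (is_RInt_derive (fun t => t * sin (w (z * t)))).
        - intros t _. replace (g t) with (1 * sin (w (z * t)) + t * (z * h (z * t))).
          2:{ unfold g, plus, scal; simpl; unfold mult; simpl. ring. }
          apply (is_derive_mult (fun t => t) (fun t => sin (w (z * t)))); [apply (is_derive_id t)| |intros; apply Rmult_comm].
          apply (is_derive_comp (fun t => sin (w t)) (fun t => z * t)); [apply D2|]. auto_derive; [exact I|ring].
        - intros t _. apply (continuous_plus (fun t => scal z (t ^ 1 * h (z * t))) (fun t => t ^ 0 * sin (w (z * t)))).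
          + apply (continuous_scal_r z (fun t => t ^ 1 * h (z * t))), (moment_integrand_continuous 1 h z t C2).
          + apply (moment_integrand_continuous 0 (fun t => sin (w t)) z t Csw). }
      rewrite <- (is_RInt_unique _ _ _ _ I1), (is_RInt_unique _ _ _ _ I2).
      rewrite Rmult_1_r. unfold minus, plus, opp; simpl. ring.
Qed.

(** * Monotonicity of the profile and the first cusp *)

Lemma derive_mean_value f f' a b :
  a <= b -> (forall t, a <= t <= b -> is_derive f t (f' t)) ->
  exists c, a <= c <= b /\ f b - f a = f' c * (b - a).
Proof.
  intros ab D. destruct (MVT_gen f a b f') as (c & Hc & E);
    rewrite Rmin_left, Rmax_right in * by lra.
  - intros x Hx. apply D. lra.
  - intros x Hx. apply continuity_pt_filterlim, (continuous_of_derive f x (f' x)), D, Hx.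
  - exists c. split; assumption.
Qed.

Lemma derive_nonneg_increasing f f' a b :
  a <= b -> (forall t, a <= t <= b -> is_derive f t (f' t)) ->
  (forall t, a <= t <= b -> 0 <= f' t) -> f a <= f b.
Proof.
  intros ab D P. destruct (derive_mean_value f f' a b ab D) as (c & Hc & E).
  specialize (P c Hc). nra.
Qed.

(** The hitting time is the supremum of the [z] for which [f] stays below [c] on [[0, z]]. *)
Lemma first_hit (f : R -> R) c Z :
  (forall t, continuous f t) -> f 0 < c -> 0 <= Z -> c <= f Z ->
  exists z, 0 < z <= Z /\ f z = c /\ forall t, 0 <= t < z -> f t < c.
Proof.
  intros Cf H0 HZ0 HZ.
  assert (loc : forall t, forall eps, 0 < eps -> exists d, 0 < d /\ forall x, Rabs (x - t) < d -> Rabs (f x - f t) < eps).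
  { intros t eps He. pose proof (Cf t) as C. apply continuity_pt_filterlim in C.
    destruct (C eps He) as (d & d0 & Hd). exists d. split; [exact d0|]. intros x Hx.
    destruct (Req_dec x t) as [->|N]; [replace (f t - f t) with 0 by ring; rewrite Rabs_R0; exact He|].
    apply (Hd x). split; [|exact Hx]. split; [exact I|auto]. }
  destruct (completeness (fun z => 0 <= z /\ forall t, 0 <= t <= z -> f t < c)) as [z [Hub Hlub]].
  - exists Z. intros z [z0 Hz]. destruct (Rle_dec z Z) as [L|L]; [exact L|exfalso].
    specialize (Hz Z). lra.
  - exists 0. split; [lra|]. intros t Ht. replace t with 0 by lra. exact H0.
  - assert (z0 : 0 <= z).
    { apply Hub. split; [lra|]. intros t Ht. replace t with 0 by lra. exact H0. }
    assert (Low : forall t, 0 <= t < z -> f t < c).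
    { intros t [t0 tz]. destruct (Rlt_dec (f t) c) as [L|L]; [exact L|exfalso].
      assert (z <= t); [|lra]. apply Hlub. intros y [y0 Hy].
      destruct (Rle_dec y t) as [Q|Q]; [exact Q|exfalso]. specialize (Hy t). lra. }
    assert (zZ : z <= Z).
    { apply Hlub. intros y [y0 Hy]. destruct (Rle_dec y Z) as [L|L]; [exact L|exfalso].
      specialize (Hy Z). lra. }
    assert (E : f z = c).
    { destruct (Rtotal_order (f z) c) as [L|[E|L]]; [exfalso|exact E|exfalso].
      - destruct (loc z (c - f z)) as (d & d0 & Hd); [lra|].
        assert (z + d / 2 <= z); [|lra]. apply Hub. split; [lra|]. intros t Ht.
        destruct (Rlt_dec t z) as [Q|Q]; [apply Low; lra|].
        assert (A : Rabs (f t - f z) < c - f z) by (apply Hd; rewrite Rabs_right; lra).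
        apply Rabs_def2 in A. lra.
      - destruct (Req_dec z 0) as [->|N]; [lra|].
        destruct (loc z (f z - c)) as (d & d0 & Hd); [lra|].
        set (t := Rmax 0 (z - d / 2)).
        assert (Ht : 0 <= t < z /\ z - d < t) by (unfold t, Rmax; destruct Rle_dec; lra).
        assert (A : Rabs (f t - f z) < f z - c) by (apply Hd; rewrite Rabs_left; lra).
        apply Rabs_def2 in A. specialize (Low t). lra. }
    exists z. split; [split; [|exact zZ]|split; assumption].
    destruct (Req_dec z 0) as [->|N]; lra.
Qed.

Lemma profile_derive k w : amsler_profile k w -> forall z, is_derive w z (Derive w z).
Proof. intros (S & _) z. apply (smooth1_is_derive _ w z S I). Qed.

Lemma profile_derive2 k w : amsler_profile k w -> forall z, is_derive (Derive w) z (Derive (Derive w) z).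
Proof. intros (S & _) z. apply (smooth1_is_derive _ _ z (smooth1_Derive _ _ S) I). Qed.

Lemma profile_continuous k w : amsler_profile k w -> forall z, continuous w z.
Proof. intros H z. apply (continuous_of_derive w z (Derive w z)), (profile_derive k w H). Qed.

(** The profile equation in divergence form. As long as [sin w] is positive the flux [z w']
    increases from [0], which gives the sign of [w'] without solving anything. *)
Lemma profile_flux k w : amsler_profile k w ->
  forall z, is_derive (fun z => z * Derive w z) z (sin (w z)).
Proof.
  intros H z. destruct H as (S & W0 & E). rewrite <- E.
  replace (z * Derive (Derive w) z + Derive w z) with (1 * Derive w z + z * Derive (Derive w) z) by ring.
  apply (is_derive_mult (fun z => z) (Derive w)); [apply (is_derive_id z)| |intros; apply Rmult_comm].
  apply (profile_derive2 k w). split; [|split]; assumption.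
Qed.

(** A drop of [w] to [k / 2] would need a point with negative derivative before it; but up to the
    first drop [sin w >= 0], so the flux [z w'] is nonnegative there. *)
Lemma profile_below_PI k w Z : amsler_profile k w -> 0 < k < PI ->
  (forall z, 0 <= z < Z -> w z < PI) ->
  forall z, 0 <= z < Z -> 0 < w z < PI /\ (0 < z -> 0 < Derive w z).
Proof.
  intros H Hk HZ.
  assert (W0 : w 0 = k) by (destruct H as (_ & W0 & _); exact W0).
  assert (P : forall z, 0 <= z < Z -> k / 2 < w z).
  { intros z Hz. destruct (Rlt_dec (k / 2) (w z)) as [L|L]; [exact L|exfalso].
    destruct (first_hit (fun t => - w t) (- (k / 2)) z) as (y & Hy & Ey & Ly); try lra.
    - intros t. apply (continuous_opp w), (profile_continuous k w H).
    - assert (D0 : forall t, 0 <= t <= y -> 0 <= t * Derive w t).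
      { intros t Ht.
        pose proof (derive_nonneg_increasing (fun z => z * Derive w z) (fun z => sin (w z)) 0 t) as Q.
        cbv beta in Q; rewrite Rmult_0_l in Q. apply Q; [lra|intros; apply (profile_flux k w H)|].
        intros s Hs. apply sin_ge_0.
        + destruct (Req_dec s y) as [->|N]; [lra|]. specialize (Ly s). lra.
        + left. apply HZ. lra. }
      destruct (derive_mean_value w (Derive w) 0 y) as (c & Hc & E); [lra|intros; apply (profile_derive k w H)|].
      (* At [c = 0] the flux carries no information; the equation itself gives
         [w' (0) = sin k > 0]. *)
      destruct (Req_dec c 0) as [->|N].
      + assert (Derive w 0 = sin k).
        { destruct H as (_ & _ & Eq). specialize (Eq 0). rewrite W0 in Eq. lra. }
        pose proof (sin_gt_0 k). nra.
      + specialize (D0 c Hc). assert (0 <= Derive w c) by nra. nra. }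
  intros z Hz. specialize (P z Hz) as Pz. split; [split; [lra|apply HZ, Hz]|].
  intros z0. destruct (derive_mean_value (fun z => z * Derive w z) (fun z => sin (w z)) 0 z) as (c & Hc & E); [lra|intros; apply (profile_flux k w H)|].
  assert (0 < sin (w c)).
  { apply sin_gt_0; [pose proof (P c); lra|apply HZ; lra]. }
  cbv beta in E. rewrite Rmult_0_l in E. nra.
Qed.

(** If [w] stayed below [PI], the flux would be at least [a = w' (1) > 0] for [z >= 1], hence
    [w (z) >= w (1) + a ln z], which is unbounded. *)
Lemma profile_reaches_PI k w : amsler_profile k w -> 0 < k < PI ->
  exists z, 0 < z /\ w z = PI /\ forall t, 0 <= t < z -> w t < PI.
Proof.
  intros H Hk.
  assert (W0 : w 0 = k) by (destruct H as (_ & W0 & _); exact W0).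
  assert (A : exists Z, 0 <= Z /\ PI <= w Z).
  { destruct (Classical_Prop.classic (exists Z, 0 <= Z /\ PI <= w Z)) as [C|C]; [exact C|exfalso].
    assert (B : forall z, 0 <= z -> w z < PI).
    { intros z z0. destruct (Rlt_dec (w z) PI) as [L|L]; [exact L|]. exfalso. apply C. exists z. lra. }
    assert (Q : forall z, 0 <= z -> 0 < w z < PI /\ (0 < z -> 0 < Derive w z)).
    { intros z z0. apply (profile_below_PI k w (z + 1) H Hk); [|lra]. intros; apply B; lra. }
    set (a := Derive w 1).
    assert (a0 : 0 < a) by (apply Q; lra).
    assert (L : forall z, 1 <= z -> a <= z * Derive w z).
    { intros z z1. replace a with (1 * Derive w 1) by (unfold a; ring).
      apply (derive_nonneg_increasing (fun z => z * Derive w z) (fun z => sin (w z)) 1 z z1).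
      - intros; apply (profile_flux k w H).
      - intros t Ht. destruct (Q t) as [Qt _]; [lra|]. left. apply sin_gt_0; lra. }
    (* Chosen with [a ln Z = PI], so that the logarithmic lower bound already exceeds [PI] at
       [Z]. *)
    set (Z := exp (PI / a)).
    assert (Z1 : 1 <= Z).
    { unfold Z. rewrite <- exp_0. pose proof PI_RGT_0. assert (0 < PI / a) by (apply Rdiv_lt_0_compat; lra).
      left; apply exp_increasing; lra. }
    assert (I : w 1 - a * ln 1 <= w Z - a * ln Z).
    { apply (derive_nonneg_increasing (fun z => w z - a * ln z) (fun z => Derive w z - a * / z) 1 Z Z1).
      - intros t Ht. apply (is_derive_minus w (fun z => a * ln z)); [apply (profile_derive k w H)|].
        apply (is_derive_scal ln). apply is_derive_Reals, derivable_pt_lim_ln. lra.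
      - intros t Ht. specialize (L t). apply (Rmult_le_reg_l t); [lra|].
        replace (t * (Derive w t - a * / t)) with (t * Derive w t - a) by (field; lra). lra. }
    unfold Z in I at 2. rewrite ln_1, ln_exp in I. replace (a * (PI / a)) with PI in I by (field; lra).
    destruct (Q 1) as [Q1 _]; [lra|]. specialize (B Z). lra. }
  destruct A as (Z & Z0 & HZ).
  destruct (first_hit w PI Z) as (z & Hz & Ez & Lz); try lra.
  - apply (profile_continuous k w H).
  - exists z. split; [lra|]. split; assumption.
Qed.

Lemma profile_W_derive k w : amsler_profile k w ->
  forall r, is_derive (fun r => w (r ^ 2 / 4)) r (r / 2 * Derive w (r ^ 2 / 4)).
Proof.
  intros H r. apply (is_derive_comp w (fun r => r ^ 2 / 4)); [apply (profile_derive k w H)|].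
  auto_derive; [exact I|field].
Qed.

Lemma profile_W_solution k w : amsler_profile k w -> W_solution k (fun r => w (r ^ 2 / 4)).
Proof.
  intros H. split; [|split].
  - destruct H as (_ & W0 & _). rewrite <- W0. f_equal. field.
  - pose proof (profile_W_derive k w H 0) as D. apply is_derive_Reals in D.
    replace (0 / 2 * Derive w (0 ^ 2 / 4)) with 0 in D by field.
    intros P [e He]. destruct (D e (cond_pos e)) as [d Hd].
    exists d. intros r Hr r0. apply He.
    assert (Hr' : Rabs (r - 0) < d) by exact Hr.
    specialize (Hd r). rewrite Rplus_0_l in Hd. apply Hd; [lra|]. rewrite <- (Rminus_0_r r). exact Hr'.
  - intros r r0.
    assert (E : forall r, Derive (fun r => w (r ^ 2 / 4)) r = r / 2 * Derive w (r ^ 2 / 4))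
      by (intros; apply is_derive_unique, (profile_W_derive k w H)).
    assert (D2 : is_derive (fun r => r / 2 * Derive w (r ^ 2 / 4)) r
       (/ 2 * Derive w (r ^ 2 / 4) + r / 2 * (r / 2 * Derive (Derive w) (r ^ 2 / 4)))).
    { apply (is_derive_mult (fun r => r / 2) (fun r => Derive w (r ^ 2 / 4))); [| |intros; apply Rmult_comm].
      - auto_derive; [exact I|field].
      - apply (is_derive_comp (Derive w) (fun r => r ^ 2 / 4)); [apply (profile_derive2 k w H)|].
        auto_derive; [exact I|field]. }
    assert (D3 : is_derive (Derive (fun r => w (r ^ 2 / 4))) r
       (/ 2 * Derive w (r ^ 2 / 4) + r / 2 * (r / 2 * Derive (Derive w) (r ^ 2 / 4)))).
    { eapply is_derive_ext; [|exact D2]. intros t. symmetry. apply E. }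
    split; [eexists; apply (profile_W_derive k w H)|].
    split; [eexists; exact D3|].
    + rewrite (is_derive_unique _ _ _ D3), E.
      destruct H as (_ & _ & Eq). rewrite <- (Eq (r ^ 2 / 4)). field. lra.
Qed.

(** * Uniqueness of the radial solution *)

Lemma W_solution_small_quotient k W : W_solution k W -> forall eps, 0 < eps ->
  exists d, 0 < d /\ forall r, 0 < r < d -> Rabs (W r - k) <= eps * r.
Proof.
  intros (W0 & HL & _) eps He.
  destruct (HL (fun x => Rabs x < eps)) as [d Hd].
  - exists (mkposreal eps He). intros y Hy. unfold ball in Hy; simpl in Hy.
    unfold AbsRing_ball, abs, minus, plus, opp in Hy; simpl in Hy. rewrite Ropp_0, Rplus_0_r in Hy. exact Hy.
  - exists d. split; [apply cond_pos|]. intros r Hr. left.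
    assert (A : Rabs ((W r - W 0) / r) < eps).
    { apply Hd; [|lra]. unfold ball; simpl; unfold AbsRing_ball, abs, minus, plus, opp; simpl.
      rewrite Ropp_0, Rplus_0_r, Rabs_right; lra. }
    rewrite W0 in A. unfold Rdiv in A. rewrite Rabs_mult, (Rabs_right (/ r)) in A
      by (left; apply Rinv_0_lt_compat; lra).
    apply (Rmult_lt_compat_r r) in A; [|lra]. rewrite Rmult_assoc, Rinv_l, Rmult_1_r in A by lra. exact A.
Qed.

(** The initial condition only speaks of difference quotients at [0], not of [W'] near [0]. The mean
    value theorem supplies points [c] near [0] at which [c W' (c)] is small, and [(r W')' = r sin W]
    transports this to [|r W'| <= r^2]. *)
Lemma W_solution_derive_bound k W : W_solution k W -> forall r, 0 < r -> Rabs (Derive W r) <= r.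
Proof.
  intros H r r0. pose proof (W_solution_small_quotient k W H) as Q.
  destruct H as (W0 & HL & HD).
  assert (D1 : forall t, 0 < t -> is_derive W t (Derive W t)) by (intros t Ht; apply Derive_correct, HD, Ht).
  assert (Da : forall t, 0 < t -> is_derive (fun t => t * Derive W t) t (t * sin (W t))).
  { intros t Ht. destruct (HD t Ht) as (_ & E2 & Eq).
    replace (t * sin (W t)) with (1 * Derive W t + t * Derive (Derive W) t).
    - apply (is_derive_mult (fun t => t) (Derive W)); [apply (is_derive_id t)|apply Derive_correct, E2|intros; apply Rmult_comm].
    - replace (sin (W t)) with (Derive (Derive W) t + / t * Derive W t) by lra. field. lra. }
  assert (B : forall eps, 0 < eps -> Rabs (r * Derive W r) <= r * r + eps).
  (* On [[p / 2, p]] the quotient bound yields [|W' (c)| <= 3 eps / (4 r)], hence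
     [|c W' (c)| <= eps] because [c <= r]. *)
  { intros eps He. destruct (Q (eps / (4 * r))) as (d & d0 & Hd); [apply Rdiv_lt_0_compat; lra|].
    set (p := Rmin (d / 2) r).
    assert (Hp : 0 < p /\ p < d /\ p <= r) by (unfold p, Rmin; destruct Rle_dec; lra).
    destruct (derive_mean_value W (Derive W) (p / 2) p) as (c & Hc & E); [lra|intros; apply D1; lra|].
    assert (Q1 := Hd p ltac:(lra)). assert (Q2 := Hd (p / 2) ltac:(lra)).
    assert (X : Rabs (W p - W (p / 2)) <= eps / (4 * r) * (p + p / 2)).
    { replace (W p - W (p / 2)) with ((W p - k) - (W (p / 2) - k)) by ring.
      eapply Rle_trans; [apply Rabs_triang|]. rewrite Rabs_Ropp. lra. }
    rewrite E, Rabs_mult, (Rabs_right (p - p / 2)) in X by lra.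
    assert (Y : Rabs (Derive W c) <= 3 * (eps / (4 * r))) by nra.
    destruct (derive_mean_value (fun t => t * Derive W t) (fun t => t * sin (W t)) c r) as (s & Hs & Es); [lra|intros; apply Da; lra|].
    assert (Z : Rabs (r * Derive W r - c * Derive W c) <= r * r).
    { rewrite Es, !Rabs_mult, (Rabs_right s), (Rabs_right (r - c)) by lra.
      pose proof (SIN_bound (W s)). assert (Rabs (sin (W s)) <= 1) by (apply Rabs_le; lra).
      pose proof (Rabs_pos (sin (W s))). assert (s * Rabs (sin (W s)) <= r) by nra. nra. }
    assert (V : Rabs (c * Derive W c) <= eps).
    { rewrite Rabs_mult, (Rabs_right c) by lra. pose proof (Rabs_pos (Derive W c)).
      assert (r * (eps / (4 * r)) = eps / 4) by (field; lra).
      assert (c * Rabs (Derive W c) <= r * Rabs (Derive W c)) by nra. nra. }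
    replace (r * Derive W r) with ((r * Derive W r - c * Derive W c) + c * Derive W c) by ring.
    eapply Rle_trans; [apply Rabs_triang|]. lra. }
  rewrite Rabs_mult, (Rabs_right r) in B by lra.
  destruct (Rle_dec (Rabs (Derive W r)) r) as [L|L]; [exact L|exfalso].
  specialize (B (r * (Rabs (Derive W r) - r) / 2)). nra.
Qed.

(* The friction term [- W' / r] only helps in the energy estimate for the difference of
   two solutions. *)
Lemma W_solution_unique k W1 W2 : W_solution k W1 -> W_solution k W2 ->
  forall r, 0 <= r -> W1 r = W2 r.
Proof.
  intros H1 H2 r r0.
  destruct (Req_dec r 0) as [->|N]; [destruct H1 as (-> & _), H2 as (-> & _); reflexivity|].
  pose proof (W_solution_small_quotient k W1 H1 1 Rlt_0_1) as (d1 & d10 & Q1).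
  pose proof (W_solution_small_quotient k W2 H2 1 Rlt_0_1) as (d2 & d20 & Q2).
  pose proof (W_solution_derive_bound k W1 H1) as B1.
  pose proof (W_solution_derive_bound k W2 H2) as B2.
  destruct H1 as (_ & _ & D1), H2 as (_ & _ & D2).
  set (e := fun t => W1 t - W2 t). set (e1 := fun t => Derive W1 t - Derive W2 t).
  set (q := fun t => e1 t ^ 2 + e t ^ 2).
  assert (De : forall t, 0 < t -> is_derive e t (e1 t)).
  { intros t Ht. apply (is_derive_minus W1 W2); apply Derive_correct; [apply D1|apply D2]; exact Ht. }
  set (e2 := fun t => - / t * e1 t + (sin (W1 t) - sin (W2 t))).
  assert (De1 : forall t, 0 < t -> is_derive e1 t (e2 t)).
  { intros t Ht. destruct (D1 t Ht) as (_ & X1 & E1), (D2 t Ht) as (_ & X2 & E2).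
    replace (e2 t) with (Derive (Derive W1) t - Derive (Derive W2) t) by (unfold e2, e1; lra).
    apply (is_derive_minus (Derive W1) (Derive W2)); apply Derive_correct; assumption. }
  (* The energy [q] times [exp (- 2 t)] will be nonincreasing; the minus sign in front allows
     [derive_nonneg_increasing] to be used. *)
  assert (Dq : forall t, 0 < t -> is_derive (fun t => - (q t * exp (- (2 * t)))) t
      ((2 * q t - 2 * e1 t * e2 t - 2 * e t * e1 t) * exp (- (2 * t)))).
  { intros t Ht. unfold q.
    evar_last. apply (is_derive_opp (fun t => (e1 t ^ 2 + e t ^ 2) * exp (- (2 * t)))).
    apply (is_derive_mult (fun t => e1 t ^ 2 + e t ^ 2) (fun t => exp (- (2 * t)))).
    - apply (is_derive_plus (fun t => e1 t ^ 2) (fun t => e t ^ 2)).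
      + apply (is_derive_pow e1 2), De1, Ht.
      + apply (is_derive_pow e 2), De, Ht.
    - instantiate (1 := - 2 * exp (- (2 * t))). auto_derive; [exact I|ring].
    - intros; apply Rmult_comm.
    - unfold plus, mult, opp; simpl. ring. }
  assert (Dec : forall p, 0 < p -> p <= r -> q r * exp (- (2 * r)) <= q p * exp (- (2 * p))).
  { intros p p0 pr. apply Ropp_le_cancel.
    apply (derive_nonneg_increasing (fun t => - (q t * exp (- (2 * t)))) _ p r pr (fun t Ht => Dq t ltac:(lra))).
    intros t Ht. apply Rmult_le_pos; [|left; apply exp_pos].
    pose proof (sin_lipschitz (W1 t) (W2 t)) as SL. fold (e t) in SL.
    assert (It : 0 < / t) by (apply Rinv_0_lt_compat; lra).
    replace (2 * q t - 2 * e1 t * e2 t - 2 * e t * e1 t) with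
      (2 * / t * e1 t ^ 2 + (2 * e1 t ^ 2 + 2 * e t ^ 2 - 2 * e1 t * (sin (W1 t) - sin (W2 t)) - 2 * e t * e1 t))
      by (unfold q, e2; ring).
    apply Rplus_le_le_0_compat; [apply Rmult_le_pos; [lra|apply pow2_ge_0]|].
    assert (S2 : (sin (W1 t) - sin (W2 t)) ^ 2 <= e t ^ 2) by (apply pow_maj_Rabs with (n := 2%nat) in SL; rewrite <- (pow2_abs (e t)); exact SL).
    pose proof (pow2_ge_0 (e1 t - (sin (W1 t) - sin (W2 t)))). pose proof (pow2_ge_0 (e1 t - e t)). nra. }
  assert (Small : forall p, 0 < p -> p < d1 -> p < d2 -> q p <= 8 * p ^ 2).
  { intros p p0 p1 p2. unfold q.
    assert (Rabs (e1 p) <= 2 * p).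
    { unfold e1. eapply Rle_trans; [apply Rabs_triang|]. rewrite Rabs_Ropp. specialize (B1 p p0). specialize (B2 p p0). lra. }
    assert (Rabs (e p) <= 2 * p).
    { unfold e. replace (W1 p - W2 p) with ((W1 p - k) - (W2 p - k)) by ring.
      eapply Rle_trans; [apply Rabs_triang|]. rewrite Rabs_Ropp. specialize (Q1 p). specialize (Q2 p). lra. }
    rewrite <- (pow2_abs (e1 p)), <- (pow2_abs (e p)).
    pose proof (Rabs_pos (e1 p)). pose proof (Rabs_pos (e p)). nra. }
  assert (q0 : q r = 0).
  { assert (0 <= q r) by (unfold q; pose proof (pow2_ge_0 (e1 r)); pose proof (pow2_ge_0 (e r)); lra).
    destruct (Req_dec (q r) 0) as [E|NE]; [exact E|exfalso].
    set (m := q r * exp (- (2 * r))). assert (m0 : 0 < m) by (apply Rmult_lt_0_compat; [lra|apply exp_pos]).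
    (* With [p <= 1] and [p <= m / 16] one has [q p <= 8 p^2 <= m / 2], whereas monotonicity gives
       [m <= q p]. *)
    set (p := Rmin (Rmin (d1 / 2) (d2 / 2)) (Rmin r (Rmin 1 (m / 16)))).
    assert (Hp : 0 < p /\ p < d1 /\ p < d2 /\ p <= r /\ p <= 1 /\ p <= m / 16).
    { unfold p, Rmin. repeat destruct Rle_dec; lra. }
    specialize (Dec p ltac:(lra) ltac:(lra)). specialize (Small p ltac:(lra) ltac:(lra) ltac:(lra)).
    fold m in Dec.
    assert (exp (- (2 * p)) <= 1) by (rewrite <- exp_0; left; apply exp_increasing; lra).
    assert (0 <= q p) by (unfold q; pose proof (pow2_ge_0 (e1 p)); pose proof (pow2_ge_0 (e p)); lra).
    pose proof (exp_pos (- (2 * p))). nra. }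
  assert (e r = 0).
  { unfold q in q0. pose proof (pow2_ge_0 (e1 r)). pose proof (pow2_ge_0 (e r)). nra. }
  unfold e in *. lra.
Qed.

Lemma profile_unique k w W : amsler_profile k w -> W_solution k W ->
  forall z, 0 <= z -> W (sqrt (4 * z)) = w z.
Proof.
  intros H HW z z0.
  rewrite (W_solution_unique k W _ HW (profile_W_solution k w H)); [|apply sqrt_pos].
  f_equal. rewrite <- Rsqr_pow2, Rsqr_sqrt by lra. field.
Qed.

Lemma profile_first_cusp k w W r1 : amsler_profile k w -> 0 < k < PI -> W_solution k W -> first_cusp W r1 ->
  forall z, 0 <= z -> 4 * z < r1 ^ 2 -> w z < PI.
Proof.
  intros H Hk HW (r0 & _ & Hr) z z0 zr.
  destruct (Rlt_dec (w z) PI) as [L|L]; [exact L|exfalso].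
  destruct (first_hit w PI z) as (y & Hy & Ey & _); try lra.
  - apply (profile_continuous k w H).
  - destruct H as (_ & -> & _). lra.
  - apply (Hr (sqrt (4 * y))).
    + split; [apply sqrt_pos|]. rewrite <- (sqrt_pow2 r1) by lra. apply sqrt_lt_1; nra.
    + rewrite (profile_unique k w W H HW); lra.
Qed.

Lemma first_cusp_exists k w W : amsler_profile k w -> 0 < k < PI -> W_solution k W -> exists r1, first_cusp W r1.
Proof.
  intros H Hk HW. destruct (profile_reaches_PI k w H Hk) as (z & z0 & Ez & Lz).
  exists (sqrt (4 * z)). split; [apply sqrt_lt_R0; lra|].
  split; [rewrite (profile_unique k w W H HW); lra|].
  intros r [r0 Hr]. rewrite <- (sqrt_pow2 r) by exact r0.
  replace (r ^ 2) with (4 * (r ^ 2 / 4)) by field.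
  assert (r ^ 2 < 4 * z).
  { rewrite <- (sqrt_pow2 r) in Hr by exact r0. apply sqrt_lt_0_alt in Hr. exact Hr. }
  rewrite (profile_unique k w W H HW) by nra.
  specialize (Lz (r ^ 2 / 4)). nra.
Qed.

(** * Integration of the frame equations *)

Lemma continuous_bounded (f : R -> R) T : (forall t, continuous f t) ->
  exists B, 0 <= B /\ forall t, Rabs t <= T -> Rabs (f t) <= B.
Proof.
  intros Cf. destruct (Rle_dec 0 T) as [T0|T0].
  - destruct (continuity_ab_maj (fun t => Rabs (f t)) (- T) T) as (m & Hm & _); [lra| |].
    + intros c _. apply continuity_pt_filterlim. apply (continuous_comp f Rabs); [apply Cf|apply continuous_Rabs].
    + exists (Rabs (f m)). split; [apply Rabs_pos|]. intros t Ht. apply Hm. apply Rabs_le_between in Ht. lra.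
  - exists 0. split; [lra|]. intros t Ht. pose proof (Rabs_pos t). lra.
Qed.

Lemma skew_ode_exists (al be ga : R -> R) p0 q0 n0 :
  (forall t, continuous al t) -> (forall t, continuous be t) -> (forall t, continuous ga t) ->
  exists p q n : R -> R, p 0 = p0 /\ q 0 = q0 /\ n 0 = n0 /\
    forall t, is_derive p t (al t * q t + be t * n t) /\
              is_derive q t (- al t * p t + ga t * n t) /\
              is_derive n t (- be t * p t - ga t * q t).
Proof.
  intros Ca Cb Cg.
  (* [option bool] serves as a type with three elements: [None] stands for [p], [Some true] for [q]
     and [Some false] for [n]. *)
  set (rhs := fun (f : option bool -> R -> R) (i : option bool) (t : R) =>
     match i with
     | None => al t * f (Some true) t + be t * f (Some false) t
     | Some true => - al t * f None t + ga t * f (Some false) t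
     | Some false => - be t * f None t - ga t * f (Some true) t
     end).
  set (ini := fun i : option bool => match i with None => p0 | Some true => q0 | Some false => n0 end).
  set (F := fun f i t => ini i + RInt (rhs f i) 0 t).
  assert (CR : forall f, (forall i t, continuous (f i) t) -> forall i t, continuous (rhs f i) t).
  { intros f Cf [[|]|] t; unfold rhs.
    - apply (continuous_plus (fun t => - al t * f None t) (fun t => ga t * f (Some false) t)).
      + apply (continuous_mult (fun t => - al t) (f None)); [apply (continuous_opp al), Ca|apply Cf].
      + apply (continuous_mult ga (f (Some false))); [apply Cg|apply Cf].
    - apply (continuous_minus (fun t => - be t * f None t) (fun t => ga t * f (Some true) t)).
      + apply (continuous_mult (fun t => - be t) (f None)); [apply (continuous_opp be), Cb|apply Cf].
      + apply (continuous_mult ga (f (Some true))); [apply Cg|apply Cf].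
    - apply (continuous_plus (fun t => al t * f (Some true) t) (fun t => be t * f (Some false) t)).
      + apply (continuous_mult al (f (Some true))); [apply Ca|apply Cf].
      + apply (continuous_mult be (f (Some false))); [apply Cb|apply Cf]. }
  destruct (volterra_fixed_point (option bool) F) as (f & Cf & Ef).
  - intros f Cf i t. apply (continuous_of_derive _ t (rhs f i t)). apply RInt_primitive, CR, Cf.
  - intros T _. exists (Rabs p0 + Rabs q0 + Rabs n0). intros i t _. unfold F.
    rewrite (RInt_ext _ (fun _ => 0)).
    + rewrite RInt_const. unfold scal; simpl; unfold mult; simpl. rewrite Rmult_0_r, Rplus_0_r.
      pose proof (Rabs_pos p0). pose proof (Rabs_pos q0). pose proof (Rabs_pos n0).
      destruct i as [[|]|]; simpl; lra.
    + intros x _. destruct i as [[|]|]; unfold rhs; rewrite !Rmult_0_r; [apply Rplus_0_r|apply Rminus_0_r|apply Rplus_0_r].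
  - intros T T0.
    destruct (continuous_bounded al T Ca) as (B1 & B10 & HB1).
    destruct (continuous_bounded be T Cb) as (B2 & B20 & HB2).
    destruct (continuous_bounded ga T Cg) as (B3 & B30 & HB3).
    exists (2 * (B1 + B2 + B3)). split; [lra|]. intros f g n M Cf Cg' M0 H i t Ht.
    unfold F.
    replace (ini i + RInt (rhs f i) 0 t - (ini i + RInt (rhs g i) 0 t)) with (RInt (rhs f i) 0 t - RInt (rhs g i) 0 t) by ring.
    change (RInt (rhs f i) 0 t - RInt (rhs g i) 0 t) with (minus (RInt (rhs f i) 0 t) (RInt (rhs g i) 0 t)).
    rewrite <- (RInt_minus (rhs f i) (rhs g i)) by (apply ex_RInt_cont, CR; assumption).
    apply RInt_volterra_bound.
    + intros s. apply (continuous_minus (rhs f i) (rhs g i)); apply CR; assumption.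
    + intros s Hs. assert (HsT : Rabs s <= T) by lra.
      specialize (HB1 s HsT). specialize (HB2 s HsT). specialize (HB3 s HsT).
      set (K := Rabs s ^ n / INR (fact n)) in *.
      assert (E : forall j, Rabs (f j s - g j s) <= M * K) by (intros; apply H, HsT).
      assert (K0 : 0 <= M * K) by (eapply Rle_trans; [apply Rabs_pos|apply (E None)]).
      assert (P : forall u v b, Rabs u <= b -> Rabs v <= M * K -> Rabs (u * v) <= b * (M * K)).
      { intros u v b Hu Hv. rewrite Rabs_mult. apply Rmult_le_compat; try apply Rabs_pos; assumption. }
      rewrite Rmult_assoc.
      assert (0 <= B1 * (M * K)) by (apply Rmult_le_pos; assumption).
      assert (0 <= B2 * (M * K)) by (apply Rmult_le_pos; assumption).
      assert (0 <= B3 * (M * K)) by (apply Rmult_le_pos; assumption).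
      destruct i as [[|]|]; unfold rhs, minus, plus, opp; simpl.
      * replace (- al s * f None s + ga s * f (Some false) s + - (- al s * g None s + ga s * g (Some false) s))
          with (- (al s * (f None s - g None s)) + ga s * (f (Some false) s - g (Some false) s)) by ring.
        eapply Rle_trans; [apply Rabs_triang|]. rewrite Rabs_Ropp.
        pose proof (P _ _ _ HB1 (E None)). pose proof (P _ _ _ HB3 (E (Some false))). lra.
      * replace (- be s * f None s - ga s * f (Some true) s + - (- be s * g None s - ga s * g (Some true) s))
          with (- (be s * (f None s - g None s)) + - (ga s * (f (Some true) s - g (Some true) s))) by ring.
        eapply Rle_trans; [apply Rabs_triang|]. rewrite !Rabs_Ropp.
        pose proof (P _ _ _ HB2 (E None)). pose proof (P _ _ _ HB3 (E (Some true))). lra.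
      * replace (al s * f (Some true) s + be s * f (Some false) s + - (al s * g (Some true) s + be s * g (Some false) s))
          with (al s * (f (Some true) s - g (Some true) s) + be s * (f (Some false) s - g (Some false) s)) by ring.
        eapply Rle_trans; [apply Rabs_triang|].
        pose proof (P _ _ _ HB1 (E (Some true))). pose proof (P _ _ _ HB2 (E (Some false))). lra.
  - exists (f None), (f (Some true)), (f (Some false)).
    assert (I0 : forall i, f i 0 = ini i).
    { intros i. rewrite Ef. unfold F. rewrite RInt_point. apply Rplus_0_r. }
    split; [apply (I0 None)|]. split; [apply (I0 (Some true))|]. split; [apply (I0 (Some false))|].
    assert (Df : forall i t, is_derive (f i) t (rhs f i t)).
    { intros i t. apply (is_derive_ext (F f i)); [intros; symmetry; apply Ef|]. apply RInt_primitive, CR, Cf. }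
    intros t. split; [apply (Df None)|]. split; [apply (Df (Some true))|apply (Df (Some false))].
Qed.

(** The product [(q + K) exp (- t)] is nonincreasing. *)
Lemma gronwall_pos (q q' : R -> R) K y :
  0 <= y -> (forall t, 0 <= t <= y -> is_derive q t (q' t) /\ q' t <= q t + K) ->
  q y + K <= (q 0 + K) * exp y.
Proof.
  intros y0 H.
  assert (D : - ((q 0 + K) * exp (- 0)) <= - ((q y + K) * exp (- y))).
  { apply (derive_nonneg_increasing (fun t => - ((q t + K) * exp (- t))) (fun t => - (q' t * exp (- t) + (q t + K) * - exp (- t))) 0 y y0).
    - intros t Ht. destruct (H t Ht) as [D _].
      apply (is_derive_opp (fun t => (q t + K) * exp (- t))).
      apply (is_derive_mult (fun t => q t + K) (fun t => exp (- t))); [| |intros; apply Rmult_comm].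
      + replace (q' t) with (q' t + 0) by ring. apply (is_derive_plus q (fun _ => K)); [exact D|apply (is_derive_const K)].
      + auto_derive; [exact I|ring].
    - intros t Ht. destruct (H t Ht) as [_ L]. pose proof (exp_pos (- t)). nra. }
  rewrite Ropp_0, exp_0 in D.
  apply (Rmult_le_reg_r (exp (- y))); [apply exp_pos|].
  rewrite (Rmult_assoc _ (exp y)), <- exp_plus. replace (y + - y) with 0 by ring. rewrite exp_0. lra.
Qed.

Lemma gronwall (q q' : R -> R) K Y :
  (forall t, Rabs t <= Y -> is_derive q t (q' t) /\ Rabs (q' t) <= q t + K) ->
  forall y, Rabs y <= Y -> q y + K <= (q 0 + K) * exp (Rabs y).
Proof.
  intros H y Hy. destruct (Rle_dec 0 y) as [y0|y0].
  - rewrite (Rabs_right y) in * by lra. apply (gronwall_pos q q' K y y0).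
    intros t Ht. destruct (H t) as [D L]; [rewrite Rabs_right; lra|]. split; [exact D|].
    apply Rabs_le_between in L. lra.
  - rewrite (Rabs_left y) in * by lra.
    pose proof (gronwall_pos (fun t => q (- t)) (fun t => - q' (- t)) K (- y)) as G. cbv beta in G.
    rewrite Ropp_involutive, Ropp_0 in G. apply G; [lra|].
    intros t Ht. destruct (H (- t)) as [D L]; [rewrite Rabs_Ropp, Rabs_right; lra|]. split.
    + replace (- q' (- t)) with (-1 * q' (- t)) by ring.
      apply (is_derive_comp q Ropp); [exact D|]. auto_derive; [exact I|ring].
    + apply Rabs_le_between in L. lra.
Qed.

Definition plane : dom := fun _ _ => True.

Lemma open_plane : open_dom plane.
Proof. intros u v _. exists (mkposreal 1 Rlt_0_1). intros; exact I. Qed.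

(** Boundedness from uniform continuity: walking from the corner [(a, c)] to [(x, y)] in [N] equal
    steps, with [N] independent of the end point, changes [f] by less than [1] at each step. *)
Lemma continuity_2d_bounded f a b c d :
  a <= b -> c <= d -> (forall x y, continuity_2d_pt f x y) ->
  exists B, 0 <= B /\ forall x y, a <= x <= b -> c <= y <= d -> Rabs (f x y) <= B.
Proof.
  intros ab cd Cf.
  destruct (uniform_continuity_2d f a b c d (fun x y _ _ => Cf x y) (mkposreal 1 Rlt_0_1)) as [de Hde].
  simpl in Hde. set (W := (b - a) + (d - c) + 1).
  destruct (INR_unbounded (W / de)) as [N HN].
  assert (W0 : 0 < W) by (unfold W; lra).
  assert (Wd : 0 < W / de) by (apply Rdiv_lt_0_compat; [exact W0|apply cond_pos]).
  assert (N0 : 0 < INR N) by lra.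
  assert (step : W / INR N < de).
  { apply (Rmult_lt_reg_r (INR N)); [exact N0|]. unfold Rdiv. rewrite Rmult_assoc, Rinv_l, Rmult_1_r by lra.
    apply (Rmult_lt_reg_r (/ de)); [apply Rinv_0_lt_compat, cond_pos|].
    replace (de * INR N * / de) with (INR N) by (field; apply Rgt_not_eq, cond_pos). exact HN. }
  exists (Rabs (f a c) + INR N). split; [pose proof (Rabs_pos (f a c)); lra|].
  intros x y Hx Hy.
  assert (P : forall i, (i <= N)%nat -> Rabs (f (a + INR i / INR N * (x - a)) (c + INR i / INR N * (y - c))) <= Rabs (f a c) + INR i).
  { induction i as [|i IH]; intros Hi.
    - simpl INR. replace (0 / INR N) with 0 by (field; lra). rewrite !Rmult_0_l, !Rplus_0_r. lra.
    - specialize (IH ltac:(lia)).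
      assert (r0 : 0 <= INR i / INR N <= 1 /\ 0 <= INR (S i) / INR N <= 1).
      { assert (INR (S i) <= INR N) by (apply le_INR; lia). pose proof (pos_INR i). rewrite S_INR in *.
        repeat split; try (apply Rdiv_le_0_compat; lra); apply (Rmult_le_reg_r (INR N)); try lra; unfold Rdiv; rewrite Rmult_assoc, Rinv_l by lra; lra. }
      assert (E : INR (S i) / INR N = INR i / INR N + / INR N) by (rewrite S_INR; field; lra).
      assert (iN : 0 < / INR N) by (apply Rinv_0_lt_compat, N0).
      assert (HW : / INR N * W < de) by (rewrite Rmult_comm; exact step).
      specialize (Hde (a + INR i / INR N * (x - a)) (c + INR i / INR N * (y - c))
        (a + INR (S i) / INR N * (x - a)) (c + INR (S i) / INR N * (y - c))).
      set (r := INR i / INR N) in *. set (r' := INR (S i) / INR N) in *.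
      assert (A : Rabs (f (a + r' * (x - a)) (c + r' * (y - c)) - f (a + r * (x - a)) (c + r * (y - c))) < 1).
      { apply Hde; try nra.
        - rewrite E. replace (a + (r + / INR N) * (x - a) - (a + r * (x - a))) with (/ INR N * (x - a)) by ring.
          rewrite Rabs_right by nra. unfold W in HW. nra.
        - rewrite E. replace (c + (r + / INR N) * (y - c) - (c + r * (y - c))) with (/ INR N * (y - c)) by ring.
          rewrite Rabs_right by nra. unfold W in HW. nra. }
      rewrite S_INR. revert IH A. unfold Rabs. repeat destruct Rcase_abs; lra. }
  specialize (P N (le_n N)). replace (INR N / INR N) with 1 in P by (field; lra).
  rewrite !Rmult_1_l in P. replace (a + (x - a)) with x in P by ring. replace (c + (y - c)) with y in P by ring.
  exact P.
Qed.

(** Taylor bounds of first and second order with one constant for all [|y| <= Y]. This uniformity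
    allows the defect estimate to be integrated in [y]. *)
Lemma smooth_taylor_x g x Y : smooth plane g -> 0 <= Y ->
  exists B, 0 <= B /\ forall h y, Rabs h <= 1 -> Rabs y <= Y ->
    Rabs (g (x + h) y - g x y) <= B * Rabs h /\
    Rabs (g (x + h) y - g x y - h * du g x y) <= B * h ^ 2.
Proof.
  intros S Y0. pose proof (smooth_du _ _ S) as S1. pose proof (smooth_du _ _ S1) as S2.
  destruct (continuity_2d_bounded (du g) (x - 1) (x + 1) (- Y) Y) as (B1 & B10 & H1); [lra|lra|intros; apply (smooth_continuity plane _ _ _ S1 I)|].
  destruct (continuity_2d_bounded (du (du g)) (x - 1) (x + 1) (- Y) Y) as (B2 & B20 & H2); [lra|lra|intros; apply (smooth_continuity plane _ _ _ S2 I)|].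
  exists (B1 + B2). split; [lra|]. intros h y Hh Hy.
  apply Rabs_le_between in Hy. apply Rabs_le_between in Hh.
  assert (Between : forall c u, Rmin x u <= c <= Rmax x u -> Rabs (c - x) <= Rabs (u - x)).
  { intros c u. unfold Rmin, Rmax, Rabs. destruct Rle_dec; repeat destruct Rcase_abs; lra. }
  assert (MV : forall G, smooth plane G -> forall u, exists c, Rabs (c - x) <= Rabs (u - x) /\ G u y - G x y = du G c y * (u - x)).
  { intros G SG u. destruct (MVT_gen (fun t => G t y) x u (fun t => du G t y)) as (c & Hc & Ec).
    - intros t _. apply (smooth_has_du plane G t y SG I).
    - intros t _. apply continuity_pt_filterlim. apply (continuous_of_derive (fun t => G t y) t (du G t y)). apply (smooth_has_du plane G t y SG I).
    - exists c. split; [apply Between, Hc|exact Ec]. }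
  destruct (MV g S (x + h)) as (c & Hc & Ec). replace (x + h - x) with h in * by ring.
  destruct (MV (du g) S1 c) as (e & He & Ee).
  assert (Hh' : Rabs h <= 1) by (apply Rabs_le; lra).
  assert (Hc1 : Rabs (c - x) <= 1) by lra. assert (He1 : Rabs (e - x) <= 1) by lra.
  apply Rabs_le_between in Hc1. apply Rabs_le_between in He1.
  assert (A1 : Rabs (du g c y) <= B1) by (apply H1; lra).
  assert (A2 : Rabs (du (du g) e y) <= B2) by (apply H2; lra).
  pose proof (Rabs_pos h). pose proof (Rabs_pos (c - x)).
  rewrite Ec. split.
  - rewrite Rabs_mult. nra.
  - replace (du g c y * h - h * du g x y) with ((du g c y - du g x y) * h) by ring.
    rewrite Ee, !Rabs_mult, <- (pow2_abs h).
    pose proof (Rabs_pos (du (du g) e y)).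
    assert (Rabs (du (du g) e y) * Rabs (c - x) <= B2 * Rabs h) by (apply Rmult_le_compat; lra). nra.
Qed.

(* One row of an orthonormal frame [(e1, e2, n)] of a pseudospherical surface in
   canonical asymptotic coordinates: [psi_x = cos (om/2) e1 - sin (om/2) e2] and
   [psi_y = cos (om/2) e1 + sin (om/2) e2].  Contrary to [(psi_x, psi_y)], this frame has
   no singularity where [sin om = 0]. *)
Definition frame_eq (om p q n : R -> R -> R) (x y : R) : Prop :=
  let s := sin (om x y / 2) in let c := cos (om x y / 2) in
  (has_du p x y (- (du om x y / 2) * q x y + s * n x y) /\
   has_du q x y (du om x y / 2 * p x y + c * n x y) /\
   has_du n x y (- s * p x y - c * q x y)) /\
  (has_dv p x y (dv om x y / 2 * q x y + s * n x y) /\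
   has_dv q x y (- (dv om x y / 2) * p x y - c * n x y) /\
   has_dv n x y (- s * p x y + c * q x y)).

(** Both coefficient matrices of the system are skew, so the scalar product of two solutions does
    not change. *)
Lemma frame_eq_dot (om p q n p' q' n' : R -> R -> R) x y :
  frame_eq om p q n x y -> frame_eq om p' q' n' x y ->
  has_du (fun x y => p x y * p' x y + q x y * q' x y + n x y * n' x y) x y 0 /\
  has_dv (fun x y => p x y * p' x y + q x y * q' x y + n x y * n' x y) x y 0.
Proof.
  intros ((P1 & Q1 & N1) & (P2 & Q2 & N2)) ((P1' & Q1' & N1') & (P2' & Q2' & N2')).
  assert (dot_rule : forall f g h f' g' h' : R -> R, forall t a b c a' b' c',
    is_derive f t a -> is_derive g t b -> is_derive h t c ->
    is_derive f' t a' -> is_derive g' t b' -> is_derive h' t c' ->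
    is_derive (fun t => f t * f' t + g t * g' t + h t * h' t) t
      (a * f' t + f t * a' + (b * g' t + g t * b') + (c * h' t + h t * c'))).
  { intros. apply (is_derive_plus (fun t => f t * f' t + g t * g' t) (fun t => h t * h' t)).
    - apply (is_derive_plus (fun t => f t * f' t) (fun t => g t * g' t)).
      + apply (is_derive_mult f f'); [assumption..|intros; apply Rmult_comm].
      + apply (is_derive_mult g g'); [assumption..|intros; apply Rmult_comm].
    - apply (is_derive_mult h h'); [assumption..|intros; apply Rmult_comm]. }
  split.
  - pose proof (dot_rule _ _ _ _ _ _ _ _ _ _ _ _ _ P1 Q1 N1 P1' Q1' N1') as D. cbv beta in D.
    unfold has_du. evar_last; [exact D|]. ring.
  - pose proof (dot_rule _ _ _ _ _ _ _ _ _ _ _ _ _ P2 Q2 N2 P2' Q2' N2') as D. cbv beta in D.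
    unfold has_dv. evar_last; [exact D|]. ring.
Qed.

Lemma is_derive_of_little_o f x l :
  (forall eta, 0 < eta -> exists d, 0 < d /\ forall h, Rabs h < d ->
     Rabs (f (x + h) - f x - h * l) <= eta * Rabs h) -> is_derive f x l.
Proof.
  intros H. apply is_derive_Reals. intros eps He.
  destruct (H (eps / 2)) as (d & d0 & Hd); [lra|].
  exists (mkposreal d d0). intros h h0 Hh. specialize (Hd h Hh).
  replace ((f (x + h) - f x) / h - l) with ((f (x + h) - f x - h * l) / h) by (field; exact h0).
  unfold Rdiv. rewrite Rabs_mult, Rabs_inv. pose proof (Rabs_pos_lt h h0).
  apply (Rmult_lt_reg_r (Rabs h)); [assumption|]. rewrite Rmult_assoc, Rinv_l by lra. nra.
Qed.

Lemma little_o_of_is_derive f x l : is_derive f x l ->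
  forall eta, 0 < eta -> exists d, 0 < d /\ forall h, Rabs h < d ->
     Rabs (f (x + h) - f x - h * l) <= eta * Rabs h.
Proof.
  intros D eta He. apply is_derive_Reals in D. destruct (D eta He) as [d Hd].
  exists d. split; [apply cond_pos|]. intros h Hh.
  destruct (Req_dec h 0) as [->|h0].
  - replace (f (x + 0) - f x - 0 * l) with 0 by (rewrite Rplus_0_r; ring). rewrite Rabs_R0. lra.
  - specialize (Hd h h0 Hh).
    replace (f (x + h) - f x - h * l) with (((f (x + h) - f x) / h - l) * h) by (field; exact h0).
    rewrite Rabs_mult. pose proof (Rabs_pos h). nra.
Qed.

Lemma Rabs_le_of_sq_le x y : 0 <= y -> x ^ 2 <= y ^ 2 -> Rabs x <= y.
Proof. intros y0 H. rewrite <- (Rabs_right y) by lra. apply Rsqr_le_abs_0. rewrite !Rsqr_pow2. exact H. Qed.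

(** The common shape of the three remainders in the defect estimate: coefficient errors of second
    order times entries of the frame, plus [h] times coefficient errors of first order. *)
Lemma Rabs_sum4_le q n X Y b s b1 s1 h B N U :
  Rabs q <= N -> Rabs n <= N -> Rabs X <= U -> Rabs Y <= U ->
  Rabs b <= B * h ^ 2 -> Rabs s <= B * h ^ 2 -> Rabs b1 <= B * Rabs h -> Rabs s1 <= B * Rabs h ->
  0 <= B -> 0 <= N -> 0 <= U ->
  Rabs (b * q + s * n + h * (b1 * X + s1 * Y)) <= 2 * B * (N + U) * h ^ 2.
Proof.
  intros. rewrite <- (pow2_abs h) in *.
  assert (M : forall u v a c, Rabs u <= a -> Rabs v <= c -> Rabs (u * v) <= a * c).
  { intros. rewrite Rabs_mult. apply Rmult_le_compat; auto using Rabs_pos. }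
  pose proof (M b q _ _ ltac:(eassumption) ltac:(eassumption)).
  pose proof (M s n _ _ ltac:(eassumption) ltac:(eassumption)).
  pose proof (M b1 X _ _ ltac:(eassumption) ltac:(eassumption)).
  pose proof (M s1 Y _ _ ltac:(eassumption) ltac:(eassumption)).
  assert (Rabs (b1 * X + s1 * Y) <= 2 * (B * Rabs h * U)) by (eapply Rle_trans; [apply Rabs_triang|lra]).
  pose proof (M h (b1 * X + s1 * Y) (Rabs h) _ (Rle_refl _) ltac:(eassumption)).
  eapply Rle_trans; [apply Rabs_triang|].
  assert (Rabs (b * q + s * n) <= 2 * (B * Rabs h ^ 2 * N)) by (eapply Rle_trans; [apply Rabs_triang|lra]).
  replace (2 * B * (N + U) * Rabs h ^ 2) with (2 * (B * Rabs h ^ 2 * N) + Rabs h * (2 * (B * Rabs h * U))) by ring.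
  lra.
Qed.

Section FrameExistence.
Variable om : R -> R -> R.
Hypothesis Som : smooth plane om.
Hypothesis SG : forall x y, dv (du om) x y = sin (om x y).

Let a := fun x y => du om x y / 2.
Let b := fun x y => dv om x y / 2.
Let s := fun x y => sin (om x y / 2).
Let c := fun x y => cos (om x y / 2).

Lemma half_smooth : smooth plane a /\ smooth plane b /\ smooth plane s /\ smooth plane c.
Proof.
  pose proof open_plane. pose proof (smooth_du _ _ Som). pose proof (smooth_dv _ _ Som).
  unfold a, b, s, c. repeat split; unfold Rdiv; smooth_tac; auto.
Qed.

Lemma half_sin x y : sin (om x y) / 2 = s x y * c x y.
Proof.
  unfold s, c. replace (om x y) with (2 * (om x y / 2)) at 1 by field. rewrite sin_2a. field.
Qed.

(** The sine-Gordon equation enters the construction of the frame here, as [a_y = b_x = s c]; this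
    is the compatibility of the two halves of the system. *)
Lemma half_partials x y :
  du b x y = s x y * c x y /\ du s x y = c x y * a x y /\ du c x y = - s x y * a x y /\
  has_dv a x y (s x y * c x y) /\ has_dv s x y (c x y * b x y) /\ has_dv c x y (- s x y * b x y).
Proof.
  pose proof (smooth_has_du plane om x y Som I) as D1. pose proof (smooth_has_dv plane om x y Som I) as D2.
  split; [|split; [|split; [|split; [|split]]]].
  - apply du_eq. unfold b. rewrite <- half_sin, <- (SG x y), (smooth_schwarz plane om x y open_plane Som I).
    unfold has_du, Rdiv.
    pose proof (smooth_has_du plane (dv om) x y (smooth_dv _ _ Som) I) as D3.
    apply (is_derive_ext (fun t => / 2 * dv om t y)); [intros; apply Rmult_comm|].
    rewrite Rmult_comm. apply (is_derive_scal (fun t => dv om t y)), D3.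
  - apply du_eq. unfold s, c, a. unfold has_du.
    replace (cos (om x y / 2) * (du om x y / 2)) with (du om x y / 2 * cos (om x y / 2)) by ring.
    apply (is_derive_comp sin (fun t => om t y / 2)); [apply is_derive_sin|].
    apply (is_derive_ext (fun t => / 2 * om t y)); [intros; unfold Rdiv; apply Rmult_comm|].
    unfold Rdiv. rewrite Rmult_comm. apply (is_derive_scal (fun t => om t y)), D1.
  - apply du_eq. unfold s, c, a. unfold has_du.
    replace (- sin (om x y / 2) * (du om x y / 2)) with (du om x y / 2 * - sin (om x y / 2)) by ring.
    apply (is_derive_comp cos (fun t => om t y / 2)); [apply is_derive_cos|].
    apply (is_derive_ext (fun t => / 2 * om t y)); [intros; unfold Rdiv; apply Rmult_comm|].
    unfold Rdiv. rewrite Rmult_comm. apply (is_derive_scal (fun t => om t y)), D1.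
  - unfold a. rewrite <- half_sin, <- (SG x y).
    unfold has_dv, Rdiv.
    pose proof (smooth_has_dv plane (du om) x y (smooth_du _ _ Som) I) as D3.
    apply (is_derive_ext (fun t => / 2 * du om x t)); [intros; apply Rmult_comm|].
    rewrite Rmult_comm. apply (is_derive_scal (fun t => du om x t)), D3.
  - unfold s, c, b. unfold has_dv.
    replace (cos (om x y / 2) * (dv om x y / 2)) with (dv om x y / 2 * cos (om x y / 2)) by ring.
    apply (is_derive_comp sin (fun t => om x t / 2)); [apply is_derive_sin|].
    apply (is_derive_ext (fun t => / 2 * om x t)); [intros; unfold Rdiv; apply Rmult_comm|].
    unfold Rdiv. rewrite Rmult_comm. apply (is_derive_scal (fun t => om x t)), D2.
  - unfold s, c, b. unfold has_dv.
    replace (- sin (om x y / 2) * (dv om x y / 2)) with (dv om x y / 2 * - sin (om x y / 2)) by ring.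
    apply (is_derive_comp cos (fun t => om x t / 2)); [apply is_derive_cos|].
    apply (is_derive_ext (fun t => / 2 * om x t)); [intros; unfold Rdiv; apply Rmult_comm|].
    unfold Rdiv. rewrite Rmult_comm. apply (is_derive_scal (fun t => om x t)), D2.
Qed.

Lemma continuous_x f y t : smooth plane f -> continuous (fun x => f x y) t.
Proof. intros S. apply (continuous_of_derive _ t (du f t y)). exact (smooth_has_du plane f t y S I). Qed.

Lemma continuous_y f x t : smooth plane f -> continuous (fun y => f x y) t.
Proof. intros S. apply (continuous_of_derive _ t (dv f x t)). exact (smooth_has_dv plane f x t S I). Qed.

(** The candidate solves the x-system along the axis [y = 0] only, and the y-system along every
    vertical line. That the x-system then holds everywhere is shown by a growth estimate in [y],
    which avoids differentiating solutions with respect to their initial values. *)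
Section Frame.
Variables p q n : R -> R -> R.
Hypothesis Hx : forall x,
  has_du p x 0 (- a x 0 * q x 0 + s x 0 * n x 0) /\
  has_du q x 0 (a x 0 * p x 0 + c x 0 * n x 0) /\
  has_du n x 0 (- s x 0 * p x 0 - c x 0 * q x 0).
Hypothesis Hy : forall x y,
  has_dv p x y (b x y * q x y + s x y * n x y) /\
  has_dv q x y (- b x y * p x y - c x y * n x y) /\
  has_dv n x y (- s x y * p x y + c x y * q x y).

Lemma sum_sq_derive (f g h : R -> R) t f' g' h' : is_derive f t f' -> is_derive g t g' -> is_derive h t h' ->
  is_derive (fun t => f t ^ 2 + g t ^ 2 + h t ^ 2) t (2 * (f t * f' + g t * g' + h t * h')).
Proof.
  intros Df Dg Dh. evar_last.
  - apply (is_derive_plus (fun t => f t ^ 2 + g t ^ 2) (fun t => h t ^ 2)); [|apply (is_derive_pow h 2), Dh].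
    apply (is_derive_plus (fun t => f t ^ 2) (fun t => g t ^ 2)); [apply (is_derive_pow f 2), Df|apply (is_derive_pow g 2), Dg].
  - unfold plus; simpl. ring.
Qed.

(** Skewness again: the norm is constant along the axis and along each vertical line, which bounds
    all entries on the whole plane. *)
Lemma frame_norm x y : p x y ^ 2 + q x y ^ 2 + n x y ^ 2 = p 0 0 ^ 2 + q 0 0 ^ 2 + n 0 0 ^ 2.
Proof.
  transitivity (p x 0 ^ 2 + q x 0 ^ 2 + n x 0 ^ 2).
  - apply (const_on_segment (fun y => p x y ^ 2 + q x y ^ 2 + n x y ^ 2)). intros t _.
    destruct (Hy x t) as (D1 & D2 & D3). evar_last; [apply (sum_sq_derive _ _ _ _ _ _ _ D1 D2 D3)|]. ring.
  - apply (const_on_segment (fun x => p x 0 ^ 2 + q x 0 ^ 2 + n x 0 ^ 2)). intros t _.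
    destruct (Hx t) as (D1 & D2 & D3). evar_last; [apply (sum_sq_derive _ _ _ _ _ _ _ D1 D2 D3)|]. ring.
Qed.

(** With the summand [1] the squared norm itself bounds the entries: [z^2 <= S] implies
    [|z| <= 1 + S]. *)
Let Nn := 1 + (p 0 0 ^ 2 + q 0 0 ^ 2 + n 0 0 ^ 2).

Lemma frame_bound x y : Rabs (p x y) <= Nn /\ Rabs (q x y) <= Nn /\ Rabs (n x y) <= Nn.
Proof.
  pose proof (frame_norm x y) as E. unfold Nn. rewrite <- E.
  pose proof (pow2_ge_0 (p x y)). pose proof (pow2_ge_0 (q x y)). pose proof (pow2_ge_0 (n x y)).
  repeat split; apply Rabs_le_of_sq_le; nra.
Qed.

Let Pu := fun x y => - a x y * q x y + s x y * n x y.
Let Qu := fun x y => a x y * p x y + c x y * n x y.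
Let Nu := fun x y => - s x y * p x y - c x y * q x y.
Let Err := fun x h y => (p (x + h) y - p x y - h * Pu x y) ^ 2 + (q (x + h) y - q x y - h * Qu x y) ^ 2
   + (n (x + h) y - n x y - h * Nu x y) ^ 2.

Lemma is_derive_defect (f g k : R -> R) t f' g' k' h :
  is_derive f t f' -> is_derive g t g' -> is_derive k t k' ->
  is_derive (fun t => f t - g t - h * k t) t (f' - g' - h * k').
Proof.
  intros D1 D2 D3. apply (is_derive_minus (fun t => f t - g t) (fun t => h * k t)).
  - apply (is_derive_minus f g); assumption.
  - apply (is_derive_scal k), D3.
Qed.

Lemma is_derive_comb (f g k l : R -> R) t f' g' k' l' :
  is_derive f t f' -> is_derive g t g' -> is_derive k t k' -> is_derive l t l' ->
  is_derive (fun t => f t * g t + k t * l t) t (f' * g t + f t * g' + (k' * l t + k t * l')).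
Proof.
  intros. apply (is_derive_plus (fun t => f t * g t) (fun t => k t * l t)).
  - apply (is_derive_mult f g); [assumption..|intros; apply Rmult_comm].
  - apply (is_derive_mult k l); [assumption..|intros; apply Rmult_comm].
Qed.

(* [Err] measures the failure of [x |-> (p, q, n)] to satisfy the first half of the system
   to first order.  Since the system along [y] is skew, its homogeneous part does not
   contribute to the growth of [Err]; the remainder is quadratic in [h] because the two
   halves are compatible. *)
Lemma defect_growth x Y : 0 <= Y -> exists K, 0 <= K /\
  forall h y, Rabs h <= 1 -> Rabs y <= Y ->
    Err x h y + K * h ^ 4 <= (Err x h 0 + K * h ^ 4) * exp Y.
Proof.
  intros Y0. destruct half_smooth as (Sa & Sb & Ss & Sc).
  destruct (smooth_taylor_x b x Y Sb Y0) as (Bb & Bb0 & Tb).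
  destruct (smooth_taylor_x s x Y Ss Y0) as (Bs & Bs0 & Ts).
  destruct (smooth_taylor_x c x Y Sc Y0) as (Bc & Bc0 & Tc).
  destruct (continuous_bounded (fun y => a x y) Y (fun t => continuous_y a x t Sa)) as (Ba & Ba0 & Ta).
  set (B := Bb + Bs + Bc). set (U := (Ba + 2) * Nn). set (Q := 2 * B * (Nn + U)).
  assert (N0 : 0 <= Nn) by (eapply Rle_trans; [apply Rabs_pos|apply (frame_bound 0 0)]).
  assert (U0 : 0 <= U) by (apply Rmult_le_pos; lra).
  assert (B0 : 0 <= B) by (unfold B; lra).
  (* Each remainder is at most [Q h^2]; by [2 u r <= u^2 + r^2], the three of them contribute
     [3 Q^2 h^4] to the Gronwall inequality. *)
  exists (3 * Q ^ 2). split; [pose proof (pow2_ge_0 Q); lra|].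
  intros h y Hh HyY.
  apply Rle_trans with ((Err x h 0 + 3 * Q ^ 2 * h ^ 4) * exp (Rabs y)).
  2:{ apply Rmult_le_compat_l.
      - assert (0 <= h ^ 4) by (replace (h ^ 4) with ((h ^ 2) ^ 2) by ring; apply pow2_ge_0).
        assert (0 <= Err x h 0) by (unfold Err; repeat apply Rplus_le_le_0_compat; apply pow2_ge_0).
        pose proof (pow2_ge_0 Q). nra.
      - destruct HyY as [L|E]; [left; apply exp_increasing, L|right; rewrite E; reflexivity]. }
  (* What remains of the y-derivative of the defect after subtracting the skew system at [x + h]:
     Taylor errors of the coefficients, all of order [h^2]. *)
  set (rho := fun t =>
    ((b (x + h) t - b x t - h * du b x t) * q x t + (s (x + h) t - s x t - h * du s x t) * n x t
       + h * ((b (x + h) t - b x t) * Qu x t + (s (x + h) t - s x t) * Nu x t),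
     ((b (x + h) t - b x t - h * du b x t) * - p x t + (c (x + h) t - c x t - h * du c x t) * - n x t
       + h * ((b (x + h) t - b x t) * - Pu x t + (c (x + h) t - c x t) * - Nu x t),
     (s (x + h) t - s x t - h * du s x t) * - p x t + (c (x + h) t - c x t - h * du c x t) * q x t
       + h * ((s (x + h) t - s x t) * - Pu x t + (c (x + h) t - c x t) * Qu x t)))).
  set (r1 := fun t => fst (rho t)). set (r2 := fun t => fst (snd (rho t))). set (r3 := fun t => snd (snd (rho t))).
  set (ep := fun t => p (x + h) t - p x t - h * Pu x t).
  set (eq := fun t => q (x + h) t - q x t - h * Qu x t).
  set (en := fun t => n (x + h) t - n x t - h * Nu x t).
  apply (gronwall (Err x h) (fun t => 2 * (ep t * r1 t + eq t * r2 t + en t * r3 t)) (3 * Q ^ 2 * h ^ 4) Y); [|exact HyY].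
  intros t Ht. split.
  - destruct (half_partials x t) as (Eb & Es & Ec & Da & Ds & Dc).
    pose proof (smooth_has_dv plane b x t Sb I) as Db0.
    destruct (Hy x t) as (Dp & Dq & Dn). destruct (Hy (x + h) t) as (Dp' & Dq' & Dn').
    assert (DP : is_derive ep t (b (x + h) t * eq t + s (x + h) t * en t + r1 t)).
    { evar_last.
      - apply is_derive_defect; [exact Dp'|exact Dp|].
        apply (is_derive_comb (fun y => - a x y) (fun y => q x y) (fun y => s x y) (fun y => n x y));
          [apply (is_derive_opp (fun y => a x y)), Da|exact Dq|exact Ds|exact Dn].
      - unfold r1, rho, eq, en, Pu, Qu, Nu, opp; simpl. rewrite Eb, Es. ring. }
    assert (DQ : is_derive eq t (- b (x + h) t * ep t - c (x + h) t * en t + r2 t)).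
    { evar_last.
      - apply is_derive_defect; [exact Dq'|exact Dq|].
        apply (is_derive_comb (fun y => a x y) (fun y => p x y) (fun y => c x y) (fun y => n x y));
          [exact Da|exact Dp|exact Dc|exact Dn].
      - unfold r2, rho, ep, en, Pu, Qu, Nu, opp; simpl. rewrite Eb, Ec. ring. }
    assert (DN : is_derive en t (- s (x + h) t * ep t + c (x + h) t * eq t + r3 t)).
    { evar_last.
      - apply is_derive_defect; [exact Dn'|exact Dn|].
        apply (is_derive_ext (fun y => - s x y * p x y + - c x y * q x y)); [intros; unfold Nu; simpl; ring|].
        apply (is_derive_comb (fun y => - s x y) (fun y => p x y) (fun y => - c x y) (fun y => q x y));
          [apply (is_derive_opp (fun y => s x y)), Ds|exact Dp|apply (is_derive_opp (fun y => c x y)), Dc|exact Dq].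
      - unfold r3, rho, ep, eq, Pu, Qu, Nu, opp; simpl. rewrite Es, Ec. ring. }
    evar_last; [apply (sum_sq_derive _ _ _ _ _ _ _ DP DQ DN)|]. ring.
  - destruct (frame_bound x t) as (Bp & Bq & Bn).
    specialize (Tb h t Hh Ht). specialize (Ts h t Hh Ht). specialize (Tc h t Hh Ht). specialize (Ta t Ht).
    pose proof (Rabs_pos h). pose proof (pow2_ge_0 h).
    assert (Bs1 : Rabs (s x t) <= 1) by (apply Rabs_le; pose proof (SIN_bound (om x t / 2)); unfold s; lra).
    assert (Bc1 : Rabs (c x t) <= 1) by (apply Rabs_le; pose proof (COS_bound (om x t / 2)); unfold c; lra).
    assert (M : forall u v k l, Rabs u <= k -> Rabs v <= l -> Rabs (u * v) <= k * l).
    { intros. rewrite Rabs_mult. apply Rmult_le_compat; auto using Rabs_pos. }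
    assert (BU : Rabs (Pu x t) <= U /\ Rabs (Qu x t) <= U /\ Rabs (Nu x t) <= U).
    { pose proof (M _ _ _ _ Ta Bq). pose proof (M _ _ _ _ Ta Bp).
      pose proof (M _ _ _ _ Bs1 Bn). pose proof (M _ _ _ _ Bc1 Bn).
      pose proof (M _ _ _ _ Bs1 Bp). pose proof (M _ _ _ _ Bc1 Bq).
      assert (0 <= Ba * Nn) by (apply Rmult_le_pos; lra).
      unfold U, Pu, Qu, Nu. unfold Rminus. rewrite <- !Ropp_mult_distr_l.
      repeat split; (eapply Rle_trans; [apply Rabs_triang|]); rewrite ?Rabs_Ropp; lra. }
    destruct BU as (BP & BQ & BN).
    assert (Up : forall X Z k, 0 <= k <= B -> X <= k * Rabs h /\ Z <= k * h ^ 2 -> X <= B * Rabs h /\ Z <= B * h ^ 2).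
    { intros X Z k Hk [HX HZ]. split; nra. }
    apply Up in Tb; [|unfold B; lra]. apply Up in Ts; [|unfold B; lra]. apply Up in Tc; [|unfold B; lra].
    destruct Tb, Ts, Tc.
    assert (R1 : Rabs (r1 t) <= Q * h ^ 2).
    { unfold r1, rho; cbn [fst snd]. apply Rabs_sum4_le; assumption. }
    assert (R2 : Rabs (r2 t) <= Q * h ^ 2).
    { unfold r2, rho; cbn [fst snd]. apply Rabs_sum4_le; rewrite ?Rabs_Ropp; assumption. }
    assert (R3 : Rabs (r3 t) <= Q * h ^ 2).
    { unfold r3, rho; cbn [fst snd]. apply Rabs_sum4_le; rewrite ?Rabs_Ropp; assumption. }
    assert (Y1 : forall u r, Rabs r <= Q * h ^ 2 -> Rabs (2 * (u * r)) <= u ^ 2 + Q ^ 2 * h ^ 4).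
    { intros u r Hr. rewrite !Rabs_mult, (Rabs_right 2) by lra. rewrite <- (pow2_abs u).
      assert (Rabs r ^ 2 <= Q ^ 2 * h ^ 4).
      { replace (Q ^ 2 * h ^ 4) with ((Q * h ^ 2) ^ 2) by ring. apply pow_incr. split; [apply Rabs_pos|exact Hr]. }
      pose proof (pow2_ge_0 (Rabs u - Rabs r)). nra. }
    pose proof (Y1 (ep t) _ R1) as Z1. pose proof (Y1 (eq t) _ R2) as Z2. pose proof (Y1 (en t) _ R3) as Z3.
    replace (2 * (ep t * r1 t + eq t * r2 t + en t * r3 t)) with (2 * (ep t * r1 t) + 2 * (eq t * r2 t) + 2 * (en t * r3 t)) by ring.
    eapply Rle_trans; [apply Rabs_triang|].
    assert (Rabs (2 * (ep t * r1 t) + 2 * (eq t * r2 t)) <= Rabs (2 * (ep t * r1 t)) + Rabs (2 * (eq t * r2 t))) by apply Rabs_triang.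
    change (Err x h t) with (ep t ^ 2 + eq t ^ 2 + en t ^ 2). lra.
Qed.

(** On the axis the x-system makes the defect [o (h^2)]. Gronwall transports this to height [y] at
    the price of the factor [exp |y|], and the extra term of order [h^4] is harmless. *)
Lemma frame_x_derivative x y :
  has_du p x y (Pu x y) /\ has_du q x y (Qu x y) /\ has_du n x y (Nu x y).
Proof.
  destruct (defect_growth x (Rabs y) (Rabs_pos y)) as (K & K0 & G).
  assert (L : forall eta, 0 < eta -> exists d, 0 < d /\ forall h, Rabs h < d -> Err x h y <= (eta * Rabs h) ^ 2).
  { intros eta He. set (m := exp (- Rabs y)).
    assert (m0 : 0 < m) by apply exp_pos.
    assert (m1 : m <= 1) by (unfold m; rewrite <- exp_0; pose proof (Rabs_pos y); destruct (Req_dec (Rabs y) 0) as [->|]; [rewrite Ropp_0; lra|left; apply exp_increasing; lra]).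
    assert (mE : m * exp (Rabs y) = 1) by (unfold m; rewrite <- exp_plus; replace (- Rabs y + Rabs y) with 0 by ring; apply exp_0).
    (* [ep] and [d4] are tuned so that [3 ep^2] and [K d4^2] are each at most [eta^2 m / 3], where
       [m] cancels the Gronwall factor [exp |y|]. *)
    set (ep := eta * m / 3). assert (ep0 : 0 < ep) by (unfold ep; apply Rdiv_lt_0_compat; [apply Rmult_lt_0_compat; lra|lra]).
    destruct (Hx x) as (D1 & D2 & D3).
    destruct (little_o_of_is_derive _ _ _ D1 ep ep0) as (d1 & d10 & H1).
    destruct (little_o_of_is_derive _ _ _ D2 ep ep0) as (d2 & d20 & H2).
    destruct (little_o_of_is_derive _ _ _ D3 ep ep0) as (d3 & d30 & H3).
    set (d4 := eta * m / (3 * (K + 1))).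
    assert (d40 : 0 < d4) by (unfold d4; apply Rdiv_lt_0_compat; [apply Rmult_lt_0_compat; lra|lra]).
    exists (Rmin (Rmin d1 d2) (Rmin (Rmin d3 d4) 1)).
    split; [repeat apply Rmin_pos; lra|]. intros h Hh.
    assert (Hd : Rabs h < d1 /\ Rabs h < d2 /\ Rabs h < d3 /\ Rabs h < d4 /\ Rabs h < 1).
    { pose proof (Rmin_l (Rmin d1 d2) (Rmin (Rmin d3 d4) 1)). pose proof (Rmin_r (Rmin d1 d2) (Rmin (Rmin d3 d4) 1)).
      pose proof (Rmin_l d1 d2). pose proof (Rmin_r d1 d2). pose proof (Rmin_l (Rmin d3 d4) 1).
      pose proof (Rmin_r (Rmin d3 d4) 1). pose proof (Rmin_l d3 d4). pose proof (Rmin_r d3 d4). lra. }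
    destruct Hd as (h1 & h2 & h3 & h4 & h5).
    specialize (H1 h h1). specialize (H2 h h2). specialize (H3 h h3).
    specialize (G h y ltac:(lra) (Rle_refl _)).
    assert (SQ : forall z, Rabs z <= ep * Rabs h -> z ^ 2 <= ep ^ 2 * h ^ 2).
    { intros z Hz. rewrite <- (pow2_abs z), <- (pow2_abs h), <- Rpow_mult_distr. apply pow_incr. split; [apply Rabs_pos|exact Hz]. }
    apply SQ in H1. apply SQ in H2. apply SQ in H3.
    assert (E0 : Err x h 0 <= 3 * ep ^ 2 * h ^ 2) by (unfold Err, Pu, Qu, Nu; lra).
    assert (h42 : h ^ 4 <= d4 ^ 2 * h ^ 2).
    { replace (h ^ 4) with (Rabs h ^ 2 * h ^ 2) by (rewrite pow2_abs; ring).
      apply Rmult_le_compat_r; [apply pow2_ge_0|]. apply pow_incr. split; [apply Rabs_pos|lra]. }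
    pose proof (pow2_ge_0 h) as hh. pose proof (exp_pos (Rabs y)) as e0.
    assert (K4 : 0 <= K * h ^ 4) by (apply Rmult_le_pos; [exact K0|replace (h ^ 4) with ((h ^ 2) ^ 2) by ring; apply pow2_ge_0]).
    rewrite Rpow_mult_distr, pow2_abs.
    assert (A1 : 3 * ep ^ 2 <= eta ^ 2 * m / 3).
    { unfold ep. replace (3 * (eta * m / 3) ^ 2) with (eta ^ 2 * m / 3 * m) by field.
      assert (0 <= eta ^ 2 * m / 3) by (pose proof (pow2_ge_0 eta); unfold Rdiv; apply Rmult_le_pos; [apply Rmult_le_pos|]; lra). nra. }
    assert (A2 : K * d4 ^ 2 <= eta ^ 2 * m / 3).
    { unfold d4. replace (K * (eta * m / (3 * (K + 1))) ^ 2) with (eta ^ 2 * m / 3 * (m * (K / (3 * (K + 1) ^ 2)))) by (field; lra).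
      assert (0 <= eta ^ 2 * m / 3) by (pose proof (pow2_ge_0 eta); unfold Rdiv; apply Rmult_le_pos; [apply Rmult_le_pos|]; lra).
      assert (K / (3 * (K + 1) ^ 2) <= 1).
      { apply (Rmult_le_reg_r (3 * (K + 1) ^ 2)); [nra|]. unfold Rdiv. rewrite Rmult_assoc, Rinv_l by nra. nra. }
      assert (m * (K / (3 * (K + 1) ^ 2)) <= 1) by nra. nra. }
    assert (A3 : Err x h 0 + K * h ^ 4 <= eta ^ 2 * h ^ 2 * m).
    { assert (K * h ^ 4 <= K * (d4 ^ 2 * h ^ 2)) by (apply Rmult_le_compat_l; assumption).
      assert (0 <= eta ^ 2 * m) by (pose proof (pow2_ge_0 eta); apply Rmult_le_pos; lra). nra. }
    apply Rle_trans with (eta ^ 2 * h ^ 2 * m * exp (Rabs y)); [|rewrite Rmult_assoc, mE; lra].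
    nra. }
  assert (C : forall u v k, 0 <= k -> u ^ 2 <= v -> v <= k ^ 2 -> Rabs u <= k).
  { intros. apply Rabs_le_of_sq_le; lra. }
  split; [|split]; apply is_derive_of_little_o; intros eta He; destruct (L eta He) as (d & d0 & Hd);
    exists d; (split; [exact d0|]); intros h Hh; specialize (Hd h Hh);
    (apply (C _ (Err x h y)); [apply Rmult_le_pos; [lra|apply Rabs_pos]| |exact Hd]); unfold Err;
    pose proof (pow2_ge_0 (p (x + h) y - p x y - h * Pu x y));
    pose proof (pow2_ge_0 (q (x + h) y - q x y - h * Qu x y));
    pose proof (pow2_ge_0 (n (x + h) y - n x y - h * Nu x y)); lra.
Qed.
End Frame.
End FrameExistence.

(** The partials of the frame entries are expressed through the entries themselves, so their
    continuity cannot be presupposed; boundedness, which the constant norm provides, suffices for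
    joint continuity. *)
Lemma bounded_partials_continuous (f fu fv : R -> R -> R) u v B :
  0 <= B ->
  (forall x y, Rabs (x - u) <= 1 -> Rabs (y - v) <= 1 ->
     has_du f x y (fu x y) /\ has_dv f x y (fv x y) /\ Rabs (fu x y) <= B /\ Rabs (fv x y) <= B) ->
  continuity_2d_pt f u v.
Proof.
  intros B0 H eps.
  assert (d0 : 0 < Rmin 1 (eps / (2 * B + 1))).
  { apply Rmin_pos; [lra|]. apply Rdiv_lt_0_compat; [apply cond_pos|lra]. }
  exists (mkposreal _ d0). simpl. intros x y Hx Hy.
  assert (Hx1 : Rabs (x - u) < 1) by (eapply Rlt_le_trans; [exact Hx|apply Rmin_l]).
  assert (Hy1 : Rabs (y - v) < 1) by (eapply Rlt_le_trans; [exact Hy|apply Rmin_l]).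
  assert (Hx2 : Rabs (x - u) < eps / (2 * B + 1)) by (eapply Rlt_le_trans; [exact Hx|apply Rmin_r]).
  assert (Hy2 : Rabs (y - v) < eps / (2 * B + 1)) by (eapply Rlt_le_trans; [exact Hy|apply Rmin_r]).
  assert (Between : forall c p q, Rmin p q <= c <= Rmax p q -> Rabs (c - p) <= Rabs (q - p)).
  { intros c p q. unfold Rmin, Rmax, Rabs. destruct Rle_dec; repeat destruct Rcase_abs; lra. }
  assert (vv : Rabs (v - v) <= 1) by (rewrite Rminus_diag, Rabs_R0; lra).
  destruct (MVT_gen (fun t => f x t) v y (fun t => fv x t)) as (c & Hc & Ec).
  { intros t Ht. apply H; [lra|]. eapply Rle_trans; [apply (Between t v y); lra|lra]. }
  { intros t Ht. apply continuity_pt_filterlim. apply (continuous_of_derive (fun t => f x t) t (fv x t)).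
    apply H; [lra|]. eapply Rle_trans; [apply (Between t v y); lra|lra]. }
  destruct (MVT_gen (fun t => f t v) u x (fun t => fu t v)) as (e & He & Ee).
  { intros t Ht. apply H; [|exact vv]. eapply Rle_trans; [apply (Between t u x); lra|lra]. }
  { intros t Ht. apply continuity_pt_filterlim. apply (continuous_of_derive (fun t => f t v) t (fu t v)).
    apply H; [|exact vv]. eapply Rle_trans; [apply (Between t u x); lra|lra]. }
  replace (f x y - f u v) with ((f x y - f x v) + (f x v - f u v)) by ring.
  rewrite Ec, Ee.
  assert (A1 : Rabs (fv x c) <= B).
  { apply H; [lra|]. eapply Rle_trans; [apply (Between c v y Hc)|lra]. }
  assert (A2 : Rabs (fu e v) <= B).
  { apply H; [|exact vv]. eapply Rle_trans; [apply (Between e u x He)|lra]. }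
  eapply Rle_lt_trans; [apply Rabs_triang|]. rewrite !Rabs_mult.
  set (d := eps / (2 * B + 1)) in *.
  assert (E : eps = d * (2 * B + 1) :> R) by (unfold d; field; lra).
  pose proof (Rabs_pos (y - v)). pose proof (Rabs_pos (x - u)). pose proof (Rabs_pos (fv x c)). pose proof (Rabs_pos (fu e v)).
  rewrite E. assert (Rabs (fv x c) * Rabs (y - v) <= B * d) by (apply Rmult_le_compat; lra).
  assert (Rabs (fu e v) * Rabs (x - u) <= B * d) by (apply Rmult_le_compat; lra). nra.
Qed.

(** Existence line by line, then the x-system by the defect estimate, then continuity from bounded
    partials, and finally smoothness by bootstrap with [p], [q], [n] as the generators of a hull. *)
Lemma frame_rows_exist om : smooth plane om -> (forall x y, dv (du om) x y = sin (om x y)) ->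
  forall p0 q0 n0, exists p q n, smooth plane p /\ smooth plane q /\ smooth plane n /\
    (forall x y, frame_eq om p q n x y) /\ p 0 0 = p0 /\ q 0 0 = q0 /\ n 0 0 = n0.
Proof.
  intros S SG p0 q0 n0.
  destruct (half_smooth om S) as (Sa & Sb & Ss & Sc).
  destruct (skew_ode_exists (fun t => - (du om t 0 / 2)) (fun t => sin (om t 0 / 2)) (fun t => cos (om t 0 / 2)) p0 q0 n0)
    as (P & Q & N & P0 & Q0 & N0 & HX).
  { intros t. apply (continuous_opp (fun t => du om t 0 / 2)), (continuous_x (fun x y => du om x y / 2) 0 t Sa). }
  { intros t. apply (continuous_x (fun x y => sin (om x y / 2)) 0 t Ss). }
  { intros t. apply (continuous_x (fun x y => cos (om x y / 2)) 0 t Sc). }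
  assert (HY : forall x, exists f : (R -> R) * (R -> R) * (R -> R),
    fst (fst f) 0 = P x /\ snd (fst f) 0 = Q x /\ snd f 0 = N x /\ forall t,
     is_derive (fst (fst f)) t (dv om x t / 2 * snd (fst f) t + sin (om x t / 2) * snd f t) /\
     is_derive (snd (fst f)) t (- (dv om x t / 2) * fst (fst f) t + - cos (om x t / 2) * snd f t) /\
     is_derive (snd f) t (- sin (om x t / 2) * fst (fst f) t - - cos (om x t / 2) * snd (fst f) t)).
  { intros x.
    destruct (skew_ode_exists (fun t => dv om x t / 2) (fun t => sin (om x t / 2)) (fun t => - cos (om x t / 2)) (P x) (Q x) (N x))
      as (p & q & n & E1 & E2 & E3 & H).
    { intros t. apply (continuous_y (fun x y => dv om x y / 2) x t Sb). }
    { intros t. apply (continuous_y (fun x y => sin (om x y / 2)) x t Ss). }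
    { intros t. apply (continuous_opp (fun t => cos (om x t / 2))), (continuous_y (fun x y => cos (om x y / 2)) x t Sc). }
    exists (p, q, n). simpl. auto. }
  (* The solutions on the vertical lines are chosen independently of each other; only the initial
     values on the axis tie them together. *)
  apply functional_choice in HY. destruct HY as [F HF].
  set (p := fun x y => fst (fst (F x)) y). set (q := fun x y => snd (fst (F x)) y). set (n := fun x y => snd (F x) y).
  assert (Hx : forall x,
    has_du p x 0 (- (du om x 0 / 2) * q x 0 + sin (om x 0 / 2) * n x 0) /\
    has_du q x 0 (du om x 0 / 2 * p x 0 + cos (om x 0 / 2) * n x 0) /\
    has_du n x 0 (- sin (om x 0 / 2) * p x 0 - cos (om x 0 / 2) * q x 0)).
  { assert (E : forall x, p x 0 = P x /\ q x 0 = Q x /\ n x 0 = N x).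
    { intros x. destruct (HF x) as (E1 & E2 & E3 & _). auto. }
    intros x. destruct (HX x) as (D1 & D2 & D3). destruct (E x) as (Ep & Eq & En). rewrite Ep, Eq, En.
    unfold has_du. split; [|split].
    - apply (is_derive_ext P); [intros; symmetry; apply E|exact D1].
    - apply (is_derive_ext Q); [intros; symmetry; apply E|]. rewrite Ropp_involutive in D2. exact D2.
    - apply (is_derive_ext N); [intros; symmetry; apply E|exact D3]. }
  assert (Hy : forall x y,
    has_dv p x y (dv om x y / 2 * q x y + sin (om x y / 2) * n x y) /\
    has_dv q x y (- (dv om x y / 2) * p x y - cos (om x y / 2) * n x y) /\
    has_dv n x y (- sin (om x y / 2) * p x y + cos (om x y / 2) * q x y)).
  { intros x y. destruct (HF x) as (_ & _ & _ & H). destruct (H y) as (D1 & D2 & D3). split; [exact D1|]. split.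
    - unfold has_dv. evar_last; [exact D2|]. unfold p, n. ring.
    - unfold has_dv. evar_last; [exact D3|]. unfold p, q. ring. }
  assert (FE : forall x y, frame_eq om p q n x y).
  { intros x y. split; [|apply Hy]. exact (frame_x_derivative om S SG p q n Hx Hy x y). }
  pose proof (frame_bound om p q n Hx Hy) as Bd.
  set (K := 1 + (p 0 0 ^ 2 + q 0 0 ^ 2 + n 0 0 ^ 2)) in *.
  assert (Cont : forall f, f = p \/ f = q \/ f = n -> forall x y, continuity_2d_pt f x y).
  { intros f Hf x y.
    destruct (continuity_2d_bounded (fun x y => du om x y / 2) (x - 1) (x + 1) (y - 1) (y + 1)) as (B1 & B10 & H1);
      [lra|lra|intros; apply (smooth_continuity plane _ _ _ Sa I)|].
    destruct (continuity_2d_bounded (fun x y => dv om x y / 2) (x - 1) (x + 1) (y - 1) (y + 1)) as (B2 & B20 & H2);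
      [lra|lra|intros; apply (smooth_continuity plane _ _ _ Sb I)|].
    assert (K0 : 0 <= K) by (eapply Rle_trans; [apply Rabs_pos|apply (Bd 0 0)]).
    assert (M : forall u v k l, Rabs u <= k -> Rabs v <= l -> Rabs (u * v) <= k * l).
    { intros. rewrite Rabs_mult. apply Rmult_le_compat; auto using Rabs_pos. }
    assert (G : forall a b, Rabs (a - x) <= 1 -> Rabs (b - y) <= 1 -> exists fu fv,
       has_du f a b fu /\ has_dv f a b fv /\ Rabs fu <= (B1 + B2 + 2) * K /\ Rabs fv <= (B1 + B2 + 2) * K).
    { intros a b Ha Hb. apply Rabs_le_between in Ha. apply Rabs_le_between in Hb.
      specialize (H1 a b ltac:(lra) ltac:(lra)). specialize (H2 a b ltac:(lra) ltac:(lra)). cbv beta in H1, H2.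
      destruct (FE a b) as ((D1 & D2 & D3) & (D1' & D2' & D3')). destruct (Bd a b) as (Bp & Bq & Bn).
      assert (Bs1 : Rabs (sin (om a b / 2)) <= 1) by (apply Rabs_le; pose proof (SIN_bound (om a b / 2)); lra).
      assert (Bc1 : Rabs (cos (om a b / 2)) <= 1) by (apply Rabs_le; pose proof (COS_bound (om a b / 2)); lra).
      assert (G2 : forall u v k l z z', Rabs u <= k -> Rabs v <= l -> k <= B1 + B2 + 1 -> l <= 1 -> Rabs z <= K -> Rabs z' <= K ->
         Rabs (u * z + v * z') <= (B1 + B2 + 2) * K).
      { intros u v k l z z' Hu Hv Hk Hl Hz Hz'. eapply Rle_trans; [apply Rabs_triang|].
        assert (Rabs u <= B1 + B2 + 1) by lra. assert (Rabs v <= 1) by lra.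
        pose proof (M u z _ _ ltac:(eassumption) Hz). pose proof (M v z' _ _ ltac:(eassumption) Hz'). lra. }
      destruct Hf as [-> | [-> | ->]]; do 2 eexists; (split; [eassumption|]); (split; [eassumption|]);
        unfold Rminus; rewrite ?Ropp_mult_distr_l; split;
        eapply G2; rewrite ?Rabs_Ropp; try eassumption; lra. }
    pose (fu := fun a b => Derive (fun t => f t b) a). pose (fv := fun a b => Derive (fun t => f a t) b).
    apply (bounded_partials_continuous f fu fv x y ((B1 + B2 + 2) * K)); [apply Rmult_le_pos; lra|].
    intros a b Ha Hb. destruct (G a b Ha Hb) as (u & v & Du & Dv & Bu & Bv).
    assert (E1 : fu a b = u) by (apply is_derive_unique, Du).
    assert (E2 : fv a b = v) by (apply is_derive_unique, Dv).
    rewrite E1, E2. auto. }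
  assert (Sm : forall f, f = p \/ f = q \/ f = n -> smooth plane f).
  { intros f Hf. apply (hull_is_smooth plane (fun f => f = p \/ f = q \/ f = n)); [apply open_plane| |apply hull_gen, Hf].
    intros g Hg. split; [intros; apply Cont, Hg|].
    assert (Gp : hull plane (fun f => f = p \/ f = q \/ f = n) p) by (apply hull_gen; auto).
    assert (Gq : hull plane (fun f => f = p \/ f = q \/ f = n) q) by (apply hull_gen; auto).
    assert (Gn : hull plane (fun f => f = p \/ f = q \/ f = n) n) by (apply hull_gen; auto).
    pose proof open_plane as OP.
    assert (comb : forall a b f g, smooth plane a -> smooth plane b ->
       hull plane (fun f => f = p \/ f = q \/ f = n) f -> hull plane (fun f => f = p \/ f = q \/ f = n) g ->
       hull plane (fun f => f = p \/ f = q \/ f = n) (fun x y => a x y * f x y + b x y * g x y)).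
    { intros. apply hull_plus; apply hull_mult; try assumption; apply hull_smooth; assumption. }
    pose proof (smooth_opp plane _ OP Sa) as Sa'. pose proof (smooth_opp plane _ OP Sb) as Sb'.
    pose proof (smooth_opp plane _ OP Ss) as Ss'. pose proof (smooth_opp plane _ OP Sc) as Sc'.
    assert (neg : forall x y, forall l l', l = l' -> has_du g x y l -> has_du g x y l') by (intros; subst; assumption).
    assert (neg' : forall x y, forall l l', l = l' -> has_dv g x y l -> has_dv g x y l') by (intros; subst; assumption).
    destruct Hg as [-> | [-> | ->]].
    - exists (fun x y => - (du om x y / 2) * q x y + sin (om x y / 2) * n x y), (fun x y => dv om x y / 2 * q x y + sin (om x y / 2) * n x y).
      split; [apply (comb _ _ _ _ Sa' Ss Gq Gn)|]. split; [apply (comb _ _ _ _ Sb Ss Gq Gn)|].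
      intros x y _. destruct (FE x y) as ((D1 & D2 & D3) & (D1' & D2' & D3')). split; assumption.
    - exists (fun x y => du om x y / 2 * p x y + cos (om x y / 2) * n x y), (fun x y => - (dv om x y / 2) * p x y + - cos (om x y / 2) * n x y).
      split; [apply (comb _ _ _ _ Sa Sc Gp Gn)|]. split; [apply (comb _ _ _ _ Sb' Sc' Gp Gn)|].
      intros x y _. destruct (FE x y) as ((D1 & D2 & D3) & (D1' & D2' & D3')). split; [assumption|].
      eapply neg'; [|exact D2']. ring.
    - exists (fun x y => - sin (om x y / 2) * p x y + - cos (om x y / 2) * q x y), (fun x y => - sin (om x y / 2) * p x y + cos (om x y / 2) * q x y).
      split; [apply (comb _ _ _ _ Ss' Sc' Gp Gq)|]. split; [apply (comb _ _ _ _ Ss' Sc Gp Gq)|].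
      intros x y _. destruct (FE x y) as ((D1 & D2 & D3) & (D1' & D2' & D3')). split; [|assumption].
      eapply neg; [|exact D3]. ring. }
  exists p, q, n. repeat (split; [apply Sm; auto|]). split; [exact FE|].
  destruct (HF 0) as (E1 & E2 & E3 & _). unfold p, q, n. rewrite E1, E2, E3. auto.
Qed.

(** * Vector-valued maps and orthonormal frames *)

Inductive axis := ax1 | ax2 | ax3.

Definition co (i : axis) : vec -> R := match i with ax1 => cx | ax2 => cy | ax3 => cz end.

Ltac vunf := unfold vsub, vadd, vscal, dot, cross, co, cx, cy, cz, vzero in *; cbn [fst snd] in *.

Ltac vec_ring :=
  repeat match goal with p : vec |- _ => destruct p as [[? ?] ?] end;
  vunf; try (f_equal; [f_equal|]); ring.

Lemma vec_ext p q : (forall i, co i p = co i q) -> p = q.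
Proof.
  intros H. pose proof (H ax1) as E1. pose proof (H ax2) as E2. pose proof (H ax3) as E3.
  destruct p as [[? ?] ?], q as [[? ?] ?]. vunf. congruence.
Qed.

Lemma co_vadd i p q : co i (vadd p q) = co i p + co i q.
Proof. destruct i; reflexivity. Qed.

Lemma co_vscal i a p : co i (vscal a p) = a * co i p.
Proof. destruct i; reflexivity. Qed.

Definition vderiv (F : R -> vec) (t : R) (D : vec) : Prop :=
  forall i, is_derive (fun t => co i (F t)) t (co i D).

Definition has_du3 (F : map3) (u v : R) (D : vec) : Prop := vderiv (fun x => F x v) u D.
Definition has_dv3 (F : map3) (u v : R) (D : vec) : Prop := vderiv (fun y => F u y) v D.

Lemma pu_eq F u v D : has_du3 F u v D -> pu F u v = D.
Proof.
  intros H. apply vec_ext. intros i. transitivity (du (fun x y => co i (F x y)) u v).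
  - destruct i; reflexivity.
  - apply (is_derive_unique _ _ _ (H i)).
Qed.

Lemma pv_eq F u v D : has_dv3 F u v D -> pv F u v = D.
Proof.
  intros H. apply vec_ext. intros i. transitivity (dv (fun x y => co i (F x y)) u v).
  - destruct i; reflexivity.
  - apply (is_derive_unique _ _ _ (H i)).
Qed.

Lemma vderiv_add F G t D E : vderiv F t D -> vderiv G t E -> vderiv (fun t => vadd (F t) (G t)) t (vadd D E).
Proof.
  intros HF HG i. rewrite co_vadd. apply (is_derive_ext (fun t => co i (F t) + co i (G t))).
  - intros. symmetry. apply co_vadd.
  - apply (is_derive_plus (fun t => co i (F t)) (fun t => co i (G t))); auto.
Qed.

Lemma vderiv_scal (f : R -> R) F t d D : is_derive f t d -> vderiv F t D ->
  vderiv (fun t => vscal (f t) (F t)) t (vadd (vscal d (F t)) (vscal (f t) D)).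
Proof.
  intros Hf HF i. rewrite co_vadd, !co_vscal. apply (is_derive_ext (fun t => f t * co i (F t))).
  - intros. symmetry. apply co_vscal.
  - apply (is_derive_mult f (fun t => co i (F t))); [exact Hf|apply HF|intros; apply Rmult_comm].
Qed.

Lemma vderiv_scal_const a F t D : vderiv F t D -> vderiv (fun t => vscal a (F t)) t (vscal a D).
Proof.
  intros HF i. rewrite co_vscal. apply (is_derive_ext (fun t => a * co i (F t))).
  - intros. symmetry. apply co_vscal.
  - apply (is_derive_scal (fun t => co i (F t))), HF.
Qed.

Lemma vderiv_const a t : vderiv (fun _ => a) t vzero.
Proof. intros i. replace (co i vzero) with 0 by (destruct i; reflexivity). apply (is_derive_const (co i a)). Qed.

Lemma vderiv_dot F G t D E : vderiv F t D -> vderiv G t E ->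
  is_derive (fun t => dot (F t) (G t)) t (dot D (G t) + dot (F t) E).
Proof.
  intros HF HG.
  assert (M : forall i, is_derive (fun t => co i (F t) * co i (G t)) t (co i D * co i (G t) + co i (F t) * co i E)).
  { intros i. apply (is_derive_mult (fun t => co i (F t)) (fun t => co i (G t))); [apply HF|apply HG|intros; apply Rmult_comm]. }
  replace (dot D (G t) + dot (F t) E) with
   (co ax1 D * co ax1 (G t) + co ax1 (F t) * co ax1 E + (co ax2 D * co ax2 (G t) + co ax2 (F t) * co ax2 E)
     + (co ax3 D * co ax3 (G t) + co ax3 (F t) * co ax3 E)) by (vunf; ring).
  apply (is_derive_plus (fun t => co ax1 (F t) * co ax1 (G t) + co ax2 (F t) * co ax2 (G t)) (fun t => co ax3 (F t) * co ax3 (G t))); [|apply M].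
  apply (is_derive_plus (fun t => co ax1 (F t) * co ax1 (G t)) (fun t => co ax2 (F t) * co ax2 (G t))); apply M.
Qed.

Lemma vderiv_eq F t D E : D = E -> vderiv F t D -> vderiv F t E.
Proof. intros ->. auto. Qed.

Lemma vderiv_ext_loc F G t D : locally t (fun x => F x = G x) -> vderiv F t D -> vderiv G t D.
Proof.
  intros H HF i. apply (is_derive_ext_loc (fun t => co i (F t))); [|apply HF].
  revert H. apply filter_imp. intros x ->. reflexivity.
Qed.

Lemma vderiv_comp F g t d D : vderiv F (g t) D -> is_derive g t d -> vderiv (fun t => F (g t)) t (vscal d D).
Proof.
  intros HF Hg i. rewrite co_vscal. apply (is_derive_comp (fun t => co i (F t)) g); [apply HF|exact Hg].
Qed.

Lemma locally_of_2d_x (P : R -> R -> Prop) u v : locally_2d P u v -> locally u (fun x => P x v).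
Proof.
  intros [d Hd]. exists d. intros x Hx. apply Hd; [exact Hx|]. rewrite Rminus_diag, Rabs_R0. apply cond_pos.
Qed.

Lemma locally_of_2d_y (P : R -> R -> Prop) u v : locally_2d P u v -> locally v (fun y => P u y).
Proof.
  intros [d Hd]. exists d. intros y Hy. apply Hd; [|exact Hy]. rewrite Rminus_diag, Rabs_R0. apply cond_pos.
Qed.

Lemma has_du3_ext (Om : dom) F G u v D : open_dom Om -> Om u v -> (forall x y, Om x y -> F x y = G x y) ->
  has_du3 F u v D -> has_du3 G u v D.
Proof.
  intros HO H E. apply vderiv_ext_loc. apply (locally_of_2d_x (fun x y => F x y = G x y)).
  apply (locally_2d_of_dom Om); assumption.
Qed.

Lemma has_dv3_ext (Om : dom) F G u v D : open_dom Om -> Om u v -> (forall x y, Om x y -> F x y = G x y) ->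
  has_dv3 F u v D -> has_dv3 G u v D.
Proof.
  intros HO H E. apply vderiv_ext_loc. apply (locally_of_2d_y (fun x y => F x y = G x y)).
  apply (locally_2d_of_dom Om); assumption.
Qed.

Lemma smooth_map_co Om F : smooth_map Om F <-> forall i, smooth Om (fun u v => co i (F u v)).
Proof.
  split.
  - intros (H1 & H2 & H3) [| |]; assumption.
  - intros H. split; [apply (H ax1)|split; [apply (H ax2)|apply (H ax3)]].
Qed.

Lemma smooth_map_has_du3 Om F u v : smooth_map Om F -> Om u v -> has_du3 F u v (pu F u v).
Proof.
  intros S H i. apply smooth_map_co with (i := i) in S.
  replace (co i (pu F u v)) with (du (fun x y => co i (F x y)) u v) by (destruct i; reflexivity).
  apply (smooth_has_du Om _ u v S H).
Qed.

Lemma smooth_map_has_dv3 Om F u v : smooth_map Om F -> Om u v -> has_dv3 F u v (pv F u v).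
Proof.
  intros S H i. apply smooth_map_co with (i := i) in S.
  replace (co i (pv F u v)) with (dv (fun x y => co i (F x y)) u v) by (destruct i; reflexivity).
  apply (smooth_has_dv Om _ u v S H).
Qed.

Lemma smooth_map_pu Om F : smooth_map Om F -> smooth_map Om (pu F).
Proof. intros (S1 & S2 & S3). split; [|split]; apply smooth_du; assumption. Qed.

Lemma smooth_map_pv Om F : smooth_map Om F -> smooth_map Om (pv F).
Proof. intros (S1 & S2 & S3). split; [|split]; apply smooth_dv; assumption. Qed.

Lemma smooth_map_schwarz Om F u v : open_dom Om -> smooth_map Om F -> Om u v -> pv (pu F) u v = pu (pv F) u v.
Proof.
  intros HO (S1 & S2 & S3) H.
  unfold pu, pv, cx, cy, cz; simpl. f_equal; [f_equal|]; apply (smooth_schwarz Om); assumption.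
Qed.

Lemma smooth_map_add Om F G : open_dom Om -> smooth_map Om F -> smooth_map Om G -> smooth_map Om (fun u v => vadd (F u v) (G u v)).
Proof.
  intros HO HF HG. apply smooth_map_co. intros i.
  apply (smooth_ext Om (fun u v => co i (F u v) + co i (G u v))); [exact HO|intros; symmetry; apply co_vadd|].
  apply smooth_plus; [exact HO|revert i; apply smooth_map_co; assumption..].
Qed.

Lemma smooth_map_scal Om f F : open_dom Om -> smooth Om f -> smooth_map Om F -> smooth_map Om (fun u v => vscal (f u v) (F u v)).
Proof.
  intros HO Hf HF. apply smooth_map_co. intros i.
  apply (smooth_ext Om (fun u v => f u v * co i (F u v))); [exact HO|intros; symmetry; apply co_vscal|].
  apply smooth_mult; [exact HO|exact Hf|revert i; apply smooth_map_co; assumption].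
Qed.

Lemma smooth_map_const Om a : open_dom Om -> smooth_map Om (fun _ _ => a).
Proof. intros HO. apply smooth_map_co. intros i. apply smooth_const, HO. Qed.

Lemma smooth_map_cross Om F G : open_dom Om -> smooth_map Om F -> smooth_map Om G -> smooth_map Om (fun u v => cross (F u v) (G u v)).
Proof.
  intros HO (F1 & F2 & F3) (G1 & G2 & G3). split; [|split]; unfold cross, cx, cy, cz; cbn [fst snd];
  apply smooth_minus; try exact HO; apply smooth_mult; assumption.
Qed.

Lemma smooth_dot Om F G : open_dom Om -> smooth_map Om F -> smooth_map Om G -> smooth Om (fun u v => dot (F u v) (G u v)).
Proof.
  intros HO (F1 & F2 & F3) (G1 & G2 & G3). unfold dot. smooth_tac.
Qed.

Lemma smooth_map_comp2 (Om U : dom) F f g : open_dom Om -> open_dom U -> smooth_map U F -> smooth Om f -> smooth Om g ->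
  (forall u v, Om u v -> U (f u v) (g u v)) -> smooth_map Om (fun u v => F (f u v) (g u v)).
Proof.
  intros HO HU HF Hf Hg H. apply smooth_map_co. intros i.
  apply (smooth_comp2 Om U (fun u v => co i (F u v)) f g); try assumption.
  revert i. apply smooth_map_co. exact HF.
Qed.

Lemma smooth_map_sub (Om D : dom) F : (forall u v, D u v -> Om u v) -> smooth_map Om F -> smooth_map D F.
Proof. intros H (S1 & S2 & S3). split; [|split]; apply (smooth_sub Om); assumption. Qed.

Lemma chain_du3 (U : dom) F f g u v a b : open_dom U -> smooth_map U F -> U (f u v) (g u v) ->
  has_du f u v a -> has_du g u v b ->
  has_du3 (fun u v => F (f u v) (g u v)) u v (vadd (vscal a (pu F (f u v) (g u v))) (vscal b (pv F (f u v) (g u v)))).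
Proof.
  intros HO HF HU Hf Hg i. rewrite co_vadd, !co_vscal. apply smooth_map_co with (i := i) in HF.
  apply is_derive_Reals. rewrite (Rmult_comm a), (Rmult_comm b).
  apply (derivable_pt_lim_comp_2d (fun x y => co i (F x y)) (fun x => f x v) (fun x => g x v)).
  - replace (co i (pu F (f u v) (g u v))) with (du (fun x y => co i (F x y)) (f u v) (g u v)) by (destruct i; reflexivity).
    replace (co i (pv F (f u v) (g u v))) with (dv (fun x y => co i (F x y)) (f u v) (g u v)) by (destruct i; reflexivity).
    apply (smooth_differentiable U); assumption.
  - apply is_derive_Reals, Hf.
  - apply is_derive_Reals, Hg.
Qed.

Lemma chain_dv3 (U : dom) F f g u v a b : open_dom U -> smooth_map U F -> U (f u v) (g u v) ->
  has_dv f u v a -> has_dv g u v b ->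
  has_dv3 (fun u v => F (f u v) (g u v)) u v (vadd (vscal a (pu F (f u v) (g u v))) (vscal b (pv F (f u v) (g u v)))).
Proof.
  intros HO HF HU Hf Hg i. rewrite co_vadd, !co_vscal. apply smooth_map_co with (i := i) in HF.
  apply is_derive_Reals. rewrite (Rmult_comm a), (Rmult_comm b).
  apply (derivable_pt_lim_comp_2d (fun x y => co i (F x y)) (fun y => f u y) (fun y => g u y)).
  - replace (co i (pu F (f u v) (g u v))) with (du (fun x y => co i (F x y)) (f u v) (g u v)) by (destruct i; reflexivity).
    replace (co i (pv F (f u v) (g u v))) with (dv (fun x y => co i (F x y)) (f u v) (g u v)) by (destruct i; reflexivity).
    apply (smooth_differentiable U); assumption.
  - apply is_derive_Reals, Hf.
  - apply is_derive_Reals, Hg.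
Qed.

Lemma closed_map_exact (D : dom) (P Q : map3) :
  open_dom D -> star_shaped D -> smooth_map D P -> smooth_map D Q ->
  (forall u v, D u v -> pv P u v = pu Q u v) ->
  exists F, smooth_map D F /\ forall u v, D u v -> has_du3 F u v (P u v) /\ has_dv3 F u v (Q u v).
Proof.
  intros HO HS SP SQ E.
  assert (A : forall i, exists f, smooth D f /\ forall u v, D u v -> has_du f u v (co i (P u v)) /\ has_dv f u v (co i (Q u v))).
  { intros i. apply closed_form_exact; try assumption.
    - revert i. apply smooth_map_co, SP.
    - revert i. apply smooth_map_co, SQ.
    - intros u v H. specialize (E u v H). apply (f_equal (co i)) in E. destruct i; exact E. }
  destruct (A ax1) as (f1 & S1 & D1), (A ax2) as (f2 & S2 & D2), (A ax3) as (f3 & S3 & D3).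
  exists (fun u v => (f1 u v, f2 u v, f3 u v)). split; [split; [|split]; assumption|].
  intros u v H. split; intros [| |]; [apply D1|apply D2|apply D3|apply D1|apply D2|apply D3]; exact H.
Qed.

(** * Orthonormal bases and orthogonal matrices *)

Definition onb (a b c : vec) : Prop :=
  dot a a = 1 /\ dot b b = 1 /\ dot c c = 1 /\ dot a b = 0 /\ dot a c = 0 /\ dot b c = 0.

(** Both orientations are allowed. With the determinant [d], Cramer's rule expands [d v] in cross
    products; applied to [a], [b], [c] it identifies these products as [d a], [d b], [d c], and the
    Gram determinant gives [d^2 = 1]. *)
Lemma onb_decomp a b c v : onb a b c ->
  v = vadd (vadd (vscal (dot v a) a) (vscal (dot v b) b)) (vscal (dot v c) c).
Proof.
  intros (Haa & Hbb & Hcc & Hab & Hac & Hbc).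
  set (d := dot a (cross b c)).
  assert (Cr : forall v, vscal d v = vadd (vadd (vscal (dot v a) (cross b c)) (vscal (dot v b) (cross c a))) (vscal (dot v c) (cross a b))).
  { intros x. unfold d. vec_ring. }
  assert (d2 : d * d = 1).
  { assert (G : d * d = dot a a * (dot b b * dot c c - dot b c * dot b c) - dot a b * (dot a b * dot c c - dot b c * dot a c)
       + dot a c * (dot a b * dot b c - dot b b * dot a c)).
    { unfold d. destruct a as [[? ?] ?], b as [[? ?] ?], c as [[? ?] ?]. vunf. ring. }
    rewrite G, Haa, Hbb, Hcc, Hab, Hac, Hbc. ring. }
  assert (comm : forall p q, dot p q = dot q p) by (intros; unfold dot; ring).
  pose proof (Cr a) as Ca. rewrite Haa, Hab, Hac in Ca.
  pose proof (Cr b) as Cb. rewrite Hbb, (comm b a), Hab, Hbc in Cb.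
  pose proof (Cr c) as Cc. rewrite Hcc, (comm c a), (comm c b), Hac, Hbc in Cc.
  assert (Z : forall p q r, vadd (vadd (vscal 1 p) (vscal 0 q)) (vscal 0 r) = p) by (intros; vec_ring).
  assert (Z2 : forall p q r, vadd (vadd (vscal 0 p) (vscal 1 q)) (vscal 0 r) = q) by (intros; vec_ring).
  assert (Z3 : forall p q r, vadd (vadd (vscal 0 p) (vscal 0 q)) (vscal 1 r) = r) by (intros; vec_ring).
  rewrite Z in Ca. rewrite Z2 in Cb. rewrite Z3 in Cc.
  pose proof (Cr v) as Cv. rewrite <- Ca, <- Cb, <- Cc in Cv.
  transitivity (vscal d (vscal d v)).
  - transitivity (vscal (d * d) v); [rewrite d2|]; vec_ring.
  - rewrite Cv. generalize (dot v a), (dot v b), (dot v c). intros x y z.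
    transitivity (vscal (d * d) (vadd (vadd (vscal x a) (vscal y b)) (vscal z c))); [vec_ring|].
    rewrite d2. vec_ring.
Qed.

Lemma onb_rows a b c i j : onb a b c ->
  co i a * co j a + co i b * co j b + co i c * co j c =
  match i, j with ax1, ax1 | ax2, ax2 | ax3, ax3 => 1 | _, _ => 0 end.
Proof.
  intros H.
  pose proof (onb_decomp a b c (1, 0, 0) H) as E1.
  pose proof (onb_decomp a b c (0, 1, 0) H) as E2.
  pose proof (onb_decomp a b c (0, 0, 1) H) as E3.
  apply (f_equal (co j)) in E1. apply (f_equal (co j)) in E2. apply (f_equal (co j)) in E3.
  rewrite !co_vadd, !co_vscal in *.
  destruct i, j; unfold co, dot, cx, cy, cz in *; cbn [fst snd] in *; lra.
Qed.

(** The triple lists the columns of the matrix. The predicate [orthogonal] admits determinant [-1],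
    in accordance with isometries that may reverse orientation. *)
Definition lin (o : vec * vec * vec) (v : vec) : vec :=
  vadd (vadd (vscal (cx v) (fst (fst o))) (vscal (cy v) (snd (fst o)))) (vscal (cz v) (snd o)).

Definition orthogonal (o : vec * vec * vec) : Prop := onb (fst (fst o)) (snd (fst o)) (snd o).

Lemma lin_add o p q : lin o (vadd p q) = vadd (lin o p) (lin o q).
Proof. destruct o as [[? ?] ?]. unfold lin. cbn [fst snd]. vec_ring. Qed.

Lemma lin_scal o a p : lin o (vscal a p) = vscal a (lin o p).
Proof. destruct o as [[? ?] ?]. unfold lin. cbn [fst snd]. vec_ring. Qed.

Lemma lin_dot o p q : orthogonal o -> dot (lin o p) (lin o q) = dot p q.
Proof.
  destruct o as [[a b] c]. unfold orthogonal, lin. cbn [fst snd]. intros (Haa & Hbb & Hcc & Hab & Hac & Hbc).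
  transitivity (cx p * cx q * dot a a + cy p * cy q * dot b b + cz p * cz q * dot c c
    + (cx p * cy q + cy p * cx q) * dot a b + (cx p * cz q + cz p * cx q) * dot a c + (cy p * cz q + cz p * cy q) * dot b c).
  - destruct p as [[? ?] ?], q as [[? ?] ?], a as [[? ?] ?], b as [[? ?] ?], c as [[? ?] ?]. vunf. ring.
  - rewrite Haa, Hbb, Hcc, Hab, Hac, Hbc. unfold dot. ring.
Qed.

Definition transpose (o : vec * vec * vec) : vec * vec * vec :=
  let '(a, b, c) := o in ((cx a, cx b, cx c), (cy a, cy b, cy c), (cz a, cz b, cz c)).

Lemma transpose_orthogonal o : orthogonal o -> orthogonal (transpose o).
Proof.
  destruct o as [[a b] c]. unfold orthogonal, transpose. cbn [fst snd]. intros H.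
  pose proof (fun i j => onb_rows a b c i j H) as E.
  unfold onb, dot. cbn [cx cy cz fst snd].
  pose proof (E ax1 ax1). pose proof (E ax2 ax2). pose proof (E ax3 ax3).
  pose proof (E ax1 ax2). pose proof (E ax1 ax3). pose proof (E ax2 ax3).
  unfold co, cx, cy, cz in *. cbn [fst snd] in *. repeat split; lra.
Qed.

Lemma lin_transpose o v : orthogonal o -> lin (transpose o) (lin o v) = v.
Proof.
  destruct o as [[a b] c]. unfold orthogonal, transpose, lin. cbn [fst snd].
  intros (Haa & Hbb & Hcc & Hab & Hac & Hbc).
  transitivity (cx v * dot a a + cy v * dot a b + cz v * dot a c, cx v * dot a b + cy v * dot b b + cz v * dot b c,
    cx v * dot a c + cy v * dot b c + cz v * dot c c).
  - vec_ring.
  - rewrite Haa, Hbb, Hcc, Hab, Hac, Hbc. vec_ring.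
Qed.

Lemma vderiv_lin o F t D : vderiv F t D -> vderiv (fun t => lin o (F t)) t (lin o D).
Proof.
  intros H.
  apply (vderiv_ext_loc (fun t => vadd (vadd (vscal (cx (F t)) (fst (fst o))) (vscal (cy (F t)) (snd (fst o)))) (vscal (cz (F t)) (snd o)))).
  { apply filter_forall. reflexivity. }
  eapply vderiv_eq; [|apply vderiv_add; [apply vderiv_add|]; apply vderiv_scal; [apply (H ax1)|apply vderiv_const|apply (H ax2)|apply vderiv_const|apply (H ax3)|apply vderiv_const]].
  unfold lin. destruct o as [[? ?] ?]. cbn [fst snd]. generalize (F t). intros. vec_ring.
Qed.

Lemma smooth_map_lin Om o F : open_dom Om -> smooth_map Om F -> smooth_map Om (fun u v => lin o (F u v)).
Proof.
  intros HO (S1 & S2 & S3). unfold lin.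
  apply smooth_map_add; [exact HO| |apply smooth_map_scal; [exact HO|exact S3|apply smooth_map_const, HO]].
  apply smooth_map_add; [exact HO| |]; apply smooth_map_scal; try assumption; apply smooth_map_const, HO.
Qed.

Lemma isometry_affine o sg c : orthogonal o -> sg = 1 \/ sg = -1 -> isometry (fun v => vadd (vscal sg (lin o v)) c).
Proof.
  intros H Hs p q. unfold vnorm. f_equal.
  replace (vsub (vadd (vscal sg (lin o p)) c) (vadd (vscal sg (lin o q)) c)) with (vscal sg (lin o (vsub p q))).
  - transitivity (sg * sg * dot (lin o (vsub p q)) (lin o (vsub p q))); [unfold dot, vscal, cx, cy, cz; cbn [fst snd]; ring|].
    rewrite (lin_dot _ _ _ H). destruct Hs as [-> | ->]; ring.
  - unfold vsub. rewrite lin_add, lin_scal. generalize (lin o p), (lin o q). intros. vec_ring.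
Qed.

(** * Frame fields and their rigidity *)

Definition frame3 (om : R -> R -> R) (e1 e2 n : map3) (x y : R) : Prop :=
  let s := sin (om x y / 2) in let c := cos (om x y / 2) in
  (has_du3 e1 x y (vadd (vscal (- (du om x y / 2)) (e2 x y)) (vscal s (n x y))) /\
   has_du3 e2 x y (vadd (vscal (du om x y / 2) (e1 x y)) (vscal c (n x y))) /\
   has_du3 n x y (vadd (vscal (- s) (e1 x y)) (vscal (- c) (e2 x y)))) /\
  (has_dv3 e1 x y (vadd (vscal (dv om x y / 2) (e2 x y)) (vscal s (n x y))) /\
   has_dv3 e2 x y (vadd (vscal (- (dv om x y / 2)) (e1 x y)) (vscal (- c) (n x y))) /\
   has_dv3 n x y (vadd (vscal (- s) (e1 x y)) (vscal c (e2 x y)))).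

Lemma frame3_rows om e1 e2 n x y :
  frame3 om e1 e2 n x y <->
  forall i, frame_eq om (fun x y => co i (e1 x y)) (fun x y => co i (e2 x y)) (fun x y => co i (n x y)) x y.
Proof.
  assert (K : forall (f : R -> R) (t l l' : R), is_derive f t l -> l = l' -> is_derive f t l') by (intros; subst; assumption).
  split.
  - intros ((A1 & A2 & A3) & (B1 & B2 & B3)) i.
    specialize (A1 i). specialize (A2 i). specialize (A3 i). specialize (B1 i). specialize (B2 i). specialize (B3 i).
    rewrite co_vadd, !co_vscal in A1, A2, A3, B1, B2, B3.
    split; (split; [|split]).
    + exact A1.
    + exact A2.
    + eapply K; [exact A3|ring].
    + exact B1.
    + eapply K; [exact B2|ring].
    + exact B3.
  - intros H. split; (split; [|split]); intros i; destruct (H i) as ((A1 & A2 & A3) & (B1 & B2 & B3)); rewrite co_vadd, !co_vscal.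
    + exact A1.
    + exact A2.
    + eapply K; [exact A3|ring].
    + exact B1.
    + eapply K; [exact B2|ring].
    + exact B3.
Qed.

Definition frame_field (D : dom) (om : R -> R -> R) (e1 e2 n : map3) : Prop :=
  forall x y, D x y -> onb (e1 x y) (e2 x y) (n x y) /\ frame3 om e1 e2 n x y.

Lemma plane_const f : (forall x y, has_du f x y 0 /\ has_dv f x y 0) -> forall x y, f x y = f 0 0.
Proof.
  intros H x y. apply (const_on_box f 0 0 (Rabs x + Rabs y + 1)).
  - intros; apply H.
  - rewrite Rminus_0_r. pose proof (Rabs_pos y). lra.
  - rewrite Rminus_0_r. pose proof (Rabs_pos x). lra.
Qed.

(** Three scalar rows with the identity matrix as initial value. The products of the rows are
    constant, so the rows stay orthonormal, and transposition gives orthonormality of [e1], [e2],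
    [n]. *)
Lemma frame_field_exists om : smooth plane om -> (forall x y, dv (du om) x y = sin (om x y)) ->
  exists e1 e2 n, smooth_map plane e1 /\ smooth_map plane e2 /\ smooth_map plane n /\ frame_field plane om e1 e2 n.
Proof.
  intros S SG. pose proof (frame_rows_exist om S SG) as Ex.
  destruct (Ex 1 0 0) as (p1 & q1 & n1 & Sp1 & Sq1 & Sn1 & F1 & P1 & Q1 & N1).
  destruct (Ex 0 1 0) as (p2 & q2 & n2 & Sp2 & Sq2 & Sn2 & F2 & P2 & Q2 & N2).
  destruct (Ex 0 0 1) as (p3 & q3 & n3 & Sp3 & Sq3 & Sn3 & F3 & P3 & Q3 & N3).
  exists (fun x y => (p1 x y, p2 x y, p3 x y)), (fun x y => (q1 x y, q2 x y, q3 x y)), (fun x y => (n1 x y, n2 x y, n3 x y)).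
  split; [split; [|split]; assumption|]. split; [split; [|split]; assumption|]. split; [split; [|split]; assumption|].
  intros x y _. split.
  - assert (G : forall p q n p' q' n', (forall x y, frame_eq om p q n x y) -> (forall x y, frame_eq om p' q' n' x y) ->
      p x y * p' x y + q x y * q' x y + n x y * n' x y = p 0 0 * p' 0 0 + q 0 0 * q' 0 0 + n 0 0 * n' 0 0).
    { intros p q n p' q' n' Hf Hg. apply (plane_const (fun x y => p x y * p' x y + q x y * q' x y + n x y * n' x y)).
      intros a b. apply frame_eq_dot with (om := om); auto. }
    pose proof (G _ _ _ _ _ _ F1 F1) as G11. pose proof (G _ _ _ _ _ _ F2 F2) as G22. pose proof (G _ _ _ _ _ _ F3 F3) as G33.
    pose proof (G _ _ _ _ _ _ F1 F2) as G12. pose proof (G _ _ _ _ _ _ F1 F3) as G13. pose proof (G _ _ _ _ _ _ F2 F3) as G23.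
    rewrite ?P1, ?P2, ?P3, ?Q1, ?Q2, ?Q3, ?N1, ?N2, ?N3 in *.
    apply (transpose_orthogonal ((p1 x y, q1 x y, n1 x y), (p2 x y, q2 x y, n2 x y), (p3 x y, q3 x y, n3 x y))).
    unfold orthogonal, onb, dot, cx, cy, cz. cbn [fst snd]. repeat split; lra.
  - apply frame3_rows. intros [| |]; [apply F1|apply F2|apply F3].
Qed.

Lemma frame_field_lin D om e1 e2 n o : orthogonal o -> frame_field D om e1 e2 n ->
  frame_field D om (fun x y => lin o (e1 x y)) (fun x y => lin o (e2 x y)) (fun x y => lin o (n x y)).
Proof.
  intros Ho H x y Hxy. destruct (H x y Hxy) as (On & (A1 & A2 & A3) & (B1 & B2 & B3)). split.
  - unfold onb in *. rewrite !(lin_dot o) by exact Ho. exact On.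
  - split; (split; [|split]); rewrite <- !lin_scal, <- lin_add; apply vderiv_lin; assumption.
Qed.

(** The consequence of connectedness on which rigidity rests. It is established separately for
    connected net domains, for domains with the rectangle property of Amsler surfaces, and for
    [Omega_k]. *)
Definition gradient_rigid (D : dom) (x0 y0 : R) : Prop :=
  D x0 y0 /\
  forall f, (forall x y, D x y -> has_du f x y 0 /\ has_dv f x y 0) -> forall x y, D x y -> f x y = f x0 y0.

Lemma rigid_connected D x0 y0 : open_dom D -> connected_dom D -> D x0 y0 -> gradient_rigid D x0 y0.
Proof. intros HO HC H0. split; [exact H0|]. intros f Hf x y H. apply (connected_const D); assumption. Qed.

Lemma rigid_rectangular (D : dom) : D 0 0 ->
  (forall x y a b, D x y -> 0 <= a <= 1 -> 0 <= b <= 1 -> D (a * x) (b * y)) -> gradient_rigid D 0 0.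
Proof.
  intros H0 HR. split; [exact H0|]. intros f Hf x y Hxy.
  assert (Seg : forall t x, Rmin 0 x <= t <= Rmax 0 x -> exists a, 0 <= a <= 1 /\ t = a * x).
  { intros t z Ht. destruct (Req_dec z 0) as [->|N].
    - exists 0. rewrite Rmin_left, Rmax_left in Ht by lra. split; lra.
    - exists (t / z). split; [|field; exact N].
      revert Ht. unfold Rmin, Rmax. destruct Rle_dec; intros Ht.
      + split; [apply Rdiv_le_0_compat; lra|]. apply (Rmult_le_reg_r z); [lra|]. unfold Rdiv. rewrite Rmult_assoc, Rinv_l; lra.
      + split.
        * replace (t / z) with ((- t) / (- z)) by (field; exact N). apply Rdiv_le_0_compat; lra.
        * replace (t / z) with ((- t) / (- z)) by (field; exact N). apply (Rmult_le_reg_r (- z)); [lra|]. unfold Rdiv. rewrite Rmult_assoc, Rinv_l; lra. }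
  transitivity (f x 0).
  - symmetry. apply (const_on_segment (fun t => f x t)). intros t Ht.
    destruct (Seg t y Ht) as (a & Ha & ->).
    assert (P : D (1 * x) (a * y)) by (apply HR; [exact Hxy|lra|exact Ha]). rewrite Rmult_1_l in P. exact (proj2 (Hf _ _ P)).
  - symmetry. apply (const_on_segment (fun t => f t 0)). intros t Ht.
    destruct (Seg t x Ht) as (a & Ha & ->).
    assert (P : D (a * x) (0 * y)) by (apply HR; [exact Hxy|exact Ha|lra]). rewrite Rmult_0_l in P. exact (proj1 (Hf _ _ P)).
Qed.

(** A point is joined to the base point inside the region by three segments: vertically to the
    height [m = min (v, r1 / 4)], horizontally at this height, and vertically up. *)
Lemma rigid_Omega r1 : 0 < r1 -> gradient_rigid (Omega_k r1) (r1 / 4) (r1 / 4).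
Proof.
  intros r0. split; [unfold Omega_k; nra|]. intros f Hf u v (u0 & v0 & Huv).
  remember (r1 / 4) as b eqn:Eb. assert (b0 : 0 < b) by lra. assert (Er : r1 = 4 * b) by lra.
  clear Eb. subst r1. set (m := Rmin v b).
  assert (Hm : 0 < m /\ m <= v /\ m <= b) by (unfold m, Rmin; destruct Rle_dec; lra).
  transitivity (f u m); [|transitivity (f b m)].
  - apply (const_on_segment (fun t => f u t)). intros t Ht. refine (proj2 (Hf _ _ _)).
    rewrite Rmin_right, Rmax_left in Ht by lra. unfold Omega_k. repeat split; nra.
  - apply (const_on_segment (fun t => f t m)). intros t Ht. refine (proj1 (Hf _ _ _)).
    unfold Omega_k. revert Ht. unfold Rmin, Rmax. destruct Rle_dec; intros; repeat split; nra.
  - apply (const_on_segment (fun t => f b t)). intros t Ht. refine (proj2 (Hf _ _ _)).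
    rewrite Rmin_left, Rmax_right in Ht by lra. unfold Omega_k. repeat split; nra.
Qed.

Lemma rigid_const3 D x0 y0 F : gradient_rigid D x0 y0 ->
  (forall u v, D u v -> has_du3 F u v vzero /\ has_dv3 F u v vzero) -> forall u v, D u v -> F u v = F x0 y0.
Proof.
  intros [_ HD] H u v Huv. apply vec_ext. intros i. apply (HD (fun u v => co i (F u v))); [|exact Huv].
  intros x y Hxy. destruct (H x y Hxy) as [D1 D2]. specialize (D1 i). specialize (D2 i).
  replace (co i vzero) with 0 in * by (destruct i; reflexivity). split; assumption.
Qed.

(* The matrix [f e^T] has vanishing derivative. *)
Lemma frame_field_rigid D x0 y0 om e1 e2 n f1 f2 m :
  gradient_rigid D x0 y0 -> frame_field D om e1 e2 n -> frame_field D om f1 f2 m ->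
  exists o, orthogonal o /\ forall x y, D x y ->
    f1 x y = lin o (e1 x y) /\ f2 x y = lin o (e2 x y) /\ m x y = lin o (n x y).
Proof.
  intros [D0 HD] HE HF.
  set (T := fun i j x y => co i (f1 x y) * co j (e1 x y) + co i (f2 x y) * co j (e2 x y) + co i (m x y) * co j (n x y)).
  assert (HT : forall i j x y, D x y -> T i j x y = T i j x0 y0).
  { intros i j. apply HD. intros x y Hxy.
    destruct (HE x y Hxy) as [_ E]. destruct (HF x y Hxy) as [_ F].
    apply frame_eq_dot with (om := om); revert i j; intros i j; [apply (proj1 (frame3_rows _ _ _ _ _ _) F)|apply (proj1 (frame3_rows _ _ _ _ _ _) E)]. }
  set (col := fun j => (T ax1 j x0 y0, T ax2 j x0 y0, T ax3 j x0 y0)).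
  assert (coT : forall i j, co i (col j) = T i j x0 y0) by (intros [| |] j; reflexivity).
  exists (col ax1, col ax2, col ax3). split.
  - assert (G : forall j l, dot (col j) (col l) = match j, l with ax1, ax1 | ax2, ax2 | ax3, ax3 => 1 | _, _ => 0 end).
    { intros j l. destruct (HE x0 y0 D0) as [OE _]. destruct (HF x0 y0 D0) as [(Haa & Hbb & Hcc & Hab & Hac & Hbc) _].
      rewrite <- (onb_rows _ _ _ j l OE).
      transitivity (co j (e1 x0 y0) * co l (e1 x0 y0) * dot (f1 x0 y0) (f1 x0 y0) + co j (e2 x0 y0) * co l (e2 x0 y0) * dot (f2 x0 y0) (f2 x0 y0)
        + co j (n x0 y0) * co l (n x0 y0) * dot (m x0 y0) (m x0 y0)
        + (co j (e1 x0 y0) * co l (e2 x0 y0) + co j (e2 x0 y0) * co l (e1 x0 y0)) * dot (f1 x0 y0) (f2 x0 y0)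
        + (co j (e1 x0 y0) * co l (n x0 y0) + co j (n x0 y0) * co l (e1 x0 y0)) * dot (f1 x0 y0) (m x0 y0)
        + (co j (e2 x0 y0) * co l (n x0 y0) + co j (n x0 y0) * co l (e2 x0 y0)) * dot (f2 x0 y0) (m x0 y0)).
      - assert (D3 : forall p q r p' q' r' : R, dot (p, q, r) (p', q', r') = p * p' + q * q' + r * r') by reflexivity.
        unfold col. rewrite D3. unfold T, dot. cbn [co].
        generalize (co j (e1 x0 y0)), (co j (e2 x0 y0)), (co j (n x0 y0)), (co l (e1 x0 y0)), (co l (e2 x0 y0)), (co l (n x0 y0)).
        intros. ring.
      - rewrite Haa, Hbb, Hcc, Hab, Hac, Hbc. ring. }
    unfold orthogonal, onb. cbn [fst snd]. rewrite !G. repeat split.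
  - intros x y Hxy. destruct (HE x y Hxy) as [(Haa & Hbb & Hcc & Hab & Hac & Hbc) _].
    assert (L : forall v i, co i (lin (col ax1, col ax2, col ax3) v) =
      co i (f1 x y) * dot v (e1 x y) + co i (f2 x y) * dot v (e2 x y) + co i (m x y) * dot v (n x y)).
    { intros v i. unfold lin. cbn [fst snd]. rewrite !co_vadd, !co_vscal, !coT, <- !(HT _ _ x y Hxy). unfold T, dot. cbn [co]. ring. }
    assert (comm : forall p q, dot p q = dot q p) by (intros; unfold dot; ring).
    repeat split; apply vec_ext; intros i; rewrite L.
    + rewrite Haa, Hab, Hac. ring.
    + rewrite Hbb, (comm (e2 x y) (e1 x y)), Hab, Hbc. ring.
    + rewrite Hcc, (comm (n x y) (e1 x y)), (comm (n x y) (e2 x y)), Hac, Hbc. ring.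
Qed.

Definition frP (om : R -> R -> R) (e1 e2 : map3) : map3 := fun x y =>
  vadd (vscal (cos (om x y / 2)) (e1 x y)) (vscal (- sin (om x y / 2)) (e2 x y)).
Definition frQ (om : R -> R -> R) (e1 e2 : map3) : map3 := fun x y =>
  vadd (vscal (cos (om x y / 2)) (e1 x y)) (vscal (sin (om x y / 2)) (e2 x y)).

Lemma sin_half om : sin om = 2 * sin (om / 2) * cos (om / 2).
Proof. rewrite <- sin_2a. f_equal. field. Qed.

Lemma cos_half om : cos om = 1 - 2 * sin (om / 2) ^ 2.
Proof. replace om with (2 * (om / 2)) at 1 by field. rewrite cos_2a_sin. ring. Qed.

Lemma cos_half' om : cos om = 2 * cos (om / 2) ^ 2 - 1.
Proof. replace om with (2 * (om / 2)) at 1 by field. rewrite cos_2a_cos. ring. Qed.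

Lemma sin_cos_sq t : sin t ^ 2 + cos t ^ 2 = 1.
Proof. pose proof (sin2_cos2 t) as H. unfold Rsqr in H. lra. Qed.

Lemma is_derive_half_trig (f : R -> R) t l : is_derive f t l ->
  is_derive (fun t => sin (f t / 2)) t (l / 2 * cos (f t / 2)) /\
  is_derive (fun t => cos (f t / 2)) t (- (l / 2) * sin (f t / 2)).
Proof.
  intros D.
  assert (D2 : is_derive (fun t => f t / 2) t (l / 2)).
  { apply (is_derive_ext (fun t => / 2 * f t)); [intros; unfold Rdiv; apply Rmult_comm|].
    unfold Rdiv. rewrite Rmult_comm. apply (is_derive_scal f), D. }
  split.
  - apply (is_derive_comp sin (fun t => f t / 2)); [apply is_derive_sin|exact D2].
  - replace (- (l / 2) * sin (f t / 2)) with (l / 2 * - sin (f t / 2)) by ring.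
    apply (is_derive_comp cos (fun t => f t / 2)); [apply is_derive_cos|exact D2].
Qed.

(** [P_y = Q_x] is the closedness that integrates [(P, Q)] to a surface. The derivatives [P_x] and
    [Q_y] are tangential, so the coordinate lines of that surface are asymptotic. *)
Lemma frame_PQ_partials om e1 e2 n x y : has_du om x y (du om x y) -> has_dv om x y (dv om x y) ->
  frame3 om e1 e2 n x y ->
  has_du3 (frP om e1 e2) x y (vscal (- du om x y) (vadd (vscal (sin (om x y / 2)) (e1 x y)) (vscal (cos (om x y / 2)) (e2 x y)))) /\
  has_dv3 (frP om e1 e2) x y (vscal (sin (om x y)) (n x y)) /\
  has_du3 (frQ om e1 e2) x y (vscal (sin (om x y)) (n x y)) /\
  has_dv3 (frQ om e1 e2) x y (vscal (dv om x y) (vadd (vscal (- sin (om x y / 2)) (e1 x y)) (vscal (cos (om x y / 2)) (e2 x y)))).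
Proof.
  intros Du Dv ((A1 & A2 & A3) & (B1 & B2 & B3)).
  destruct (is_derive_half_trig _ _ _ Du) as [Sx Cx]. destruct (is_derive_half_trig _ _ _ Dv) as [Sy Cy].
  rewrite (sin_half (om x y)).
  split; [|split; [|split]].
  - eapply vderiv_eq; [|apply vderiv_add; [apply vderiv_scal; [exact Cx|exact A1]|apply vderiv_scal; [apply (is_derive_opp (fun x => sin (om x y / 2))), Sx|exact A2]]].
    cbv beta. generalize (sin (om x y / 2)), (cos (om x y / 2)), (e1 x y), (e2 x y), (n x y), (du om x y). intros. unfold opp; simpl.
    repeat match goal with p : vec |- _ => destruct p as [[? ?] ?] end; vunf; f_equal; [f_equal|]; field.
  - eapply vderiv_eq; [|apply vderiv_add; [apply vderiv_scal; [exact Cy|exact B1]|apply vderiv_scal; [apply (is_derive_opp (fun y => sin (om x y / 2))), Sy|exact B2]]].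
    cbv beta. generalize (sin (om x y / 2)), (cos (om x y / 2)), (e1 x y), (e2 x y), (n x y), (dv om x y). intros. unfold opp; simpl.
    repeat match goal with p : vec |- _ => destruct p as [[? ?] ?] end; vunf; f_equal; [f_equal|]; field.
  - eapply vderiv_eq; [|apply vderiv_add; [apply vderiv_scal; [exact Cx|exact A1]|apply vderiv_scal; [exact Sx|exact A2]]].
    cbv beta. generalize (sin (om x y / 2)), (cos (om x y / 2)), (e1 x y), (e2 x y), (n x y), (du om x y). intros.
    repeat match goal with p : vec |- _ => destruct p as [[? ?] ?] end; vunf; f_equal; [f_equal|]; field.
  - eapply vderiv_eq; [|apply vderiv_add; [apply vderiv_scal; [exact Cy|exact B1]|apply vderiv_scal; [exact Sy|exact B2]]].
    cbv beta. generalize (sin (om x y / 2)), (cos (om x y / 2)), (e1 x y), (e2 x y), (n x y), (dv om x y). intros.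
    repeat match goal with p : vec |- _ => destruct p as [[? ?] ?] end; vunf; f_equal; [f_equal|]; field.
Qed.

Lemma dot_comb2 a b c d e f : dot e e = 1 -> dot f f = 1 -> dot e f = 0 ->
  dot (vadd (vscal a e) (vscal b f)) (vadd (vscal c e) (vscal d f)) = a * c + b * d.
Proof.
  intros He Hf Hef. transitivity (a * c * dot e e + b * d * dot f f + (a * d + b * c) * dot e f).
  - destruct e as [[? ?] ?], f as [[? ?] ?]. vunf. ring.
  - rewrite He, Hf, Hef. ring.
Qed.

Lemma dot_comb2_orth a b e f g : dot e g = 0 -> dot f g = 0 -> dot (vadd (vscal a e) (vscal b f)) g = 0.
Proof.
  intros He Hf. transitivity (a * dot e g + b * dot f g).
  - destruct e as [[? ?] ?], f as [[? ?] ?], g as [[? ?] ?]. vunf. ring.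
  - rewrite He, Hf. ring.
Qed.

Lemma frame_PQ_gram om e1 e2 n x y : onb (e1 x y) (e2 x y) (n x y) ->
  dot (frP om e1 e2 x y) (frP om e1 e2 x y) = 1 /\ dot (frQ om e1 e2 x y) (frQ om e1 e2 x y) = 1 /\
  dot (frP om e1 e2 x y) (frQ om e1 e2 x y) = cos (om x y) /\
  dot (frP om e1 e2 x y) (n x y) = 0 /\ dot (frQ om e1 e2 x y) (n x y) = 0.
Proof.
  intros (Haa & Hbb & Hcc & Hab & Hac & Hbc). unfold frP, frQ.
  rewrite !dot_comb2 by assumption. pose proof (sin_cos_sq (om x y / 2)). pose proof (cos_half (om x y)).
  split; [nra|]. split; [nra|]. split; [nra|]. split; apply dot_comb2_orth; assumption.
Qed.

(** * Cross products and unit normals *)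

Lemma vnorm_sq p : vnorm p ^ 2 = dot p p.
Proof. unfold vnorm. apply pow2_sqrt. unfold dot. nra. Qed.

Lemma lagrange_identity p q : dot (cross p q) (cross p q) = dot p p * dot q q - dot p q ^ 2.
Proof. destruct p as [[? ?] ?], q as [[? ?] ?]. vunf. ring. Qed.

Lemma dot_vscal_l a p q : dot (vscal a p) q = a * dot p q.
Proof. unfold dot, vscal, cx, cy, cz; cbn [fst snd]. ring. Qed.

Lemma dot_vscal_r a p q : dot p (vscal a q) = a * dot p q.
Proof. unfold dot, vscal, cx, cy, cz; cbn [fst snd]. ring. Qed.

Lemma dot_vadd_l p p' q : dot (vadd p p') q = dot p q + dot p' q.
Proof. unfold dot, vadd, cx, cy, cz; cbn [fst snd]. ring. Qed.

Lemma dot_vadd_r p q q' : dot p (vadd q q') = dot p q + dot p q'.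
Proof. unfold dot, vadd, cx, cy, cz; cbn [fst snd]. ring. Qed.

Lemma dot_comm p q : dot p q = dot q p.
Proof. unfold dot. ring. Qed.

Lemma cross_along_normal X Y n : dot n n = 1 -> dot X n = 0 -> dot Y n = 0 ->
  cross X Y = vscal (dot (cross X Y) n) n.
Proof.
  intros Hn HX HY.
  assert (E : vscal (dot n n) (cross X Y) = vadd (vscal (dot (cross X Y) n) n) (cross n (vadd (vscal (dot X n) Y) (vscal (- dot Y n) X)))).
  { vec_ring. }
  rewrite Hn, HX, HY in E. generalize dependent (dot (cross X Y) n). intros z E.
  transitivity (vscal 1 (cross X Y)); [vec_ring|]. rewrite E. vec_ring.
Qed.

(** The unit normal of a net is oriented by its coordinates, whereas a frame brings its own normal.
    The sign between the two is kept explicit, since the sign of the second form depends on it. *)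
Lemma unit_normal_sign eta u v n : dot n n = 1 -> dot (pu eta u v) n = 0 -> dot (pv eta u v) n = 0 ->
  cross (pu eta u v) (pv eta u v) <> vzero ->
  let d := dot (cross (pu eta u v) (pv eta u v)) n in
  d <> 0 /\ unit_normal eta u v = vscal (/ Rabs d * d) n.
Proof.
  intros Hn HX HY H0 d. pose proof (cross_along_normal _ _ n Hn HX HY) as E. fold d in E.
  assert (d0 : d <> 0).
  { intros Z. apply H0. rewrite E, Z. clear. vec_ring. }
  split; [exact d0|]. unfold unit_normal. rewrite E.
  assert (N : vnorm (vscal d n) = Rabs d).
  { unfold vnorm. rewrite dot_vscal_l, dot_vscal_r, Hn, Rmult_1_r. apply sqrt_Rsqr_abs. }
  rewrite N. generalize (/ Rabs d). intros z. clear. generalize d. intros. vec_ring.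
Qed.

Lemma sign_sq d : d <> 0 -> (/ Rabs d * d) * (/ Rabs d * d) = 1.
Proof.
  intros H. replace (/ Rabs d * d * (/ Rabs d * d)) with (d * d / (Rabs d * Rabs d)) by (field; apply Rabs_no_R0, H).
  assert (E : Rabs d * Rabs d = d * d) by (unfold Rabs; destruct Rcase_abs; ring). rewrite E. field. exact H.
Qed.

Lemma unit_normal_pm eta u v n : dot n n = 1 -> dot (pu eta u v) n = 0 -> dot (pv eta u v) n = 0 ->
  cross (pu eta u v) (pv eta u v) <> vzero ->
  exists tau, tau * tau = 1 /\ unit_normal eta u v = vscal tau n.
Proof.
  intros Hn HX HY H0. destruct (unit_normal_sign eta u v n Hn HX HY H0) as [d0 E].
  exists (/ Rabs (dot (cross (pu eta u v) (pv eta u v)) n) * dot (cross (pu eta u v) (pv eta u v)) n).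
  split; [apply sign_sq, d0|exact E].
Qed.

Lemma cross_nonzero p q : 0 < dot p p * dot q q - dot p q ^ 2 -> cross p q <> vzero.
Proof.
  intros H E. rewrite <- lagrange_identity, E in H. unfold dot, vzero, cx, cy, cz in H. cbn [fst snd] in H. lra.
Qed.

Lemma cross_nonzero_iff p q : cross p q <> vzero -> 0 < dot p p * dot q q - dot p q ^ 2.
Proof.
  intros H. rewrite <- lagrange_identity. generalize dependent (cross p q). intros [[a b] c] H.
  unfold dot, cx, cy, cz. cbn [fst snd].
  destruct (Req_dec a 0) as [Ea|Na]; [destruct (Req_dec b 0) as [Eb|Nb]; [destruct (Req_dec c 0) as [Ec|Nc]|]|]; [exfalso; apply H; subst; reflexivity|nra..].
Qed.

Lemma unit_normal_props eta u v : cross (pu eta u v) (pv eta u v) <> vzero ->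
  dot (unit_normal eta u v) (unit_normal eta u v) = 1 /\ dot (pu eta u v) (unit_normal eta u v) = 0 /\
  dot (pv eta u v) (unit_normal eta u v) = 0.
Proof.
  intros H. pose proof (cross_nonzero_iff _ _ H) as P. rewrite <- lagrange_identity in P.
  unfold unit_normal. set (X := pu eta u v) in *. set (Y := pv eta u v) in *.
  rewrite !dot_vscal_r, dot_vscal_l. split; [|split].
  - rewrite <- (vnorm_sq (cross X Y)). field. intros Z. rewrite <- vnorm_sq, Z in P. lra.
  - replace (dot X (cross X Y)) with 0; [ring|]. destruct X as [[? ?] ?], Y as [[? ?] ?]. vunf. ring.
  - replace (dot Y (cross X Y)) with 0; [ring|]. destruct X as [[? ?] ?], Y as [[? ?] ?]. vunf. ring.
Qed.

(** * The Amsler angle and exactness on [Omega_k] *)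

Definition om_of (w : R -> R) : R -> R -> R := fun x y => w (x * y).

Lemma smooth_om k w : amsler_profile k w -> smooth plane (om_of w).
Proof.
  intros (S & _). pose proof open_plane. apply (smooth_comp1 plane (fun _ => True) w); auto. smooth_tac.
Qed.

Lemma om_partials k w x y : amsler_profile k w ->
  has_du (om_of w) x y (y * Derive w (x * y)) /\ has_dv (om_of w) x y (x * Derive w (x * y)).
Proof.
  intros H. split.
  - apply (is_derive_comp w (fun x => x * y)); [apply (profile_derive k w H)|]. auto_derive; [exact I|ring].
  - apply (is_derive_comp w (fun y => x * y)); [apply (profile_derive k w H)|]. auto_derive; [exact I|ring].
Qed.

Lemma om_sine_gordon k w x y : amsler_profile k w -> dv (du (om_of w)) x y = sin (om_of w x y).
Proof.
  intros H. apply dv_eq. unfold has_dv.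
  apply (is_derive_ext (fun y => y * Derive w (x * y))).
  - intros t. symmetry. apply du_eq, (om_partials k w x t H).
  - destruct (H) as (_ & _ & E). unfold om_of. rewrite <- E.
    evar_last.
    + apply (is_derive_mult (fun y => y) (fun y => Derive w (x * y))); [apply (is_derive_id y)| |intros; apply Rmult_comm].
      apply (is_derive_comp (Derive w) (fun y => x * y)); [apply (profile_derive2 k w H)|]. instantiate (1 := x). auto_derive; [exact I|ring].
    + unfold plus, mult, scal, one; simpl; unfold mult; simpl. ring.
Qed.

(* In logarithmic coordinates [Omega_k] is a half-plane. *)
Lemma closed_map_exact_Omega r1 (P Q : map3) :
  0 < r1 -> open_dom (Omega_k r1) -> smooth_map (Omega_k r1) P -> smooth_map (Omega_k r1) Q ->
  (forall u v, Omega_k r1 u v -> pv P u v = pu Q u v) ->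
  exists F, forall u v, Omega_k r1 u v -> has_du3 F u v (P u v) /\ has_dv3 F u v (Q u v).
Proof.
  (* With [r1 = 4 b], [u = b exp x] and [v = b exp y], the inequality [4 u v < r1^2] becomes
     [x + y < ln 4]; since [ln 4 > 0], this half-plane is star-shaped about the origin. *)
  intros r0 HO SP SQ E. set (b := r1 / 4). assert (b0 : 0 < b) by (unfold b; lra).
  set (L := fun x y : R => x + y < ln 4).
  assert (ln4 : 0 < ln 4) by (rewrite <- ln_1; apply ln_increasing; lra).
  assert (OL : open_dom L).
  { intros x y H. unfold L in *. assert (d0 : 0 < (ln 4 - (x + y)) / 2) by lra. exists (mkposreal _ d0). simpl. intros p q Hp Hq.
    apply Rabs_def2 in Hp. apply Rabs_def2 in Hq. cbv beta in *. lra. }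
  assert (SL : star_shaped L).
  { intros x y s H Hs. unfold L in *. rewrite <- Rmult_plus_distr_l. destruct (Rle_dec (x + y) 0); nra. }
  set (g := fun t => b * exp t).
  assert (HL : forall x y, L x y -> Omega_k r1 (g x) (g y)).
  { intros x y H. unfold g. pose proof (exp_pos x). pose proof (exp_pos y).
    split; [nra|]. split; [nra|]. unfold L in H. apply exp_increasing in H. rewrite exp_ln, exp_plus in H by lra.
    replace r1 with (4 * b) by (unfold b; field). assert (0 < b * b) by nra. nra. }
  assert (Sg1 : smooth L (fun x _ => g x)) by (unfold g; smooth_tac).
  assert (Sg2 : smooth L (fun _ y => g y)) by (unfold g; smooth_tac).
  assert (Dg : forall t, is_derive g t (g t)) by (intros t; unfold g; auto_derive; [exact I|ring]).
  destruct (closed_map_exact L (fun x y => vscal (g x) (P (g x) (g y))) (fun x y => vscal (g y) (Q (g x) (g y)))) as (F & _ & DF).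
  - exact OL.
  - exact SL.
  - apply smooth_map_scal; [exact OL|exact Sg1|]. apply (smooth_map_comp2 L (Omega_k r1) P (fun x _ => g x) (fun _ y => g y)); assumption.
  - apply smooth_map_scal; [exact OL|exact Sg2|]. apply (smooth_map_comp2 L (Omega_k r1) Q (fun x _ => g x) (fun _ y => g y)); assumption.
  - intros x y Hxy. specialize (HL x y Hxy).
    rewrite (pv_eq _ x y (vscal (g x) (vscal (g y) (pv P (g x) (g y))))).
    + rewrite (pu_eq _ x y (vscal (g y) (vscal (g x) (pu Q (g x) (g y))))).
      * rewrite (E _ _ HL). generalize (pu Q (g x) (g y)), (g x), (g y). clear. intros. vec_ring.
      * apply vderiv_scal_const. apply (vderiv_comp (fun x => Q x (g y)) g); [|apply Dg].
        apply (smooth_map_has_du3 (Omega_k r1)); assumption.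
    + apply vderiv_scal_const. apply (vderiv_comp (fun y => P (g x) y) g); [|apply Dg].
      apply (smooth_map_has_dv3 (Omega_k r1)); assumption.
  - set (l := fun t => ln (t / b)).
    assert (Dl : forall t, 0 < t -> is_derive l t (/ t) /\ g (l t) = t).
    { intros t t0. assert (0 < t / b) by (apply Rdiv_lt_0_compat; lra). split.
      - unfold l. auto_derive; [assumption|field; lra].
      - unfold g, l. rewrite exp_ln by assumption. field. lra. }
    exists (fun u v => F (l u) (l v)). intros u v (u0 & v0 & Huv).
    destruct (Dl u u0) as [Du Eu]. destruct (Dl v v0) as [Dv Ev].
    assert (HLuv : L (l u) (l v)).
    { unfold L, l. rewrite <- ln_mult by (apply Rdiv_lt_0_compat; lra). apply ln_increasing.
      - apply Rmult_lt_0_compat; apply Rdiv_lt_0_compat; lra.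
      - replace r1 with (4 * b) in Huv by (unfold b; field).
        apply (Rmult_lt_reg_r (b * b)); [nra|]. replace (u / b * (v / b) * (b * b)) with (u * v) by (field; lra). nra. }
    destruct (DF _ _ HLuv) as [D1 D2]. rewrite Eu, Ev in D1, D2. split.
    + eapply vderiv_eq; [|apply (vderiv_comp (fun x => F x (l v)) l u _ _ D1 Du)].
      generalize (P u v). intros [[? ?] ?]. vunf. f_equal; [f_equal|]; field; lra.
    + eapply vderiv_eq; [|apply (vderiv_comp (fun y => F (l u) y) l v _ _ D2 Dv)].
      generalize (Q u v). intros [[? ?] ?]. vunf. f_equal; [f_equal|]; field; lra.
Qed.

Lemma open_Omega r1 : open_dom (Omega_k r1).
Proof.
  intros u v (u0 & v0 & H).
  assert (C : continuity_2d_pt (fun u v => 4 * u * v) u v).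
  { apply continuity_2d_pt_mult; [apply continuity_2d_pt_mult; [apply continuity_2d_pt_const|apply continuity_2d_pt_id1]|apply continuity_2d_pt_id2]. }
  assert (e0 : 0 < r1 ^ 2 - 4 * u * v) by lra. destruct (C (mkposreal _ e0)) as [d Hd]. simpl in Hd.
  assert (m0 : 0 < Rmin d (Rmin u v)) by (repeat apply Rmin_pos; try assumption; apply cond_pos).
  exists (mkposreal _ m0). simpl. intros x y Hx Hy.
  pose proof (Rmin_l d (Rmin u v)). pose proof (Rmin_r d (Rmin u v)). pose proof (Rmin_l u v). pose proof (Rmin_r u v).
  specialize (Hd x y ltac:(lra) ltac:(lra)). apply Rabs_def2 in Hx. apply Rabs_def2 in Hy. apply Rabs_def2 in Hd.
  unfold Omega_k. simpl in *. repeat split; lra.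
Qed.

(** * Amsler surfaces and model nets *)

Definition is_sign (sg : R) : Prop := sg = 1 \/ sg = -1.

Lemma is_sign_sq sg : is_sign sg -> sg * sg = 1.
Proof. intros [-> | ->]; ring. Qed.

(* [beta 1 om = csc^2 (om/2)] and [beta (-1) om = sec^2 (om/2)]. *)
Definition beta (sg om : R) : R := 2 / (1 - sg * cos om).
Definition beta' (sg om : R) : R := - (2 * sg * sin om) / (1 - sg * cos om) ^ 2.

Lemma cos_strict om : 0 < om < PI -> -1 < cos om < 1.
Proof.
  intros H. pose proof (sin_gt_0 om (proj1 H) (proj2 H)). pose proof (sin_cos_sq om). nra.
Qed.

Lemma beta_den_pos sg om : is_sign sg -> 0 < om < PI -> 0 < 1 - sg * cos om.
Proof. intros [-> | ->] H; pose proof (cos_strict om H); lra. Qed.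

Lemma beta_pos sg om : is_sign sg -> 0 < om < PI -> 0 < beta sg om.
Proof. intros Hs H. pose proof (beta_den_pos sg om Hs H). apply Rdiv_lt_0_compat; lra. Qed.

Lemma beta_derive sg (f : R -> R) t l : is_sign sg -> 0 < f t < PI -> is_derive f t l ->
  is_derive (fun t => beta sg (f t)) t (l * beta' sg (f t)).
Proof.
  intros Hs H D. pose proof (beta_den_pos sg (f t) Hs H).
  apply (is_derive_comp (beta sg) f); [|exact D].
  unfold beta, beta'. auto_derive; [lra|field; lra].
Qed.

Lemma smooth_beta Om sg f : open_dom Om -> is_sign sg -> smooth Om f ->
  (forall u v, Om u v -> 0 < f u v < PI) -> smooth Om (fun u v => beta sg (f u v)).
Proof.
  intros HO Hs Sf H. unfold beta. smooth_tac. intros u v Huv.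
  pose proof (beta_den_pos sg (f u v) Hs (H u v Huv)). lra.
Qed.

(* The compatibility of [eta_x = (beta/x) Q] and [eta_y = (sg beta/y) P] reduces to this identity. *)
Lemma beta_compat sg om e1 e2 : is_sign sg -> 0 < om < PI ->
  vadd (vscal (beta' sg om) (vadd (vscal (cos (om / 2)) e1) (vscal (sin (om / 2)) e2)))
       (vscal (beta sg om) (vadd (vscal (- sin (om / 2)) e1) (vscal (cos (om / 2)) e2))) =
  vscal sg (vadd (vscal (beta' sg om) (vadd (vscal (cos (om / 2)) e1) (vscal (- sin (om / 2)) e2)))
       (vscal (beta sg om) (vscal (-1) (vadd (vscal (sin (om / 2)) e1) (vscal (cos (om / 2)) e2))))).
Proof.
  intros Hs H.
  assert (s0 : 0 < sin (om / 2)) by (apply sin_gt_0; lra).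
  assert (c0 : 0 < cos (om / 2)) by (apply cos_gt_0; lra).
  assert (B1 : beta 1 om = / sin (om / 2) ^ 2) by (unfold beta; rewrite (cos_half om); field; split; nra).
  assert (B2 : beta (-1) om = / cos (om / 2) ^ 2) by (unfold beta; rewrite (cos_half' om); field; split; nra).
  assert (B1' : beta' 1 om = - cos (om / 2) / sin (om / 2) ^ 3) by (unfold beta'; rewrite (cos_half om), (sin_half om); field; split; nra).
  assert (B2' : beta' (-1) om = sin (om / 2) / cos (om / 2) ^ 3) by (unfold beta'; rewrite (cos_half' om), (sin_half om); field; split; nra).
  destruct Hs as [-> | ->].
  - rewrite B1, B1'. destruct e1 as [[? ?] ?], e2 as [[? ?] ?]. vunf. f_equal; [f_equal|]; field; lra.
  - rewrite B2, B2'. destruct e1 as [[? ?] ?], e2 as [[? ?] ?]. vunf. f_equal; [f_equal|]; field; lra.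
Qed.

(** Up to the first cusp the angle stays strictly between [0] and [PI]: this keeps [sin om] and the
    denominators of [beta] away from zero. Positivity of [w'] is what later allows the turning terms
    to be compared. *)
Lemma Omega_range k w W r1 u v : amsler_profile k w -> 0 < k < PI -> W_solution k W -> first_cusp W r1 ->
  Omega_k r1 u v -> 0 < om_of w u v < PI /\ 0 < Derive w (u * v) /\ omega W u v = om_of w u v.
Proof.
  intros H Hk HW Hc (u0 & v0 & Huv). assert (uv0 : 0 < u * v) by nra.
  destruct (profile_below_PI k w (r1 ^ 2 / 4) H Hk) with (z := u * v) as [A1 A2].
  - intros z Hz. apply (profile_first_cusp k w W r1 H Hk HW Hc); lra.
  - lra.
  - split; [exact A1|]. split; [apply A2, uv0|].
    unfold omega, om_of. rewrite <- (profile_unique k w W H HW (u * v)) by lra. f_equal. f_equal. ring.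
Qed.

Lemma smooth_map_primitive Om F P Q : open_dom Om -> smooth_map Om P -> smooth_map Om Q ->
  (forall u v, Om u v -> has_du3 F u v (P u v) /\ has_dv3 F u v (Q u v)) -> smooth_map Om F.
Proof.
  intros HO SP SQ H. apply smooth_map_co. intros i.
  apply (smooth_primitive Om _ (fun u v => co i (P u v)) (fun u v => co i (Q u v))); try assumption.
  - revert i. apply smooth_map_co, SP.
  - revert i. apply smooth_map_co, SQ.
  - intros u v Huv. destruct (H u v Huv) as [D1 D2]. split; [apply D1|apply D2].
Qed.

Lemma smooth_PQ om e1 e2 : smooth plane om -> smooth_map plane e1 -> smooth_map plane e2 ->
  smooth_map plane (frP om e1 e2) /\ smooth_map plane (frQ om e1 e2).
Proof.
  intros S S1 S2. pose proof open_plane as OP.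
  assert (Ss : smooth plane (fun x y => sin (om x y / 2))) by (unfold Rdiv; smooth_tac).
  assert (Sc : smooth plane (fun x y => cos (om x y / 2))) by (unfold Rdiv; smooth_tac).
  split; (apply smooth_map_add; [exact OP|apply smooth_map_scal|apply smooth_map_scal]); try assumption.
  apply smooth_opp; assumption.
Qed.

(** The frame lives on the whole plane, also where the surface is singular, so that one and the same
    frame can be compared with objects on [Omega_k] and on the domain of any Amsler surface. *)
Record amsler_frame (k : R) (w : R -> R) (e1 e2 n : map3) : Prop := {
  af_profile : amsler_profile k w;
  af_e1 : smooth_map plane e1;
  af_e2 : smooth_map plane e2;
  af_n : smooth_map plane n;
  af_field : frame_field plane (om_of w) e1 e2 n
}.

Lemma amsler_frame_exists k w : amsler_profile k w -> exists e1 e2 n, amsler_frame k w e1 e2 n.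
Proof.
  intros H. destruct (frame_field_exists (om_of w) (smooth_om k w H)) as (e1 & e2 & n & S1 & S2 & S3 & F).
  - intros x y. apply (om_sine_gordon k w x y H).
  - exists e1, e2, n. split; assumption.
Qed.

Lemma amsler_frame_lin k w e1 e2 n o : orthogonal o -> amsler_frame k w e1 e2 n ->
  amsler_frame k w (fun x y => lin o (e1 x y)) (fun x y => lin o (e2 x y)) (fun x y => lin o (n x y)).
Proof.
  intros Ho [H S1 S2 S3 F]. pose proof open_plane. split; try (apply smooth_map_lin; assumption); [exact H|].
  apply frame_field_lin; assumption.
Qed.

Notation Pf w e1 e2 := (frP (om_of w) e1 e2).
Notation Qf w e1 e2 := (frQ (om_of w) e1 e2).

Lemma amsler_frame_PQ k w e1 e2 n : amsler_frame k w e1 e2 n -> forall x y,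
  has_du3 (Pf w e1 e2) x y (vscal (- (y * Derive w (x * y))) (vadd (vscal (sin (om_of w x y / 2)) (e1 x y)) (vscal (cos (om_of w x y / 2)) (e2 x y)))) /\
  has_dv3 (Pf w e1 e2) x y (vscal (sin (om_of w x y)) (n x y)) /\
  has_du3 (Qf w e1 e2) x y (vscal (sin (om_of w x y)) (n x y)) /\
  has_dv3 (Qf w e1 e2) x y (vscal (x * Derive w (x * y)) (vadd (vscal (- sin (om_of w x y / 2)) (e1 x y)) (vscal (cos (om_of w x y / 2)) (e2 x y)))).
Proof.
  intros [H S1 S2 S3 F] x y. destruct (om_partials k w x y H) as [D1 D2].
  pose proof (du_eq _ _ _ _ D1) as E1. pose proof (dv_eq _ _ _ _ D2) as E2.
  pose proof (frame_PQ_partials (om_of w) e1 e2 n x y) as K. rewrite E1, E2 in K.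
  apply K; [exact D1|exact D2|apply F; exact I].
Qed.

(** In the mixed derivatives the factors [1 / x] and [1 / y] cancel against [om_y = x w'] and
    [om_x = y w']. Both sides then carry the factor [w' (x y)], and [beta_compat] identifies what is
    left. *)
Lemma model_net_exists k w W r1 sg e1 e2 n : amsler_frame k w e1 e2 n -> 0 < k < PI -> W_solution k W -> first_cusp W r1 ->
  is_sign sg ->
  exists eta, smooth_map (Omega_k r1) eta /\ forall x y, Omega_k r1 x y ->
    has_du3 eta x y (vscal (beta sg (om_of w x y) / x) (Qf w e1 e2 x y)) /\
    has_dv3 eta x y (vscal (sg * beta sg (om_of w x y) / y) (Pf w e1 e2 x y)).
Proof.
  intros AF Hk HW Hc Hs. pose proof (af_profile _ _ _ _ _ AF) as H. pose proof (open_Omega r1) as OO.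
  assert (Rg : forall u v, Omega_k r1 u v -> 0 < om_of w u v < PI /\ 0 < Derive w (u * v) /\ omega W u v = om_of w u v)
    by (intros; apply (Omega_range k w W r1); assumption).
  assert (Som : smooth (Omega_k r1) (om_of w)) by (apply (smooth_sub plane); [intros; exact I|apply (smooth_om k), H]).
  destruct (smooth_PQ (om_of w) e1 e2 (smooth_om k w H) (af_e1 _ _ _ _ _ AF) (af_e2 _ _ _ _ _ AF)) as [SP SQ].
  apply (smooth_map_sub plane (Omega_k r1)) in SP; [|intros; exact I].
  apply (smooth_map_sub plane (Omega_k r1)) in SQ; [|intros; exact I].
  assert (Sb : smooth (Omega_k r1) (fun u v => beta sg (om_of w u v))).
  { apply smooth_beta; try assumption. intros u v Huv. apply Rg, Huv. }
  assert (Sx : smooth_map (Omega_k r1) (fun x y => vscal (beta sg (om_of w x y) / x) (Qf w e1 e2 x y))).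
  { apply smooth_map_scal; [exact OO| |exact SQ]. smooth_tac. intros u v (u0 & _). lra. }
  assert (Sy : smooth_map (Omega_k r1) (fun x y => vscal (sg * beta sg (om_of w x y) / y) (Pf w e1 e2 x y))).
  { apply smooth_map_scal; [exact OO| |exact SP]. smooth_tac. intros u v (_ & v0 & _). lra. }
  destruct (closed_map_exact_Omega r1 (fun x y => vscal (beta sg (om_of w x y) / x) (Qf w e1 e2 x y))
     (fun x y => vscal (sg * beta sg (om_of w x y) / y) (Pf w e1 e2 x y))) as (eta & De); try assumption.
  - destruct Hc as (r0 & _). exact r0.
  - intros x y Hxy. destruct (Rg x y Hxy) as (R1 & R2 & _). destruct Hxy as (x0 & y0 & _).
    destruct (om_partials k w x y H) as [Dx Dy]. destruct (amsler_frame_PQ _ _ _ _ _ AF x y) as (P1 & P2 & Q1 & Q2).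
    pose proof (beta_compat sg (om_of w x y) (e1 x y) (e2 x y) Hs R1) as BC.
    assert (V1 : is_derive (fun t => beta sg (om_of w x t) / x) y (/ x * (x * Derive w (x * y) * beta' sg (om_of w x y)))).
    { apply (is_derive_ext (fun t => / x * beta sg (om_of w x t))); [intros; unfold Rdiv; apply Rmult_comm|].
      apply (is_derive_scal (fun t => beta sg (om_of w x t))). apply (beta_derive sg (fun t => om_of w x t)); assumption. }
    assert (V2 : is_derive (fun t => sg * beta sg (om_of w t y) / y) x (sg / y * (y * Derive w (x * y) * beta' sg (om_of w x y)))).
    { apply (is_derive_ext (fun t => sg / y * beta sg (om_of w t y))); [intros t; match goal with |- ?a = ?b => change (@eq R a b) end; unfold Rdiv; ring|].
      apply (is_derive_scal (fun t => beta sg (om_of w t y))). apply (beta_derive sg (fun t => om_of w t y)); assumption. }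
    rewrite (pv_eq _ x y _ (vderiv_scal _ _ _ _ _ V1 Q2)).
    rewrite (pu_eq _ x y _ (vderiv_scal _ _ _ _ _ V2 P1)).
    unfold frP, frQ. cbv beta.
    set (p := om_of w x y) in *. set (d := Derive w (x * y)) in *.
    set (S := vadd (vscal (beta' sg p) (vadd (vscal (cos (p / 2)) (e1 x y)) (vscal (sin (p / 2)) (e2 x y))))
       (vscal (beta sg p) (vadd (vscal (- sin (p / 2)) (e1 x y)) (vscal (cos (p / 2)) (e2 x y))))) in *.
    transitivity (vscal d S).
    + unfold S. generalize (e1 x y), (e2 x y), (cos (p / 2)), (sin (p / 2)), (beta sg p), (beta' sg p). intros [[? ?] ?] [[? ?] ?] ? ? ? ?.
      vunf. f_equal; [f_equal|]; field; lra.
    + rewrite BC. generalize (e1 x y), (e2 x y), (cos (p / 2)), (sin (p / 2)), (beta sg p), (beta' sg p). intros [[? ?] ?] [[? ?] ?] ? ? ? ?.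
      vunf. f_equal; [f_equal|]; field; lra.
  - exists eta. split; [|exact De].
    apply (smooth_map_primitive _ _ _ _ OO Sx Sy De).
Qed.

Lemma net_second_derivatives (Om : dom) eta A B : open_dom Om ->
  (forall u v, Om u v -> has_du3 eta u v (A u v) /\ has_dv3 eta u v (B u v)) ->
  forall u v Au Av Bv, Om u v -> has_du3 A u v Au -> has_dv3 A u v Av -> has_dv3 B u v Bv ->
  pu eta u v = A u v /\ pv eta u v = B u v /\
  pu (pu eta) u v = Au /\ pv (pu eta) u v = Av /\ pv (pv eta) u v = Bv.
Proof.
  intros HO H u v Au Av Bv Huv D1 D2 D3.
  assert (E1 : forall x y, Om x y -> A x y = pu eta x y) by (intros x y Hxy; symmetry; apply pu_eq, H, Hxy).
  assert (E2 : forall x y, Om x y -> B x y = pv eta x y) by (intros x y Hxy; symmetry; apply pv_eq, H, Hxy).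
  split; [symmetry; apply E1, Huv|]. split; [symmetry; apply E2, Huv|].
  split; [|split].
  - apply pu_eq, (has_du3_ext Om A); assumption.
  - apply pv_eq, (has_dv3_ext Om A); assumption.
  - apply pv_eq, (has_dv3_ext Om B); assumption.
Qed.

Lemma amsler_potential_exists k w e1 e2 n : amsler_frame k w e1 e2 n ->
  exists Psi, smooth_map plane Psi /\ forall x y, has_du3 Psi x y (Pf w e1 e2 x y) /\ has_dv3 Psi x y (Qf w e1 e2 x y).
Proof.
  intros AF. pose proof (af_profile _ _ _ _ _ AF) as H. pose proof open_plane.
  destruct (smooth_PQ (om_of w) e1 e2 (smooth_om k w H) (af_e1 _ _ _ _ _ AF) (af_e2 _ _ _ _ _ AF)) as [SP SQ].
  destruct (closed_map_exact plane (Pf w e1 e2) (Qf w e1 e2)) as (Psi & SPsi & D); try assumption.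
  - intros x y s _ _. exact I.
  - intros x y _. destruct (amsler_frame_PQ _ _ _ _ _ AF x y) as (P1 & P2 & Q1 & Q2).
    rewrite (pv_eq _ _ _ _ P2), (pu_eq _ _ _ _ Q1). reflexivity.
  - exists Psi. split; [exact SPsi|]. intros; apply D; exact I.
Qed.

(** The unit normal may be [n] or [- n], so [fM] is known up to sign only; its square is what the
    Gaussian curvature involves. *)
Lemma amsler_potential_forms k w e1 e2 n Psi x y : amsler_frame k w e1 e2 n ->
  (forall x y, has_du3 Psi x y (Pf w e1 e2 x y) /\ has_dv3 Psi x y (Qf w e1 e2 x y)) ->
  sin (om_of w x y) <> 0 ->
  pu Psi x y = Pf w e1 e2 x y /\ pv Psi x y = Qf w e1 e2 x y /\
  cross (pu Psi x y) (pv Psi x y) <> vzero /\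
  fE Psi x y = 1 /\ fG Psi x y = 1 /\ fF Psi x y = cos (om_of w x y) /\ fL Psi x y = 0 /\ fN Psi x y = 0 /\
  fM Psi x y ^ 2 = sin (om_of w x y) ^ 2.
Proof.
  intros AF D s0. destruct (amsler_frame_PQ _ _ _ _ _ AF x y) as (P1 & P2 & Q1 & Q2).
  destruct (net_second_derivatives plane Psi (Pf w e1 e2) (Qf w e1 e2) open_plane (fun u v _ => D u v) x y _ _ _ I P1 P2 Q2)
    as (E1 & E2 & E3 & E4 & E5).
  pose proof (af_field _ _ _ _ _ AF x y I) as [On _].
  destruct (frame_PQ_gram (om_of w) e1 e2 n x y On) as (G1 & G2 & G3 & G4 & G5).
  destruct On as (Haa & Hbb & Hcc & Hab & Hac & Hbc).
  assert (Cr : cross (pu Psi x y) (pv Psi x y) <> vzero).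
  { apply cross_nonzero. rewrite E1, E2, G1, G2, G3. pose proof (sin_cos_sq (om_of w x y)). assert (0 < sin (om_of w x y) ^ 2) by (apply pow2_gt_0, s0). lra. }
  destruct (unit_normal_pm Psi x y (n x y)) as (tau & Ht & En); try assumption; [rewrite E1; exact G4|rewrite E2; exact G5|].
  unfold fE, fF, fG, fL, fM, fN. rewrite E3, E4, E5, En, E1, E2, !dot_vscal_r, !dot_vscal_l, !dot_comb2_orth, Hcc by assumption.
  split; [reflexivity|]. split; [reflexivity|]. split; [rewrite <- E1, <- E2; exact Cr|].
  repeat split; try assumption; try ring.
  replace ((tau * (sin (om_of w x y) * 1)) ^ 2) with (tau * tau * sin (om_of w x y) ^ 2) by ring. rewrite Ht. ring.
Qed.

(** An open domain containing both axes must reach into [x y < 0], where the monotonicity of the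
    profile says nothing; continuity of [w] at [0] provides the margin [z]. The rectangle property
    of [U] holds because scaling the coordinates by factors in [[0, 1]] moves [x y] towards [0]. *)
Lemma amsler_surface_exists k w W r1 e1 e2 n Psi : amsler_frame k w e1 e2 n -> 0 < k < PI -> W_solution k W -> first_cusp W r1 ->
  smooth_map plane Psi -> (forall x y, has_du3 Psi x y (Pf w e1 e2 x y) /\ has_dv3 Psi x y (Qf w e1 e2 x y)) ->
  exists U, Amsler_surface k U Psi /\ (forall x y, Omega_k r1 x y -> U x y) /\ (forall x y, U x y -> sin (om_of w x y) <> 0).
Proof.
  intros AF Hk HW Hc SPsi D. pose proof (af_profile _ _ _ _ _ AF) as H.
  assert (W0 : w 0 = k) by (destruct H as (_ & W0 & _); exact W0).
  assert (r0 : 0 < r1) by (destruct Hc as (r0 & _); exact r0).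
  assert (Z : exists z, 0 < z /\ forall t, - z < t < 0 -> 0 < w t < PI).
  { pose proof (profile_continuous k w H 0) as C. apply continuity_pt_filterlim in C.
    destruct (C (Rmin k (PI - k))) as (z & z0 & Hz); [apply Rmin_pos; lra|]. exists z. split; [exact z0|].
    intros t Ht. assert (A : Rabs (w t - w 0) < Rmin k (PI - k)).
    { apply (Hz t). split; [split; [exact I|lra]|]. simpl; unfold R_dist. rewrite Rminus_0_r, Rabs_left; lra. }
    rewrite W0 in A. pose proof (Rmin_l k (PI - k)). pose proof (Rmin_r k (PI - k)). apply Rabs_def2 in A. lra. }
  destruct Z as (z & z0 & Hz).
  set (U := fun x y => - z < x * y < r1 ^ 2 / 4).
  assert (r2 : 0 < r1 ^ 2 / 4) by nra.
  assert (RU : forall x y, U x y -> 0 < om_of w x y < PI).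
  { intros x y Hxy. unfold U in Hxy. unfold om_of. destruct (Rlt_dec (x * y) 0) as [L|L]; [apply Hz; lra|].
    apply (profile_below_PI k w (r1 ^ 2 / 4) H Hk); [|lra]. intros t Ht. apply (profile_first_cusp k w W r1 H Hk HW Hc); lra. }
  assert (sU : forall x y, U x y -> sin (om_of w x y) <> 0).
  { intros x y Hxy. apply Rgt_not_eq, sin_gt_0; apply RU, Hxy. }
  assert (OU : open_dom U).
  { intros x y Hxy. unfold U in *.
    assert (C : continuity_2d_pt (fun u v => u * v) x y) by (apply continuity_2d_pt_mult; [apply continuity_2d_pt_id1|apply continuity_2d_pt_id2]).
    assert (e0 : 0 < Rmin (x * y + z) (r1 ^ 2 / 4 - x * y)) by (apply Rmin_pos; lra).
    destruct (C (mkposreal _ e0)) as [d Hd]. exists d. intros p q Hp Hq. specialize (Hd p q Hp Hq). cbn [pos] in Hd.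
    pose proof (Rmin_l (x * y + z) (r1 ^ 2 / 4 - x * y)). pose proof (Rmin_r (x * y + z) (r1 ^ 2 / 4 - x * y)).
    apply Rabs_def2 in Hd. cbv beta in *. lra. }
  pose proof (fun x y Hxy => amsler_potential_forms k w e1 e2 n Psi x y AF D (sU x y Hxy)) as Fm.
  assert (U0 : forall t, U t 0 /\ U 0 t) by (intros t; unfold U; rewrite Rmult_0_r, Rmult_0_l; lra).
  (* On [y = 0] the factor [y w'] in [P_x] vanishes, so the tangent vector is constant and the axis
     is a straight line; on [x = 0] the same happens to [Q_y]. *)
  assert (axis1 : forall t, Psi t 0 = vadd (Psi 0 0) (vscal t (Pf w e1 e2 0 0))).
  { intros t.
    assert (PC : forall t, Pf w e1 e2 t 0 = Pf w e1 e2 0 0).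
    { intros s. apply vec_ext. intros i. apply (const_on_segment (fun t => co i (Pf w e1 e2 t 0))). intros c _.
      destruct (amsler_frame_PQ _ _ _ _ _ AF c 0) as (P1 & _). specialize (P1 i). rewrite Rmult_0_l, Ropp_0 in P1.
      rewrite co_vscal, Rmult_0_l in P1. exact P1. }
    apply vec_ext. intros i. rewrite co_vadd, co_vscal.
    assert (E : co i (Psi t 0) - t * co i (Pf w e1 e2 0 0) = co i (Psi 0 0) - 0 * co i (Pf w e1 e2 0 0)).
    { apply (const_on_segment (fun t => co i (Psi t 0) - t * co i (Pf w e1 e2 0 0))). intros c _.
      destruct (D c 0) as [D1 _]. specialize (D1 i). rewrite PC in D1. cbv beta in D1.
      evar_last; [apply (is_derive_minus (fun t => co i (Psi t 0)) (fun t => t * co i (Pf w e1 e2 0 0))); [exact D1|]|].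
      - apply (is_derive_mult (fun t => t) (fun _ => co i (Pf w e1 e2 0 0))); [apply (is_derive_id c)|apply (is_derive_const (co i (Pf w e1 e2 0 0)))|intros; apply Rmult_comm].
      - unfold minus, plus, opp, mult, one, zero; simpl. unfold mult; simpl. ring. }
    lra. }
  assert (axis2 : forall t, Psi 0 t = vadd (Psi 0 0) (vscal t (Qf w e1 e2 0 0))).
  { intros t.
    assert (PC : forall t, Qf w e1 e2 0 t = Qf w e1 e2 0 0).
    { intros s. apply vec_ext. intros i. apply (const_on_segment (fun t => co i (Qf w e1 e2 0 t))). intros c _.
      destruct (amsler_frame_PQ _ _ _ _ _ AF 0 c) as (_ & _ & _ & P1). specialize (P1 i). rewrite co_vscal, !Rmult_0_l in P1. exact P1. }
    apply vec_ext. intros i. rewrite co_vadd, co_vscal.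
    assert (E : co i (Psi 0 t) - t * co i (Qf w e1 e2 0 0) = co i (Psi 0 0) - 0 * co i (Qf w e1 e2 0 0)).
    { apply (const_on_segment (fun t => co i (Psi 0 t) - t * co i (Qf w e1 e2 0 0))). intros c _.
      destruct (D 0 c) as [_ D1]. specialize (D1 i). rewrite PC in D1. cbv beta in D1.
      evar_last; [apply (is_derive_minus (fun t => co i (Psi 0 t)) (fun t => t * co i (Qf w e1 e2 0 0))); [exact D1|]|].
      - apply (is_derive_mult (fun t => t) (fun _ => co i (Qf w e1 e2 0 0))); [apply (is_derive_id c)|apply (is_derive_const (co i (Qf w e1 e2 0 0)))|intros; apply Rmult_comm].
      - unfold minus, plus, opp, mult, one, zero; simpl. unfold mult; simpl. ring. }
    lra. }
  exists U. split; [|split; [|exact sU]].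
  - split; [exact U0|]. split; [|split; [|split]].
    + intros x y a b Hxy Ha Hb. unfold U in *. replace (a * x * (b * y)) with (a * b * (x * y)) by ring.
      assert (0 <= a * b <= 1) by nra. generalize dependent (a * b). intros c Hc'. generalize dependent (x * y). intros q Hq.
      destruct (Rle_dec 0 q); nra.
    + split.
      * split; [exact OU|]. split; [apply (smooth_map_sub plane); [intros; exact I|exact SPsi]|].
        intros x y Hxy. apply (Fm x y Hxy).
      * intros x y Hxy. destruct (Fm x y Hxy) as (_ & _ & _ & E1 & E2 & E3 & E4 & E5 & E6).
        unfold gauss_curvature. rewrite E1, E2, E3, E4, E5, E6. pose proof (sin_cos_sq (om_of w x y)).
        replace (1 * 1 - cos (om_of w x y) ^ 2) with (sin (om_of w x y) ^ 2) by lra. field. apply sU, Hxy.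
    + intros x y Hxy. destruct (Fm x y Hxy) as (_ & _ & _ & E1 & E2 & E3 & E4 & E5 & E6). auto.
    + exists (Pf w e1 e2 0 0), (Qf w e1 e2 0 0). split; [exact axis1|]. split; [exact axis2|].
      pose proof (af_field _ _ _ _ _ AF 0 0 I) as [On _].
      destruct (frame_PQ_gram (om_of w) e1 e2 n 0 0 On) as (_ & _ & G3 & _). rewrite G3. unfold om_of. rewrite Rmult_0_l, W0. reflexivity.
  - intros x y (x0 & y0 & Hxy). unfold U. nra.
Qed.

(* [sg = 1] is [eta_plus] and [sg = -1] is [eta_minus]. *)
Definition eta_sg (sg : R) (w : R -> R) (r1 lam eps : R) (eta : map3) : Prop :=
  immersed_net (Omega_k r1) eta /\
  forall u v, Omega_k r1 u v ->
    let om := om_of w u v in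
    let b := beta sg om in
    fE eta u v = b ^ 2 / u ^ 2 /\
    fF eta u v = sg * b ^ 2 * cos om / (u * v) /\
    fG eta u v = b ^ 2 / v ^ 2 /\
    fL eta u v = eps * (lam * b * sin om / u) /\
    fM eta u v = 0 /\
    fN eta u v = eps * (sg * b * sin om / (lam * v)).

Lemma beta_plus om : 0 < om < PI -> beta 1 om = / sin (om / 2) ^ 2.
Proof. intros H. assert (0 < sin (om / 2)) by (apply sin_gt_0; lra). unfold beta; rewrite (cos_half om); field; split; nra. Qed.

Lemma beta_minus om : 0 < om < PI -> beta (-1) om = / cos (om / 2) ^ 2.
Proof. intros H. assert (0 < cos (om / 2)) by (apply cos_gt_0; lra). unfold beta; rewrite (cos_half' om); field; split; nra. Qed.

(** Half-angle formulas: [csc^4 (om / 2) = beta^2] and [2 cot (om / 2) = beta sin om]. The analogous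
    identities with secant and tangent for [sg = -1] let both families be treated at once. *)
Lemma eta_plus_iff w W r1 lam eps eta : lam <> 0 ->
  (forall u v, Omega_k r1 u v -> 0 < om_of w u v < PI /\ omega W u v = om_of w u v) ->
  eta_plus W r1 lam eps eta <-> eta_sg 1 w r1 lam eps eta.
Proof.
  intros l0 R.
  assert (K : forall u v, Omega_k r1 u v -> let om := om_of w u v in
     csc (om / 2) ^ 4 = beta 1 om ^ 2 /\ 2 * cot (om / 2) = beta 1 om * sin om /\ u <> 0 /\ v <> 0).
  { intros u v Huv. destruct (R u v Huv) as [R1 _]. destruct Huv as (u0 & v0 & _). cbv zeta.
    rewrite (beta_plus _ R1), (sin_half (om_of w u v)).
    assert (0 < sin (om_of w u v / 2)) by (apply sin_gt_0; lra).
    unfold csc, cot. repeat split; try lra; field; lra. }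
  split; intros [Im Fm]; (split; [exact Im|]); intros u v Huv;
    destruct (K u v Huv) as (K1 & K2 & u0 & v0); destruct (R u v Huv) as [_ Eo]; specialize (Fm u v Huv); cbv zeta in *;
    rewrite Eo in *; rewrite ?K1, ?K2 in *; destruct Fm as (-> & -> & -> & -> & -> & ->);
    repeat split; field; auto.
Qed.

Lemma eta_minus_iff w W r1 lam eps eta : lam <> 0 ->
  (forall u v, Omega_k r1 u v -> 0 < om_of w u v < PI /\ omega W u v = om_of w u v) ->
  eta_minus W r1 lam eps eta <-> eta_sg (-1) w r1 lam eps eta.
Proof.
  intros l0 R.
  assert (K : forall u v, Omega_k r1 u v -> let om := om_of w u v in
     sec (om / 2) ^ 4 = beta (-1) om ^ 2 /\ 2 * tan (om / 2) = beta (-1) om * sin om /\ u <> 0 /\ v <> 0).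
  { intros u v Huv. destruct (R u v Huv) as [R1 _]. destruct Huv as (u0 & v0 & _). cbv zeta.
    rewrite (beta_minus _ R1), (sin_half (om_of w u v)).
    assert (0 < cos (om_of w u v / 2)) by (apply cos_gt_0; lra).
    unfold sec, tan. repeat split; try lra; field; lra. }
  split; intros [Im Fm]; (split; [exact Im|]); intros u v Huv;
    destruct (K u v Huv) as (K1 & K2 & u0 & v0); destruct (R u v Huv) as [_ Eo]; specialize (Fm u v Huv); cbv zeta in *;
    rewrite Eo in *; rewrite ?K1, ?K2 in *; destruct Fm as (-> & -> & -> & -> & -> & ->);
    repeat split; field; auto.
Qed.

Lemma eta_sg_curvatures sg w r1 lam eps eta u v : is_sign sg -> is_sign eps -> 0 < lam -> eta_sg sg w r1 lam eps eta ->
  Omega_k r1 u v -> 0 < om_of w u v < PI ->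
  gauss_curvature eta u v = sg * (u * v) / beta sg (om_of w u v) ^ 2 /\
  mean_curvature eta u v = eps * ((lam * u + sg * v / lam) / (2 * (beta sg (om_of w u v) * sin (om_of w u v)))).
Proof.
  intros Hs He l0 [_ Fm] Huv R. destruct (Fm u v Huv) as (E & F & G & L & M & N). destruct Huv as (u0 & v0 & _).
  pose proof (beta_pos sg _ Hs R) as b0. pose proof (sin_gt_0 _ (proj1 R) (proj2 R)) as s0.
  pose proof (sin_cos_sq (om_of w u v)) as sc. pose proof (is_sign_sq sg Hs) as ss. pose proof (is_sign_sq eps He) as ee.
  unfold gauss_curvature, mean_curvature. rewrite E, F, G, L, M, N.
  set (b := beta sg (om_of w u v)) in *. set (s := sin (om_of w u v)) in *. set (c := cos (om_of w u v)) in *.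
  assert (Den : b ^ 2 / u ^ 2 * (b ^ 2 / v ^ 2) - (sg * b ^ 2 * c / (u * v)) ^ 2 = b ^ 4 * s ^ 2 / (u ^ 2 * v ^ 2)).
  { replace (s ^ 2) with (1 - sg * sg * c ^ 2) by (rewrite ss; lra). field. lra. }
  rewrite Den. split.
  - replace (eps * (lam * b * s / u) * (eps * (sg * b * s / (lam * v))) - 0 ^ 2) with (eps * eps * (sg * b ^ 2 * s ^ 2 / (u * v))) by (field; lra).
    rewrite ee. field. lra.
  - field. lra.
Qed.

(* The net with K-surface coordinates [(lam u, v / lam)]. *)
Definition scaled_net (sg : R) (w : R -> R) (r1 lam : R) (e1 e2 eta : map3) : Prop :=
  forall u v, Omega_k r1 u v ->
    has_du3 eta u v (vscal (beta sg (om_of w u v) / u) (Qf w e1 e2 (lam * u) (v / lam))) /\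
    has_dv3 eta u v (vscal (sg * beta sg (om_of w u v) / v) (Pf w e1 e2 (lam * u) (v / lam))).

Lemma Omega_scale r1 lam u v : 0 < lam -> Omega_k r1 u v -> Omega_k r1 (lam * u) (v / lam).
Proof.
  intros l0 (u0 & v0 & H). unfold Omega_k. split; [nra|]. split; [apply Rdiv_lt_0_compat; lra|].
  replace (4 * (lam * u) * (v / lam)) with (4 * u * v) by (field; lra). exact H.
Qed.

Lemma om_scale w lam u v : 0 < lam -> om_of w (lam * u) (v / lam) = om_of w u v.
Proof. intros l0. unfold om_of. f_equal. field. lra. Qed.

Lemma vscal_vscal a b p : vscal a (vscal b p) = vscal (a * b) p.
Proof. vec_ring. Qed.

Lemma scaled_partials (F : map3) lam u v A B : has_du3 F (lam * u) (v / lam) A -> has_dv3 F (lam * u) (v / lam) B ->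
  has_du3 (fun u v => F (lam * u) (v / lam)) u v (vscal lam A) /\ has_dv3 (fun u v => F (lam * u) (v / lam)) u v (vscal (/ lam) B).
Proof.
  intros DA DB. split.
  - apply (vderiv_comp (fun x => F x (v / lam)) (fun u => lam * u)); [exact DA|]. auto_derive; [exact I|ring].
  - apply (vderiv_comp (fun y => F (lam * u) y) (fun v => v / lam)); [exact DB|]. unfold Rdiv. auto_derive; [exact I|ring].
Qed.

(** The coefficients [c] may stay unspecified: that the tangential parts of [eta_uu] and [eta_vv]
    are parallel to [eta_u] and [eta_v] already makes the coordinate lines geodesics. *)
Lemma scaled_net_second k w r1 sg lam e1 e2 n eta u v : amsler_frame k w e1 e2 n -> 0 < lam -> is_sign sg ->
  scaled_net sg w r1 lam e1 e2 eta -> Omega_k r1 u v -> 0 < om_of w u v < PI ->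
  let P := Pf w e1 e2 (lam * u) (v / lam) in let Q := Qf w e1 e2 (lam * u) (v / lam) in let m := n (lam * u) (v / lam) in
  let om := om_of w u v in let b := beta sg om in
  pu eta u v = vscal (b / u) Q /\ pv eta u v = vscal (sg * b / v) P /\
  (exists c, pu (pu eta) u v = vadd (vscal c Q) (vscal (lam * b * sin om / u) m)) /\
  dot (pv (pu eta) u v) m = 0 /\
  (exists c, pv (pv eta) u v = vadd (vscal c P) (vscal (sg * b * sin om / (lam * v)) m)).
Proof.
  intros AF l0 Hs SN Huv R P Q m om b. pose proof (af_profile _ _ _ _ _ AF) as H.
  destruct (amsler_frame_PQ _ _ _ _ _ AF (lam * u) (v / lam)) as (P1 & P2 & Q1 & Q2).
  destruct (scaled_partials _ _ _ _ _ _ P1 P2) as [DP1 DP2]. destruct (scaled_partials _ _ _ _ _ _ Q1 Q2) as [DQ1 DQ2].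
  destruct (om_partials k w u v H) as [Du Dv].
  pose proof (beta_derive sg (fun t => om_of w t v) u _ Hs R Du) as Bu.
  pose proof (beta_derive sg (fun t => om_of w u t) v _ Hs R Dv) as Bv.
  assert (u0 : 0 < u) by (destruct Huv; lra). assert (v0 : 0 < v) by (destruct Huv as (_ & v0 & _); exact v0).
  assert (C1 : exists c, is_derive (fun t => beta sg (om_of w t v) / t) u c).
  { eexists. apply (is_derive_div (fun t => beta sg (om_of w t v)) (fun t => t)); [exact Bu|apply (is_derive_id u)|lra]. }
  assert (C2 : exists c, is_derive (fun t => beta sg (om_of w u t) / u) v c).
  { eexists. apply (is_derive_div (fun t => beta sg (om_of w u t)) (fun _ => u)); [exact Bv|apply (is_derive_const u)|lra]. }
  assert (C3 : exists c, is_derive (fun t => sg * beta sg (om_of w u t) / t) v c).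
  { eexists. apply (is_derive_div (fun t => sg * beta sg (om_of w u t)) (fun t => t)); [apply (is_derive_scal (fun t => beta sg (om_of w u t))), Bv|apply (is_derive_id v)|lra]. }
  destruct C1 as [c1 C1], C2 as [c2 C2], C3 as [c3 C3].
  destruct (net_second_derivatives (Omega_k r1) eta _ _ (open_Omega r1) SN u v _ _ _ Huv
     (vderiv_scal _ _ _ _ _ C1 DQ1) (vderiv_scal _ _ _ _ _ C2 DQ2) (vderiv_scal _ _ _ _ _ C3 DP2)) as (E1 & E2 & E3 & E4 & E5).
  rewrite om_scale in * by exact l0. cbv beta in *.
  fold P in E2, E5. fold Q in E1, E3, E4. fold m in E3, E5. fold om in E1, E2, E3, E4, E5. fold b in E1, E2, E3, E4, E5.
  split; [exact E1|]. split; [exact E2|]. split; [|split].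
  - exists c1. rewrite E3. f_equal. rewrite !vscal_vscal. f_equal. field. lra.
  - rewrite E4. pose proof (af_field _ _ _ _ _ AF (lam * u) (v / lam) I) as [On _].
    destruct (frame_PQ_gram (om_of w) e1 e2 n _ _ On) as (_ & _ & _ & _ & G5). fold Q m in G5.
    destruct On as (_ & _ & _ & _ & Hac & Hbc). fold m in Hac, Hbc.
    rewrite dot_vadd_l, !dot_vscal_l, G5, dot_vadd_l, !dot_vscal_l, Hac, Hbc. ring.
  - exists c3. rewrite E5. f_equal. rewrite !vscal_vscal. f_equal. field. lra.
Qed.

Lemma scaled_net_forms k w r1 sg lam e1 e2 n eta u v : amsler_frame k w e1 e2 n -> 0 < lam -> is_sign sg ->
  scaled_net sg w r1 lam e1 e2 eta -> Omega_k r1 u v -> 0 < om_of w u v < PI ->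
  let om := om_of w u v in let b := beta sg om in
  let d := dot (cross (pu eta u v) (pv eta u v)) (n (lam * u) (v / lam)) in
  let tau := / Rabs d * d in
  cross (pu eta u v) (pv eta u v) <> vzero /\
  unit_normal eta u v = vscal tau (n (lam * u) (v / lam)) /\ d <> 0 /\
  fE eta u v = b ^ 2 / u ^ 2 /\
  fF eta u v = sg * b ^ 2 * cos om / (u * v) /\
  fG eta u v = b ^ 2 / v ^ 2 /\
  fL eta u v = tau * (lam * b * sin om / u) /\
  fM eta u v = 0 /\
  fN eta u v = tau * (sg * b * sin om / (lam * v)).
Proof.
  intros AF l0 Hs SN Huv R om b d tau.
  destruct (scaled_net_second k w r1 sg lam e1 e2 n eta u v AF l0 Hs SN Huv R) as (E1 & E2 & (c & E3) & E4 & (c' & E5)).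
  fold om b in E1, E2, E3, E5.
  pose proof (af_field _ _ _ _ _ AF (lam * u) (v / lam) I) as [On _].
  destruct (frame_PQ_gram (om_of w) e1 e2 n _ _ On) as (G1 & G2 & G3 & G4 & G5).
  rewrite (om_scale w lam u v l0) in G3. fold om in G3, R.
  destruct On as (_ & _ & Hcc & _).
  set (P := Pf w e1 e2 (lam * u) (v / lam)) in *. set (Q := Qf w e1 e2 (lam * u) (v / lam)) in *. set (m := n (lam * u) (v / lam)) in *.
  assert (u0 : 0 < u) by (destruct Huv; lra). assert (v0 : 0 < v) by (destruct Huv as (_ & v0 & _); exact v0).
  pose proof (beta_pos sg om Hs R) as b0. fold b in b0. pose proof (sin_gt_0 _ (proj1 R) (proj2 R)) as s0. pose proof (sin_cos_sq om) as sc.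
  pose proof (is_sign_sq sg Hs) as ss.
  assert (FE : fE eta u v = b ^ 2 / u ^ 2).
  { unfold fE. rewrite E1, dot_vscal_l, dot_vscal_r, G2. field. lra. }
  assert (FF : fF eta u v = sg * b ^ 2 * cos om / (u * v)).
  { unfold fF. rewrite E1, E2, dot_vscal_l, dot_vscal_r, dot_comm, G3. field. lra. }
  assert (FG : fG eta u v = b ^ 2 / v ^ 2).
  { unfold fG. rewrite E2, dot_vscal_l, dot_vscal_r, G1. replace (sg * b / v * (sg * b / v * 1)) with (sg * sg * b ^ 2 / v ^ 2) by (field; lra). rewrite ss. field; lra. }
  assert (Cr : cross (pu eta u v) (pv eta u v) <> vzero).
  { apply cross_nonzero. fold (fE eta u v) (fG eta u v) (fF eta u v). rewrite FE, FF, FG.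
    replace (b ^ 2 / u ^ 2 * (b ^ 2 / v ^ 2) - (sg * b ^ 2 * cos om / (u * v)) ^ 2) with (b ^ 4 * (1 - sg * sg * cos om ^ 2) / (u ^ 2 * v ^ 2)) by (field; lra).
    rewrite ss. apply Rdiv_lt_0_compat; [apply Rmult_lt_0_compat; [apply pow_lt, b0|nra]|]. apply Rmult_lt_0_compat; apply pow_lt; assumption. }
  destruct (unit_normal_sign eta u v m Hcc) as [d0 En]; try assumption; [rewrite E1, dot_vscal_l, G5; ring|rewrite E2, dot_vscal_l, G4; ring|].
  fold d in d0, En. fold tau in En.
  split; [exact Cr|]. split; [exact En|]. split; [exact d0|]. split; [exact FE|]. split; [exact FF|]. split; [exact FG|].
  unfold fL, fM, fN. rewrite En, !dot_vscal_r, E3, E4, E5, !dot_vadd_l, !dot_vscal_l, G4, G5, Hcc.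
  split; [ring|]. split; ring.
Qed.

Lemma vderiv_cross F G t D E : vderiv F t D -> vderiv G t E ->
  vderiv (fun t => cross (F t) (G t)) t (vadd (cross D (G t)) (cross (F t) E)).
Proof.
  intros HF HG.
  assert (M : forall i j, is_derive (fun t => co i (F t) * co j (G t) - co j (F t) * co i (G t)) t
     (co i D * co j (G t) + co i (F t) * co j E - (co j D * co i (G t) + co j (F t) * co i E))).
  { intros i j. apply (is_derive_minus (fun t => co i (F t) * co j (G t)) (fun t => co j (F t) * co i (G t)));
    apply (is_derive_mult (fun t => co _ (F t)) (fun t => co _ (G t))); first [apply HF|apply HG|intros; apply Rmult_comm]. }
  intros [| |].
  - evar_last; [apply (M ax2 ax3)|]. unfold co, vadd, cross, cx, cy, cz. cbn [fst snd]. ring.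
  - evar_last; [apply (M ax3 ax1)|]. unfold co, vadd, cross, cx, cy, cz. cbn [fst snd]. ring.
  - evar_last; [apply (M ax1 ax2)|]. unfold co, vadd, cross, cx, cy, cz. cbn [fst snd]. ring.
Qed.

(** The handedness of a frame is constant on the plane, and the central inversion reverses it.
    Choosing it fixes the sign of the second form in the existence statement. *)
Lemma amsler_frame_oriented k w dl : amsler_profile k w -> is_sign dl ->
  exists e1 e2 n, amsler_frame k w e1 e2 n /\ forall x y, dot (cross (e1 x y) (e2 x y)) (n x y) = dl.
Proof.
  intros H Hd. destruct (amsler_frame_exists k w H) as (e1 & e2 & n & AF).
  assert (C : forall x y, dot (cross (e1 x y) (e2 x y)) (n x y) = dot (cross (e1 0 0) (e2 0 0)) (n 0 0)).
  { apply (plane_const (fun x y => dot (cross (e1 x y) (e2 x y)) (n x y))). intros x y.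
    destruct (af_field _ _ _ _ _ AF x y I) as (On & (A1 & A2 & A3) & (B1 & B2 & B3)).
    split.
    - evar_last; [apply (vderiv_dot _ _ _ _ _ (vderiv_cross _ _ _ _ _ A1 A2) A3)|]. cbv beta.
      generalize (e1 x y), (e2 x y), (n x y). intros [[? ?] ?] [[? ?] ?] [[? ?] ?]. vunf. ring.
    - evar_last; [apply (vderiv_dot _ _ _ _ _ (vderiv_cross _ _ _ _ _ B1 B2) B3)|]. cbv beta.
      generalize (e1 x y), (e2 x y), (n x y). intros [[? ?] ?] [[? ?] ?] [[? ?] ?]. vunf. ring. }
  assert (S0 : is_sign (dot (cross (e1 0 0) (e2 0 0)) (n 0 0))).
  { destruct (af_field _ _ _ _ _ AF 0 0 I) as ((Haa & Hbb & Hcc & Hab & Hac & Hbc) & _).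
    pose proof (cross_along_normal _ _ _ Hcc Hac Hbc) as E. set (d := dot (cross (e1 0 0) (e2 0 0)) (n 0 0)) in *.
    pose proof (lagrange_identity (e1 0 0) (e2 0 0)) as L. rewrite E, Haa, Hbb, Hab, dot_vscal_l, dot_vscal_r, Hcc in L.
    assert (Z : (d - 1) * (d + 1) = 0) by lra. apply Rmult_integral in Z. unfold is_sign. destruct Z; [left|right]; lra. }
  assert (Dec : dot (cross (e1 0 0) (e2 0 0)) (n 0 0) = dl \/ dot (cross (e1 0 0) (e2 0 0)) (n 0 0) = - dl).
  { unfold is_sign in *. destruct S0 as [-> | ->], Hd as [-> | ->]; lra. }
  destruct Dec as [E|E].
  - exists e1, e2, n. split; [exact AF|]. intros x y. rewrite C. exact E.
  - set (o := ((-1, 0, 0), (0, -1, 0), (0, 0, -1)) : vec * vec * vec).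
    assert (Ho : orthogonal o) by (unfold orthogonal, o, onb, dot, cx, cy, cz; cbn [fst snd]; repeat split; ring).
    exists (fun x y => lin o (e1 x y)), (fun x y => lin o (e2 x y)), (fun x y => lin o (n x y)).
    split; [apply amsler_frame_lin; assumption|]. intros x y.
    replace dl with (- dot (cross (e1 x y) (e2 x y)) (n x y)) by (rewrite C, E; ring).
    unfold o, lin. generalize (e1 x y), (e2 x y), (n x y). intros [[? ?] ?] [[? ?] ?] [[? ?] ?]. vunf. ring.
Qed.

Lemma model_scaled_net k w W r1 sg lam e1 e2 n : amsler_frame k w e1 e2 n -> 0 < k < PI -> W_solution k W -> first_cusp W r1 ->
  is_sign sg -> 0 < lam -> exists eta, smooth_map (Omega_k r1) eta /\ scaled_net sg w r1 lam e1 e2 eta.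
Proof.
  intros AF Hk HW Hc Hs l0. destruct (model_net_exists k w W r1 sg e1 e2 n AF Hk HW Hc Hs) as (eta & Se & De).
  pose proof (open_Omega r1) as OO.
  exists (fun u v => eta (lam * u) (v / lam)). split.
  - apply (smooth_map_comp2 (Omega_k r1) (Omega_k r1) eta (fun u _ => lam * u) (fun _ v => v / lam)); try assumption.
    + smooth_tac.
    + unfold Rdiv. smooth_tac.
    + intros u v. apply Omega_scale, l0.
  - intros u v Huv. destruct (De _ _ (Omega_scale r1 lam u v l0 Huv)) as [D1 D2].
    destruct (scaled_partials _ _ _ _ _ _ D1 D2) as [S1 S2]. rewrite om_scale, vscal_vscal in S1, S2 by exact l0.
    destruct Huv as (u0 & v0 & _). split; (eapply vderiv_eq; [|first [exact S1|exact S2]]); f_equal; field; lra.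
Qed.

Lemma eta_sg_exists k w W r1 sg lam : amsler_profile k w -> 0 < k < PI -> W_solution k W -> first_cusp W r1 ->
  is_sign sg -> 0 < lam -> exists eta, eta_sg sg w r1 lam 1 eta.
Proof.
  intros H Hk HW Hc Hs l0.
  (* [eta_u x eta_v] is a positive multiple of [sg Q x P], and [Q x P] is a negative multiple of
     [e1 x e2]; the handedness [- sg] therefore makes the unit normal equal to [n]. *)
  destruct (amsler_frame_oriented k w (- sg) H) as (e1 & e2 & n & AF & Or); [unfold is_sign in *; lra|].
  destruct (model_scaled_net k w W r1 sg lam e1 e2 n AF Hk HW Hc Hs l0) as (eta & Se & SN).
  exists eta.
  assert (Rg : forall u v, Omega_k r1 u v -> 0 < om_of w u v < PI) by (intros u v Huv; apply (Omega_range k w W r1 u v H Hk HW Hc Huv)).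
  split.
  - split; [apply open_Omega|]. split; [exact Se|]. intros u v Huv.
    apply (scaled_net_forms k w r1 sg lam e1 e2 n eta u v AF l0 Hs SN Huv (Rg u v Huv)).
  - intros u v Huv. destruct (scaled_net_forms k w r1 sg lam e1 e2 n eta u v AF l0 Hs SN Huv (Rg u v Huv)) as (_ & _ & d0 & E & F & G & L & M & N).
    destruct (scaled_net_second k w r1 sg lam e1 e2 n eta u v AF l0 Hs SN Huv (Rg u v Huv)) as (E1 & E2 & _).
    set (d := dot (cross (pu eta u v) (pv eta u v)) (n (lam * u) (v / lam))) in *.
    assert (dp : 0 < d).
    { unfold d. rewrite E1, E2. specialize (Or (lam * u) (v / lam)). unfold frP, frQ. rewrite (om_scale w lam u v l0).
      pose proof (Rg u v Huv) as R. pose proof (beta_pos sg _ Hs R) as b0. pose proof (is_sign_sq sg Hs) as ss.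
      pose proof (sin_gt_0 _ (proj1 R) (proj2 R)) as s0. rewrite (sin_half (om_of w u v)) in s0. destruct Huv as (u0 & v0 & _).
      set (b := beta sg (om_of w u v)) in *. set (s := sin (om_of w u v / 2)) in *. set (c := cos (om_of w u v / 2)) in *.
      replace (dot (cross (vscal (b / u) (vadd (vscal c (e1 (lam * u) (v / lam))) (vscal s (e2 (lam * u) (v / lam)))))
        (vscal (sg * b / v) (vadd (vscal c (e1 (lam * u) (v / lam))) (vscal (- s) (e2 (lam * u) (v / lam)))))) (n (lam * u) (v / lam)))
        with (- (b / u * (sg * b / v) * (2 * s * c)) * dot (cross (e1 (lam * u) (v / lam)) (e2 (lam * u) (v / lam))) (n (lam * u) (v / lam))).
      - rewrite Or. replace (- (b / u * (sg * b / v) * (2 * s * c)) * - sg) with (sg * sg * (b ^ 2 / (u * v)) * (2 * s * c)) by (field; lra).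
        rewrite ss, Rmult_1_l. apply Rmult_lt_0_compat; [apply Rdiv_lt_0_compat; nra|exact s0].
      - generalize (e1 (lam * u) (v / lam)), (e2 (lam * u) (v / lam)), (n (lam * u) (v / lam)). intros [[? ?] ?] [[? ?] ?] [[? ?] ?]. vunf. ring. }
    rewrite Rabs_right, Rinv_l in L, N by lra. cbv zeta. repeat split; assumption.
Qed.

(** For [sg = 1] and [sg = -1] this is convertible to the positive and the negative notion of the
    statement. *)
Definition second_kind (sg k : R) (Om : dom) (eta : map3) : Prop :=
  V_net Om eta /\
  exists (psi : map3) (E1 E3 : field) (phi1 phi2 : R -> R -> R),
    K_surface_of Om eta psi E1 E3 /\ Amsler_piece k Om psi phi1 phi2 /\
    canonical_frame Om phi1 phi2 E1 E3 /\ alignment sg Om eta psi E1 E3.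

(** [a] and [b] solve the Gram system of [X] and [Y]; the difference [z] is then orthogonal to [X],
    [Y] and [n], hence zero. *)
Lemma tangent_span X Y n v : dot n n = 1 -> dot X n = 0 -> dot Y n = 0 -> cross X Y <> vzero -> dot v n = 0 ->
  exists a b, v = vadd (vscal a X) (vscal b Y).
Proof.
  intros Hn HX HY HC Hv. pose proof (cross_nonzero_iff _ _ HC) as g0.
  set (g := dot X X * dot Y Y - dot X Y ^ 2) in *.
  set (a := (dot v X * dot Y Y - dot v Y * dot X Y) / g). set (b := (dot v Y * dot X X - dot v X * dot X Y) / g).
  exists a, b. set (z := vadd v (vscal (-1) (vadd (vscal a X) (vscal b Y)))).
  assert (zX : dot z X = 0).
  { unfold z. rewrite dot_vadd_l, dot_vscal_l, dot_vadd_l, !dot_vscal_l, (dot_comm Y X).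
    assert (a * dot X X + b * dot X Y = dot v X) by (unfold a, b, g; field; fold g; lra). lra. }
  assert (zY : dot z Y = 0).
  { unfold z. rewrite dot_vadd_l, dot_vscal_l, dot_vadd_l, !dot_vscal_l.
    assert (a * dot X Y + b * dot Y Y = dot v Y) by (unfold a, b, g; field; fold g; lra). lra. }
  assert (zn : dot z n = 0).
  { unfold z. rewrite dot_vadd_l, dot_vscal_l, dot_vadd_l, !dot_vscal_l, Hv, HX, HY. ring. }
  assert (d0 : dot (cross X Y) n <> 0).
  { intros Z. apply HC. rewrite (cross_along_normal X Y n Hn HX HY), Z. vec_ring. }
  assert (E : vscal (dot (cross X Y) n) z = vzero).
  { transitivity (vadd (vadd (vscal (dot z X) (cross Y n)) (vscal (dot z Y) (cross n X))) (vscal (dot z n) (cross X Y))).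
    - clear. vec_ring.
    - rewrite zX, zY, zn. clear. vec_ring. }
  assert (z = vzero).
  { transitivity (vscal (/ dot (cross X Y) n) (vscal (dot (cross X Y) n) z)).
    - rewrite vscal_vscal, Rinv_l by exact d0. clear. vec_ring.
    - rewrite E. clear. vec_ring. }
  transitivity (vadd z (vadd (vscal a X) (vscal b Y))).
  - unfold z. clear. vec_ring.
  - rewrite H. clear. vec_ring.
Qed.

(** The K-surface of the net is the Amsler surface in the coordinates [(lam u, v / lam)]. Its
    tangents [P] and [Q] are crossed with respect to the net: [eta_u] is parallel to [psi_v] and
    [eta_v] to [psi_u]. *)
Lemma scaled_net_second_kind k w W r1 sg lam e1 e2 n eta : amsler_frame k w e1 e2 n -> 0 < k < PI -> W_solution k W -> first_cusp W r1 ->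
  is_sign sg -> 0 < lam -> smooth_map (Omega_k r1) eta -> scaled_net sg w r1 lam e1 e2 eta -> second_kind sg k (Omega_k r1) eta.
Proof.
  intros AF Hk HW Hc Hs l0 Se SN. pose proof (af_profile _ _ _ _ _ AF) as H. pose proof (open_Omega r1) as OO.
  assert (Rg : forall u v, Omega_k r1 u v -> 0 < om_of w u v < PI) by (intros u v Huv; apply (Omega_range k w W r1 u v H Hk HW Hc Huv)).
  pose proof (fun u v Huv => scaled_net_second k w r1 sg lam e1 e2 n eta u v AF l0 Hs SN Huv (Rg u v Huv)) as Sec.
  pose proof (fun u v Huv => scaled_net_forms k w r1 sg lam e1 e2 n eta u v AF l0 Hs SN Huv (Rg u v Huv)) as Fm.
  cbv zeta in Sec, Fm.
  destruct (amsler_potential_exists k w e1 e2 n AF) as (Psi & SPsi & DPsi).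
  destruct (amsler_surface_exists k w W r1 e1 e2 n Psi AF Hk HW Hc SPsi DPsi) as (U & AU & OU & sU).
  set (psi := fun u v => Psi (lam * u) (v / lam)).
  assert (S1 : smooth (Omega_k r1) (fun u _ => lam * u)) by smooth_tac.
  assert (S2 : smooth (Omega_k r1) (fun _ v => v / lam)) by (unfold Rdiv; smooth_tac).
  assert (Spsi : smooth_map (Omega_k r1) psi).
  { apply (smooth_map_comp2 (Omega_k r1) plane Psi (fun u _ => lam * u) (fun _ v => v / lam)); try assumption; [apply open_plane|intros; exact I]. }
  assert (Dpsi : forall u v, has_du3 psi u v (vscal lam (Pf w e1 e2 (lam * u) (v / lam))) /\ has_dv3 psi u v (vscal (/ lam) (Qf w e1 e2 (lam * u) (v / lam)))).
  { intros u v. apply scaled_partials; apply DPsi. }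
  assert (Gm : forall u v, Omega_k r1 u v ->
     dot (Pf w e1 e2 (lam * u) (v / lam)) (Pf w e1 e2 (lam * u) (v / lam)) = 1 /\ dot (Qf w e1 e2 (lam * u) (v / lam)) (Qf w e1 e2 (lam * u) (v / lam)) = 1 /\
     dot (Pf w e1 e2 (lam * u) (v / lam)) (Qf w e1 e2 (lam * u) (v / lam)) = cos (om_of w u v) /\
     dot (Pf w e1 e2 (lam * u) (v / lam)) (n (lam * u) (v / lam)) = 0 /\ dot (Qf w e1 e2 (lam * u) (v / lam)) (n (lam * u) (v / lam)) = 0 /\
     dot (n (lam * u) (v / lam)) (n (lam * u) (v / lam)) = 1).
  { intros u v Huv. destruct (af_field _ _ _ _ _ AF (lam * u) (v / lam) I) as [On _].
    destruct (frame_PQ_gram (om_of w) e1 e2 n _ _ On) as (G1 & G2 & G3 & G4 & G5). rewrite om_scale in G3 by exact l0.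
    destruct On as (_ & _ & Hcc & _). auto 10. }
  assert (Pform : forall u v, Omega_k r1 u v -> pu psi u v = vscal lam (Pf w e1 e2 (lam * u) (v / lam)) /\ pv psi u v = vscal (/ lam) (Qf w e1 e2 (lam * u) (v / lam)) /\
     cross (pu psi u v) (pv psi u v) <> vzero /\ fL psi u v = 0 /\ fN psi u v = 0 /\ gauss_curvature psi u v = -1).
  { intros u v Huv. destruct (Gm u v Huv) as (G1 & G2 & G3 & G4 & G5 & Hcc).
    destruct (amsler_frame_PQ _ _ _ _ _ AF (lam * u) (v / lam)) as (P1 & P2 & Q1 & Q2).
    destruct (scaled_partials _ _ _ _ _ _ P1 P2) as [DP1 DP2]. destruct (scaled_partials _ _ _ _ _ _ Q1 Q2) as [DQ1 DQ2].
    destruct (net_second_derivatives (Omega_k r1) psi _ _ OO (fun u v _ => Dpsi u v) u v _ _ _ Huv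
      (vderiv_scal_const lam _ _ _ DP1) (vderiv_scal_const lam _ _ _ DP2) (vderiv_scal_const (/ lam) _ _ _ DQ2)) as (E1 & E2 & E3 & E4 & E5).
    pose proof (Rg u v Huv) as R. pose proof (sin_gt_0 _ (proj1 R) (proj2 R)) as s0. pose proof (sin_cos_sq (om_of w u v)) as sc.
    assert (Cr : cross (pu psi u v) (pv psi u v) <> vzero).
    { apply cross_nonzero. rewrite E1, E2, !dot_vscal_l, !dot_vscal_r, G1, G2, G3.
      replace (lam * (lam * 1) * (/ lam * (/ lam * 1)) - (lam * (/ lam * cos (om_of w u v))) ^ 2) with (1 - cos (om_of w u v) ^ 2) by (field; lra).
      assert (0 < sin (om_of w u v) ^ 2) by (apply pow_lt, s0). lra. }
    destruct (unit_normal_pm psi u v (n (lam * u) (v / lam))) as (tau & Ht & En); try assumption; [rewrite E1, dot_vscal_l, G4; ring|rewrite E2, dot_vscal_l, G5; ring|].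
    pose proof (af_field _ _ _ _ _ AF (lam * u) (v / lam) I) as [(_ & _ & _ & _ & Hac & Hbc) _].
    assert (L0 : fL psi u v = 0).
    { unfold fL. rewrite En, E3, dot_vscal_r, !dot_vscal_l, dot_comb2_orth by assumption. ring. }
    assert (N0 : fN psi u v = 0).
    { unfold fN. rewrite En, E5, dot_vscal_r, !dot_vscal_l, dot_comb2_orth by assumption. ring. }
    split; [exact E1|]. split; [exact E2|]. split; [exact Cr|]. split; [exact L0|]. split; [exact N0|].
    unfold gauss_curvature. rewrite L0, N0. unfold fE, fF, fG, fM. rewrite En, E1, E2, E4, !dot_vscal_r, !dot_vscal_l, G1, G2, G3, Hcc, om_scale by exact l0.
    replace (lam * (lam * 1) * (/ lam * (/ lam * 1)) - (/ lam * (lam * cos (om_of w u v))) ^ 2) with (sin (om_of w u v) ^ 2) by (replace (sin (om_of w u v) ^ 2) with (1 - cos (om_of w u v) ^ 2) by lra; field; lra).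
    replace (0 * 0 - (tau * (lam * (/ lam * (sin (om_of w u v) * 1)))) ^ 2) with (- (tau * tau * sin (om_of w u v) ^ 2)) by (field; lra).
    rewrite Ht. field. lra. }
  split.
  - split.
    + split; [exact OO|]. split; [exact Se|]. intros u v Huv. apply (Fm u v Huv).
    + intros u v Huv. destruct (Fm u v Huv) as (Cr & En & d0 & FE & FF & FG & FL & FM & FN).
      destruct (Sec u v Huv) as (E1 & E2 & (c & E3) & E4 & (c' & E5)). destruct (Gm u v Huv) as (G1 & G2 & G3 & G4 & G5 & Hcc).
      pose proof (Rg u v Huv) as R. pose proof (sin_gt_0 _ (proj1 R) (proj2 R)) as s0. pose proof (sin_cos_sq (om_of w u v)) as sc.
      pose proof (beta_pos sg _ Hs R) as b0. pose proof (is_sign_sq sg Hs) as ss. destruct (Huv) as (u0 & v0 & _).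
      split; [|split; [|split]].
      * unfold gauss_curvature. pose proof (cross_nonzero_iff _ _ Cr) as g0. fold (fE eta u v) (fG eta u v) (fF eta u v) in g0.
        rewrite FL, FM, FN. set (d := dot (cross (pu eta u v) (pv eta u v)) (n (lam * u) (v / lam))) in *.
        pose proof (sign_sq d d0) as dd. set (tau := / Rabs d * d) in *. set (b := beta sg (om_of w u v)) in *. set (s := sin (om_of w u v)) in *.
        replace (tau * (lam * b * s / u) * (tau * (sg * b * s / (lam * v))) - 0 ^ 2) with (tau * tau * sg * (b ^ 2 * s ^ 2 / (u * v))) by (field; lra).
        rewrite dd, Rmult_1_l. assert (0 < b ^ 2 * s ^ 2 / (u * v)) by (apply Rdiv_lt_0_compat; [apply Rmult_lt_0_compat; apply pow_lt; assumption|apply Rmult_lt_0_compat; assumption]).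
        unfold Rdiv at 1. apply Rmult_integral_contrapositive_currified; [apply Rmult_integral_contrapositive_currified|apply Rinv_neq_0_compat]; try lra.
        intros Z. rewrite Z in ss. lra.
      * apply (tangent_span (pu eta u v) (pv eta u v) (n (lam * u) (v / lam))); try assumption; [rewrite E1, dot_vscal_l, G5; ring|rewrite E2, dot_vscal_l, G4; ring].
      * unfold geodesic_curvature_u. rewrite En, E3, E1. unfold Rdiv at 1.
        replace (dot _ _) with 0; [ring|]. generalize (Qf w e1 e2 (lam * u) (v / lam)), (n (lam * u) (v / lam)). clear. intros. vec_ring.
      * unfold geodesic_curvature_v. rewrite En, E5, E2. unfold Rdiv at 1.
        replace (dot _ _) with 0; [ring|]. generalize (Pf w e1 e2 (lam * u) (v / lam)), (n (lam * u) (v / lam)). clear. intros. vec_ring.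
  - set (E1 := (fun _ _ => (/ lam, 0)) : field). set (E3 := (fun _ _ => (0, lam)) : field).
    set (th1 := (fun _ _ => (lam, 0)) : field). set (th3 := (fun _ _ => (0, / lam)) : field).
    exists psi, E1, E3, (fun u _ => lam * u), (fun _ v => v / lam).
    assert (smooth_fields : forall a b, smooth_field (Omega_k r1) (fun _ _ => (a, b))) by (intros a b; split; apply smooth_const; exact OO).
    assert (dE1 : forall u v, Omega_k r1 u v -> diff psi u v (E1 u v) = Pf w e1 e2 (lam * u) (v / lam)).
    { intros u v Huv. destruct (Pform u v Huv) as (P1 & P2 & _). unfold diff, E1. cbn [fst snd]. rewrite P1, P2, vscal_vscal, Rinv_l by lra.
      generalize (Pf w e1 e2 (lam * u) (v / lam)), (Qf w e1 e2 (lam * u) (v / lam)). intros. vec_ring. }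
    assert (dE3 : forall u v, Omega_k r1 u v -> diff psi u v (E3 u v) = Qf w e1 e2 (lam * u) (v / lam)).
    { intros u v Huv. destruct (Pform u v Huv) as (P1 & P2 & _). unfold diff, E3. cbn [fst snd]. rewrite P1, P2, !vscal_vscal, (Rinv_r lam) by lra.
      generalize (Pf w e1 e2 (lam * u) (v / lam)), (Qf w e1 e2 (lam * u) (v / lam)). intros. vec_ring. }
    split; [|split; [|split]].
    + split; [|split; [|split]].
      * split.
        -- split; [exact OO|]. split; [exact Spsi|]. intros u v Huv. apply (Pform u v Huv).
        -- intros u v Huv. apply (Pform u v Huv).
      * split; [apply smooth_fields|]. split; [apply smooth_fields|]. intros u v Huv.
        destruct (Gm u v Huv) as (G1 & G2 & _). destruct (Pform u v Huv) as (_ & _ & _ & L0 & N0 & _).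
        rewrite dE1, dE3 by exact Huv. unfold vnorm. rewrite G1, G2, sqrt_1.
        split; [reflexivity|]. split; [reflexivity|]. unfold second_form, E1, E3. cbn [fst snd]. rewrite L0, N0.
        split; [ring|]. split; [ring|]. replace (/ lam * lam - 0 * 0) with 1 by (field; lra). lra.
      (* The form [eta x d psi] is closed: [eta_v x psi_u] and [eta_u x psi_v] vanish because the
         factors are parallel, and the remaining terms agree by symmetry of [psi_uv]. *)
      * destruct (closed_map_exact_Omega r1 (fun u v => cross (eta u v) (pu psi u v)) (fun u v => cross (eta u v) (pv psi u v))) as (xi & Dxi).
        -- destruct Hc as (r0 & _); exact r0.
        -- exact OO.
        -- apply smooth_map_cross; [exact OO|exact Se|apply smooth_map_pu, Spsi].
        -- apply smooth_map_cross; [exact OO|exact Se|apply smooth_map_pv, Spsi].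
        -- intros u v Huv.
           pose proof (smooth_map_has_du3 _ _ u v Se Huv) as D1. pose proof (smooth_map_has_dv3 _ _ u v Se Huv) as D2.
           pose proof (smooth_map_has_dv3 _ _ u v (smooth_map_pu _ _ Spsi) Huv) as D3. pose proof (smooth_map_has_du3 _ _ u v (smooth_map_pv _ _ Spsi) Huv) as D4.
           rewrite (pv_eq _ _ _ _ (vderiv_cross _ _ _ _ _ D2 D3)), (pu_eq _ _ _ _ (vderiv_cross _ _ _ _ _ D1 D4)).
           rewrite (smooth_map_schwarz (Omega_k r1) psi u v OO Spsi Huv).
           destruct (Sec u v Huv) as (A1 & A2 & _). destruct (Pform u v Huv) as (P1 & P2 & _). rewrite A1, A2, P1, P2.
           generalize (Pf w e1 e2 (lam * u) (v / lam)), (Qf w e1 e2 (lam * u) (v / lam)), (eta u v), (pu (pv psi) u v).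
           generalize (beta sg (om_of w u v) / u), (sg * beta sg (om_of w u v) / v), (/ lam). clear. intros. vec_ring.
        -- exists xi. split.
           ++ apply (smooth_map_primitive _ _ _ _ OO (smooth_map_cross _ _ _ OO Se (smooth_map_pu _ _ Spsi)) (smooth_map_cross _ _ _ OO Se (smooth_map_pv _ _ Spsi)) Dxi).
           ++ intros u v Huv X. destruct (Dxi u v Huv) as [D1 D2]. unfold diff. rewrite (pu_eq _ _ _ _ D1), (pv_eq _ _ _ _ D2).
              generalize (eta u v), (pu psi u v), (pv psi u v), (fst X), (snd X). clear. intros. vec_ring.
      * intros u v Huv. split; reflexivity.
    + exists U, Psi. split; [exact AU|]. split; [exact S1|]. split; [exact S2|]. intros u v Huv.
      pose proof (Omega_scale r1 lam u v l0 Huv) as Hs'. split; [apply Hs'|]. split; [apply Hs'|]. split; [apply OU, Hs'|reflexivity].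
    + intros u v Huv.
      assert (D1 : du (fun u _ => lam * u) u v = lam) by (apply du_eq; unfold has_du; auto_derive; [exact I|ring]).
      assert (D2 : dv (fun u _ => lam * u) u v = 0) by (apply dv_eq; unfold has_dv; auto_derive; [exact I|ring]).
      assert (D3 : du (fun _ v => v / lam) u v = 0) by (apply du_eq; unfold has_du; auto_derive; [exact I|ring]).
      assert (D4 : dv (fun _ v => v / lam) u v = / lam) by (apply dv_eq; unfold has_dv, Rdiv; auto_derive; [exact I|ring]).
      rewrite D1, D2, D3, D4. unfold pairing, E1, E3. cbn [fst snd]. repeat split; field; lra.
    + assert (Som : smooth (Omega_k r1) (om_of w)) by (apply (smooth_sub plane); [intros; exact I|apply (smooth_om k), H]).
      assert (Sb : smooth (Omega_k r1) (fun u v => beta sg (om_of w u v))) by (apply smooth_beta; assumption).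
      (* Since [th1 = lam du] and [th3 = dv / lam], the factors have to undo [lam] in order to give
         [eta_u = (beta / u) Q] and [eta_v = (sg beta / v) P]. *)
      exists th1, th3, (fun u v => lam * (sg * beta sg (om_of w u v) / v)), (fun u v => beta sg (om_of w u v) / u / lam).
      split; [|split; [|split]].
      * split; [apply smooth_fields|]. split; [apply smooth_fields|]. intros u v Huv. unfold pairing, th1, th3, E1, E3. cbn [fst snd].
        repeat split; field; lra.
      * unfold Rdiv; smooth_tac. intros u v (_ & v0 & _). lra.
      * unfold Rdiv; smooth_tac. intros u v (u0 & _). lra.
      * intros u v Huv. pose proof (beta_pos sg _ Hs (Rg u v Huv)) as b0. pose proof (is_sign_sq sg Hs) as ss. destruct (Sec u v Huv) as (A1 & A2 & _).
        destruct (Huv) as (u0 & v0 & _).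
        split; [|split; [|split]].
        -- intros Z. apply Rmult_integral in Z. destruct Z as [Z|Z]; [lra|]. apply Rmult_integral in Z. destruct Z as [Z|Z]; [|apply Rinv_neq_0_compat in Z; lra].
           apply Rmult_integral in Z. destruct Z as [Z|Z]; [rewrite Z in ss|]; lra.
        -- apply Rgt_not_eq. apply Rdiv_lt_0_compat; [apply Rdiv_lt_0_compat|]; lra.
        -- intros X. rewrite dE1, dE3 by exact Huv. unfold diff, pairing, th1, th3. cbn [fst snd]. rewrite A1, A2.
           generalize (Pf w e1 e2 (lam * u) (v / lam)), (Qf w e1 e2 (lam * u) (v / lam)), (fst X), (snd X), (beta sg (om_of w u v)). intros p q x y b.
           destruct p as [[? ?] ?], q as [[? ?] ?]. vunf. f_equal; [f_equal|]; field; lra.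
        -- destruct (om_partials k w u v H) as [Du Dv].
           assert (Rn : 0 < om_of w u v < PI) by (apply Rg, Huv).
           unfold dform, fscal, th1, th3. cbn [fst snd].
           assert (Z1 : du (fun x y => beta sg (om_of w x y) / x / lam * 0) u v = 0).
           { apply du_eq. apply (is_derive_ext (fun _ => 0)); [intros; rewrite Rmult_0_r; reflexivity|apply (is_derive_const 0)]. }
           assert (Z2 : dv (fun x y => lam * (sg * beta sg (om_of w x y) / y) * 0) u v = 0).
           { apply dv_eq. apply (is_derive_ext (fun _ => 0)); [intros; rewrite Rmult_0_r; reflexivity|apply (is_derive_const 0)]. }
           assert (Z3 : dv (fun x y => beta sg (om_of w x y) / x / lam * lam) u v = / u * (u * Derive w (u * v) * beta' sg (om_of w u v))).
           { apply dv_eq. apply (is_derive_ext (fun t => / u * beta sg (om_of w u t))).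
             - intros t. match goal with |- ?a = ?b => change (@eq R a b) end. field. lra.
             - apply (is_derive_scal (fun t => beta sg (om_of w u t))), (beta_derive sg (fun t => om_of w u t) v _ Hs Rn Dv). }
           assert (Z4 : du (fun x y => lam * (sg * beta sg (om_of w x y) / y) * / lam) u v = sg / v * (v * Derive w (u * v) * beta' sg (om_of w u v))).
           { apply du_eq. apply (is_derive_ext (fun t => sg / v * beta sg (om_of w t v))).
             - intros t. match goal with |- ?a = ?b => change (@eq R a b) end. field. lra.
             - apply (is_derive_scal (fun t => beta sg (om_of w t v))), (beta_derive sg (fun t => om_of w t v) u _ Hs Rn Du). }
           rewrite Z1, Z2, Z3, Z4.
           replace (0 - / u * (u * Derive w (u * v) * beta' sg (om_of w u v)) + sg * (sg / v * (v * Derive w (u * v) * beta' sg (om_of w u v)) - 0))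
             with ((sg * sg - 1) * (Derive w (u * v) * beta' sg (om_of w u v))) by (field; lra).
           rewrite ss. ring.
Qed.

(** * Nets with prescribed fundamental forms *)

Lemma dot_derive_du (F G : map3) u v D E l : has_du3 F u v D -> has_du3 G u v E ->
  has_du (fun x y => dot (F x y) (G x y)) u v l -> dot D (G u v) + dot (F u v) E = l.
Proof.
  intros DF DG Dl. pose proof (vderiv_dot _ _ _ _ _ DF DG) as K.
  rewrite <- (is_derive_unique _ _ _ K). exact (is_derive_unique _ _ _ Dl).
Qed.

Lemma dot_derive_dv (F G : map3) u v D E l : has_dv3 F u v D -> has_dv3 G u v E ->
  has_dv (fun x y => dot (F x y) (G x y)) u v l -> dot D (G u v) + dot (F u v) E = l.
Proof.
  intros DF DG Dl. pose proof (vderiv_dot _ _ _ _ _ DF DG) as K.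
  rewrite <- (is_derive_unique _ _ _ K). exact (is_derive_unique _ _ _ Dl).
Qed.

Lemma has_du_const_on (Om : dom) f (c : R) u v : open_dom Om -> Om u v -> (forall x y, Om x y -> f x y = c) -> has_du f u v 0.
Proof.
  intros HO H E. apply (has_du_ext_loc (fun _ _ => c)); [|apply (is_derive_const c)].
  apply (locally_2d_of_dom Om); [exact HO| |exact H]. intros; symmetry; apply E; assumption.
Qed.

Lemma has_dv_const_on (Om : dom) f (c : R) u v : open_dom Om -> Om u v -> (forall x y, Om x y -> f x y = c) -> has_dv f u v 0.
Proof.
  intros HO H E. apply (has_dv_ext_loc (fun _ _ => c)); [|apply (is_derive_const c)].
  apply (locally_2d_of_dom Om); [exact HO| |exact H]. intros; symmetry; apply E; assumption.
Qed.

(** The diagonals [P + Q] and [Q - P] of a rhombus with unit sides are orthogonal, and their lengths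
    are [2 |c|] and [2 |s|]. *)
Lemma frame_of_gram P Q m s c : s * s + c * c = 1 -> s <> 0 -> c <> 0 ->
  dot P P = 1 -> dot Q Q = 1 -> dot m m = 1 -> dot P Q = 1 - 2 * s * s -> dot P m = 0 -> dot Q m = 0 ->
  let e1 := vscal (/ (2 * c)) (vadd P Q) in let e2 := vscal (/ (2 * s)) (vadd Q (vscal (-1) P)) in
  onb e1 e2 m /\ vadd P Q = vscal (2 * c) e1 /\ vadd Q (vscal (-1) P) = vscal (2 * s) e2 /\
  P = vadd (vscal c e1) (vscal (- s) e2) /\ Q = vadd (vscal c e1) (vscal s e2).
Proof.
  intros sc s0 c0 PP QQ mm PQ Pm Qm e1 e2.
  split; [|split; [|split; [|split]]].
  - unfold onb, e1, e2. rewrite !dot_vscal_l, !dot_vscal_r, !dot_vadd_l, !dot_vadd_r, !dot_vscal_l, !dot_vscal_r, (dot_comm Q P), PP, QQ, PQ, Pm, Qm.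
    assert (2 * (1 - s * s) = 2 * (c * c)) by lra.
    repeat split; try ring; try exact mm.
    + replace (/ (2 * c) * (/ (2 * c) * (1 + (1 - 2 * s * s) + (1 - 2 * s * s + 1)))) with (/ (2 * c) * (/ (2 * c) * (2 * (2 * (1 - s * s))))) by ring.
      rewrite H. field. exact c0.
    + field. exact s0.
  - unfold e1. rewrite vscal_vscal, Rinv_r by lra. clear. vec_ring.
  - unfold e2. rewrite vscal_vscal, Rinv_r by lra. clear. vec_ring.
  - unfold e1, e2. clear - s0 c0. destruct P as [[? ?] ?], Q as [[? ?] ?]. vunf. f_equal; [f_equal|]; field; split; assumption.
  - unfold e1, e2. clear - s0 c0. destruct P as [[? ?] ?], Q as [[? ?] ?]. vunf. f_equal; [f_equal|]; field; split; assumption.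
Qed.

(** One variable at a time. In the first conclusion [Q] moves in the normal direction and [P] turns
    in the tangent plane, which is the x-direction; the second one, with the roles exchanged, is the
    y-direction. Each derivative is recovered from its products with the frame. *)
Lemma half_frame_derivative (P Q m : R -> vec) (om : R -> R) t DP DQ Dm l :
  vderiv P t DP -> vderiv Q t DQ -> vderiv m t Dm -> is_derive om t l -> 0 < om t < PI ->
  dot (P t) (P t) = 1 -> dot (Q t) (Q t) = 1 -> dot (m t) (m t) = 1 -> dot (P t) (Q t) = cos (om t) ->
  dot (P t) (m t) = 0 -> dot (Q t) (m t) = 0 ->
  dot DP (P t) = 0 -> dot DQ (Q t) = 0 -> dot Dm (m t) = 0 ->
  dot DP (m t) + dot (P t) Dm = 0 -> dot DQ (m t) + dot (Q t) Dm = 0 ->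
  let s := sin (om t / 2) in let c := cos (om t / 2) in
  let e1 := fun t => vscal (/ (2 * cos (om t / 2))) (vadd (P t) (Q t)) in
  let e2 := fun t => vscal (/ (2 * sin (om t / 2))) (vadd (Q t) (vscal (-1) (P t))) in
  (dot DP (Q t) = - l * sin (om t) -> dot DQ (P t) = 0 -> dot DP (m t) = 0 -> dot DQ (m t) = sin (om t) ->
     vderiv e1 t (vadd (vscal (- (l / 2)) (e2 t)) (vscal s (m t))) /\
     vderiv e2 t (vadd (vscal (l / 2) (e1 t)) (vscal c (m t))) /\
     vderiv m t (vadd (vscal (- s) (e1 t)) (vscal (- c) (e2 t)))) /\
  (dot DQ (P t) = - l * sin (om t) -> dot DP (Q t) = 0 -> dot DQ (m t) = 0 -> dot DP (m t) = sin (om t) ->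
     vderiv e1 t (vadd (vscal (l / 2) (e2 t)) (vscal s (m t))) /\
     vderiv e2 t (vadd (vscal (- (l / 2)) (e1 t)) (vscal (- c) (m t))) /\
     vderiv m t (vadd (vscal (- s) (e1 t)) (vscal c (e2 t)))).
Proof.
  intros HP HQ Hm Hom R PP QQ mm PQ Pm Qm DPP DQQ Dmm DPm DQm s c e1 e2.
  assert (s0 : 0 < s) by (apply sin_gt_0; lra). assert (c0 : 0 < c) by (apply cos_gt_0; lra).
  assert (sc : s * s + c * c = 1) by (pose proof (sin_cos_sq (om t / 2)); unfold s, c; lra).
  assert (so : sin (om t) = 2 * s * c) by apply sin_half.
  assert (co' : cos (om t) = 1 - 2 * s * s) by (rewrite cos_half; unfold s; ring).
  destruct (frame_of_gram (P t) (Q t) (m t) s c sc) as (On & EP & EQ & PE & QE); try assumption; try lra.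
  change (onb (e1 t) (e2 t) (m t)) in On. change (vadd (P t) (Q t) = vscal (2 * c) (e1 t)) in EP.
  change (vadd (Q t) (vscal (-1) (P t)) = vscal (2 * s) (e2 t)) in EQ.
  destruct (is_derive_half_trig om t l Hom) as [Ds Dc]. fold s in Dc. fold c in Ds.
  assert (K1 : vderiv e1 t (vadd (vscal (l * s / (4 * (c * c))) (vadd (P t) (Q t))) (vscal (/ (2 * c)) (vadd DP DQ)))).
  { eapply vderiv_eq; [|apply (vderiv_scal (fun t => / (2 * cos (om t / 2))) (fun t => vadd (P t) (Q t)))].
    - reflexivity.
    - evar_last; [apply (is_derive_inv (fun t => 2 * cos (om t / 2)))|]; [apply (is_derive_scal (fun t => cos (om t / 2))), Dc| |].
      + fold c. lra.
      + fold c. unfold opp; simpl. field. lra.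
    - apply vderiv_add; assumption. }
  assert (K2 : vderiv e2 t (vadd (vscal (- l * c / (4 * (s * s))) (vadd (Q t) (vscal (-1) (P t)))) (vscal (/ (2 * s)) (vadd DQ (vscal (-1) DP))))).
  { eapply vderiv_eq; [|apply (vderiv_scal (fun t => / (2 * sin (om t / 2))) (fun t => vadd (Q t) (vscal (-1) (P t))))].
    - reflexivity.
    - evar_last; [apply (is_derive_inv (fun t => 2 * sin (om t / 2)))|]; [apply (is_derive_scal (fun t => sin (om t / 2))), Ds| |].
      + fold s. lra.
      + fold s. unfold opp; simpl. field. lra.
    - apply vderiv_add; [assumption|apply vderiv_scal_const; assumption]. }
  rewrite EP in K1. rewrite EQ in K2.
  assert (dE1 : forall D, dot D (e1 t) = / (2 * c) * (dot D (P t) + dot D (Q t))).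
  { intros D. unfold e1. fold c. rewrite dot_vscal_r, dot_vadd_r. reflexivity. }
  assert (dE2 : forall D, dot D (e2 t) = / (2 * s) * (dot D (Q t) - dot D (P t))).
  { intros D. unfold e2. fold s. rewrite dot_vscal_r, dot_vadd_r, dot_vscal_r. ring. }
  pose proof On as On'. destruct On' as (Haa & Hbb & Hcc & Hab & Hac & Hbc).
  assert (Dec : forall D a b g, dot D (e1 t) = a -> dot D (e2 t) = b -> dot D (m t) = g ->
      D = vadd (vadd (vscal a (e1 t)) (vscal b (e2 t))) (vscal g (m t))).
  { intros D a b g <- <- <-. apply onb_decomp, On. }
  split; intros X1 X2 X3 X4.
  - assert (ED : DP = vadd (vadd (vscal (- l * s) (e1 t)) (vscal (- l * c) (e2 t))) (vscal 0 (m t))).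
    { apply Dec; [rewrite dE1, DPP, X1, so|rewrite dE2, DPP, X1, so|exact X3]; field; lra. }
    assert (EQ' : DQ = vadd (vadd (vscal 0 (e1 t)) (vscal 0 (e2 t))) (vscal (2 * s * c) (m t))).
    { apply Dec; [rewrite dE1, DQQ, X2|rewrite dE2, DQQ, X2|rewrite X4; exact so]; ring. }
    assert (Em : Dm = vadd (vadd (vscal (- s) (e1 t)) (vscal (- c) (e2 t))) (vscal 0 (m t))).
    { rewrite X3 in DPm. rewrite X4, so in DQm. apply Dec; [rewrite dE1, !(dot_comm Dm)|rewrite dE2, !(dot_comm Dm)|exact Dmm].
      - replace (dot (P t) Dm) with 0 by lra. replace (dot (Q t) Dm) with (- (2 * s * c)) by lra. field. lra.
      - replace (dot (P t) Dm) with 0 by lra. replace (dot (Q t) Dm) with (- (2 * s * c)) by lra. field. lra. }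
    rewrite ED, EQ' in K1, K2. rewrite Em in Hm.
    split; [|split].
    + eapply vderiv_eq; [|exact K1]. generalize (e1 t), (e2 t), (m t). clear - s0 c0. intros [[? ?] ?] [[? ?] ?] [[? ?] ?]. vunf. f_equal; [f_equal|]; field; lra.
    + eapply vderiv_eq; [|exact K2]. generalize (e1 t), (e2 t), (m t). clear - s0 c0. intros [[? ?] ?] [[? ?] ?] [[? ?] ?]. vunf. f_equal; [f_equal|]; field; lra.
    + eapply vderiv_eq; [|exact Hm]. generalize (e1 t), (e2 t), (m t). clear. intros. vec_ring.
  - assert (ED : DQ = vadd (vadd (vscal (- l * s) (e1 t)) (vscal (l * c) (e2 t))) (vscal 0 (m t))).
    { apply Dec; [rewrite dE1, DQQ, X1, so|rewrite dE2, DQQ, X1, so|exact X3]; field; lra. }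
    assert (EQ' : DP = vadd (vadd (vscal 0 (e1 t)) (vscal 0 (e2 t))) (vscal (2 * s * c) (m t))).
    { apply Dec; [rewrite dE1, DPP, X2|rewrite dE2, DPP, X2|rewrite X4; exact so]; ring. }
    assert (Em : Dm = vadd (vadd (vscal (- s) (e1 t)) (vscal c (e2 t))) (vscal 0 (m t))).
    { rewrite X3 in DQm. rewrite X4, so in DPm. apply Dec; [rewrite dE1, !(dot_comm Dm)|rewrite dE2, !(dot_comm Dm)|exact Dmm].
      - replace (dot (Q t) Dm) with 0 by lra. replace (dot (P t) Dm) with (- (2 * s * c)) by lra. field. lra.
      - replace (dot (Q t) Dm) with 0 by lra. replace (dot (P t) Dm) with (- (2 * s * c)) by lra. field. lra. }
    rewrite ED, EQ' in K1, K2. rewrite Em in Hm.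
    split; [|split].
    + eapply vderiv_eq; [|exact K1]. generalize (e1 t), (e2 t), (m t). clear - s0 c0. intros [[? ?] ?] [[? ?] ?] [[? ?] ?]. vunf. f_equal; [f_equal|]; field; lra.
    + eapply vderiv_eq; [|exact K2]. generalize (e1 t), (e2 t), (m t). clear - s0 c0. intros [[? ?] ?] [[? ?] ?] [[? ?] ?]. vunf. f_equal; [f_equal|]; field; lra.
    + eapply vderiv_eq; [|exact Hm]. generalize (e1 t), (e2 t), (m t). clear. intros. vec_ring.
Qed.

Definition chE1 (om : R -> R -> R) (P Q : map3) : map3 := fun x y => vscal (/ (2 * cos (om x y / 2))) (vadd (P x y) (Q x y)).
Definition chE2 (om : R -> R -> R) (P Q : map3) : map3 := fun x y => vscal (/ (2 * sin (om x y / 2))) (vadd (Q x y) (vscal (-1) (P x y))).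

(** Characterises the asymptotic unit tangents of a pseudospherical surface by scalar products. It
    is applied twice: to the normalised partials of a net with given forms, and to the partials of
    an arbitrary Amsler surface. *)
Lemma chebyshev_frame (Om : dom) om P Q m : open_dom Om -> smooth Om om -> (forall x y, Om x y -> 0 < om x y < PI) ->
  smooth_map Om P -> smooth_map Om Q -> smooth_map Om m ->
  (forall x y, Om x y -> dot (P x y) (P x y) = 1 /\ dot (Q x y) (Q x y) = 1 /\ dot (m x y) (m x y) = 1 /\
     dot (P x y) (Q x y) = cos (om x y) /\ dot (P x y) (m x y) = 0 /\ dot (Q x y) (m x y) = 0) ->
  (forall x y, Om x y ->
     dot (pu P x y) (Q x y) = - du om x y * sin (om x y) /\ dot (pu P x y) (m x y) = 0 /\
     dot (pv Q x y) (P x y) = - dv om x y * sin (om x y) /\ dot (pv Q x y) (m x y) = 0 /\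
     dot (pu Q x y) (m x y) = sin (om x y) /\ dot (pv P x y) (m x y) = sin (om x y)) ->
  frame_field Om om (chE1 om P Q) (chE2 om P Q) m /\
  forall x y, Om x y -> P x y = frP om (chE1 om P Q) (chE2 om P Q) x y /\ Q x y = frQ om (chE1 om P Q) (chE2 om P Q) x y.
Proof.
  intros HO So R SP SQ Sm Gm Der.
  assert (Fg : forall x y, Om x y -> let e1 := chE1 om P Q x y in let e2 := chE2 om P Q x y in
     onb e1 e2 (m x y) /\ P x y = frP om (chE1 om P Q) (chE2 om P Q) x y /\ Q x y = frQ om (chE1 om P Q) (chE2 om P Q) x y).
  { intros x y H. destruct (Gm x y H) as (PP & QQ & mm & PQ & Pm & Qm). specialize (R x y H).
    assert (s0 : 0 < sin (om x y / 2)) by (apply sin_gt_0; lra). assert (c0 : 0 < cos (om x y / 2)) by (apply cos_gt_0; lra).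
    destruct (frame_of_gram (P x y) (Q x y) (m x y) (sin (om x y / 2)) (cos (om x y / 2))) as (On & _ & _ & PE & QE); try assumption; try lra.
    - pose proof (sin_cos_sq (om x y / 2)). lra.
    - rewrite PQ, cos_half. ring.
    - split; [exact On|]. split; [exact PE|exact QE]. }
  split; [|intros x y H; apply (Fg x y H)].
  intros x y H. split; [apply (Fg x y H)|].
  destruct (Gm x y H) as (PP & QQ & mm & PQ & Pm & Qm). destruct (Der x y H) as (D1 & D2 & D3 & D4 & D5 & D6).
  pose proof (smooth_map_has_du3 _ _ x y SP H) as Pu. pose proof (smooth_map_has_dv3 _ _ x y SP H) as Pv.
  pose proof (smooth_map_has_du3 _ _ x y SQ H) as Qu. pose proof (smooth_map_has_dv3 _ _ x y SQ H) as Qv.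
  pose proof (smooth_map_has_du3 _ _ x y Sm H) as Mu. pose proof (smooth_map_has_dv3 _ _ x y Sm H) as Mv.
  pose proof (smooth_has_du _ _ x y So H) as Ou. pose proof (smooth_has_dv _ _ x y So H) as Ov.
  assert (cu : has_du (fun x y => dot (P x y) (Q x y)) x y (du om x y * - sin (om x y))).
  { apply (has_du_ext_loc (fun x y => cos (om x y))).
    - apply (locally_2d_of_dom Om); [exact HO| |exact H]. intros a b Hab. symmetry. apply (Gm a b Hab).
    - apply (is_derive_comp cos (fun x => om x y)); [apply is_derive_cos|exact Ou]. }
  assert (cv : has_dv (fun x y => dot (P x y) (Q x y)) x y (dv om x y * - sin (om x y))).
  { apply (has_dv_ext_loc (fun x y => cos (om x y))).
    - apply (locally_2d_of_dom Om); [exact HO| |exact H]. intros a b Hab. symmetry. apply (Gm a b Hab).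
    - apply (is_derive_comp cos (fun y => om x y)); [apply is_derive_cos|exact Ov]. }
  pose proof (dot_derive_du P P x y _ _ _ Pu Pu (has_du_const_on Om _ 1 x y HO H (fun a b Hab => proj1 (Gm a b Hab)))) as T1.
  pose proof (dot_derive_dv P P x y _ _ _ Pv Pv (has_dv_const_on Om _ 1 x y HO H (fun a b Hab => proj1 (Gm a b Hab)))) as T2.
  pose proof (dot_derive_du Q Q x y _ _ _ Qu Qu (has_du_const_on Om _ 1 x y HO H (fun a b Hab => proj1 (proj2 (Gm a b Hab))))) as T3.
  pose proof (dot_derive_dv Q Q x y _ _ _ Qv Qv (has_dv_const_on Om _ 1 x y HO H (fun a b Hab => proj1 (proj2 (Gm a b Hab))))) as T4.
  pose proof (dot_derive_du m m x y _ _ _ Mu Mu (has_du_const_on Om _ 1 x y HO H (fun a b Hab => proj1 (proj2 (proj2 (Gm a b Hab)))))) as T5.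
  pose proof (dot_derive_dv m m x y _ _ _ Mv Mv (has_dv_const_on Om _ 1 x y HO H (fun a b Hab => proj1 (proj2 (proj2 (Gm a b Hab)))))) as T6.
  pose proof (dot_derive_du P m x y _ _ _ Pu Mu (has_du_const_on Om _ 0 x y HO H (fun a b Hab => proj1 (proj2 (proj2 (proj2 (proj2 (Gm a b Hab)))))))) as T7.
  pose proof (dot_derive_dv P m x y _ _ _ Pv Mv (has_dv_const_on Om _ 0 x y HO H (fun a b Hab => proj1 (proj2 (proj2 (proj2 (proj2 (Gm a b Hab)))))))) as T8.
  pose proof (dot_derive_du Q m x y _ _ _ Qu Mu (has_du_const_on Om _ 0 x y HO H (fun a b Hab => proj2 (proj2 (proj2 (proj2 (proj2 (Gm a b Hab)))))))) as T9.
  pose proof (dot_derive_dv Q m x y _ _ _ Qv Mv (has_dv_const_on Om _ 0 x y HO H (fun a b Hab => proj2 (proj2 (proj2 (proj2 (proj2 (Gm a b Hab)))))))) as T10.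
  pose proof (dot_derive_du P Q x y _ _ _ Pu Qu cu) as T11. pose proof (dot_derive_dv P Q x y _ _ _ Pv Qv cv) as T12.
  rewrite (dot_comm (P x y) (pu P x y)) in T1. rewrite (dot_comm (P x y) (pv P x y)) in T2.
  rewrite (dot_comm (Q x y) (pu Q x y)) in T3. rewrite (dot_comm (Q x y) (pv Q x y)) in T4.
  rewrite (dot_comm (m x y) (pu m x y)) in T5. rewrite (dot_comm (m x y) (pv m x y)) in T6.
  rewrite (dot_comm (P x y) (pu Q x y)) in T11. rewrite (dot_comm (P x y) (pv Q x y)) in T12.
  split.
  - destruct (half_frame_derivative (fun x => P x y) (fun x => Q x y) (fun x => m x y) (fun x => om x y) x _ _ _ _ Pu Qu Mu Ou (R x y H)) as [A _]; try assumption; try lra.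
    apply A; lra.
  - destruct (half_frame_derivative (fun y => P x y) (fun y => Q x y) (fun y => m x y) (fun y => om x y) y _ _ _ _ Pv Qv Mv Ov (R x y H)) as [_ A]; try assumption; try lra.
    apply A; lra.
Qed.

Lemma vscal_one p : vscal 1 p = p.
Proof. vec_ring. Qed.

Lemma smooth_unit_normal Om eta : immersed_net Om eta -> smooth_map Om (unit_normal eta).
Proof.
  intros (HO & Se & Im). pose proof (smooth_map_cross Om _ _ HO (smooth_map_pu _ _ Se) (smooth_map_pv _ _ Se)) as SC.
  apply (smooth_map_scal Om (fun u v => / vnorm (cross (pu eta u v) (pv eta u v)))); [exact HO| |exact SC].
  assert (Pos : forall u v, Om u v -> 0 < dot (cross (pu eta u v) (pv eta u v)) (cross (pu eta u v) (pv eta u v))).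
  { intros u v H. rewrite lagrange_identity. apply cross_nonzero_iff, Im, H. }
  apply smooth_inv; [exact HO| |].
  - apply smooth_sqrt; [exact HO|apply (smooth_dot Om _ _ HO SC SC)|exact Pos].
  - intros u v H. apply Rgt_not_eq. apply sqrt_lt_R0, Pos, H.
Qed.

(** The map [(x, y) |-> (l x, y / l)] preserves [Omega_k] and [x y], hence [om]. The factors [l] and
    [1 / l] cancel in the cross product of the partials and in [fM], so that only [fL] and [fN] feel
    the change of parameter. *)
Lemma eta_sg_rescale sg w r1 lam eps l eta : 0 < lam -> 0 < l -> eta_sg sg w r1 lam eps eta ->
  eta_sg sg w r1 (lam * l) eps (fun x y => eta (l * x) (y / l)).
Proof.
  intros lam0 l0 ((HO & Se & Im) & Fm). set (et := fun x y => eta (l * x) (y / l)).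
  assert (S1 : smooth (Omega_k r1) (fun u _ => l * u)) by smooth_tac.
  assert (S2 : smooth (Omega_k r1) (fun _ v => v / l)) by (unfold Rdiv; smooth_tac).
  assert (Set' : smooth_map (Omega_k r1) et).
  { apply (smooth_map_comp2 (Omega_k r1) (Omega_k r1) eta (fun u _ => l * u) (fun _ v => v / l)); try assumption.
    intros u v. apply Omega_scale, l0. }
  assert (D : forall x y, Omega_k r1 x y -> has_du3 et x y (vscal l (pu eta (l * x) (y / l))) /\ has_dv3 et x y (vscal (/ l) (pv eta (l * x) (y / l)))).
  { intros x y Hxy. apply (Omega_scale r1 l) in Hxy; [|exact l0].
    apply scaled_partials; [apply (smooth_map_has_du3 (Omega_k r1))|apply (smooth_map_has_dv3 (Omega_k r1))]; assumption. }
  assert (E : forall x y, Omega_k r1 x y ->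
    pu et x y = vscal l (pu eta (l * x) (y / l)) /\ pv et x y = vscal (/ l) (pv eta (l * x) (y / l)) /\
    pu (pu et) x y = vscal (l * l) (pu (pu eta) (l * x) (y / l)) /\ pv (pu et) x y = pv (pu eta) (l * x) (y / l) /\
    pv (pv et) x y = vscal (/ l * / l) (pv (pv eta) (l * x) (y / l)) /\ unit_normal et x y = unit_normal eta (l * x) (y / l)).
  { intros x y Hxy. pose proof (Omega_scale r1 l x y l0 Hxy) as Hs.
    pose proof (smooth_map_pu _ _ Se) as Su. pose proof (smooth_map_pv _ _ Se) as Sv.
    destruct (scaled_partials (pu eta) l x y _ _ (smooth_map_has_du3 _ _ _ _ Su Hs) (smooth_map_has_dv3 _ _ _ _ Su Hs)) as [A1 A2].
    destruct (scaled_partials (pv eta) l x y _ _ (smooth_map_has_du3 _ _ _ _ Sv Hs) (smooth_map_has_dv3 _ _ _ _ Sv Hs)) as [B1 B2].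
    destruct (net_second_derivatives (Omega_k r1) et _ _ HO D x y _ _ _ Hxy (vderiv_scal_const l _ _ _ A1) (vderiv_scal_const l _ _ _ A2) (vderiv_scal_const (/ l) _ _ _ B2)) as (E1 & E2 & E3 & E4 & E5).
    rewrite vscal_vscal in E3, E4, E5. rewrite Rinv_r in E4 by lra.
    split; [exact E1|]. split; [exact E2|]. split; [exact E3|]. split; [rewrite E4; clear; generalize (pv (pu eta) (l * x) (y / l)); intros; vec_ring|].
    split; [exact E5|]. unfold unit_normal. rewrite E1, E2.
    replace (cross (vscal l (pu eta (l * x) (y / l))) (vscal (/ l) (pv eta (l * x) (y / l)))) with (cross (pu eta (l * x) (y / l)) (pv eta (l * x) (y / l))); [reflexivity|].
    generalize (pu eta (l * x) (y / l)), (pv eta (l * x) (y / l)). intros [[? ?] ?] [[? ?] ?]. vunf. f_equal; [f_equal|]; field; lra. }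
  split; [split; [exact HO|split; [exact Set'|]]|].
  - intros x y Hxy. destruct (E x y Hxy) as (E1 & E2 & _). pose proof (Im _ _ (Omega_scale r1 l x y l0 Hxy)) as I0.
    rewrite E1, E2. intros Z. apply I0. rewrite <- Z.
    generalize (pu eta (l * x) (y / l)), (pv eta (l * x) (y / l)). intros [[? ?] ?] [[? ?] ?]. vunf. f_equal; [f_equal|]; field; lra.
  - intros x y Hxy. destruct (E x y Hxy) as (E1 & E2 & E3 & E4 & E5 & E6).
    destruct (Fm _ _ (Omega_scale r1 l x y l0 Hxy)) as (F1 & F2 & F3 & F4 & F5 & F6). rewrite om_scale in * by exact l0.
    unfold fE, fF, fG, fL, fM, fN in *. rewrite E1, E2, E3, E4, E5, E6, !dot_vscal_l, ?dot_vscal_r, F1, F2, F3, F4, F5, F6.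
    destruct Hxy as (x0 & y0 & _). cbv zeta. repeat split; field; lra.
Qed.

(** The second form gives the normal components of the derivatives of [P] and [Q]. The tangential
    components of [P_x] and [Q_y] come from pairing [eta_xy = eta_yx] with [P] and [Q]. *)
Lemma eta_sg_chebyshev k w W r1 sg eps eta : amsler_profile k w -> 0 < k < PI -> W_solution k W -> first_cusp W r1 ->
  is_sign sg -> is_sign eps -> eta_sg sg w r1 1 eps eta ->
  exists f1 f2 m, frame_field (Omega_k r1) (om_of w) f1 f2 m /\ forall x y, Omega_k r1 x y ->
    has_du3 eta x y (vscal (beta sg (om_of w x y) / x) (Qf w f1 f2 x y)) /\
    has_dv3 eta x y (vscal (sg * beta sg (om_of w x y) / y) (Pf w f1 f2 x y)).
Proof.
  intros H Hk HW Hc Hs He (Im & Fm). pose proof Im as (HO & Se & Cr).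
  assert (Rg : forall u v, Omega_k r1 u v -> 0 < om_of w u v < PI) by (intros u v Huv; apply (Omega_range k w W r1 u v H Hk HW Hc Huv)).
  assert (Som : smooth (Omega_k r1) (om_of w)) by (apply (smooth_sub plane); [intros; exact I|apply (smooth_om k), H]).
  assert (Sb : smooth (Omega_k r1) (fun u v => beta sg (om_of w u v))) by (apply smooth_beta; assumption).
  assert (b0 : forall u v, Omega_k r1 u v -> 0 < beta sg (om_of w u v)) by (intros; apply beta_pos; auto).
  pose proof (is_sign_sq sg Hs) as ss. pose proof (is_sign_sq eps He) as ee.
  set (ga := fun x y => beta sg (om_of w x y) / x). set (de := fun x y => sg * beta sg (om_of w x y) / y).
  set (P := fun x y => vscal (/ de x y) (pv eta x y)). set (Q := fun x y => vscal (/ ga x y) (pu eta x y)).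
  (* With [eps] absorbed into the normal field, the second form becomes the one for [eps = 1]. *)
  set (m := fun x y => vscal eps (unit_normal eta x y)).
  assert (ga0 : forall x y, Omega_k r1 x y -> ga x y <> 0).
  { intros x y Hxy. specialize (b0 x y Hxy). destruct Hxy as (x0 & y0 & _). apply Rgt_not_eq. apply Rdiv_lt_0_compat; lra. }
  assert (sg0 : sg <> 0) by (intros ->; lra).
  assert (de0 : forall x y, Omega_k r1 x y -> de x y <> 0).
  { intros x y Hxy. specialize (b0 x y Hxy). destruct Hxy as (x0 & y0 & _). unfold de, Rdiv.
    apply Rmult_integral_contrapositive_currified; [apply Rmult_integral_contrapositive_currified; lra|apply Rinv_neq_0_compat; lra]. }
  assert (Sga : smooth (Omega_k r1) ga) by (unfold ga; smooth_tac; intros u v (u0 & _); lra).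
  assert (Sde : smooth (Omega_k r1) de) by (unfold de; smooth_tac; intros u v (_ & v0 & _); lra).
  assert (SP : smooth_map (Omega_k r1) P) by (apply smooth_map_scal; [exact HO|apply smooth_inv; assumption|apply smooth_map_pv, Se]).
  assert (SQ : smooth_map (Omega_k r1) Q) by (apply smooth_map_scal; [exact HO|apply smooth_inv; assumption|apply smooth_map_pu, Se]).
  assert (Sm : smooth_map (Omega_k r1) m) by (apply smooth_map_scal; [exact HO|apply smooth_const, HO|apply smooth_unit_normal, Im]).
  assert (Eu : forall x y, Omega_k r1 x y -> vscal (ga x y) (Q x y) = pu eta x y).
  { intros x y Hxy. unfold Q. rewrite vscal_vscal, Rinv_r by (apply ga0, Hxy). apply vscal_one. }
  assert (Ev : forall x y, Omega_k r1 x y -> vscal (de x y) (P x y) = pv eta x y).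
  { intros x y Hxy. unfold P. rewrite vscal_vscal, Rinv_r by (apply de0, Hxy). apply vscal_one. }
  assert (Gm : forall x y, Omega_k r1 x y -> dot (P x y) (P x y) = 1 /\ dot (Q x y) (Q x y) = 1 /\ dot (m x y) (m x y) = 1 /\
     dot (P x y) (Q x y) = cos (om_of w x y) /\ dot (P x y) (m x y) = 0 /\ dot (Q x y) (m x y) = 0).
  { intros x y Hxy. destruct (Fm x y Hxy) as (F1 & F2 & F3 & _). unfold fE, fF, fG in F1, F2, F3.
    destruct (unit_normal_props eta x y (Cr x y Hxy)) as (N1 & N2 & N3). specialize (b0 x y Hxy). destruct Hxy as (x0 & y0 & _).
    unfold P, Q, m. rewrite !dot_vscal_l, !dot_vscal_r, (dot_comm (pv eta x y) (pu eta x y)), F1, F2, F3, N1, N2, N3. unfold ga, de.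
    set (b := beta sg (om_of w x y)) in *.
    repeat split; try ring.
    - replace (/ (sg * b / y) * (/ (sg * b / y) * (b ^ 2 / y ^ 2))) with (/ (sg * sg)) by (field; lra). rewrite ss. apply Rinv_1.
    - field; lra.
    - lra.
    - field; lra. }
  destruct (chebyshev_frame (Omega_k r1) (om_of w) P Q m HO Som Rg SP SQ Sm Gm) as [FF PQ].
  - intros x y Hxy. destruct (Gm x y Hxy) as (PP & QQ & mm & PQ & Pm & Qm).
    destruct (Fm x y Hxy) as (_ & _ & _ & FL & FM & FN). unfold fL, fM, fN in FL, FM, FN.
    destruct (om_partials k w x y H) as [Dx Dy]. rewrite (du_eq _ _ _ _ Dx), (dv_eq _ _ _ _ Dy).
    pose proof (Rg x y Hxy) as Rn. pose proof (b0 x y Hxy) as bp. pose proof (ga0 x y Hxy) as g0. pose proof (de0 x y Hxy) as d0.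
    pose proof (beta_den_pos sg _ Hs Rn) as den.
    destruct (Hxy) as (x0 & y0 & _).
    assert (V1 : is_derive (fun t => ga x t) y (/ x * (x * Derive w (x * y) * beta' sg (om_of w x y)))).
    { apply (is_derive_ext (fun t => / x * beta sg (om_of w x t))); [intros; unfold ga, Rdiv; apply Rmult_comm|].
      apply (is_derive_scal (fun t => beta sg (om_of w x t))). apply (beta_derive sg (fun t => om_of w x t)); assumption. }
    assert (V2 : is_derive (fun t => de t y) x (sg / y * (y * Derive w (x * y) * beta' sg (om_of w x y)))).
    { apply (is_derive_ext (fun t => sg / y * beta sg (om_of w t y))); [intros t; match goal with |- ?a = ?b => change (@eq R a b) end; unfold de, Rdiv; ring|].
      apply (is_derive_scal (fun t => beta sg (om_of w t y))). apply (beta_derive sg (fun t => om_of w t y)); assumption. }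
    pose proof (smooth_map_has_du3 _ _ x y SP Hxy) as Pu. pose proof (smooth_map_has_dv3 _ _ x y SP Hxy) as Pv.
    pose proof (smooth_map_has_du3 _ _ x y SQ Hxy) as Qu. pose proof (smooth_map_has_dv3 _ _ x y SQ Hxy) as Qv.
    pose proof (smooth_has_du _ _ x y Sga Hxy) as V3. pose proof (smooth_has_dv _ _ x y Sde Hxy) as V4.
    assert (X1 : pv (pu eta) x y = vadd (vscal (/ x * (x * Derive w (x * y) * beta' sg (om_of w x y))) (Q x y)) (vscal (ga x y) (pv Q x y))).
    { apply pv_eq. apply (has_dv3_ext (Omega_k r1) (fun x y => vscal (ga x y) (Q x y))); try assumption. apply (vderiv_scal _ _ _ _ _ V1 Qv). }
    assert (X2 : pu (pv eta) x y = vadd (vscal (sg / y * (y * Derive w (x * y) * beta' sg (om_of w x y))) (P x y)) (vscal (de x y) (pu P x y))).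
    { apply pu_eq. apply (has_du3_ext (Omega_k r1) (fun x y => vscal (de x y) (P x y))); try assumption. apply (vderiv_scal _ _ _ _ _ V2 Pu). }
    assert (X3 : pu (pu eta) x y = vadd (vscal (du ga x y) (Q x y)) (vscal (ga x y) (pu Q x y))).
    { apply pu_eq. apply (has_du3_ext (Omega_k r1) (fun x y => vscal (ga x y) (Q x y))); try assumption. apply (vderiv_scal _ _ _ _ _ V3 Qu). }
    assert (X4 : pv (pv eta) x y = vadd (vscal (dv de x y) (P x y)) (vscal (de x y) (pv P x y))).
    { apply pv_eq. apply (has_dv3_ext (Omega_k r1) (fun x y => vscal (de x y) (P x y))); try assumption. apply (vderiv_scal _ _ _ _ _ V4 Pv). }
    pose proof (smooth_map_schwarz (Omega_k r1) eta x y HO Se Hxy) as Sz.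
    pose proof (dot_derive_dv Q Q x y _ _ _ Qv Qv (has_dv_const_on _ _ 1 x y HO Hxy (fun a b Hab => proj1 (proj2 (Gm a b Hab))))) as T1.
    pose proof (dot_derive_du P P x y _ _ _ Pu Pu (has_du_const_on _ _ 1 x y HO Hxy (fun a b Hab => proj1 (Gm a b Hab)))) as T2.
    rewrite (dot_comm (Q x y) (pv Q x y)) in T1. rewrite (dot_comm (P x y) (pu P x y)) in T2.
    (* The differential equation of [beta]: it turns the derivative of the coefficient into the
       multiple of [sin om] that the frame system requires. *)
    assert (bb : beta' sg (om_of w x y) * (1 - sg * cos (om_of w x y)) = - (sg * sin (om_of w x y) * beta sg (om_of w x y))).
    { unfold beta', beta. field. lra. }
    assert (YM : dot (pv (pu eta) x y) (m x y) = 0) by (unfold m; rewrite dot_vscal_r, FM; ring).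
    assert (YL : dot (pu (pu eta) x y) (m x y) = beta sg (om_of w x y) * sin (om_of w x y) / x).
    { unfold m. rewrite dot_vscal_r, FL. replace (eps * (eps * (1 * beta sg (om_of w x y) * sin (om_of w x y) / x))) with (eps * eps * (beta sg (om_of w x y) * sin (om_of w x y) / x)) by (field; lra). rewrite ee. ring. }
    assert (YN : dot (pv (pv eta) x y) (m x y) = sg * beta sg (om_of w x y) * sin (om_of w x y) / y).
    { unfold m. rewrite dot_vscal_r, FN. replace (eps * (eps * (sg * beta sg (om_of w x y) * sin (om_of w x y) / (1 * y)))) with (eps * eps * (sg * beta sg (om_of w x y) * sin (om_of w x y) / y)) by (field; lra). rewrite ee. ring. }
    pose proof (f_equal (fun z => dot z (P x y)) Sz) as ZP. pose proof (f_equal (fun z => dot z (Q x y)) Sz) as ZQ. cbv beta in ZP, ZQ.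
    rewrite X1, X2, !dot_vadd_l, !dot_vscal_l, (dot_comm (Q x y) (P x y)), PP, PQ in ZP.
    rewrite X1, X2, !dot_vadd_l, !dot_vscal_l, PQ, QQ in ZQ.
    rewrite X3, dot_vadd_l, !dot_vscal_l, Qm in YL. rewrite X4, dot_vadd_l, !dot_vscal_l, Pm in YN.
    pose proof YM as YM2. rewrite Sz, X2, dot_vadd_l, !dot_vscal_l, Pm in YM2. rewrite X1, dot_vadd_l, !dot_vscal_l, Qm in YM.
    assert (T1' : dot (pv Q x y) (Q x y) = 0) by lra. assert (T2' : dot (pu P x y) (P x y) = 0) by lra. rewrite T1' in ZQ. rewrite T2' in ZP.
    set (b := beta sg (om_of w x y)) in *. set (b' := beta' sg (om_of w x y)) in *. set (w' := Derive w (x * y)) in *.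
    set (sn := sin (om_of w x y)) in *. set (cs := cos (om_of w x y)) in *.
    unfold ga in *. unfold de in *. fold b in YL, YN, YM, YM2, ZP, ZQ, g0, d0 |- *.
    split; [|split; [|split; [|split; [|split]]]].
    + apply (Rmult_eq_reg_l (sg * b / y)); [|exact d0].
      replace (sg * b / y * dot (pu P x y) (Q x y)) with (w' * b' * (1 - sg * cs)) by (replace (/ x * (x * w' * b')) with (w' * b') in ZQ by (field; lra); replace (sg / y * (y * w' * b')) with (sg * w' * b') in ZQ by (field; lra); lra).
      rewrite (Rmult_assoc w'), bb. field. lra.
    + apply (Rmult_eq_reg_l (sg * b / y)); [|exact d0]. lra.
    + apply (Rmult_eq_reg_l (b / x)); [|exact g0].
      replace (b / x * dot (pv Q x y) (P x y)) with (sg * (w' * (b' * (1 - sg * cs)))).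
      2:{ replace (/ x * (x * w' * b')) with (w' * b') in ZP by (field; lra). replace (sg / y * (y * w' * b')) with (sg * w' * b') in ZP by (field; lra).
          replace (sg * (w' * (b' * (1 - sg * cs)))) with (sg * w' * b' - sg * sg * (w' * b' * cs)) by ring. rewrite ss. lra. }
      rewrite bb. replace (sg * (w' * - (sg * sn * b))) with (- (sg * sg) * (w' * sn * b)) by ring. rewrite ss. field. lra.
    + apply (Rmult_eq_reg_l (b / x)); [|exact g0]. lra.
    + apply (Rmult_eq_reg_l (b / x)); [|exact g0]. replace (b / x * sn) with (b * sn / x) by (field; lra). lra.
    + apply (Rmult_eq_reg_l (sg * b / y)); [|exact d0]. replace (sg * b / y * sn) with (sg * b * sn / y) by (field; lra). lra.
  - exists (chE1 (om_of w) P Q), (chE2 (om_of w) P Q), m. split; [exact FF|]. intros x y Hxy.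
    destruct (PQ x y Hxy) as [EP EQ]. rewrite <- EP, <- EQ. fold (ga x y) (de x y). rewrite (Eu x y Hxy), (Ev x y Hxy).
    split; [apply (smooth_map_has_du3 (Omega_k r1))|apply (smooth_map_has_dv3 (Omega_k r1))]; assumption.
Qed.

Lemma frP_lin w e1 e2 o x y : Pf w (fun x y => lin o (e1 x y)) (fun x y => lin o (e2 x y)) x y = lin o (Pf w e1 e2 x y).
Proof. unfold frP. rewrite lin_add, !lin_scal. reflexivity. Qed.

Lemma frQ_lin w e1 e2 o x y : Qf w (fun x y => lin o (e1 x y)) (fun x y => lin o (e2 x y)) x y = lin o (Qf w e1 e2 x y).
Proof. unfold frQ. rewrite lin_add, !lin_scal. reflexivity. Qed.

Lemma eta_sg_scaled_net k w W r1 sg lam eps e1 e2 n eta : amsler_frame k w e1 e2 n -> 0 < k < PI -> W_solution k W -> first_cusp W r1 ->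
  is_sign sg -> is_sign eps -> 0 < lam -> eta_sg sg w r1 lam eps eta ->
  exists o, orthogonal o /\ scaled_net sg w r1 lam (fun x y => lin o (e1 x y)) (fun x y => lin o (e2 x y)) eta.
Proof.
  intros AF Hk HW Hc Hs He l0 HE. pose proof (af_profile _ _ _ _ _ AF) as H.
  assert (il0 : 0 < / lam) by (apply Rinv_0_lt_compat, l0).
  (* The Chebyshev frame is only extracted for the parameter [1]; the general net is rescaled to
     that case and back. *)
  pose proof (eta_sg_rescale sg w r1 lam eps (/ lam) eta l0 il0 HE) as HE1. rewrite Rinv_r in HE1 by lra.
  destruct (eta_sg_chebyshev k w W r1 sg eps _ H Hk HW Hc Hs He HE1) as (f1 & f2 & m & FF & D).
  assert (r0 : 0 < r1) by (destruct Hc; assumption).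
  destruct (frame_field_rigid (Omega_k r1) (r1 / 4) (r1 / 4) (om_of w) e1 e2 n f1 f2 m) as (o & Ho & Eo).
  - apply rigid_Omega, r0.
  - intros x y _. apply (af_field _ _ _ _ _ AF x y I).
  - exact FF.
  - exists o. split; [exact Ho|]. intros u v Huv. pose proof (Omega_scale r1 lam u v l0 Huv) as Hs'.
    destruct (D _ _ Hs') as [D1 D2]. destruct (Eo _ _ Hs') as (F1 & F2 & _).
    destruct (scaled_partials _ _ _ _ _ _ D1 D2) as [S1 S2]. rewrite !vscal_vscal, om_scale in S1, S2 by exact l0.
    rewrite frP_lin, frQ_lin.
    assert (EQ : Qf w f1 f2 (lam * u) (v / lam) = lin o (Qf w e1 e2 (lam * u) (v / lam))).
    { rewrite <- frQ_lin. unfold frQ. rewrite F1, F2. reflexivity. }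
    assert (EP : Pf w f1 f2 (lam * u) (v / lam) = lin o (Pf w e1 e2 (lam * u) (v / lam))).
    { rewrite <- frP_lin. unfold frP. rewrite F1, F2. reflexivity. }
    rewrite EQ in S1. rewrite EP in S2. destruct Huv as (u0 & v0 & _).
    assert (Id : forall u v, eta (/ lam * (lam * u)) (v / lam / / lam) = eta u v).
    { intros a b. f_equal; field; lra. }
    split.
    + apply (vderiv_ext_loc (fun u => eta (/ lam * (lam * u)) (v / lam / / lam))); [apply filter_forall; intros; apply Id|].
      eapply vderiv_eq; [|exact S1]. f_equal. field. lra.
    + apply (vderiv_ext_loc (fun v => eta (/ lam * (lam * u)) (v / lam / / lam))); [apply filter_forall; intros; apply Id|].
      eapply vderiv_eq; [|exact S2]. f_equal. field. lra.
Qed.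

(** * Uniqueness of Amsler surfaces *)

Lemma smooth1_acos : smooth1 (fun t => -1 < t < 1) acos.
Proof.
  assert (HJ : forall t, -1 < t < 1 -> locally t (fun t => -1 < t < 1)).
  { intros t Ht. apply filter_and; [apply (open_gt (-1) t)|apply (open_lt 1 t)]; lra. }
  apply (smooth1_primitive _ acos (fun t => - / sqrt (1 - t * t)) HJ).
  - intros t Ht. apply is_derive_Reals. pose proof (derive_pt_acos t Ht) as E.
    apply derive_pt_eq_1 in E. replace (- / sqrt (1 - t * t)) with (-1 / sqrt (1 - Rsqr t)); [exact E|].
    unfold Rsqr, Rdiv. ring.
  - assert (HO : open_dom (fun u _ => -1 < u < 1)).
    { intros u v Hu. destruct (HJ u Hu) as [d Hd]. exists d. intros x y Hx _. apply Hd, Hx. }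
    apply smooth1_of_smooth; [exact HJ|]. apply smooth_opp; [exact HO|].
    apply smooth_inv; [exact HO|apply smooth_sqrt; [exact HO|smooth_tac|]|].
    + intros u v Hu. nra.
    + intros u v Hu. apply Rgt_not_eq, sqrt_lt_R0. nra.
Qed.

Lemma orthogonal_to_all X Y n z : dot (cross X Y) n <> 0 -> dot z X = 0 -> dot z Y = 0 -> dot z n = 0 -> z = vzero.
Proof.
  intros d0 zX zY zn.
  assert (E : vscal (dot (cross X Y) n) z = vzero).
  { transitivity (vadd (vadd (vscal (dot z X) (cross Y n)) (vscal (dot z Y) (cross n X))) (vscal (dot z n) (cross X Y))).
    - clear. vec_ring.
    - rewrite zX, zY, zn. clear. vec_ring. }
  transitivity (vscal (/ dot (cross X Y) n) (vscal (dot (cross X Y) n) z)).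
  - rewrite vscal_vscal, Rinv_l by exact d0. symmetry. apply vscal_one.
  - rewrite E. generalize (/ dot (cross X Y) n). clear. intros. vec_ring.
Qed.

(** The integrability condition: the [e2]-component of the equality of the mixed derivatives of
    [e1]. *)
Lemma frame_sine_gordon (Om : dom) om e1 e2 n x y : open_dom Om -> smooth Om om -> smooth_map Om e1 ->
  frame_field Om om e1 e2 n -> Om x y -> dv (du om) x y = sin (om x y).
Proof.
  intros HO So S1 FF H.
  destruct (FF x y H) as ((Haa & Hbb & Hcc & Hab & Hac & Hbc) & (A1 & A2 & A3) & (B1 & B2 & B3)).
  pose proof (smooth_has_du _ _ x y So H) as Du. pose proof (smooth_has_dv _ _ x y So H) as Dv.
  pose proof (smooth_has_dv _ _ x y (smooth_du _ _ So) H) as Duv. pose proof (smooth_has_du _ _ x y (smooth_dv _ _ So) H) as Dvu.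
  destruct (is_derive_half_trig _ _ _ Du) as [Sx Cx]. destruct (is_derive_half_trig _ _ _ Dv) as [Sy Cy].
  assert (X1 : exists z, pv (pu e1) x y = vadd (vadd (vscal (- / 2 * dv (du om) x y) (e2 x y)) (vscal (- / 2 * du om x y) (vadd (vscal (- (dv om x y / 2)) (e1 x y)) (vscal (- cos (om x y / 2)) (n x y)))))
      (vadd (vscal z (n x y)) (vscal (sin (om x y / 2)) (vadd (vscal (- sin (om x y / 2)) (e1 x y)) (vscal (cos (om x y / 2)) (e2 x y)))))).
  { eexists. apply pv_eq. apply (has_dv3_ext Om (fun x y => vadd (vscal (- / 2 * du om x y) (e2 x y)) (vscal (sin (om x y / 2)) (n x y)))); [exact HO|exact H| |].
    - intros p q Hpq. symmetry. replace (- / 2 * du om p q) with (- (du om p q / 2)) by field. apply pu_eq. apply (FF p q Hpq).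
    - apply vderiv_add.
      + apply (vderiv_scal (fun y => - / 2 * du om x y) (fun y => e2 x y)); [apply (is_derive_scal (fun y => du om x y)), Duv|exact B2].
      + apply (vderiv_scal (fun y => sin (om x y / 2)) (fun y => n x y)); [exact Sy|exact B3]. }
  assert (X2 : exists z, pu (pv e1) x y = vadd (vadd (vscal (/ 2 * du (dv om) x y) (e2 x y)) (vscal (/ 2 * dv om x y) (vadd (vscal (du om x y / 2) (e1 x y)) (vscal (cos (om x y / 2)) (n x y)))))
      (vadd (vscal z (n x y)) (vscal (sin (om x y / 2)) (vadd (vscal (- sin (om x y / 2)) (e1 x y)) (vscal (- cos (om x y / 2)) (e2 x y)))))).
  { eexists. apply pu_eq. apply (has_du3_ext Om (fun x y => vadd (vscal (/ 2 * dv om x y) (e2 x y)) (vscal (sin (om x y / 2)) (n x y)))); [exact HO|exact H| |].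
    - intros p q Hpq. symmetry. replace (/ 2 * dv om p q) with (dv om p q / 2) by field. apply pv_eq. apply (FF p q Hpq).
    - apply vderiv_add.
      + apply (vderiv_scal (fun x => / 2 * dv om x y) (fun x => e2 x y)); [apply (is_derive_scal (fun x => dv om x y)), Dvu|exact A2].
      + apply (vderiv_scal (fun x => sin (om x y / 2)) (fun x => n x y)); [exact Sx|exact A3]. }
  destruct X1 as [z1 X1], X2 as [z2 X2].
  pose proof (smooth_map_schwarz Om e1 x y HO S1 H) as Sz. rewrite X1, X2 in Sz.
  apply (f_equal (fun z => dot z (e2 x y))) in Sz. cbv beta in Sz.
  rewrite !dot_vadd_l, !dot_vscal_l, !dot_vadd_l, !dot_vscal_l, Hbb, Hab, (dot_comm (n x y) (e2 x y)), Hbc in Sz.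
  rewrite <- (smooth_schwarz Om om x y HO So H) in Sz. rewrite sin_half. lra.
Qed.

(** Integrating [|d12| <= K |d|] first in [b] from the lower edge and then in [a] from the left edge
    improves the bound to [M K^n a^n / n!] for every [n], which tends to [0]. *)
Lemma goursat_uniqueness (d d1 d12 : R -> R -> R) K M : 0 <= K -> 0 <= M ->
  (forall a b, 0 <= a <= 1 -> 0 <= b <= 1 ->
     has_du d a b (d1 a b) /\ has_dv d1 a b (d12 a b) /\ Rabs (d12 a b) <= K * Rabs (d a b) /\ Rabs (d a b) <= M) ->
  (forall b, 0 <= b <= 1 -> d 0 b = 0) -> (forall a, 0 <= a <= 1 -> d1 a 0 = 0) ->
  forall a b, 0 <= a <= 1 -> 0 <= b <= 1 -> d a b = 0.
Proof.
  intros K0 M0 H d0 d10.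
  assert (B : forall n a b, 0 <= a <= 1 -> 0 <= b <= 1 -> Rabs (d a b) <= M * K ^ n * (a ^ n / INR (fact n))).
  { induction n as [|n IH]; intros a b Ha Hb.
    - simpl. rewrite Rdiv_1_r, !Rmult_1_r. apply H; assumption.
    - assert (D1 : forall t, 0 <= t <= 1 -> Rabs (d1 t b) <= M * K ^ S n * (t ^ n / INR (fact n))).
      { intros t Ht. destruct (derive_mean_value (fun y => d1 t y) (fun y => d12 t y) 0 b) as (c & Hc & E); [lra|intros y Hy; apply H; lra|].
        cbv beta in E. rewrite (d10 t Ht), Rminus_0_r in E. rewrite E, Rabs_mult, Rminus_0_r, (Rabs_right b) by lra.
        destruct (H t c Ht ltac:(lra)) as (_ & _ & L & _). specialize (IH t c Ht ltac:(lra)).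
        assert (Rabs (d12 t c) <= K * (M * K ^ n * (t ^ n / INR (fact n)))) by (eapply Rle_trans; [exact L|apply Rmult_le_compat_l; assumption]).
        pose proof (Rabs_pos (d12 t c)). replace (M * K ^ S n * (t ^ n / INR (fact n))) with (K * (M * K ^ n * (t ^ n / INR (fact n)))) by (simpl; ring). nra. }
      set (C := M * K ^ S n) in *.
      assert (Dg : forall t, is_derive (fun t => C * (t ^ S n / INR (fact (S n)))) t (C * (t ^ n / INR (fact n)))).
      { intros s.
        assert (E : INR (fact (S n)) = INR (S n) * INR (fact n)) by (rewrite fact_simpl; apply mult_INR).
        pose proof (INR_fact_neq_0 n). assert (INR (S n) <> 0) by (apply not_0_INR; lia).
        revert E. generalize (INR (fact (S n))). intros q E. auto_derive; [exact I|].
        change (pred (S n)) with n. rewrite E. change (match n with O => 1 | S _ => INR n + 1 end) with (INR (S n)).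
        field. split; assumption. }
      assert (Z : C * (0 ^ S n / INR (fact (S n))) = 0) by (simpl pow; unfold Rdiv; ring).
      apply Rabs_le. split.
      + assert (G : d 0 b + C * (0 ^ S n / INR (fact (S n))) <= d a b + C * (a ^ S n / INR (fact (S n)))).
        { apply (derive_nonneg_increasing (fun t => d t b + C * (t ^ S n / INR (fact (S n)))) (fun t => d1 t b + C * (t ^ n / INR (fact n))) 0 a); [lra| |].
          - intros t Ht. apply (is_derive_plus (fun t => d t b) (fun t => C * (t ^ S n / INR (fact (S n))))); [apply H; lra|apply Dg].
          - intros t Ht. specialize (D1 t ltac:(lra)). apply Rabs_le_between in D1. lra. }
        rewrite (d0 b Hb), Z in G. lra.
      + assert (G : C * (0 ^ S n / INR (fact (S n))) - d 0 b <= C * (a ^ S n / INR (fact (S n))) - d a b).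
        { apply (derive_nonneg_increasing (fun t => C * (t ^ S n / INR (fact (S n))) - d t b) (fun t => C * (t ^ n / INR (fact n)) - d1 t b) 0 a); [lra| |].
          - intros t Ht. apply (is_derive_minus (fun t => C * (t ^ S n / INR (fact (S n)))) (fun t => d t b)); [apply Dg|apply H; lra].
          - intros t Ht. specialize (D1 t ltac:(lra)). apply Rabs_le_between in D1. lra. }
        rewrite (d0 b Hb), Z in G. lra. }
  intros a b Ha Hb. destruct (Req_dec (d a b) 0) as [E|N]; [exact E|exfalso].
  assert (p0 : 0 < Rabs (d a b)) by (apply Rabs_pos_lt, N).
  destruct (cv_speed_pow_fact K (Rabs (d a b) / (M + 1))) as [n Hn]; [apply Rdiv_lt_0_compat; lra|].
  specialize (Hn n (le_n n)). unfold R_dist in Hn. rewrite Rminus_0_r in Hn.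
  assert (q0 : 0 <= K ^ n / INR (fact n)) by (apply Rmult_le_pos; [apply pow_le, K0|left; apply Rinv_0_lt_compat, INR_fact_lt_0]).
  rewrite Rabs_right in Hn by lra.
  specialize (B n a b Ha Hb).
  assert (a ^ n <= 1) by (rewrite <- (pow1 n); apply pow_incr; lra).
  assert (0 <= a ^ n) by (apply pow_le; lra).
  assert (B2 : Rabs (d a b) <= M * (K ^ n / INR (fact n))).
  { eapply Rle_trans; [exact B|]. replace (M * K ^ n * (a ^ n / INR (fact n))) with (M * (K ^ n / INR (fact n)) * a ^ n) by (unfold Rdiv; ring).
    assert (0 <= M * (K ^ n / INR (fact n))) by (apply Rmult_le_pos; assumption). nra. }
  apply (Rmult_lt_compat_r (M + 1)) in Hn; [|lra]. unfold Rdiv at 2 in Hn. rewrite Rmult_assoc, Rinv_l, Rmult_1_r in Hn by lra. nra.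
Qed.

(** The angle is read off as [th = acos F], which is smooth because an immersion with unit tangents
    has [|F| < 1]. Straightness of the axes becomes constancy of [th] along them, the boundary
    condition of the Goursat problem. *)
Lemma amsler_surface_chebyshev k U Psi : 0 < k < PI -> Amsler_surface k U Psi ->
  exists th e1 e2 m, smooth U th /\ smooth_map U e1 /\ frame_field U th e1 e2 m /\
    (forall x y, U x y -> 0 < th x y < PI /\ pu Psi x y = frP th e1 e2 x y /\ pv Psi x y = frQ th e1 e2 x y) /\
    (forall t, th t 0 = k /\ th 0 t = k) /\ (forall t, du th t 0 = 0 /\ dv th 0 t = 0).
Proof.
  intros Hk (Uax & Urect & ((HO & SPsi & Im) & GK) & Forms & (a & b & Ha & Hb & Hab)).
  assert (cosF : forall x y, U x y -> -1 < fF Psi x y < 1).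
  { intros x y H. pose proof (cross_nonzero_iff _ _ (Im x y H)) as g0. fold (fE Psi x y) (fG Psi x y) (fF Psi x y) in g0.
    destruct (Forms x y H) as (E & G & _). rewrite E, G in g0. nra. }
  pose proof (smooth_map_pu _ _ SPsi) as SP. pose proof (smooth_map_pv _ _ SPsi) as SQ.
  pose proof (smooth_map_pv _ _ SP) as SPQ.
  set (th := fun x y => acos (fF Psi x y)).
  assert (Sth : smooth U th).
  { apply (smooth_comp1 U (fun t => -1 < t < 1) acos); [exact HO|apply smooth1_acos|apply (smooth_dot U _ _ HO SP SQ)|exact cosF]. }
  assert (Rth : forall x y, U x y -> 0 < th x y < PI).
  { intros x y H. apply acos_bound_lt, cosF, H. }
  assert (Cth : forall x y, U x y -> cos (th x y) = fF Psi x y).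
  { intros x y H. apply cos_acos. pose proof (cosF x y H). lra. }
  assert (s0 : forall x y, U x y -> 0 < sin (th x y)) by (intros x y H; apply sin_gt_0; apply (Rth x y H)).
  (* [Psi_xy] is normal since both tangents have constant length, and curvature [-1] gives it the
     length [sin th]. Using it as normal direction removes the sign ambiguity of [unit_normal]. *)
  set (m := fun x y => vscal (/ sin (th x y)) (pv (pu Psi) x y)).
  assert (Sm : smooth_map U m).
  { apply smooth_map_scal; [exact HO| |exact SPQ]. apply smooth_inv; [exact HO|smooth_tac|].
    intros x y H. specialize (s0 x y H). lra. }
  assert (PP : forall x y, U x y -> dot (pu Psi x y) (pu Psi x y) = 1) by (intros x y H; apply (Forms x y H)).
  assert (QQ : forall x y, U x y -> dot (pv Psi x y) (pv Psi x y) = 1) by (intros x y H; apply (Forms x y H)).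
  assert (XP : forall x y, U x y -> dot (pv (pu Psi) x y) (pu Psi x y) = 0).
  { intros x y H. pose proof (smooth_map_has_dv3 _ _ x y SP H) as D.
    pose proof (dot_derive_dv _ _ x y _ _ _ D D (has_dv_const_on U _ 1 x y HO H PP)) as T. rewrite (dot_comm (pu Psi x y)) in T. lra. }
  assert (XQ : forall x y, U x y -> dot (pv (pu Psi) x y) (pv Psi x y) = 0).
  { intros x y H. rewrite (smooth_map_schwarz U Psi x y HO SPsi H). pose proof (smooth_map_has_du3 _ _ x y SQ H) as D.
    pose proof (dot_derive_du _ _ x y _ _ _ D D (has_du_const_on U _ 1 x y HO H QQ)) as T. rewrite (dot_comm (pv Psi x y)) in T. lra. }
  assert (XN : forall x y, U x y -> pv (pu Psi) x y = vscal (fM Psi x y) (unit_normal Psi x y)).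
  { intros x y H. destruct (unit_normal_props Psi x y (Im x y H)) as (N1 & N2 & N3).
    assert (d0 : dot (cross (pu Psi x y) (pv Psi x y)) (unit_normal Psi x y) <> 0).
    { intros Z. apply (Im x y H). rewrite (cross_along_normal _ _ _ N1 N2 N3), Z. generalize (unit_normal Psi x y). clear. intros. vec_ring. }
    assert (Z : vadd (pv (pu Psi) x y) (vscal (-1) (vscal (fM Psi x y) (unit_normal Psi x y))) = vzero).
    { apply (orthogonal_to_all _ _ _ _ d0); rewrite dot_vadd_l, !dot_vscal_l.
      - rewrite (dot_comm (unit_normal Psi x y)), N2, (XP x y H). ring.
      - rewrite (dot_comm (unit_normal Psi x y)), N3, (XQ x y H). ring.
      - rewrite N1. unfold fM. ring. }
    transitivity (vadd (vadd (pv (pu Psi) x y) (vscal (-1) (vscal (fM Psi x y) (unit_normal Psi x y)))) (vscal (fM Psi x y) (unit_normal Psi x y))).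
    - generalize (pv (pu Psi) x y), (fM Psi x y), (unit_normal Psi x y). clear. intros. vec_ring.
    - rewrite Z. generalize (fM Psi x y), (unit_normal Psi x y). clear. intros. vec_ring. }
  assert (M2 : forall x y, U x y -> fM Psi x y ^ 2 = sin (th x y) ^ 2).
  { intros x y H. pose proof (GK x y H) as G. destruct (Forms x y H) as (E & G' & L & N). unfold gauss_curvature in G. rewrite E, G', L, N in G.
    pose proof (sin_cos_sq (th x y)) as sc. rewrite (Cth x y H) in sc. specialize (s0 x y H).
    assert (q : 1 * 1 - fF Psi x y ^ 2 = sin (th x y) ^ 2) by lra. rewrite q in G.
    assert (q0 : 0 < sin (th x y) ^ 2) by (apply pow_lt, s0).
    apply (f_equal (fun z => z * sin (th x y) ^ 2)) in G. unfold Rdiv in G. rewrite Rmult_assoc, Rinv_l in G by lra. lra. }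
  assert (XX : forall x y, U x y -> dot (pv (pu Psi) x y) (pv (pu Psi) x y) = sin (th x y) ^ 2).
  { intros x y H. destruct (unit_normal_props Psi x y (Im x y H)) as (N1 & _). rewrite (XN x y H), dot_vscal_l, dot_vscal_r, N1, <- (M2 x y H). ring. }
  assert (Gm : forall x y, U x y -> dot (pu Psi x y) (pu Psi x y) = 1 /\ dot (pv Psi x y) (pv Psi x y) = 1 /\ dot (m x y) (m x y) = 1 /\
     dot (pu Psi x y) (pv Psi x y) = cos (th x y) /\ dot (pu Psi x y) (m x y) = 0 /\ dot (pv Psi x y) (m x y) = 0).
  { intros x y H. specialize (s0 x y H). unfold m. rewrite !dot_vscal_l, !dot_vscal_r, (XX x y H), !(dot_comm (_ Psi x y) (pv (pu Psi) x y)), (XP x y H), (XQ x y H), (Cth x y H).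
    split; [apply PP, H|]. split; [apply QQ, H|]. split; [field; lra|]. split; [reflexivity|]. split; ring. }
  assert (cu : forall x y, U x y -> dot (pu (pu Psi) x y) (pv Psi x y) = - du th x y * sin (th x y)).
  { intros x y H. pose proof (smooth_map_has_du3 _ _ x y SP H) as D1. pose proof (smooth_map_has_du3 _ _ x y SQ H) as D2.
    assert (cu : has_du (fun x y => dot (pu Psi x y) (pv Psi x y)) x y (du th x y * - sin (th x y))).
    { apply (has_du_ext_loc (fun x y => cos (th x y))).
      - apply (locally_2d_of_dom U); [exact HO| |exact H]. intros p q Hpq. symmetry. apply (Gm p q Hpq).
      - apply (is_derive_comp cos (fun x => th x y)); [apply is_derive_cos|apply (smooth_has_du U); assumption]. }
    pose proof (dot_derive_du _ _ x y _ _ _ D1 D2 cu) as T. rewrite <- (smooth_map_schwarz U Psi x y HO SPsi H), (dot_comm (pu Psi x y)), (XP x y H) in T. lra. }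
  assert (cv : forall x y, U x y -> dot (pv (pv Psi) x y) (pu Psi x y) = - dv th x y * sin (th x y)).
  { intros x y H. pose proof (smooth_map_has_dv3 _ _ x y SP H) as D1. pose proof (smooth_map_has_dv3 _ _ x y SQ H) as D2.
    assert (cv : has_dv (fun x y => dot (pu Psi x y) (pv Psi x y)) x y (dv th x y * - sin (th x y))).
    { apply (has_dv_ext_loc (fun x y => cos (th x y))).
      - apply (locally_2d_of_dom U); [exact HO| |exact H]. intros p q Hpq. symmetry. apply (Gm p q Hpq).
      - apply (is_derive_comp cos (fun y => th x y)); [apply is_derive_cos|apply (smooth_has_dv U); assumption]. }
    pose proof (dot_derive_dv _ _ x y _ _ _ D1 D2 cv) as T. rewrite (dot_comm (pu Psi x y)), (XQ x y H) in T. lra. }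
  destruct (chebyshev_frame U th (pu Psi) (pv Psi) m HO Sth Rth SP SQ Sm Gm) as [FF PQ].
  { intros x y H. destruct (Forms x y H) as (_ & _ & L & N). unfold fL, fN in L, N.
    assert (mn : m x y = vscal (/ sin (th x y) * fM Psi x y) (unit_normal Psi x y)) by (unfold m; rewrite (XN x y H), vscal_vscal; reflexivity).
    specialize (s0 x y H).
    split; [apply cu, H|]. split; [rewrite mn, dot_vscal_r, L; ring|]. split; [apply cv, H|]. split; [rewrite mn, dot_vscal_r, N; ring|].
    rewrite <- (smooth_map_schwarz U Psi x y HO SPsi H). unfold m. rewrite dot_vscal_r, (XX x y H). split; field; lra. }
  assert (Pa : forall t, pu Psi t 0 = a).
  { intros t. apply pu_eq. intros i. apply (is_derive_ext (fun s => co i (Psi 0 0) + s * co i a)).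
    - intros s. rewrite (Ha s), co_vadd, co_vscal. reflexivity.
    - generalize (co i a), (co i (Psi 0 0)). intros. auto_derive; [exact I|ring]. }
  assert (Qb : forall t, pv Psi 0 t = b).
  { intros t. apply pv_eq. intros i. apply (is_derive_ext (fun s => co i (Psi 0 0) + s * co i b)).
    - intros s. rewrite (Hb s), co_vadd, co_vscal. reflexivity.
    - generalize (co i b), (co i (Psi 0 0)). intros. auto_derive; [exact I|ring]. }
  (* [Psi_xx] vanishes on a straight axis, and its product with [Psi_y] is [- th_x sin th]; likewise
     for [Psi_yy] on the other axis. *)
  assert (dth : forall t, du th t 0 = 0 /\ dv th 0 t = 0).
  { intros t. destruct (Uax t) as [U1 U2]. split.
    - assert (Z : pu (pu Psi) t 0 = vzero) by (apply pu_eq; apply (vderiv_ext_loc (fun _ => a)); [apply filter_forall; intros; symmetry; apply Pa|apply vderiv_const]).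
      pose proof (cu t 0 U1) as E. rewrite Z in E. specialize (s0 _ _ U1).
      replace (dot vzero (pv Psi t 0)) with 0 in E by (unfold dot, vzero, cx, cy, cz; cbn [fst snd]; ring).
      apply (Rmult_eq_reg_r (sin (th t 0))); lra.
    - assert (Z : pv (pv Psi) 0 t = vzero) by (apply pv_eq; apply (vderiv_ext_loc (fun _ => b)); [apply filter_forall; intros; symmetry; apply Qb|apply vderiv_const]).
      pose proof (cv 0 t U2) as E. rewrite Z in E. specialize (s0 _ _ U2).
      replace (dot vzero (pu Psi 0 t)) with 0 in E by (unfold dot, vzero, cx, cy, cz; cbn [fst snd]; ring).
      apply (Rmult_eq_reg_r (sin (th 0 t))); lra. }
  assert (th00 : th 0 0 = k).
  { unfold th, fF. rewrite Pa, Qb, Hab. apply acos_cos. lra. }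
  exists th, (chE1 th (pu Psi) (pv Psi)), (chE2 th (pu Psi) (pv Psi)), m.
  split; [exact Sth|]. split; [|split; [exact FF|split; [|split; [|exact dth]]]].
  - apply smooth_map_scal; [exact HO| |apply smooth_map_add; assumption].
    apply smooth_inv; [exact HO|unfold Rdiv; smooth_tac|]. intros x y H. specialize (Rth x y H).
    assert (0 < cos (th x y / 2)) by (apply cos_gt_0; lra). lra.
  - intros x y H. split; [apply Rth, H|]. apply PQ, H.
  - intros t. split.
    + rewrite <- th00. apply (const_on_segment (fun t => th t 0)). intros s _.
      pose proof (smooth_has_du U th s 0 Sth (proj1 (Uax s))) as D. rewrite (proj1 (dth s)) in D. exact D.
    + rewrite <- th00. apply (const_on_segment (fun t => th 0 t)). intros s _.
      pose proof (smooth_has_dv U th 0 s Sth (proj2 (Uax s))) as D. rewrite (proj2 (dth s)) in D. exact D.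
Qed.

(** The rectangle spanned by the origin and [(x, y)] is parametrised by the unit square through
    [(a x, b y)]. This treats all quadrants alike and gives the constant [K = |x y|]; the rectangle
    property keeps the argument inside [U]. *)
Lemma amsler_angle_unique k w U th : amsler_profile k w ->
  open_dom U -> smooth U th ->
  (forall x y a b, U x y -> 0 <= a <= 1 -> 0 <= b <= 1 -> U (a * x) (b * y)) ->
  (forall x y, U x y -> dv (du th) x y = sin (th x y)) ->
  (forall x y, U x y -> 0 < th x y < PI) ->
  (forall t, th t 0 = k /\ th 0 t = k) -> (forall t, du th t 0 = 0) ->
  forall x y, U x y -> th x y = om_of w x y.
Proof.
  intros H HO Sth HR SG Rth Ax Dx x y Hxy.
  assert (W0 : w 0 = k) by (destruct H as (_ & W0 & _); exact W0).
  set (d := fun a b => th (a * x) (b * y) - om_of w (a * x) (b * y)).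
  set (d1 := fun a b => x * (du th (a * x) (b * y) - du (om_of w) (a * x) (b * y))).
  set (d12 := fun a b => x * (y * (sin (th (a * x) (b * y)) - sin (om_of w (a * x) (b * y))))).
  destruct (continuous_bounded w (Rabs (x * y)) (profile_continuous k w H)) as (B & B0 & HB).
  assert (E : d 1 1 = 0).
  { pose proof PI_RGT_0 as pi0.
    apply (goursat_uniqueness d d1 d12 (Rabs (x * y)) (PI + B)); [apply Rabs_pos|lra| | | |lra|lra].
    - intros a b Ha Hb. specialize (HR x y a b Hxy Ha Hb). split; [|split; [|split]].
      + apply (is_derive_ext (fun a => th (a * x) (b * y) - om_of w (a * x) (b * y))); [reflexivity|].
        unfold d1. rewrite Rmult_minus_distr_l.
        apply (is_derive_minus (fun a => th (a * x) (b * y)) (fun a => om_of w (a * x) (b * y))).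
        * apply (is_derive_comp (fun t => th t (b * y)) (fun a => a * x)); [apply (smooth_has_du U); assumption|auto_derive; [exact I|ring]].
        * apply (is_derive_comp (fun t => om_of w t (b * y)) (fun a => a * x)); [apply (smooth_has_du plane (om_of w) (a * x) (b * y)); [apply (smooth_om k w H)|exact I]|auto_derive; [exact I|ring]].
      + unfold has_dv, d12. apply (is_derive_scal (fun b => du th (a * x) (b * y) - du (om_of w) (a * x) (b * y))).
        rewrite Rmult_minus_distr_l, <- (SG _ _ HR), <- (om_sine_gordon k w _ _ H).
        apply (is_derive_minus (fun b => du th (a * x) (b * y)) (fun b => du (om_of w) (a * x) (b * y))).
        * apply (is_derive_comp (fun t => du th (a * x) t) (fun b => b * y)); [apply (smooth_has_dv U (du th)); [apply smooth_du, Sth|exact HR]|auto_derive; [exact I|ring]].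
        * apply (is_derive_comp (fun t => du (om_of w) (a * x) t) (fun b => b * y)); [apply (smooth_has_dv plane (du (om_of w)) (a * x) (b * y)); [apply smooth_du, (smooth_om k w H)|exact I]|auto_derive; [exact I|ring]].
      + unfold d12, d. rewrite <- Rmult_assoc, Rabs_mult. apply Rmult_le_compat_l; [apply Rabs_pos|apply sin_lipschitz].
      + unfold d. specialize (Rth _ _ HR).
        assert (Rabs (om_of w (a * x) (b * y)) <= B).
        { apply HB. replace (a * x * (b * y)) with (a * b * (x * y)) by ring. rewrite Rabs_mult, (Rabs_right (a * b)) by nra.
          pose proof (Rabs_pos (x * y)). assert (a * b <= 1) by nra. nra. }
        eapply Rle_trans; [apply Rabs_triang|]. rewrite Rabs_Ropp, (Rabs_right (th _ _)) by lra. lra.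
    - intros b _. unfold d, om_of. rewrite !Rmult_0_l, W0, (proj2 (Ax _)). ring.
    - intros a _. unfold d1. rewrite Rmult_0_l, Dx. destruct (om_partials k w (a * x) 0 H) as [D _]. rewrite (du_eq _ _ _ _ D). ring. }
  unfold d in E. rewrite !Rmult_1_l in E. lra.
Qed.

(** Every Amsler surface of angle [k] has the tangents of the model up to one orthogonal matrix. The
    bound on [om_of w] over all of [U] is recorded because it later confines a piece to
    [Omega_k]. *)
Lemma amsler_surface_frame k w U Psi e1 e2 n : 0 < k < PI -> amsler_frame k w e1 e2 n -> Amsler_surface k U Psi ->
  exists o, orthogonal o /\ forall x y, U x y ->
    0 < om_of w x y < PI /\ pu Psi x y = lin o (Pf w e1 e2 x y) /\ pv Psi x y = lin o (Qf w e1 e2 x y).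
Proof.
  intros Hk AF AS. pose proof (af_profile _ _ _ _ _ AF) as H.
  destruct (amsler_surface_chebyshev k U Psi Hk AS) as (th & f1 & f2 & m & Sth & S1 & FF & PQ & Ax & Dx).
  destruct AS as (Uax & Urect & ((HO & SPsi & Im) & GK) & Forms & _).
  assert (E : forall x y, U x y -> th x y = om_of w x y).
  { apply (amsler_angle_unique k w U th H HO Sth Urect).
    - intros x y Hxy. apply (frame_sine_gordon U th f1 f2 m x y HO Sth S1 FF Hxy).
    - intros x y Hxy. apply (PQ x y Hxy).
    - exact Ax.
    - intros t. apply Dx. }
  assert (FF' : frame_field U (om_of w) f1 f2 m).
  { intros x y Hxy. destruct (FF x y Hxy) as [On F3]. split; [exact On|].
    assert (Ed : du th x y = du (om_of w) x y /\ dv th x y = dv (om_of w) x y).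
    { split.
      - symmetry. apply du_eq. apply (has_du_ext_loc th); [apply (locally_2d_of_dom U); assumption|apply (smooth_has_du U); assumption].
      - symmetry. apply dv_eq. apply (has_dv_ext_loc th); [apply (locally_2d_of_dom U); assumption|apply (smooth_has_dv U); assumption]. }
    unfold frame3 in *. rewrite <- (E x y Hxy), <- (proj1 Ed), <- (proj2 Ed). exact F3. }
  destruct (frame_field_rigid U 0 0 (om_of w) e1 e2 n f1 f2 m) as (o & Ho & Eo).
  - apply rigid_rectangular; [apply (Uax 0)|exact Urect].
  - intros x y _. apply (af_field _ _ _ _ _ AF x y I).
  - exact FF'.
  - exists o. split; [exact Ho|]. intros x y Hxy. destruct (PQ x y Hxy) as (R & EP & EQ). destruct (Eo x y Hxy) as (F1 & F2 & _).
    rewrite <- (E x y Hxy). split; [exact R|]. rewrite EP, EQ, <- frP_lin, <- frQ_lin. unfold frP, frQ. rewrite F1, F2, (E x y Hxy). split; reflexivity.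
Qed.

(** * Classification *)

(** At the level of first derivatives: [eta] is [q] times the model net, moved by [o], in the
    coordinates [(phi1, phi2)]. Here [a] and [b] are the derivatives of [phi1] along u and of [phi2]
    along v. *)
Definition net_over (D : dom) (r1 sg : R) (w : R -> R) (q : R) (phi1 phi2 : R -> R -> R) (o : vec * vec * vec) (e1 e2 eta : map3) : Prop :=
  forall u v, D u v -> let x := phi1 u v in let y := phi2 u v in
    Omega_k r1 x y /\ exists a b,
    has_du phi1 u v a /\ has_dv phi1 u v 0 /\ has_du phi2 u v 0 /\ has_dv phi2 u v b /\
    has_du3 eta u v (vscal (q * (beta sg (om_of w x y) / x) * a) (lin o (Qf w e1 e2 x y))) /\
    has_dv3 eta u v (vscal (q * (sg * beta sg (om_of w x y) / y) * b) (lin o (Pf w e1 e2 x y))).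

(** The difference between the net and the transformed model has vanishing partials by the chain
    rule. *)
Lemma net_rigid D u0 v0 r1 sg w q phi1 phi2 o e1 e2 eta eta0 :
  gradient_rigid D u0 v0 -> smooth_map (Omega_k r1) eta0 ->
  (forall x y, Omega_k r1 x y ->
    has_du3 eta0 x y (vscal (beta sg (om_of w x y) / x) (Qf w e1 e2 x y)) /\
    has_dv3 eta0 x y (vscal (sg * beta sg (om_of w x y) / y) (Pf w e1 e2 x y))) ->
  net_over D r1 sg w q phi1 phi2 o e1 e2 eta ->
  exists c, forall u v, D u v -> eta u v = vadd (vscal q (lin o (eta0 (phi1 u v) (phi2 u v)))) c.
Proof.
  intros HD S0 D0 HN.
  set (F := fun u v => vadd (eta u v) (vscal (- q) (lin o (eta0 (phi1 u v) (phi2 u v))))).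
  exists (F u0 v0). intros u v Huv. rewrite <- (rigid_const3 D u0 v0 F HD) with (u := u) (v := v); [|clear u v Huv|exact Huv].
  - unfold F. generalize (eta u v), (lin o (eta0 (phi1 u v) (phi2 u v))). intros. vec_ring.
  - intros u v Huv. destruct (HN u v Huv) as (HO & a & b & A1 & A2 & B1 & B2 & E1 & E2).
    destruct (D0 _ _ HO) as [F1 F2].
    pose proof (chain_du3 (Omega_k r1) eta0 phi1 phi2 u v _ _ (open_Omega r1) S0 HO A1 B1) as C1.
    pose proof (chain_dv3 (Omega_k r1) eta0 phi1 phi2 u v _ _ (open_Omega r1) S0 HO A2 B2) as C2.
    rewrite (pu_eq _ _ _ _ F1), (pv_eq _ _ _ _ F2) in C1, C2.
    split.
    + eapply vderiv_eq; [|apply vderiv_add; [exact E1|apply vderiv_scal_const, vderiv_lin, C1]].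
      rewrite lin_add, !lin_scal. generalize (lin o (Qf w e1 e2 (phi1 u v) (phi2 u v))), (lin o (Pf w e1 e2 (phi1 u v) (phi2 u v))). intros. vec_ring.
    + eapply vderiv_eq; [|apply vderiv_add; [exact E2|apply vderiv_scal_const, vderiv_lin, C2]].
      rewrite lin_add, !lin_scal. generalize (lin o (Qf w e1 e2 (phi1 u v) (phi2 u v))), (lin o (Pf w e1 e2 (phi1 u v) (phi2 u v))). intros. vec_ring.
Qed.

Lemma scaled_net_over sg w r1 lam e1 e2 eta o : 0 < lam ->
  scaled_net sg w r1 lam (fun x y => lin o (e1 x y)) (fun x y => lin o (e2 x y)) eta ->
  net_over (Omega_k r1) r1 sg w 1 (fun u _ => lam * u) (fun _ v => v / lam) o e1 e2 eta.
Proof.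
  intros l0 SN u v Huv. cbv zeta. split; [apply Omega_scale; assumption|]. exists lam, (/ lam).
  destruct (SN u v Huv) as [D1 D2]. rewrite frQ_lin in D1. rewrite frP_lin in D2. destruct Huv as (u0 & v0 & _).
  split; [unfold has_du; auto_derive; [exact I|ring]|]. split; [unfold has_dv; auto_derive; [exact I|ring]|].
  split; [unfold has_du; auto_derive; [exact I|ring]|]. split; [unfold has_dv, Rdiv; auto_derive; [exact I|ring]|].
  rewrite om_scale by exact l0. split; (eapply vderiv_eq; [|first [exact D1|exact D2]]); f_equal; field; lra.
Qed.

Lemma isometry_comp T1 T2 : isometry T1 -> isometry T2 -> isometry (fun v => T1 (T2 v)).
Proof. intros H1 H2 p q. rewrite H1. apply H2. Qed.

Lemma isometry_affine1 o c : orthogonal o -> isometry (fun v => vadd (lin o v) c).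
Proof.
  intros Ho p q. pose proof (isometry_affine o 1 c Ho (or_introl eq_refl) p q) as E. cbv beta in E.
  rewrite !vscal_one in E. exact E.
Qed.

(** Scalings must be positive, so [s = |q|] and a negative sign of [q] is put into the isometry as a
    point reflection. The clause for [q = 1] is what yields a congruence instead of a similarity. *)
Lemma similarity_between q o c o0 c0 : q <> 0 -> orthogonal o -> orthogonal o0 ->
  exists s T, 0 < s /\ isometry T /\ (q = 1 -> s = 1) /\
    forall X, vadd (vscal q (lin o X)) c = T (vscal s (vadd (vscal 1 (lin o0 X)) c0)).
Proof.
  intros q0 Ho Ho0. set (sgn := q / Rabs q). assert (aq : 0 < Rabs q) by (apply Rabs_pos_lt, q0).
  assert (Hs : sgn = 1 \/ sgn = -1).
  { unfold sgn, Rabs. destruct Rcase_abs; [right|left]; field; lra. }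
  exists (Rabs q), (fun v => vadd (vscal sgn (lin o (vadd (lin (transpose o0) v) (lin (transpose o0) (vscal (- Rabs q) c0))))) c).
  split; [exact aq|]. split; [|split].
  - apply (isometry_comp (fun v => vadd (vscal sgn (lin o v)) c) (fun v => vadd (lin (transpose o0) v) (lin (transpose o0) (vscal (- Rabs q) c0)))).
    + apply isometry_affine; assumption.
    + apply isometry_affine1, transpose_orthogonal, Ho0.
  - intros ->. apply Rabs_R1.
  - intros X. rewrite <- lin_add. rewrite vscal_one.
    replace (vadd (vscal (Rabs q) (vadd (lin o0 X) c0)) (vscal (- Rabs q) c0)) with (lin o0 (vscal (Rabs q) X)).
    + rewrite (lin_transpose o0 _ Ho0), lin_scal, vscal_vscal. f_equal. f_equal. unfold sgn. field. lra.
    + rewrite lin_scal. generalize (lin o0 X), (Rabs q). clear. intros. vec_ring.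
Qed.

(** Both nets are moved copies of the same model in the same coordinates [(lam u, v / lam)]. The
    isometry may reverse orientation, so [eps] and [eps'] may differ. *)
Lemma eta_sg_congruent k w W r1 sg lam eps eps' eta eta' : amsler_profile k w -> 0 < k < PI -> W_solution k W -> first_cusp W r1 ->
  is_sign sg -> is_sign eps -> is_sign eps' -> 0 < lam -> eta_sg sg w r1 lam eps eta -> eta_sg sg w r1 lam eps' eta' ->
  exists T, isometry T /\ forall u v, Omega_k r1 u v -> eta' u v = T (eta u v).
Proof.
  intros H Hk HW Hc Hs He He' l0 E E'. destruct (amsler_frame_exists k w H) as (e1 & e2 & n & AF).
  destruct (model_net_exists k w W r1 sg e1 e2 n AF Hk HW Hc Hs) as (eta0 & S0 & D0).
  destruct (eta_sg_scaled_net k w W r1 sg lam eps e1 e2 n eta AF Hk HW Hc Hs He l0 E) as (o & Ho & SN).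
  destruct (eta_sg_scaled_net k w W r1 sg lam eps' e1 e2 n eta' AF Hk HW Hc Hs He' l0 E') as (o' & Ho' & SN').
  assert (r0 : 0 < r1) by (destruct Hc; assumption).
  destruct (net_rigid _ _ _ r1 sg w 1 _ _ o e1 e2 eta eta0 (rigid_Omega r1 r0) S0 D0 (scaled_net_over _ _ _ _ _ _ _ _ l0 SN)) as (c & Ec).
  destruct (net_rigid _ _ _ r1 sg w 1 _ _ o' e1 e2 eta' eta0 (rigid_Omega r1 r0) S0 D0 (scaled_net_over _ _ _ _ _ _ _ _ l0 SN')) as (c' & Ec').
  destruct (similarity_between 1 o' c' o c R1_neq_R0 Ho' Ho) as (s & T & _ & HT & s1 & ET). rewrite (s1 eq_refl) in ET.
  exists T. split; [exact HT|]. intros u v Huv. rewrite (Ec u v Huv), (Ec' u v Huv), ET. f_equal. apply vscal_one.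
Qed.

(** * Restriction to subdomains *)

Lemma K_surface_of_sub (Om D : dom) eta psi E1 E3 : open_dom D -> (forall u v, D u v -> Om u v) ->
  K_surface_of Om eta psi E1 E3 -> K_surface_of D eta psi E1 E3.
Proof.
  intros HO Sub (((_ & Sp & Ip) & GK) & ((S1 & S2) & (S3 & S4) & Fr) & (xi & Sx & Dx) & Z).
  split; [|split; [|split]].
  - split; [split; [exact HO|split; [apply (smooth_map_sub Om D _ Sub Sp)|auto]]|auto].
  - split; [split; apply (smooth_sub Om D _ Sub); assumption|]. split; [split; apply (smooth_sub Om D _ Sub); assumption|]. auto.
  - exists xi. split; [apply (smooth_map_sub Om D _ Sub Sx)|auto].
  - auto.
Qed.

Lemma V_net_sub (Om D : dom) eta : open_dom D -> (forall u v, D u v -> Om u v) -> V_net Om eta -> V_net D eta.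
Proof. intros HO Sub ((_ & Se & Ie) & V). split; [split; [exact HO|split; [apply (smooth_map_sub Om D _ Sub Se)|auto]]|auto]. Qed.

Lemma Amsler_piece_sub k (Om D : dom) psi phi1 phi2 : (forall u v, D u v -> Om u v) ->
  Amsler_piece k Om psi phi1 phi2 -> Amsler_piece k D psi phi1 phi2.
Proof.
  intros Sub (U & Psi & AS & S1 & S2 & P). exists U, Psi. split; [exact AS|].
  split; [apply (smooth_sub Om D _ Sub S1)|]. split; [apply (smooth_sub Om D _ Sub S2)|auto].
Qed.

Lemma alignment_sub s (Om D : dom) eta psi E1 E3 : (forall u v, D u v -> Om u v) ->
  alignment s Om eta psi E1 E3 -> alignment s D eta psi E1 E3.
Proof.
  intros Sub (th1 & th3 & b & c & ((S1 & S2) & (S3 & S4) & Du) & Sb & Sc & A).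
  exists th1, th3, b, c. split; [split; [split; apply (smooth_sub Om D _ Sub); assumption|split; [split; apply (smooth_sub Om D _ Sub); assumption|auto]]|].
  split; [apply (smooth_sub Om D _ Sub Sb)|]. split; [apply (smooth_sub Om D _ Sub Sc)|auto].
Qed.

Lemma second_kind_sub sg k (Om D : dom) eta : open_dom D -> (forall u v, D u v -> Om u v) -> second_kind sg k Om eta -> second_kind sg k D eta.
Proof.
  intros HO Sub (V & psi & E1 & E3 & phi1 & phi2 & KS & AP & CF & AL).
  split; [apply (V_net_sub Om D); assumption|]. exists psi, E1, E3, phi1, phi2.
  split; [apply (K_surface_of_sub Om D); assumption|]. split; [apply (Amsler_piece_sub k Om D); assumption|].
  split; [intros u v H; apply CF, Sub, H|apply (alignment_sub sg Om D); assumption].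
Qed.

(* The scalar content of [eta_uv = eta_vu] and of the alignment condition [Cv = sg Bu]. *)
Lemma alignment_solve sg cs sn Cv Bu A A' : sg * sg = 1 -> sn <> 0 ->
  Cv = sg * Bu -> Cv * cs - A * sn = Bu -> Cv = Bu * cs - A' * sn ->
  A = sg * A' /\ Bu * (1 - sg * cs) = - A * sn /\ Cv * (1 - sg * cs) = - sg * A * sn.
Proof.
  intros ss s0 -> E1 E2.
  assert (Z : (A - sg * A') * sn = 0).
  { assert (E3 : sg * (sg * Bu) = sg * (Bu * cs - A' * sn)) by (rewrite E2; reflexivity).
    assert (E4 : sg * (sg * Bu) = Bu) by (rewrite <- Rmult_assoc, ss; ring). lra. }
  apply Rmult_integral in Z. destruct Z as [Z|Z]; [|contradiction].
  split; [lra|]. split; [lra|].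
  replace (sg * Bu * (1 - sg * cs)) with (sg * (Bu * (1 - sg * cs))) by ring.
  replace (Bu * (1 - sg * cs)) with (- A * sn) by lra. ring.
Qed.

(** Reduces an aligned net to the model: the local factor [c phi1 / beta] turns out to have
    vanishing gradient, and its constant value is the scaling [q]. *)
Lemma second_kind_net k w W r1 sg D u0 v0 eta e1 e2 n : 0 < k < PI -> W_solution k W -> first_cusp W r1 ->
  amsler_frame k w e1 e2 n -> is_sign sg -> gradient_rigid D u0 v0 -> second_kind sg k D eta ->
  exists q o phi1 phi2, q <> 0 /\ orthogonal o /\ smooth D phi1 /\ smooth D phi2 /\
    (forall u v, D u v -> du phi1 u v <> 0 /\ dv phi2 u v <> 0) /\
    net_over D r1 sg w q phi1 phi2 o e1 e2 eta.
Proof.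
  intros Hk HW Hc AF Hs HD (((HO & Se & Ie) & _) & psi & E1 & E3 & phi1 & phi2 & KS & (U & Psi & AS & S1 & S2 & HP) & CF & (th1 & th3 & b & c & (_ & _ & Du) & Sb & Sc & AL)).
  pose proof (af_profile _ _ _ _ _ AF) as H. pose proof (is_sign_sq sg Hs) as ss.
  destruct KS as (_ & _ & _ & Zr).
  destruct (amsler_surface_frame k w U Psi e1 e2 n Hk AF AS) as (o & Ho & HPsi).
  destruct AS as (_ & Urect & ((OU & SPsi & _) & _) & _).
  set (om := fun u v => om_of w (phi1 u v) (phi2 u v)).
  assert (Rom : forall u v, D u v -> 0 < om u v < PI) by (intros u v Huv; apply HPsi, HP, Huv).
  (* A point beyond the first cusp curve would, by the rectangle property, put a point with
     [x y = r1^2 / 4] into [U]; there [om = PI], which is excluded on an Amsler surface. *)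
  assert (OmK : forall u v, D u v -> Omega_k r1 (phi1 u v) (phi2 u v)).
  { intros u v Huv. destruct (HP u v Huv) as (p1 & p2 & pU & _). split; [exact p1|]. split; [exact p2|].
    destruct (Rlt_dec (4 * phi1 u v * phi2 u v) (r1 ^ 2)) as [L|L]; [exact L|exfalso].
    destruct Hc as (r0 & Wr & _).
    set (z := phi1 u v * phi2 u v). assert (z0 : 0 < z) by (unfold z; nra).
    assert (Hz : r1 ^ 2 <= 4 * z) by (unfold z; lra).
    assert (Ha : 0 <= r1 ^ 2 / 4 / z <= 1).
    { split; [apply Rdiv_le_0_compat; nra|]. apply (Rmult_le_reg_r z); [exact z0|]. unfold Rdiv. rewrite Rmult_assoc, Rinv_l; lra. }
    pose proof (Urect _ _ _ 1 pU Ha ltac:(lra)) as pU'. destruct (HPsi _ _ pU') as (Rn & _).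
    unfold om_of in Rn. replace (r1 ^ 2 / 4 / z * phi1 u v * (1 * phi2 u v)) with (r1 ^ 2 / 4) in Rn.
    - rewrite <- (profile_unique k w W H HW) in Rn by nra. replace (4 * (r1 ^ 2 / 4)) with (r1 ^ 2) in Rn by field.
      rewrite sqrt_pow2 in Rn by lra. lra.
    - transitivity (r1 ^ 2 / 4 / z * z); [field; lra|unfold z; ring]. }
  (* [E1] points along u and [E3] along v, so the canonical frame forces [phi1] to depend on u only
     and [phi2] on v only, with [th1 = d phi1] and [th3 = d phi2]. *)
  assert (Loc : forall u v, D u v -> fst (E1 u v) * du phi1 u v = 1 /\ du phi2 u v = 0 /\ dv phi1 u v = 0 /\ snd (E3 u v) * dv phi2 u v = 1 /\
     fst (th1 u v) = du phi1 u v /\ snd (th1 u v) = 0 /\ fst (th3 u v) = 0 /\ snd (th3 u v) = dv phi2 u v).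
  { intros u v Huv. destruct (CF u v Huv) as (C1 & C2 & C3 & C4). destruct (Zr u v Huv) as [Z1 Z3]. destruct (Du u v Huv) as (D1 & D2 & D3 & D4).
    unfold pairing in *. cbn [fst snd] in *. rewrite Z1, ?Rmult_0_r, ?Rplus_0_r in C1, C2, D1, D3. rewrite Z3, ?Rmult_0_r, ?Rplus_0_l in C3, C4, D2, D4.
    assert (n1 : fst (E1 u v) <> 0) by (intros Z; rewrite Z in C1; lra). assert (n3 : snd (E3 u v) <> 0) by (intros Z; rewrite Z in C4; lra).
    split; [lra|]. split; [apply (Rmult_eq_reg_r (fst (E1 u v))); lra|]. split; [apply (Rmult_eq_reg_r (snd (E3 u v))); lra|]. split; [lra|].
    split; [apply (Rmult_eq_reg_r (fst (E1 u v))); lra|]. split; [apply (Rmult_eq_reg_r (snd (E3 u v))); lra|].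
    split; [apply (Rmult_eq_reg_r (fst (E1 u v))); lra|apply (Rmult_eq_reg_r (snd (E3 u v))); lra]. }
  assert (Hphi : forall u v, D u v -> has_du phi1 u v (du phi1 u v) /\ has_dv phi1 u v 0 /\ has_du phi2 u v 0 /\ has_dv phi2 u v (dv phi2 u v)).
  { intros u v Huv. destruct (Loc u v Huv) as (_ & L2 & L3 & _). split; [apply (smooth_has_du D); assumption|].
    split; [rewrite <- L3; apply (smooth_has_dv D); assumption|]. split; [rewrite <- L2; apply (smooth_has_du D); assumption|apply (smooth_has_dv D); assumption]. }
  assert (dphi0 : forall u v, D u v -> du phi1 u v <> 0 /\ dv phi2 u v <> 0).
  { intros u v Huv. destruct (Loc u v Huv) as (L1 & _ & _ & L4 & _). split; intros Z; rewrite Z in *; lra. }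
  set (Ph := fun u v => lin o (Pf w e1 e2 (phi1 u v) (phi2 u v))). set (Qh := fun u v => lin o (Qf w e1 e2 (phi1 u v) (phi2 u v))).
  assert (dpsi : forall u v, D u v -> diff psi u v (E1 u v) = Ph u v /\ diff psi u v (E3 u v) = Qh u v).
  { intros u v Huv. destruct (HP u v Huv) as (_ & _ & pU & _). destruct (HPsi _ _ pU) as (_ & PP & PQ).
    destruct (Hphi u v Huv) as (A1 & A2 & A3 & A4). destruct (Loc u v Huv) as (L1 & _ & _ & L4 & _). destruct (Zr u v Huv) as [Z1 Z3].
    assert (Epsi : forall x y, D x y -> Psi (phi1 x y) (phi2 x y) = psi x y) by (intros x y Hxy; symmetry; apply (HP x y Hxy)).
    pose proof (chain_du3 U Psi phi1 phi2 u v _ _ OU SPsi pU A1 A3) as C1. pose proof (chain_dv3 U Psi phi1 phi2 u v _ _ OU SPsi pU A2 A4) as C2.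
    apply (has_du3_ext D _ psi u v _ HO Huv Epsi) in C1. apply (has_dv3_ext D _ psi u v _ HO Huv Epsi) in C2.
    unfold diff. rewrite (pu_eq _ _ _ _ C1), (pv_eq _ _ _ _ C2), Z1, Z3, PP, PQ. fold (Ph u v) (Qh u v).
    generalize dependent (fst (E1 u v)). intros x1 Lx. generalize dependent (snd (E3 u v)). intros y3 Ly.
    generalize (Ph u v), (Qh u v). clear - Lx Ly. intros p q. split.
    - transitivity (vscal (x1 * du phi1 u v) p); [vec_ring|]. rewrite Lx. apply vscal_one.
    - transitivity (vscal (y3 * dv phi2 u v) q); [vec_ring|]. rewrite Ly. apply vscal_one. }
  set (C := fun u v => c u v * du phi1 u v). set (B := fun u v => b u v * dv phi2 u v).
  assert (deta : forall u v, D u v -> pu eta u v = vscal (C u v) (Qh u v) /\ pv eta u v = vscal (B u v) (Ph u v)).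
  { intros u v Huv. destruct (AL u v Huv) as (_ & _ & X & _). destruct (dpsi u v Huv) as [X1 X3]. destruct (Loc u v Huv) as (_ & _ & _ & _ & L5 & L6 & L7 & L8).
    pose proof (X (1, 0)) as Xu. pose proof (X (0, 1)) as Xv. unfold diff at 1 in Xu. unfold diff at 1 in Xv. rewrite X1, X3 in Xu, Xv.
    unfold pairing in Xu, Xv. cbn [fst snd] in Xu, Xv. rewrite L5, L6, L7, L8 in Xu, Xv. unfold C, B. clear X X1 X3 dpsi.
    generalize dependent (pu eta u v). intros pe Xu. generalize dependent (pv eta u v). intros qe Xv. generalize dependent (Ph u v). generalize dependent (Qh u v).
    clear. intros q p Xu Xv. split.
    - transitivity (vadd (vscal 1 pe) (vscal 0 qe)); [vec_ring|]. rewrite Xu. vec_ring.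
    - transitivity (vadd (vscal 0 pe) (vscal 1 qe)); [vec_ring|]. rewrite Xv. vec_ring. }
  assert (SC : smooth D C) by (apply smooth_mult; [exact HO|exact Sc|apply smooth_du, S1]).
  assert (SB : smooth D B) by (apply smooth_mult; [exact HO|exact Sb|apply smooth_dv, S2]).
  assert (Al : forall u v, D u v -> dv C u v = sg * du B u v).
  { intros u v Huv. destruct (AL u v Huv) as (_ & _ & _ & X). unfold dform, fscal in X. cbn [fst snd] in X.
    assert (T1 : du (fun x y => c x y * snd (th1 x y)) u v = 0).
    { apply du_eq. apply (has_du_const_on D _ 0 u v HO Huv). intros x y Hxy. destruct (Loc x y Hxy) as (_ & _ & _ & _ & _ & L6 & _). rewrite L6. ring. }
    assert (T2 : dv (fun x y => b x y * fst (th3 x y)) u v = 0).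
    { apply dv_eq. apply (has_dv_const_on D _ 0 u v HO Huv). intros x y Hxy. destruct (Loc x y Hxy) as (_ & _ & _ & _ & _ & _ & L7 & _). rewrite L7. ring. }
    assert (T3 : dv (fun x y => c x y * fst (th1 x y)) u v = dv C u v).
    { apply dv_eq. apply (has_dv_ext_loc C); [|apply (smooth_has_dv D); assumption].
      apply (locally_2d_of_dom D); [exact HO| |exact Huv]. intros x y Hxy. unfold C. destruct (Loc x y Hxy) as (_ & _ & _ & _ & L5 & _). rewrite L5. reflexivity. }
    assert (T4 : du (fun x y => b x y * snd (th3 x y)) u v = du B u v).
    { apply du_eq. apply (has_du_ext_loc B); [|apply (smooth_has_du D); assumption].
      apply (locally_2d_of_dom D); [exact HO| |exact Huv]. intros x y Hxy. unfold B. destruct (Loc x y Hxy) as (_ & _ & _ & _ & _ & _ & _ & L8). rewrite L8. reflexivity. }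
    rewrite T1, T2, T3, T4 in X. lra. }
  assert (OP := open_plane).
  destruct (smooth_PQ (om_of w) e1 e2 (smooth_om k w H) (af_e1 _ _ _ _ _ AF) (af_e2 _ _ _ _ _ AF)) as [SPf SQf].
  (* Pairing [eta_uv = eta_vu] with [P] and with [Q] leaves the two scalar equations of
     [alignment_solve]; [A] and [A'] come from the turning of [Q] along v and of [P] along u. *)
  assert (Main : forall u v, D u v -> let w' := Derive w (phi1 u v * phi2 u v) in let A := C u v * dv phi2 u v * (phi1 u v * w') in
     let A' := B u v * du phi1 u v * (phi2 u v * w') in
     A = sg * A' /\ du B u v * (1 - sg * cos (om u v)) = - A * sin (om u v) /\ dv C u v * (1 - sg * cos (om u v)) = - sg * A * sin (om u v)).
  { intros u v Huv w' A A'. destruct (Hphi u v Huv) as (A1 & A2 & A3 & A4).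
    destruct (amsler_frame_PQ _ _ _ _ _ AF (phi1 u v) (phi2 u v)) as (P1 & P2 & Q1 & Q2).
    pose proof (vderiv_lin o _ _ _ (chain_du3 plane _ phi1 phi2 u v _ _ OP SPf I A1 A3)) as C1.
    pose proof (vderiv_lin o _ _ _ (chain_dv3 plane _ phi1 phi2 u v _ _ OP SQf I A2 A4)) as C2.
    rewrite (pu_eq _ _ _ _ P1), (pv_eq _ _ _ _ P2) in C1. rewrite (pu_eq _ _ _ _ Q1), (pv_eq _ _ _ _ Q2) in C2.
    fold w' in C1, C2. fold (om u v) in C1, C2.
    assert (X1 : pv (pu eta) u v = vadd (vscal (dv C u v) (Qh u v)) (vscal (C u v) (pv Qh u v))).
    { apply pv_eq. apply (has_dv3_ext D (fun u v => vscal (C u v) (Qh u v))); [exact HO|exact Huv|intros x y Hxy; symmetry; apply (deta x y Hxy)|].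
      rewrite (pv_eq _ _ _ _ C2). apply (vderiv_scal (fun v => C u v) (fun v => Qh u v)); [apply (smooth_has_dv D); assumption|exact C2]. }
    assert (X2 : pu (pv eta) u v = vadd (vscal (du B u v) (Ph u v)) (vscal (B u v) (pu Ph u v))).
    { apply pu_eq. apply (has_du3_ext D (fun u v => vscal (B u v) (Ph u v))); [exact HO|exact Huv|intros x y Hxy; symmetry; apply (deta x y Hxy)|].
      rewrite (pu_eq _ _ _ _ C1). apply (vderiv_scal (fun u => B u v) (fun u => Ph u v)); [apply (smooth_has_du D); assumption|exact C1]. }
    pose proof (smooth_map_schwarz D eta u v HO Se Huv) as Sz.
    rewrite (pv_eq _ _ _ _ C2) in X1. rewrite (pu_eq _ _ _ _ C1) in X2. rewrite X1, X2 in Sz.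
    destruct (af_field _ _ _ _ _ AF (phi1 u v) (phi2 u v) I) as [On _].
    destruct (frame_PQ_gram (om_of w) e1 e2 n _ _ On) as (G1 & G2 & G3 & _). fold (om u v) in G3.
    destruct On as (Haa & Hbb & Hcc & Hab & Hac & Hbc).
    set (p := Pf w e1 e2 (phi1 u v) (phi2 u v)) in *. set (q := Qf w e1 e2 (phi1 u v) (phi2 u v)) in *.
    assert (EP : p = vadd (vscal (cos (om u v / 2)) (e1 (phi1 u v) (phi2 u v))) (vscal (- sin (om u v / 2)) (e2 (phi1 u v) (phi2 u v)))) by reflexivity.
    assert (EQ : q = vadd (vscal (cos (om u v / 2)) (e1 (phi1 u v) (phi2 u v))) (vscal (sin (om u v / 2)) (e2 (phi1 u v) (phi2 u v)))) by reflexivity.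
    set (J1 := vadd (vscal (sin (om u v / 2)) (e1 (phi1 u v) (phi2 u v))) (vscal (cos (om u v / 2)) (e2 (phi1 u v) (phi2 u v)))) in *.
    set (J2 := vadd (vscal (- sin (om u v / 2)) (e1 (phi1 u v) (phi2 u v))) (vscal (cos (om u v / 2)) (e2 (phi1 u v) (phi2 u v)))) in *.
    assert (j1p : dot J1 p = 0) by (rewrite EP; unfold J1; rewrite dot_comb2 by assumption; ring).
    assert (j2q : dot J2 q = 0) by (rewrite EQ; unfold J2; rewrite dot_comb2 by assumption; ring).
    assert (j1q : dot J1 q = sin (om u v)) by (rewrite EQ; unfold J1; rewrite dot_comb2, (sin_half (om u v)) by assumption; ring).
    assert (j2p : dot J2 p = - sin (om u v)) by (rewrite EP; unfold J2; rewrite dot_comb2, (sin_half (om u v)) by assumption; ring).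
    change (Qh u v) with (lin o q) in Sz. change (Ph u v) with (lin o p) in Sz. rewrite <- !lin_scal, <- !lin_add in Sz.
    pose proof (f_equal (fun z => dot z (lin o p)) Sz) as ZP. pose proof (f_equal (fun z => dot z (lin o q)) Sz) as ZQ. cbv beta in ZP, ZQ.
    rewrite !(lin_dot o) in ZP, ZQ by exact Ho.
    rewrite !dot_vadd_l, !dot_vscal_l, ?dot_vadd_l, ?dot_vscal_l, (dot_comm q p), G1, G3, j1p, j2p in ZP.
    rewrite !dot_vadd_l, !dot_vscal_l, ?dot_vadd_l, ?dot_vscal_l, G2, G3, j1q, j2q in ZQ.
    pose proof (Rom u v Huv) as Rn. pose proof (sin_gt_0 _ (proj1 Rn) (proj2 Rn)) as s0.
    apply alignment_solve; [exact ss|lra|apply Al, Huv| |]; unfold A, A'; lra. }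
  assert (w0 : forall u v, D u v -> 0 < Derive w (phi1 u v * phi2 u v)).
  { intros u v Huv. apply (Omega_range k w W r1 (phi1 u v) (phi2 u v) H Hk HW Hc (OmK u v Huv)). }
  (* [A = sg A'] after cancelling the nonzero derivatives of the coordinates and [w'], which is
     positive on [Omega_k]. *)
  assert (Rel : forall u v, D u v -> c u v * phi1 u v = sg * (b u v * phi2 u v)).
  { intros u v Huv. destruct (Main u v Huv) as (M1 & _). destruct (dphi0 u v Huv) as [n1 n2]. specialize (w0 u v Huv). cbv zeta in M1. unfold C, B in M1.
    apply (Rmult_eq_reg_l (du phi1 u v * dv phi2 u v * Derive w (phi1 u v * phi2 u v))).
    - lra.
    - apply Rmult_integral_contrapositive_currified; [apply Rmult_integral_contrapositive_currified; assumption|lra]. }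
  set (h := fun u v => (1 - sg * cos (om u v)) / 2).
  assert (hb : forall u v, D u v -> h u v * beta sg (om u v) = 1).
  { intros u v Huv. pose proof (beta_den_pos sg _ Hs (Rom u v Huv)). unfold h, beta. field. lra. }
  (* [h] is the reciprocal of [beta], so [q] is the factor by which the net differs from the
     model. *)
  set (q := fun u v => c u v * phi1 u v * h u v).
  assert (Dom : forall u v, D u v -> has_du om u v (du phi1 u v * (phi2 u v * Derive w (phi1 u v * phi2 u v))) /\ has_dv om u v (dv phi2 u v * (phi1 u v * Derive w (phi1 u v * phi2 u v)))).
  { intros u v Huv. destruct (Hphi u v Huv) as (A1 & A2 & A3 & A4). split.
    - unfold has_du. evar_last.
      + apply (is_derive_comp w (fun u => phi1 u v * phi2 u v)); [apply (profile_derive k w H)|].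
        apply (is_derive_mult (fun u => phi1 u v) (fun u => phi2 u v)); [exact A1|exact A3|intros; apply Rmult_comm].
      + unfold plus, mult, scal; simpl; unfold mult; simpl. ring.
    - unfold has_dv. evar_last.
      + apply (is_derive_comp w (fun v => phi1 u v * phi2 u v)); [apply (profile_derive k w H)|].
        apply (is_derive_mult (fun v => phi1 u v) (fun v => phi2 u v)); [exact A2|exact A4|intros; apply Rmult_comm].
      + unfold plus, mult, scal; simpl; unfold mult; simpl. ring. }
  assert (Dh : forall (f : R -> R) t l, is_derive f t l -> is_derive (fun t => (1 - sg * cos (f t)) / 2) t (sg * sin (f t) * l / 2)).
  { intros f t l Df. evar_last; [apply (is_derive_comp (fun z => (1 - sg * cos z) / 2) f); [auto_derive; [exact I|reflexivity]|exact Df]|].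
    unfold scal; simpl; unfold mult; simpl. field. }
  assert (Dq : forall u v, D u v -> has_du q u v 0 /\ has_dv q u v 0).
  { intros u v Huv. destruct (Main u v Huv) as (M1 & M2 & M3). cbv zeta in M1, M2, M3. destruct (Hphi u v Huv) as (A1 & A2 & A3 & A4).
    destruct (Dom u v Huv) as [Ou Ov]. destruct (dphi0 u v Huv) as [n1 n2].
    pose proof (Dh _ _ _ Ou) as Hu. pose proof (Dh _ _ _ Ov) as Hv.
    pose proof (smooth_has_dv _ _ u v Sc Huv) as Dc. pose proof (smooth_has_du _ _ u v Sb Huv) as Db.
    assert (EC : dv C u v = dv c u v * du phi1 u v).
    { apply dv_eq. unfold has_dv. evar_last.
      - apply (is_derive_mult (fun v => c u v) (fun v => du phi1 u v)); [exact Dc| |intros; apply Rmult_comm].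
        apply (smooth_has_dv D (du phi1)); [apply smooth_du, S1|exact Huv].
      - rewrite (smooth_schwarz D phi1 u v HO S1 Huv).
        rewrite (du_eq (dv phi1) u v 0) by (apply (has_du_const_on D _ 0 u v HO Huv); intros x y Hxy; apply (Loc x y Hxy)).
        unfold plus, mult; simpl. ring. }
    assert (EB : du B u v = du b u v * dv phi2 u v).
    { apply du_eq. unfold has_du. evar_last.
      - apply (is_derive_mult (fun u => b u v) (fun u => dv phi2 u v)); [exact Db| |intros; apply Rmult_comm].
        apply (smooth_has_du D (dv phi2)); [apply smooth_dv, S2|exact Huv].
      - rewrite <- (smooth_schwarz D phi2 u v HO S2 Huv).
        rewrite (dv_eq (du phi2) u v 0) by (apply (has_dv_const_on D _ 0 u v HO Huv); intros x y Hxy; apply (Loc x y Hxy)).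
        unfold plus, mult; simpl. ring. }
    set (w' := Derive w (phi1 u v * phi2 u v)) in *. change (C u v) with (c u v * du phi1 u v) in M1, M2, M3. change (B u v) with (b u v * dv phi2 u v) in M1.
    split.
    (* Only [C_v] and [B_u] are under control. For the u-derivative, [q] is therefore rewritten
       through [Rel] in terms of [b]; the v-derivative uses [c]. *)
    - apply (has_du_ext_loc (fun u v => sg * (b u v * phi2 u v) * h u v)).
      + apply (locally_2d_of_dom D); [exact HO| |exact Huv]. intros x y Hxy. unfold q. rewrite (Rel x y Hxy). reflexivity.
      + unfold has_du. evar_last.
        * apply (is_derive_mult (fun u => sg * (b u v * phi2 u v)) (fun u => h u v)); [|exact Hu|intros; apply Rmult_comm].
          apply (is_derive_scal (fun u => b u v * phi2 u v)). apply (is_derive_mult (fun u => b u v) (fun u => phi2 u v)); [exact Db|exact A3|intros; apply Rmult_comm].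
        * unfold plus, mult, scal; simpl; unfold mult; simpl.
          apply (Rmult_eq_reg_r (dv phi2 u v)); [|exact n2]. rewrite Rmult_0_l.
          transitivity (sg * phi2 u v / 2 * (du b u v * dv phi2 u v * (1 - sg * cos (om u v)) + sg * (b u v * dv phi2 u v * du phi1 u v * (phi2 u v * w')) * sin (om u v))).
          -- unfold h. field.
          -- rewrite <- EB, M2, <- M1. ring.
    - unfold has_dv, q. evar_last.
      + apply (is_derive_mult (fun v => c u v * phi1 u v) (fun v => h u v)); [|exact Hv|intros; apply Rmult_comm].
        apply (is_derive_mult (fun v => c u v) (fun v => phi1 u v)); [exact Dc|exact A2|intros; apply Rmult_comm].
      + unfold plus, mult, scal; simpl; unfold mult; simpl.
        apply (Rmult_eq_reg_r (du phi1 u v)); [|exact n1]. rewrite Rmult_0_l.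
        transitivity (phi1 u v / 2 * (dv c u v * du phi1 u v * (1 - sg * cos (om u v)) + sg * (c u v * du phi1 u v * dv phi2 u v * (phi1 u v * w')) * sin (om u v))).
        * unfold h. field.
        * rewrite <- EC, M3. ring. }
  exists (q u0 v0), o, phi1, phi2.
  assert (Hq : forall u v, D u v -> q u v = q u0 v0) by (apply (proj2 HD); exact Dq).
  split; [|split; [exact Ho|split; [exact S1|split; [exact S2|split; [exact dphi0|]]]]].
  - destruct HD as [H0 _]. destruct (AL u0 v0 H0) as (_ & c0 & _). destruct (HP u0 v0 H0) as (p1 & _). pose proof (hb u0 v0 H0) as hb0.
    unfold q. apply Rmult_integral_contrapositive_currified; [apply Rmult_integral_contrapositive_currified; [exact c0|lra]|].
    intros Z. rewrite Z in hb0. lra.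
  - intros u v Huv. cbv zeta. split; [apply OmK, Huv|]. exists (du phi1 u v), (dv phi2 u v).
    destruct (Hphi u v Huv) as (A1 & A2 & A3 & A4). do 4 (split; [assumption|]).
    destruct (HP u v Huv) as (p1 & p2 & _). pose proof (hb u v Huv) as hb0. rewrite <- (Hq u v Huv). destruct (deta u v Huv) as [E1' E2'].
    fold (om u v). fold (Qh u v) (Ph u v). split.
    + replace (q u v * (beta sg (om u v) / phi1 u v) * du phi1 u v) with (C u v).
      * rewrite <- E1'. apply (smooth_map_has_du3 D); assumption.
      * unfold q, C. transitivity (c u v * (h u v * beta sg (om u v)) * du phi1 u v); [rewrite hb0; ring|field; lra].
    + replace (q u v * (sg * beta sg (om u v) / phi2 u v) * dv phi2 u v) with (B u v).
      * rewrite <- E2'. apply (smooth_map_has_dv3 D); assumption.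
      * unfold q, B. rewrite (Rel u v Huv). transitivity (b u v * (h u v * beta sg (om u v)) * dv phi2 u v); [rewrite hb0; ring|].
        transitivity (sg * sg * (b u v * (h u v * beta sg (om u v)) * dv phi2 u v)); [rewrite ss; ring|field; lra].
Qed.

Lemma smooth_ex_derive_n_x (D : dom) f n u v : open_dom D -> smooth D f -> D u v -> ex_derive_n (fun x => f x v) n u.
Proof.
  intros HO Sf H.
  assert (HJ : forall t, D t v -> locally t (fun t => D t v)) by (intros t Ht; apply (locally_of_2d_x D), HO, Ht).
  assert (HO' : open_dom (fun u _ => D u v)).
  { intros x y Hx. destruct (HJ x Hx) as [d Hd]. exists d. intros p q Hp _. apply Hd, Hp. }
  apply (smooth1_of_smooth (fun t => D t v) (fun x => f x v) HJ); [|exact H].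
  apply (smooth_comp2 _ D f (fun x _ => x) (fun _ _ => v)); smooth_tac. intros x y Hx; exact Hx.
Qed.

Lemma smooth_ex_derive_n_y (D : dom) f n u v : open_dom D -> smooth D f -> D u v -> ex_derive_n (fun y => f u y) n v.
Proof.
  intros HO Sf H. apply (smooth_ex_derive_n_x (swap_dom D) (fun x y => f y x) n v u (open_swap D HO) (smooth_swap D f HO Sf) H).
Qed.

(** Both the given net and [eta0] are compared with the model net in canonical coordinates;
    eliminating the model leaves a similarity and a coordinate change. *)
Lemma second_kind_equivalent k w W r1 sg lam eps Om D eta eta0 : 0 < k < PI -> amsler_profile k w -> W_solution k W -> first_cusp W r1 ->
  is_sign sg -> is_sign eps -> 0 < lam -> second_kind sg k Om eta -> net_domain D -> (forall u v, D u v -> Om u v) ->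
  eta_sg sg w r1 lam eps eta0 -> equivalent_to_piece_of D eta (Omega_k r1) eta0.
Proof.
  intros Hk H HW Hc Hs He l0 SK (HO & HC & Hv & Hu) Sub E0.
  destruct (classic (exists u v, D u v)) as [(u0 & v0 & H0)|Emp].
  (* On an empty [D] the pointwise claim is vacuous, and any data will do; the main argument needs a
     base point. *)
  2:{ exists (fun _ => 0), (fun _ => 0), 1, (fun v => v). split; [lra|]. split; [intros p q; reflexivity|].
      intros u v Huv. exfalso. apply Emp. exists u, v. exact Huv. }
  pose proof (rigid_connected D u0 v0 HO HC H0) as HR.
  destruct (amsler_frame_exists k w H) as (e1 & e2 & n & AF).
  destruct (model_net_exists k w W r1 sg e1 e2 n AF Hk HW Hc Hs) as (mo & Smo & Dmo).
  destruct (second_kind_net k w W r1 sg D u0 v0 eta e1 e2 n Hk HW Hc AF Hs HR (second_kind_sub sg k Om D eta HO Sub SK))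
    as (q & o & phi1 & phi2 & q0 & Ho & S1 & S2 & dphi & NO).
  destruct (net_rigid D u0 v0 r1 sg w q phi1 phi2 o e1 e2 eta mo HR Smo Dmo NO) as (c & Ec).
  destruct (eta_sg_scaled_net k w W r1 sg lam eps e1 e2 n eta0 AF Hk HW Hc Hs He l0 E0) as (o0 & Ho0 & SN).
  assert (r0 : 0 < r1) by (destruct Hc; assumption).
  destruct (net_rigid _ _ _ r1 sg w 1 _ _ o0 e1 e2 eta0 mo (rigid_Omega r1 r0) Smo Dmo (scaled_net_over _ _ _ _ _ _ _ _ l0 SN)) as (c0 & Ec0).
  (* [phi1] is constant on each vertical slice of [D], which is an interval by [net_domain]; [f]
     picks this value, and [0] over an empty slice. *)
  assert (F1 : exists f, forall u v, D u v -> phi1 u v = f u).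
  { assert (X : forall u, exists r, forall v, D u v -> phi1 u v = r).
    { intros u. destruct (classic (exists v, D u v)) as [(v1 & H1)|N].
      - exists (phi1 u v1). intros v Huv. apply (const_on_segment (fun v => phi1 u v)). intros t Ht.
        destruct (NO u t) as (_ & a & b & _ & A2 & _); [|exact A2].
        destruct (Rle_dec v v1) as [L|L]; [rewrite Rmin_left, Rmax_right in Ht by lra; apply (Hv u v v1)|rewrite Rmin_right, Rmax_left in Ht by lra; apply (Hv u v1 v)]; assumption.
      - exists 0. intros v Huv. exfalso. apply N. exists v. exact Huv. }
    apply functional_choice in X. destruct X as [f Hf]. exists f. intros u v Huv. apply Hf, Huv. }
  assert (F2 : exists g, forall u v, D u v -> phi2 u v = g v).
  { assert (X : forall v, exists r, forall u, D u v -> phi2 u v = r).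
    { intros v. destruct (classic (exists u, D u v)) as [(u1 & H1)|N].
      - exists (phi2 u1 v). intros u Huv. apply (const_on_segment (fun u => phi2 u v)). intros t Ht.
        destruct (NO t v) as (_ & a & b & _ & _ & A3 & _); [|exact A3].
        destruct (Rle_dec u u1) as [L|L]; [rewrite Rmin_left, Rmax_right in Ht by lra; apply (Hu u u1)|rewrite Rmin_right, Rmax_left in Ht by lra; apply (Hu u1 u)]; assumption.
      - exists 0. intros u Huv. exfalso. apply N. exists u. exact Huv. }
    apply functional_choice in X. destruct X as [g Hg]. exists g. intros u v Huv. apply Hg, Huv. }
  destruct F1 as [f Hf], F2 as [g Hg].
  destruct (similarity_between q o c o0 c0 q0 Ho Ho0) as (s & T & s0 & HT & _ & ET).
  (* [eta0] is the model in the coordinates [(lam u, v / lam)], so the canonical coordinates have to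
     be rescaled by [1 / lam] and [lam]. *)
  exists (fun u => / lam * f u), (fun v => lam * g v), s, T. split; [exact s0|]. split; [exact HT|].
  intros u v Huv.
  assert (Lx : locally u (fun x => / lam * phi1 x v = / lam * f x)).
  { apply (locally_of_2d_x (fun x y => / lam * phi1 x y = / lam * f x)). apply (locally_2d_of_dom D); [exact HO| |exact Huv].
    intros x y Hxy. rewrite (Hf x y Hxy). reflexivity. }
  assert (Ly : locally v (fun y => lam * phi2 u y = lam * g y)).
  { apply (locally_of_2d_y (fun x y => lam * phi2 x y = lam * g y)). apply (locally_2d_of_dom D); [exact HO| |exact Huv].
    intros x y Hxy. rewrite (Hg x y Hxy). reflexivity. }
  assert (il0 : 0 < / lam) by (apply Rinv_0_lt_compat, l0).
  destruct (dphi u v Huv) as [n1 n2]. destruct (NO u v Huv) as (OK & _).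
  assert (Sf : smooth D (fun x y => / lam * phi1 x y)) by (apply smooth_mult; [exact HO|apply smooth_const, HO|exact S1]).
  assert (Sg : smooth D (fun x y => lam * phi2 x y)) by (apply smooth_mult; [exact HO|apply smooth_const, HO|exact S2]).
  split; [|split; [|split; [|split]]].
  - intros m. split.
    + apply (ex_derive_n_ext_loc (fun x => / lam * phi1 x v)); [exact Lx|].
      apply (smooth_ex_derive_n_x D (fun x y => / lam * phi1 x y)); assumption.
    + apply (ex_derive_n_ext_loc (fun y => lam * phi2 u y)); [exact Ly|].
      apply (smooth_ex_derive_n_y D (fun x y => lam * phi2 x y)); assumption.
  - assert (X : Derive (fun x => / lam * f x) u = / lam * du phi1 u v).
    { transitivity (Derive (fun x => / lam * phi1 x v) u); [symmetry; apply Derive_ext_loc, Lx|apply Derive_scal]. }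
    rewrite X. apply Rmult_integral_contrapositive_currified; [lra|exact n1].
  - assert (X : Derive (fun y => lam * g y) v = lam * dv phi2 u v).
    { transitivity (Derive (fun y => lam * phi2 u y) v); [symmetry; apply Derive_ext_loc, Ly|apply Derive_scal]. }
    rewrite X. apply Rmult_integral_contrapositive_currified; [lra|exact n2].
  - rewrite <- (Hf u v Huv), <- (Hg u v Huv). pose proof (Omega_scale r1 (/ lam) _ _ il0 OK) as X.
    replace (lam * phi2 u v) with (phi2 u v / / lam) by (field; lra). exact X.
  - rewrite (Ec u v Huv), ET. f_equal. f_equal. rewrite <- (Hf u v Huv), <- (Hg u v Huv).
    rewrite Ec0.
    + f_equal. f_equal. f_equal. f_equal; field; lra.
    + pose proof (Omega_scale r1 (/ lam) _ _ il0 OK) as X.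
      replace (lam * phi2 u v) with (phi2 u v / / lam) by (field; lra). exact X.
Qed.

(** * Signs of the K-frame and exchange of the asymptotic families *)

Definition signed (e : R) (X : field) : field := fun u v => (e * fst (X u v), e * snd (X u v)).

Lemma smooth_signed Om e X : open_dom Om -> smooth_field Om X -> smooth_field Om (signed e X).
Proof. intros HO [S1 S2]. split; (apply smooth_mult; [exact HO|apply smooth_const, HO|assumption]). Qed.

Lemma diff_scal F u v e X : diff F u v (e * fst X, e * snd X) = vscal e (diff F u v X).
Proof. unfold diff. cbn [fst snd]. generalize (pu F u v), (pv F u v), (fst X), (snd X). intros. vec_ring. Qed.

Lemma vnorm_scal_sign e p : e * e = 1 -> vnorm (vscal e p) = vnorm p.
Proof.
  intros E. unfold vnorm. f_equal. rewrite dot_vscal_l, dot_vscal_r, <- Rmult_assoc, E. ring.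
Qed.

Lemma K_surface_of_signed Om eta psi E1 E3 a b : a * a = 1 -> b * b = 1 ->
  K_surface_of Om eta psi E1 E3 -> K_surface_of Om eta psi (signed a E1) (signed b E3).
Proof.
  intros Ha Hb (KS & (S1 & S3 & Fr) & RF & Z). pose proof (proj1 (proj1 KS)) as HO.
  split; [exact KS|]. split; [|split; [exact RF|]].
  - split; [apply smooth_signed; assumption|]. split; [apply smooth_signed; assumption|]. intros u v H.
    destruct (Fr u v H) as (N1 & N3 & F1 & F3 & Dt). unfold signed at 1 2. rewrite !diff_scal, !vnorm_scal_sign by assumption.
    split; [exact N1|]. split; [exact N3|]. unfold second_form in *. unfold signed. cbn [fst snd].
    split; [|split].
    + transitivity (a * a * (fL psi u v * fst (E1 u v) ^ 2 + 2 * fM psi u v * fst (E1 u v) * snd (E1 u v) + fN psi u v * snd (E1 u v) ^ 2)); [ring|rewrite F1; ring].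
    + transitivity (b * b * (fL psi u v * fst (E3 u v) ^ 2 + 2 * fM psi u v * fst (E3 u v) * snd (E3 u v) + fN psi u v * snd (E3 u v) ^ 2)); [ring|rewrite F3; ring].
    + replace (a * fst (E1 u v) * (b * snd (E3 u v)) - a * snd (E1 u v) * (b * fst (E3 u v))) with (a * b * (fst (E1 u v) * snd (E3 u v) - snd (E1 u v) * fst (E3 u v))) by ring.
      apply Rmult_integral_contrapositive_currified; [apply Rmult_integral_contrapositive_currified|exact Dt]; intros E; rewrite E in *; lra.
  - intros u v H. destruct (Z u v H) as [Z1 Z3]. unfold signed. cbn [fst snd]. rewrite Z1, Z3. split; ring.
Qed.

(** Both tensor coefficients acquire the factor [a b], and the dual forms acquire [a] and [b]. Hence
    [c th1] is multiplied by [b] and [b th3] by [a], which changes the relative sign in the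
    alignment condition by [a b]. *)
Lemma alignment_signed s Om eta psi E1 E3 a b : open_dom Om -> a * a = 1 -> b * b = 1 ->
  alignment s Om eta psi E1 E3 -> alignment (s * a * b) Om eta psi (signed a E1) (signed b E3).
Proof.
  intros HO Ha Hb (th1 & th3 & be & ga & (S1 & S3 & Du) & Sb & Sc & AL).
  exists (signed a th1), (signed b th3), (fun u v => a * b * be u v), (fun u v => a * b * ga u v).
  assert (nz : forall x, x * x = 1 -> x <> 0) by (intros x E Z; rewrite Z in E; lra).
  split; [|split; [|split]].
  - split; [apply smooth_signed; assumption|]. split; [apply smooth_signed; assumption|]. intros u v H.
    destruct (Du u v H) as (D1 & D2 & D3 & D4). unfold pairing, signed in *. cbn [fst snd].
    split; [|split; [|split]].
    + transitivity (a * a * (fst (th1 u v) * fst (E1 u v) + snd (th1 u v) * snd (E1 u v))); [ring|rewrite Ha, D1; ring].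
    + transitivity (a * b * (fst (th1 u v) * fst (E3 u v) + snd (th1 u v) * snd (E3 u v))); [ring|rewrite D2; ring].
    + transitivity (a * b * (fst (th3 u v) * fst (E1 u v) + snd (th3 u v) * snd (E1 u v))); [ring|rewrite D3; ring].
    + transitivity (b * b * (fst (th3 u v) * fst (E3 u v) + snd (th3 u v) * snd (E3 u v))); [ring|rewrite Hb, D4; ring].
  - apply smooth_mult; [exact HO|apply smooth_const, HO|exact Sb].
  - apply smooth_mult; [exact HO|apply smooth_const, HO|exact Sc].
  - intros u v H. destruct (AL u v H) as (b0 & c0 & X & Df).
    split; [|split; [|split]].
    + apply Rmult_integral_contrapositive_currified; [apply Rmult_integral_contrapositive_currified; auto|exact b0].
    + apply Rmult_integral_contrapositive_currified; [apply Rmult_integral_contrapositive_currified; auto|exact c0].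
    + intros V. rewrite X. unfold signed at 2 4. rewrite !diff_scal, !vscal_vscal. unfold pairing, signed. cbn [fst snd]. f_equal; f_equal.
      * transitivity (a * a * (b * b) * (be u v * (fst (th3 u v) * fst V + snd (th3 u v) * snd V))); [rewrite Ha, Hb; ring|ring].
      * transitivity (a * a * (b * b) * (ga u v * (fst (th1 u v) * fst V + snd (th1 u v) * snd V))); [rewrite Ha, Hb; ring|ring].
    + assert (K : forall e (h : R -> R -> R) (th : field) e', e' * e = 1 -> forall e0,
         dform (fscal (fun u v => e0 * e * h u v) (signed e' th)) u v = e0 * dform (fscal h th) u v).
      { intros e h th e' Ee e0. unfold dform, fscal, signed, du, dv. cbn [fst snd]. rewrite Rmult_minus_distr_l, <- !Derive_scal. f_equal.
        - apply Derive_ext. intros t. transitivity (e0 * (e' * e) * (h t v * snd (th t v))); [ring|rewrite Ee; ring].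
        - apply Derive_ext. intros t. transitivity (e0 * (e' * e) * (h u t * fst (th u t))); [ring|rewrite Ee; ring]. }
      rewrite (K b be th3 b Hb a).
      assert (E2 : dform (fscal (fun u v => a * b * ga u v) (signed a th1)) u v = b * dform (fscal ga th1) u v).
      { rewrite <- (K a ga th1 a Ha b). unfold dform, fscal, signed, du, dv. cbn [fst snd]. f_equal; apply Derive_ext; intros t; ring. }
      rewrite E2. transitivity (b * (dform (fscal ga th1) u v + a * a * s * dform (fscal be th3) u v)); [ring|].
      rewrite Ha. transitivity (b * (dform (fscal ga th1) u v + s * dform (fscal be th3) u v)); [ring|rewrite Df; ring].
Qed.

(** Serves pieces whose u-lines belong to the second asymptotic family. Exchanging the coordinates
    reverses the unit normal, which affects neither the curvature nor the vanishing of [fL] and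
    [fN]; the angle of the sector stays [k]. *)
Lemma amsler_surface_swap k U Psi : Amsler_surface k U Psi -> Amsler_surface k (swap_dom U) (fun x y => Psi y x).
Proof.
  intros (Ax & HR & ((HO & SP & Im) & GK) & Fm & (a & b & Ha & Hb & Hab)).
  set (Ps := fun x y => Psi y x).
  assert (E1 : forall x y, pu Ps x y = pv Psi y x) by reflexivity.
  assert (E2 : forall x y, pv Ps x y = pu Psi y x) by reflexivity.
  assert (E3 : forall x y, pu (pu Ps) x y = pv (pv Psi) y x) by reflexivity.
  assert (E4 : forall x y, pv (pu Ps) x y = pu (pv Psi) y x) by reflexivity.
  assert (E5 : forall x y, pv (pv Ps) x y = pu (pu Psi) y x) by reflexivity.
  assert (Cx : forall x y, cross (pu Ps x y) (pv Ps x y) = vscal (-1) (cross (pu Psi y x) (pv Psi y x))).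
  { intros x y. rewrite E1, E2. generalize (pu Psi y x), (pv Psi y x). intros. vec_ring. }
  assert (Nn : forall x y, unit_normal Ps x y = vscal (-1) (unit_normal Psi y x)).
  { intros x y. unfold unit_normal. rewrite Cx, vnorm_scal_sign by ring. rewrite !vscal_vscal. f_equal. ring. }
  assert (FL : forall x y, fL Ps x y = - fN Psi y x) by (intros; unfold fL, fN; rewrite E3, Nn, dot_vscal_r; ring).
  assert (FN : forall x y, fN Ps x y = - fL Psi y x) by (intros; unfold fL, fN; rewrite E5, Nn, dot_vscal_r; ring).
  split; [intros t; destruct (Ax t); split; assumption|].
  split; [intros x y p q H Hp Hq; apply HR; assumption|].
  split; [split; [split; [apply open_swap, HO|split]|]|split].
  - destruct SP as (S1 & S2 & S3). split; [|split]; [apply (smooth_swap U (fun x y => cx (Psi x y)))|apply (smooth_swap U (fun x y => cy (Psi x y)))|apply (smooth_swap U (fun x y => cz (Psi x y)))]; assumption.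
  - intros x y H. rewrite Cx. intros Z. apply (Im y x H).
    transitivity (vscal (-1) (vscal (-1) (cross (pu Psi y x) (pv Psi y x)))); [rewrite vscal_vscal; replace (-1 * -1) with 1 by ring; symmetry; apply vscal_one|rewrite Z; vec_ring].
  - intros x y H. rewrite <- (GK y x H). unfold gauss_curvature.
    assert (FM : fM Ps x y = - fM Psi y x) by (unfold fM; rewrite E4, Nn, dot_vscal_r, <- (smooth_map_schwarz U Psi y x HO SP H); ring).
    rewrite FL, FN, FM. unfold fE, fF, fG. rewrite E1, E2, (dot_comm (pv Psi y x) (pu Psi y x)). f_equal; [ring|]. f_equal. ring.
  - intros x y H. destruct (Fm y x H) as (F1 & F2 & F3 & F4). rewrite FL, FN, F3, F4. unfold fE, fG in *. rewrite E1, E2. repeat split; try assumption; ring.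
  - exists b, a. split; [exact Hb|]. split; [exact Ha|]. rewrite dot_comm. exact Hab.
Qed.

(** Differentiating [f^2 = 1] shows that the gradient vanishes. *)
Lemma rigid_sign (D : dom) u0 v0 f : open_dom D -> gradient_rigid D u0 v0 -> smooth D f ->
  (forall u v, D u v -> f u v * f u v = 1) -> forall u v, D u v -> f u v = f u0 v0.
Proof.
  intros HO [H0 HD] Sf E. apply HD. intros u v H.
  pose proof (smooth_has_du _ _ u v Sf H) as D1. pose proof (smooth_has_dv _ _ u v Sf H) as D2.
  assert (n0 : f u v <> 0) by (intros Z; pose proof (E u v H) as X; rewrite Z in X; lra).
  assert (X1 : du f u v = 0).
  { pose proof (is_derive_mult (fun x => f x v) (fun x => f x v) u _ _ D1 D1 (fun a b => Rmult_comm a b)) as M.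
    pose proof (is_derive_unique _ _ _ (has_du_const_on D (fun x y => f x y * f x y) 1 u v HO H E)) as X0.
    assert (X : 0 = du f u v * f u v + f u v * du f u v) by (rewrite <- X0; apply (is_derive_unique _ _ _ M)).
    apply (Rmult_eq_reg_r (f u v)); [|exact n0]. lra. }
  assert (X2 : dv f u v = 0).
  { pose proof (is_derive_mult (fun y => f u y) (fun y => f u y) v _ _ D2 D2 (fun a b => Rmult_comm a b)) as M.
    pose proof (is_derive_unique _ _ _ (has_dv_const_on D (fun x y => f x y * f x y) 1 u v HO H E)) as X0.
    assert (X : 0 = dv f u v * f u v + f u v * dv f u v) by (rewrite <- X0; apply (is_derive_unique _ _ _ M)).
    apply (Rmult_eq_reg_r (f u v)); [|exact n0]. lra. }
  rewrite X1 in D1. rewrite X2 in D2. split; assumption.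
Qed.

(** Without a canonical frame the coordinates [phi1], [phi2] may a priori mix u and v. Along the
    u-lines the normal part of [psi_uu] is [2 phi1_u phi2_u sin om], and these lines are asymptotic,
    so the product vanishes; likewise along v. The last two clauses express that [E1] and [E3] have
    unit length. *)
Lemma amsler_piece_asymptotic k w e1 e2 n D eta psi E1 E3 phi1 phi2 : 0 < k < PI -> amsler_frame k w e1 e2 n -> open_dom D ->
  K_surface_of D eta psi E1 E3 -> Amsler_piece k D psi phi1 phi2 ->
  forall u v, D u v ->
    du phi1 u v * du phi2 u v = 0 /\ dv phi1 u v * dv phi2 u v = 0 /\ du phi1 u v * dv phi2 u v - du phi2 u v * dv phi1 u v <> 0 /\
    (du phi2 u v = 0 -> (fst (E1 u v) * du phi1 u v) * (fst (E1 u v) * du phi1 u v) = 1) /\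
    (dv phi1 u v = 0 -> (snd (E3 u v) * dv phi2 u v) * (snd (E3 u v) * dv phi2 u v) = 1).
Proof.
  intros Hk AF HO (((_ & Sp & Ip) & GK) & (_ & _ & Fr) & _ & Zr) (U & Psi & AS & S1 & S2 & HP) u v Huv.
  destruct (amsler_surface_frame k w U Psi e1 e2 n Hk AF AS) as (o & Ho & HPsi).
  destruct AS as (_ & _ & ((OU & SPsi & _) & _) & _).
  pose proof (af_profile _ _ _ _ _ AF) as H. pose proof open_plane as OP.
  destruct (smooth_PQ (om_of w) e1 e2 (smooth_om k w H) (af_e1 _ _ _ _ _ AF) (af_e2 _ _ _ _ _ AF)) as [SPf SQf].
  set (Ph := fun u v => lin o (Pf w e1 e2 (phi1 u v) (phi2 u v))). set (Qh := fun u v => lin o (Qf w e1 e2 (phi1 u v) (phi2 u v))).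
  assert (Dpsi : forall x y, D x y -> has_du3 psi x y (vadd (vscal (du phi1 x y) (Ph x y)) (vscal (du phi2 x y) (Qh x y))) /\
     has_dv3 psi x y (vadd (vscal (dv phi1 x y) (Ph x y)) (vscal (dv phi2 x y) (Qh x y)))).
  { intros x y Hxy. destruct (HP x y Hxy) as (_ & _ & pU & _). destruct (HPsi _ _ pU) as (_ & PP & PQ).
    assert (Epsi : forall x y, D x y -> Psi (phi1 x y) (phi2 x y) = psi x y) by (intros a b Hab; symmetry; apply (HP a b Hab)).
    pose proof (chain_du3 U Psi phi1 phi2 x y _ _ OU SPsi pU (smooth_has_du _ _ x y S1 Hxy) (smooth_has_du _ _ x y S2 Hxy)) as C1.
    pose proof (chain_dv3 U Psi phi1 phi2 x y _ _ OU SPsi pU (smooth_has_dv _ _ x y S1 Hxy) (smooth_has_dv _ _ x y S2 Hxy)) as C2.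
    rewrite PP, PQ in C1, C2. split; [apply (has_du3_ext D _ psi x y _ HO Hxy Epsi C1)|apply (has_dv3_ext D _ psi x y _ HO Hxy Epsi C2)]. }
  destruct (HP u v Huv) as (_ & _ & pU & _). destruct (HPsi _ _ pU) as (Rn & _).
  pose proof (sin_gt_0 _ (proj1 Rn) (proj2 Rn)) as s0.
  destruct (af_field _ _ _ _ _ AF (phi1 u v) (phi2 u v) I) as [On _].
  destruct (frame_PQ_gram (om_of w) e1 e2 n _ _ On) as (G1 & G2 & G3 & G4 & G5). destruct On as (_ & _ & Hcc & _ & Hac & Hbc).
  destruct (amsler_frame_PQ _ _ _ _ _ AF (phi1 u v) (phi2 u v)) as (P1 & P2 & Q1 & Q2).
  set (N := lin o (n (phi1 u v) (phi2 u v))).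
  assert (NN : dot N N = 1) by (unfold N; rewrite (lin_dot o) by exact Ho; exact Hcc).
  assert (PN : dot (Ph u v) N = 0) by (unfold N, Ph; rewrite (lin_dot o) by exact Ho; exact G4).
  assert (QN : dot (Qh u v) N = 0) by (unfold N, Qh; rewrite (lin_dot o) by exact Ho; exact G5).
  assert (PP : dot (Ph u v) (Ph u v) = 1) by (unfold Ph; rewrite (lin_dot o) by exact Ho; exact G1).
  assert (QQ : dot (Qh u v) (Qh u v) = 1) by (unfold Qh; rewrite (lin_dot o) by exact Ho; exact G2).
  destruct (Dpsi u v Huv) as [Du Dv]. pose proof (pu_eq _ _ _ _ Du) as Eu. pose proof (pv_eq _ _ _ _ Dv) as Ev.
  destruct (unit_normal_pm psi u v N NN) as (tau & Ht & En).
  { rewrite Eu, dot_vadd_l, !dot_vscal_l, PN, QN. ring. }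
  { rewrite Ev, dot_vadd_l, !dot_vscal_l, PN, QN. ring. }
  { apply Ip, Huv. }
  destruct (Fr u v Huv) as (N1 & N3 & F1 & F3 & Dt). destruct (Zr u v Huv) as [Z1 Z3].
  unfold second_form in F1, F3. rewrite Z1 in F1, Dt. rewrite Z3 in F3, Dt.
  assert (n1 : fst (E1 u v) <> 0) by (intros Z; rewrite Z in Dt; lra).
  assert (n3 : snd (E3 u v) <> 0) by (intros Z; rewrite Z in Dt; lra).
  assert (tau0 : tau <> 0) by (intros Z; rewrite Z in Ht; lra).
  assert (L0 : dot (pu (pu psi) u v) N = 0).
  { assert (fL psi u v = 0) as L by (apply (Rmult_eq_reg_r (fst (E1 u v) ^ 2)); [lra|apply pow_nonzero, n1]).
    unfold fL in L. rewrite En, dot_vscal_r in L. apply (Rmult_eq_reg_l tau); lra. }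
  assert (N0 : dot (pv (pv psi) u v) N = 0).
  { assert (fN psi u v = 0) as L by (apply (Rmult_eq_reg_r (snd (E3 u v) ^ 2)); [lra|apply pow_nonzero, n3]).
    unfold fN in L. rewrite En, dot_vscal_r in L. apply (Rmult_eq_reg_l tau); lra. }
  pose proof (chain_du3 plane _ phi1 phi2 u v _ _ OP SPf I (smooth_has_du _ _ u v S1 Huv) (smooth_has_du _ _ u v S2 Huv)) as CP1.
  pose proof (chain_dv3 plane _ phi1 phi2 u v _ _ OP SPf I (smooth_has_dv _ _ u v S1 Huv) (smooth_has_dv _ _ u v S2 Huv)) as CP2.
  pose proof (chain_du3 plane _ phi1 phi2 u v _ _ OP SQf I (smooth_has_du _ _ u v S1 Huv) (smooth_has_du _ _ u v S2 Huv)) as CQ1.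
  pose proof (chain_dv3 plane _ phi1 phi2 u v _ _ OP SQf I (smooth_has_dv _ _ u v S1 Huv) (smooth_has_dv _ _ u v S2 Huv)) as CQ2.
  rewrite (pu_eq _ _ _ _ P1), (pv_eq _ _ _ _ P2) in CP1, CP2. rewrite (pu_eq _ _ _ _ Q1), (pv_eq _ _ _ _ Q2) in CQ1, CQ2.
  set (om := om_of w (phi1 u v) (phi2 u v)) in *. set (m := n (phi1 u v) (phi2 u v)) in *.
  assert (nJ : forall z x y, dot (lin o (vscal z (vadd (vscal x (e1 (phi1 u v) (phi2 u v))) (vscal y (e2 (phi1 u v) (phi2 u v)))))) N = 0).
  { intros z x y. unfold N. rewrite (lin_dot o) by exact Ho. rewrite dot_vscal_l, dot_comb2_orth by assumption. ring. }
  assert (nM : forall z, dot (lin o (vscal z m)) N = z).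
  { intros z. unfold N. rewrite (lin_dot o) by exact Ho. rewrite dot_vscal_l, Hcc. ring. }
  assert (Prod1 : du phi1 u v * du phi2 u v = 0).
  { rewrite (pu_eq (pu psi) u v _ (has_du3_ext D _ (pu psi) u v _ HO Huv (fun x y Hxy => eq_sym (pu_eq _ _ _ _ (proj1 (Dpsi x y Hxy))))
       (vderiv_add _ _ _ _ _ (vderiv_scal _ _ _ _ _ (smooth_has_du _ _ u v (smooth_du _ _ S1) Huv) (vderiv_lin o _ _ _ CP1))
          (vderiv_scal _ _ _ _ _ (smooth_has_du _ _ u v (smooth_du _ _ S2) Huv) (vderiv_lin o _ _ _ CQ1))))) in L0.
    fold (Ph u v) (Qh u v) in L0. cbv beta in L0.
    rewrite !lin_add, !(lin_scal o (du _ u v)), !dot_vadd_l, !dot_vscal_l, ?dot_vadd_l, ?dot_vscal_l, !nJ, !nM in L0.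
    change (lin o (Pf w e1 e2 (phi1 u v) (phi2 u v))) with (Ph u v) in L0. change (lin o (Qf w e1 e2 (phi1 u v) (phi2 u v))) with (Qh u v) in L0.
    rewrite PN, QN in L0. apply (Rmult_eq_reg_r (2 * sin om)); lra. }
  assert (Prod2 : dv phi1 u v * dv phi2 u v = 0).
  { rewrite (pv_eq (pv psi) u v _ (has_dv3_ext D _ (pv psi) u v _ HO Huv (fun x y Hxy => eq_sym (pv_eq _ _ _ _ (proj2 (Dpsi x y Hxy))))
       (vderiv_add _ _ _ _ _ (vderiv_scal _ _ _ _ _ (smooth_has_dv _ _ u v (smooth_dv _ _ S1) Huv) (vderiv_lin o _ _ _ CP2))
          (vderiv_scal _ _ _ _ _ (smooth_has_dv _ _ u v (smooth_dv _ _ S2) Huv) (vderiv_lin o _ _ _ CQ2))))) in N0.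
    cbv beta in N0.
    rewrite !lin_add, !(lin_scal o (dv _ u v)), !dot_vadd_l, !dot_vscal_l, ?dot_vadd_l, ?dot_vscal_l, !nJ, !nM in N0.
    change (lin o (Pf w e1 e2 (phi1 u v) (phi2 u v))) with (Ph u v) in N0. change (lin o (Qf w e1 e2 (phi1 u v) (phi2 u v))) with (Qh u v) in N0.
    rewrite PN, QN in N0. apply (Rmult_eq_reg_r (2 * sin om)); lra. }
  split; [exact Prod1|]. split; [exact Prod2|]. split; [|split].
  - intros Z. apply (Ip u v Huv). rewrite Eu, Ev.
    transitivity (vscal (du phi1 u v * dv phi2 u v - du phi2 u v * dv phi1 u v) (cross (Ph u v) (Qh u v))).
    + generalize (Ph u v), (Qh u v). clear. intros. vec_ring.
    + rewrite Z. generalize (cross (Ph u v) (Qh u v)). clear. intros. vec_ring.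
  - intros Z. pose proof (vnorm_sq (diff psi u v (E1 u v))) as X. rewrite N1 in X. unfold diff in X. rewrite Z1, Eu, Z in X.
    replace (vadd (vscal (fst (E1 u v)) (vadd (vscal (du phi1 u v) (Ph u v)) (vscal 0 (Qh u v)))) (vscal 0 (pv psi u v)))
      with (vscal (fst (E1 u v) * du phi1 u v) (Ph u v)) in X by (generalize (Ph u v), (Qh u v), (pv psi u v), (fst (E1 u v)), (du phi1 u v); clear; intros; vec_ring).
    rewrite dot_vscal_l, dot_vscal_r, PP in X. lra.
  - intros Z. pose proof (vnorm_sq (diff psi u v (E3 u v))) as X. rewrite N3 in X. unfold diff in X. rewrite Z3, Ev, Z in X.
    replace (vadd (vscal 0 (pu psi u v)) (vscal (snd (E3 u v)) (vadd (vscal 0 (Ph u v)) (vscal (dv phi2 u v) (Qh u v)))))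
      with (vscal (snd (E3 u v) * dv phi2 u v) (Qh u v)) in X by (generalize (Ph u v), (Qh u v), (pu psi u v), (snd (E3 u v)), (dv phi2 u v); clear; intros; vec_ring).
    rewrite dot_vscal_l, dot_vscal_r, QQ in X. lra.
Qed.

(** Once the u-lines belong to the first family, the given K-frame differs from the canonical one by
    signs [a] and [b], constant on [D]. Correcting the frame by them changes the alignment sign from
    [s] to [s a b]. *)
Lemma second_kind_of_straight k w e1 e2 n s D u0 v0 eta psi E1 E3 phi1 phi2 : 0 < k < PI -> amsler_frame k w e1 e2 n ->
  open_dom D -> gradient_rigid D u0 v0 -> V_net D eta -> is_sign s ->
  K_surface_of D eta psi E1 E3 -> Amsler_piece k D psi phi1 phi2 -> alignment s D eta psi E1 E3 ->
  (forall u v, D u v -> du phi2 u v = 0) -> second_kind 1 k D eta \/ second_kind (-1) k D eta.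
Proof.
  intros Hk AF HO HD HV Hs KS AP AL Z2.
  pose proof (amsler_piece_asymptotic k w e1 e2 n D eta psi E1 E3 phi1 phi2 Hk AF HO KS AP) as As.
  assert (Z1 : forall u v, D u v -> dv phi1 u v = 0).
  { intros u v H. destruct (As u v H) as (_ & A2 & A3 & _). rewrite (Z2 u v H) in A3.
    apply (Rmult_eq_reg_r (dv phi2 u v)); [lra|]. intros Z. rewrite Z in A3. lra. }
  pose proof AP as (U & Psi & _ & S1 & S2 & _). pose proof KS as (_ & ((SE1 & _) & (_ & SE3) & _) & _ & Zr).
  assert (X1 : forall u v, D u v -> fst (E1 u v) * du phi1 u v = fst (E1 u0 v0) * du phi1 u0 v0).
  { apply (rigid_sign D u0 v0 (fun u v => fst (E1 u v) * du phi1 u v)); [exact HO|exact HD|apply smooth_mult; [exact HO|exact SE1|apply smooth_du, S1]|].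
    intros u v H. apply (As u v H), Z2, H. }
  assert (X3 : forall u v, D u v -> snd (E3 u v) * dv phi2 u v = snd (E3 u0 v0) * dv phi2 u0 v0).
  { apply (rigid_sign D u0 v0 (fun u v => snd (E3 u v) * dv phi2 u v)); [exact HO|exact HD|apply smooth_mult; [exact HO|exact SE3|apply smooth_dv, S2]|].
    intros u v H. apply (As u v H), Z1, H. }
  destruct HD as [H0 _]. destruct (As u0 v0 H0) as (_ & _ & _ & A4 & A5). specialize (A4 (Z2 _ _ H0)). specialize (A5 (Z1 _ _ H0)).
  set (a := fst (E1 u0 v0) * du phi1 u0 v0) in *. set (b := snd (E3 u0 v0) * dv phi2 u0 v0) in *.
  assert (SK : second_kind (s * a * b) k D eta).
  { split; [exact HV|]. exists psi, (signed a E1), (signed b E3), phi1, phi2.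
    split; [apply K_surface_of_signed; assumption|]. split; [exact AP|]. split; [|apply alignment_signed; assumption].
    intros u v H. destruct (Zr u v H) as [Y1 Y3]. unfold pairing, signed. cbn [fst snd]. rewrite Y1, Y3, (Z1 u v H), (Z2 u v H).
    split; [|split; [ring|split; [ring|]]].
    - transitivity (a * (fst (E1 u v) * du phi1 u v)); [ring|]. rewrite (X1 u v H). exact A4.
    - transitivity (b * (snd (E3 u v) * dv phi2 u v)); [ring|]. rewrite (X3 u v H). exact A5. }
  assert (Sg : s * a * b = 1 \/ s * a * b = -1).
  { assert (Q : (s * a * b - 1) * (s * a * b + 1) = 0).
    { transitivity (s * s * (a * a) * (b * b) - 1); [ring|]. rewrite (is_sign_sq s Hs), A4, A5. ring. }
    apply Rmult_integral in Q. destruct Q; [left|right]; lra. }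
  destruct Sg as [E|E]; rewrite E in SK; [left|right]; exact SK.
Qed.

(** At each point exactly one of [phi1_u] and [phi2_u] vanishes, and each alternative is an open
    condition. Connectedness selects one of them on all of [D]; the second is reduced to the first
    by exchanging the asymptotic coordinates. *)
Lemma alignable_dichotomy k Om D eta : 0 < k < PI -> alignable_second_kind k Om eta -> net_domain D ->
  (forall u v, D u v -> Om u v) -> second_kind 1 k D eta \/ second_kind (-1) k D eta.
Proof.
  intros Hk (HV & psi & E1 & E3 & phi1 & phi2 & KS & AP & AL) (HO & HC & _) Sub.
  apply (V_net_sub Om D eta HO Sub) in HV. apply (K_surface_of_sub Om D eta psi E1 E3 HO Sub) in KS. apply (Amsler_piece_sub k Om D psi phi1 phi2 Sub) in AP.
  assert (AL' : exists s, is_sign s /\ alignment s D eta psi E1 E3).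
  { destruct AL as [AL|AL]; [exists 1|exists (-1)]; (split; [unfold is_sign; lra|apply (alignment_sub _ Om D); assumption]). }
  clear AL. destruct AL' as (s & Hs & AL).
  destruct (classic (exists u v, D u v)) as [(u0 & v0 & H0)|Emp].
  2:{ assert (SK : second_kind s k D eta).
      { split; [exact HV|]. exists psi, E1, E3, phi1, phi2. split; [exact KS|]. split; [exact AP|]. split; [|exact AL].
        intros u v H. exfalso. apply Emp. exists u, v. exact H. }
      destruct Hs as [-> | ->]; [left|right]; exact SK. }
  pose proof (rigid_connected D u0 v0 HO HC H0) as HD.
  destruct (amsler_profile_exists k) as [w H]. destruct (amsler_frame_exists k w H) as (e1 & e2 & n & AF).
  pose proof (amsler_piece_asymptotic k w e1 e2 n D eta psi E1 E3 phi1 phi2 Hk AF HO KS AP) as As.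
  pose proof AP as (U & Psi & AS & S1 & S2 & HP).
  assert (Loc0 : forall f u v, smooth D f -> D u v -> f u v <> 0 -> locally_2d (fun x y => f x y <> 0) u v).
  { intros f u v Sf Huv N. apply continuity_2d_pt_neq_0; [apply (smooth_continuity D); assumption|exact N]. }
  (* The zero set of [phi2_u] is relatively open because there [phi1_u] is nonzero, hence nonzero
     nearby, and the product of the two vanishes everywhere. *)
  destruct (HC (fun u v => du phi2 u v = 0)) as [A|A].
  - intros u v Huv Z. destruct (As u v Huv) as (_ & _ & A3 & _).
    assert (N : du phi1 u v <> 0) by (intros Z'; rewrite Z, Z' in A3; lra).
    destruct (Loc0 (du phi1) u v (smooth_du _ _ S1) Huv N) as [d Hd]. exists d. intros x y Hx Hy Hxy.
    destruct (As x y Hxy) as (A1 & _). apply (Rmult_eq_reg_l (du phi1 x y)); [lra|apply Hd; assumption].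
  - intros u v Huv N. destruct (Loc0 (du phi2) u v (smooth_du _ _ S2) Huv N) as [d Hd]. exists d. intros x y Hx Hy _. apply Hd; assumption.
  - apply (second_kind_of_straight k w e1 e2 n s D u0 v0 eta psi E1 E3 phi1 phi2); assumption.
  - apply (second_kind_of_straight k w e1 e2 n s D u0 v0 eta psi E1 E3 phi2 phi1); try assumption.
    + exists (swap_dom U), (fun x y => Psi y x). split; [apply amsler_surface_swap, AS|]. split; [exact S2|]. split; [exact S1|].
      intros u v Huv. destruct (HP u v Huv) as (p1 & p2 & pU & pE). split; [exact p2|]. split; [exact p1|]. split; [exact pU|exact pE].
    + intros u v Huv. destruct (As u v Huv) as (A1 & _). apply (Rmult_eq_reg_r (du phi2 u v)); [lra|apply (A u v Huv)].
Qed.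

Lemma eta_sg_second_kind k w W r1 sg lam eps eta : amsler_profile k w -> 0 < k < PI -> W_solution k W -> first_cusp W r1 ->
  is_sign sg -> is_sign eps -> 0 < lam -> eta_sg sg w r1 lam eps eta -> second_kind sg k (Omega_k r1) eta.
Proof.
  intros H Hk HW Hc Hs He l0 E. destruct (amsler_frame_exists k w H) as (e1 & e2 & n & AF).
  destruct (eta_sg_scaled_net k w W r1 sg lam eps e1 e2 n eta AF Hk HW Hc Hs He l0 E) as (o & Ho & SN).
  apply (scaled_net_second_kind k w W r1 sg lam _ _ _ eta (amsler_frame_lin k w e1 e2 n o Ho AF)); try assumption.
  exact (proj1 (proj2 (proj1 E))).
Qed.

Lemma half_angle_pos om : 0 < om < PI -> 0 < sin (om / 2) /\ 0 < cos (om / 2).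
Proof. intros [A B]. split; [apply sin_gt_0|apply cos_gt_0]; lra. Qed.

Theorem theorem6p8 :
  (* W_k and r_1 are well defined *)
  (forall k : R, 0 < k < PI ->
     exists W : R -> R,
       W_solution k W /\
       (forall W' : R -> R, W_solution k W' -> forall r : R, 0 <= r -> W' r = W r) /\
       exists r1 : R, first_cusp W r1) /\
  forall (k : R) (W : R -> R) (r1 : R),
    0 < k < PI -> W_solution k W -> first_cusp W r1 ->
    (* for each value of the deformation parameter, the nets exist on Omega^k,
       are determined by their forms up to isometries, are alignable V-nets of the
       second kind, and have the stated curvatures *)
    (forall t : R,
       (exists eta : map3, eta_plus W r1 (exp t) 1 eta) /\
       (exists eta : map3, eta_minus W r1 (exp t) 1 eta) /\
       (forall (eps : R) (eta : map3),
          eps = 1 \/ eps = -1 -> eta_plus W r1 (exp t) eps eta ->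
          positive_alignable_second_kind k (Omega_k r1) eta /\
          (forall (eps' : R) (eta' : map3),
             eps' = 1 \/ eps' = -1 -> eta_plus W r1 (exp t) eps' eta' ->
             exists T : vec -> vec, isometry T /\
               forall u v : R, Omega_k r1 u v -> eta' u v = T (eta u v)) /\
          forall u v : R, Omega_k r1 u v ->
            gauss_curvature eta u v = u * v * sin (omega W u v / 2) ^ 4 /\
            mean_curvature eta u v =
              eps * (/ 4 * (exp t * u + v / exp t) * tan (omega W u v / 2))) /\
       (forall (eps : R) (eta : map3),
          eps = 1 \/ eps = -1 -> eta_minus W r1 (exp t) eps eta ->
          negative_alignable_second_kind k (Omega_k r1) eta /\
          (forall (eps' : R) (eta' : map3),
             eps' = 1 \/ eps' = -1 -> eta_minus W r1 (exp t) eps' eta' ->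
             exists T : vec -> vec, isometry T /\
               forall u v : R, Omega_k r1 u v -> eta' u v = T (eta u v)) /\
          forall u v : R, Omega_k r1 u v ->
            gauss_curvature eta u v = - (u * v * cos (omega W u v / 2) ^ 4) /\
            mean_curvature eta u v =
              eps * (/ 4 * (exp t * u - v / exp t) * cot (omega W u v / 2)))) /\
    (* every alignable V-net of the second kind is positive- or negative-alignable
       with respect to the canonical K-frame, and belongs to the corresponding family *)
    (forall (Om D : dom) (eta : map3),
       alignable_second_kind k Om eta ->
       net_domain D -> (forall u v : R, D u v -> Om u v) ->
       positive_alignable_second_kind k D eta \/
       negative_alignable_second_kind k D eta) /\
    (forall (Om D : dom) (eta : map3),
       positive_alignable_second_kind k Om eta ->
       net_domain D -> (forall u v : R, D u v -> Om u v) ->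
       forall (t eps : R) (eta0 : map3),
         eps = 1 \/ eps = -1 -> eta_plus W r1 (exp t) eps eta0 ->
         equivalent_to_piece_of D eta (Omega_k r1) eta0) /\
    (forall (Om D : dom) (eta : map3),
       negative_alignable_second_kind k Om eta ->
       net_domain D -> (forall u v : R, D u v -> Om u v) ->
       forall (t eps : R) (eta0 : map3),
         eps = 1 \/ eps = -1 -> eta_minus W r1 (exp t) eps eta0 ->
         equivalent_to_piece_of D eta (Omega_k r1) eta0).

Proof.
  split.
  - intros k Hk. destruct (amsler_profile_exists k) as [w H]. exists (fun r => w (r ^ 2 / 4)).
    pose proof (profile_W_solution k w H) as HW. split; [exact HW|]. split.
    + intros W' HW' r r0. exact (W_solution_unique k W' _ HW' HW r r0).
    + exact (first_cusp_exists k w _ H Hk HW).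
  - intros k W r1 Hk HW Hc. destruct (amsler_profile_exists k) as [w H].
    assert (Rg : forall u v, Omega_k r1 u v -> 0 < om_of w u v < PI /\ omega W u v = om_of w u v).
    { intros u v Huv. destruct (Omega_range k w W r1 u v H Hk HW Hc Huv) as (A & _ & B). split; assumption. }
    assert (l0 : forall t, exp t <> 0) by (intros t; pose proof (exp_pos t); lra).
    assert (Sp : is_sign 1) by (left; reflexivity). assert (Sm : is_sign (-1)) by (right; reflexivity).
    pose proof (fun t eps eta => eta_plus_iff w W r1 (exp t) eps eta (l0 t) Rg) as IP.
    pose proof (fun t eps eta => eta_minus_iff w W r1 (exp t) eps eta (l0 t) Rg) as IM.
    split; [|split; [|split]].
    + intros t. pose proof (exp_pos t) as e0. split; [|split; [|split]].
      * destruct (eta_sg_exists k w W r1 1 (exp t) H Hk HW Hc Sp e0) as [eta E]. exists eta. apply IP, E.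
      * destruct (eta_sg_exists k w W r1 (-1) (exp t) H Hk HW Hc Sm e0) as [eta E]. exists eta. apply IM, E.
      * intros eps eta He E. apply IP in E. split; [|split].
        -- exact (eta_sg_second_kind k w W r1 1 (exp t) eps eta H Hk HW Hc Sp He e0 E).
        -- intros eps' eta' He' E'. apply IP in E'.
           exact (eta_sg_congruent k w W r1 1 (exp t) eps eps' eta eta' H Hk HW Hc Sp He He' e0 E E').
        -- intros u v Huv. destruct (Rg u v Huv) as [R1 R2]. destruct (half_angle_pos _ R1) as [s0 c0].
           destruct (eta_sg_curvatures 1 w r1 (exp t) eps eta u v Sp He e0 E Huv R1) as [-> ->].
           rewrite R2, (beta_plus _ R1), (sin_half (om_of w u v)). unfold tan. split; field; repeat split; lra.
      * intros eps eta He E. apply IM in E. split; [|split].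
        -- exact (eta_sg_second_kind k w W r1 (-1) (exp t) eps eta H Hk HW Hc Sm He e0 E).
        -- intros eps' eta' He' E'. apply IM in E'.
           exact (eta_sg_congruent k w W r1 (-1) (exp t) eps eps' eta eta' H Hk HW Hc Sm He He' e0 E E').
        -- intros u v Huv. destruct (Rg u v Huv) as [R1 R2]. destruct (half_angle_pos _ R1) as [s0 c0].
           destruct (eta_sg_curvatures (-1) w r1 (exp t) eps eta u v Sm He e0 E Huv R1) as [-> ->].
           rewrite R2, (beta_minus _ R1), (sin_half (om_of w u v)). unfold cot. split; field; repeat split; lra.
    + intros Om D eta AL ND Sub. exact (alignable_dichotomy k Om D eta Hk AL ND Sub).
    + intros Om D eta AL ND Sub t eps eta0 He E. apply IP in E.
      exact (second_kind_equivalent k w W r1 1 (exp t) eps Om D eta eta0 Hk H HW Hc Sp He (exp_pos t) AL ND Sub E).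
    + intros Om D eta AL ND Sub t eps eta0 He E. apply IM in E.
      exact (second_kind_equivalent k w W r1 (-1) (exp t) eps Om D eta eta0 Hk H HW Hc Sm He (exp_pos t) AL ND Sub E).
Qed.
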